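(* Let $\mathcal{X}$ be a two-sided quaternionic Banach space. Let $U_+\subset\mathbb{H}$ be a bounded, axially symmetric open set such that for every $j\in\mathbb{S}$ the set $\partial(U_+\cap\mathbb{C}_j)$ is a closed piecewise $\mathcal{C}^1$-contour (oriented as the positively oriented boundary of $U_+\cap\mathbb{C}_j$), and set $U_-=\mathbb{H}\setminus\overline{U_+}$. Let $f:\partial U_+\to\mathcal{X}$ be a left slice continuous function, let $\hat f$ be its left Cauchy integral transform $$\hat f(p)=\frac{1}{2\pi}\int_{\partial(U_+\cap\mathbb{C}_j)}S_L^{-1}(s,p)\,ds_j\,f(s),\qquad p\in\mathbb{H}\setminus\partial U_+,$$ with $\hat f(\infty)=0$, and let $\hat f_+:=\hat f|_{U_+}$ and $\hat f_-:=\hat f|_{U_-\cup\{\infty\}}$. Then the following two conditions are equivalent: (i) $f$ splits additively with respect to $\partial U_+$; (ii) $\hat f_+$ admits a continuous extension to $\overline{U_+}$ and $\hat f_-$ admits a continuous extension to $\overline{U_-}$. Moreover, in this case (denoting the extensions by the same symbols) $f=\hat f_++(-\hat f_-)$ on $\partial U_+$, and $(\hat f_+,-\hat f_-)$ is the splitting of $f$ which vanishes at infinity.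
   Context: $\mathbb{H}$ is the algebra of quaternions; $\mathbb{S}$ is the 2-sphere of purely imaginary unit quaternions; for $j\in\mathbb{S}$, $\mathbb{C}_j=\mathbb{R}+j\mathbb{R}$. For $q=x_0+j|\mathrm{Im}(q)|$, $[q]=\{x_0+i|\mathrm{Im}(q)|: i\in\mathbb{S}\}$; a set is axially symmetric if it contains $[q]$ whenever it contains $q$. A two-sided quaternionic Banach space is a two-sided $\mathbb{H}$-module which is complete for a norm with $\|qx\|=\|xq\|=|q|\|x\|$. Slice functions: a function $f$ on an axially symmetric set with values in $\mathcal{X}$ is a left slice function if $f(u+jv)=f_0(u,v)+jf_1(u,v)$ for all $j\in\mathbb{S}$, where $f_0,f_1$ are $\mathcal{X}$-valued functions depending only on $(u,v)$ with $f_0(u,-v)=f_0(u,v)$, $f_1(u,-v)=-f_1(u,v)$. It is left slice continuous if $f_0,f_1$ are continuous; on an open set it is (left) slice hyperholomorphic if $f_0,f_1$ are real differentiable and $\partial_uf_0-\partial_vf_1=0$, $\partial_vf_0+\partial_uf_1=0$. If $V\subset\mathbb{H}$ is open with bounded complement, a function on $V\cup\{\infty\}$ is slice hyperholomorphic if it is so on $V$ and $p\mapsto f(1/p)$ (with value $f(\infty)$ at $0$) is so on $\{p: 1/p\in V\}\cup\{0\}$. Cauchy kernel: $S_L^{-1}(s,p)=-(p^2-2p\,\mathrm{Re}(s)+|s|^2)^{-1}(p-\overline{s})$; $ds_j=ds/j=-j\,ds$. The integral defining $\hat f$ does not depend on $j\in\mathbb{S}$. A closed piecewise $\mathcal{C}^1$-contour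 in $\mathbb{C}_j$ is a finite union of pairwise disjoint simple closed curves, each having a continuous, piecewise $\mathcal{C}^1$ parametrization with nowhere vanishing one-sided derivatives, such that at each corner the quotient of the two one-sided derivatives lies in $\mathbb{C}_j\setminus(-\infty,0]$. Splitting: $f$ splits additively with respect to $\partial U_+$ if there are functions $f_+:\overline{U_+}\to\mathcal{X}$, slice continuous on $\overline{U_+}$ and slice hyperholomorphic in $U_+$, and $f_-:\overline{U_-}\cup\{\infty\}\to\mathcal{X}$, slice continuous on $\overline{U_-}$ and slice hyperholomorphic in $U_-\cup\{\infty\}$, such that $f=f_++f_-$ on $\partial U_+$; the pair is called a splitting of $f$, and it vanishes at infinity if $f_-(\infty)=0$. *)

(* Defs.v *)
From Stdlib Require Export Reals List.
From Coquelicot Require Export Coquelicot.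
Open Scope R_scope.

(* [(a, b, c, d)] is a + b e1 + c e2 + d e1 e2.  The topology is the one that
   Coquelicot's product structures put on R * R * R * R. *)
Definition quat : Type := (R * R * R * R)%type.

Definition RtoH (a : R) : quat := (a, 0, 0, 0).

Definition Hplus (p q : quat) : quat :=
  let '(a1, b1, c1, d1) := p in
  let '(a2, b2, c2, d2) := q in
  (a1 + a2, b1 + b2, c1 + c2, d1 + d2).

Definition Hopp (p : quat) : quat :=
  let '(a, b, c, d) := p in (- a, - b, - c, - d).

Definition Hminus (p q : quat) : quat := Hplus p (Hopp q).

Definition Hmult (p q : quat) : quat :=
  let '(a1, b1, c1, d1) := p in
  let '(a2, b2, c2, d2) := q in
  (a1 * a2 - b1 * b2 - c1 * c2 - d1 * d2,
   a1 * b2 + b1 * a2 + c1 * d2 - d1 * c2,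
   a1 * c2 - b1 * d2 + c1 * a2 + d1 * b2,
   a1 * d2 + b1 * c2 - c1 * b2 + d1 * a2).

Definition Hconj (p : quat) : quat :=
  let '(a, b, c, d) := p in (a, - b, - c, - d).

Definition Hre (p : quat) : R := let '(a, _, _, _) := p in a.

Definition Him (p : quat) : quat := let '(_, b, c, d) := p in (0, b, c, d).

Definition Hnorm (p : quat) : R :=
  let '(a, b, c, d) := p in sqrt (a ^ 2 + b ^ 2 + c ^ 2 + d ^ 2).

(* Only meaningful for [p] nonzero. *)
Definition Hinv (p : quat) : quat := Hmult (RtoH (/ Hnorm p ^ 2)) (Hconj p).

Definition imag_unit (j : quat) : Prop := Hre j = 0 /\ Hnorm j = 1.

(* (u, v) |-> u + j v; for j an imaginary unit, this identifies the plane C_j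
   with R * R, and with Coquelicot's C (which is R * R) as a field. *)
Definition slice (j : quat) (z : R * R) : quat :=
  Hplus (RtoH (fst z)) (Hmult j (RtoH (snd z))).

Definition Hclass (q q' : quat) : Prop :=
  exists i, imag_unit i /\ q' = slice i (Hre q, Hnorm (Him q)).

Definition axially_symmetric (A : quat -> Prop) : Prop :=
  forall q q', A q -> Hclass q q' -> A q'.

Definition Hbounded (A : quat -> Prop) : Prop :=
  exists M, forall q, A q -> Hnorm q <= M.

Definition closure {T : UniformSpace} (A : T -> Prop) (x : T) : Prop :=
  forall eps : posreal, exists y, ball x eps y /\ A y.

Definition boundary {T : UniformSpace} (A : T -> Prop) (x : T) : Prop :=
  closure A x /\ closure (fun y => ~ A y) x.

(* For A = U_+, this is U_-. *)
Definition exterior {T : UniformSpace} (A : T -> Prop) (x : T) : Prop :=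
  ~ closure A x.

(* The two axioms [_real] identify Coquelicot's real scaling with the one of
   the bimodule.  They are no restriction: the actions of a rational number on
   either side are determined by additivity and unitality, and those of a real
   number then by continuity. *)
Record QBanach : Type := {
  qb_space :> CompleteNormedModule R_AbsRing;
  lmul : quat -> qb_space -> qb_space;
  rmul : qb_space -> quat -> qb_space;
  lmul_plus_r : forall q x y, lmul q (plus x y) = plus (lmul q x) (lmul q y);
  lmul_plus_l : forall p q x, lmul (Hplus p q) x = plus (lmul p x) (lmul q x);
  lmul_assoc : forall p q x, lmul p (lmul q x) = lmul (Hmult p q) x;
  lmul_one : forall x, lmul (RtoH 1) x = x;
  rmul_plus_l : forall q x y, rmul (plus x y) q = plus (rmul x q) (rmul y q);
  rmul_plus_r : forall p q x, rmul x (Hplus p q) = plus (rmul x p) (rmul x q);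
  rmul_assoc : forall p q x, rmul (rmul x p) q = rmul x (Hmult p q);
  rmul_one : forall x, rmul x (RtoH 1) = x;
  lmul_rmul : forall p q x, rmul (lmul p x) q = lmul p (rmul x q);
  lmul_real : forall a x, lmul (RtoH a) x = scal a x;
  rmul_real : forall a x, rmul x (RtoH a) = scal a x;
  norm_lmul : forall q x, norm (lmul q x) = Hnorm q * norm x;
  norm_rmul : forall q x, norm (rmul x q) = Hnorm q * norm x
}.

Arguments lmul {q} _ _ : rename.
Arguments rmul {q} _ _ : rename.

(* The set of (u, v) with u + j v in A, for some j (equivalently, when A is
   axially symmetric, for all j). *)
Definition slice_base (A : quat -> Prop) (z : R * R) : Prop :=
  exists j, imag_unit j /\ A (slice j z).

Definition slice_components {X : QBanach} (A : quat -> Prop) (f : quat -> X)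
    (f0 f1 : R * R -> X) : Prop :=
  (forall j z, imag_unit j -> A (slice j z) ->
     f (slice j z) = plus (f0 z) (lmul j (f1 z))) /\
  (forall u v, slice_base A (u, v) ->
     f0 (u, - v) = f0 (u, v) /\ f1 (u, - v) = opp (f1 (u, v))).

Definition slice_continuous {X : QBanach} (A : quat -> Prop) (f : quat -> X)
    : Prop :=
  exists f0 f1 : R * R -> X,
    slice_components A f f0 f1 /\
    continuous_on (slice_base A) f0 /\ continuous_on (slice_base A) f1.

Definition cauchy_riemann {X : QBanach} (f0 f1 : R * R -> X) (z : R * R)
    : Prop :=
  ex_filterdiff f0 (locally z) /\ ex_filterdiff f1 (locally z) /\
  exists du_f0 dv_f0 du_f1 dv_f1 : X,
    is_derive (fun u => f0 (u, snd z)) (fst z) du_f0 /\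
    is_derive (fun v => f0 (fst z, v)) (snd z) dv_f0 /\
    is_derive (fun u => f1 (u, snd z)) (fst z) du_f1 /\
    is_derive (fun v => f1 (fst z, v)) (snd z) dv_f1 /\
    minus du_f0 dv_f1 = zero /\ plus dv_f0 du_f1 = zero.

Definition slice_hyperholomorphic {X : QBanach} (V : quat -> Prop)
    (f : quat -> X) : Prop :=
  exists f0 f1 : R * R -> X,
    slice_components V f f0 f1 /\
    forall z, slice_base V z -> cauchy_riemann f0 f1 z.

(* H together with the point at infinity, [None]. *)
Definition quat_ext : Type := option quat.

Definition at_inverse {X : QBanach} (f : quat_ext -> X) (p : quat) : X :=
  if Req_EM_T (Hnorm p) 0 then f None else f (Some (Hinv p)).

Definition slice_hyperholomorphic_infty {X : QBanach} (V : quat -> Prop)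
    (f : quat_ext -> X) : Prop :=
  slice_hyperholomorphic V (fun q => f (Some q)) /\
  slice_hyperholomorphic
    (fun p => p = RtoH 0 \/ (p <> RtoH 0 /\ V (Hinv p))) (at_inverse f).

(* Contours lie in C_j, in the coordinates (u, v) of [slice]. *)

Definition Icc (a b t : R) : Prop := a <= t <= b.

(* z and w, as complex numbers, have their quotient outside (-oo, 0]. *)
Definition no_cusp (z w : R * R) : Prop :=
  ~ exists r, r <= 0 /\ Cdiv z w = RtoC r.

(* [delta k] is the derivative of [gamma] along [t k, t (k+1)], one-sided at
   the two ends; the last condition concerns the corner gamma 0 = gamma 1. *)
Definition piecewise_C1_regular (gamma : R -> R * R) : Prop :=
  exists (n : nat) (t : nat -> R) (delta : nat -> R -> R * R),
    (0 < n)%nat /\ t 0%nat = 0 /\ t n = 1 /\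
    (forall k, (k < n)%nat ->
       t k < t (S k) /\
       continuous_on (Icc (t k) (t (S k))) (delta k) /\
       forall s, Icc (t k) (t (S k)) s ->
         delta k s <> (0, 0) /\
         filterdiff gamma (within (Icc (t k) (t (S k))) (locally s))
           (fun h => scal h (delta k s))) /\
    (forall k, (S k < n)%nat ->
       no_cusp (delta k (t (S k))) (delta (S k) (t (S k)))) /\
    no_cusp (delta (pred n) 1) (delta 0%nat 0).

Definition simple_closed_curve (gamma : R -> R * R) : Prop :=
  continuous_on (Icc 0 1) gamma /\ gamma 0 = gamma 1 /\
  forall s t, 0 <= s < 1 -> 0 <= t < 1 -> gamma s = gamma t -> s = t.

Definition on_curve (gamma : R -> R * R) (z : R * R) : Prop :=
  exists t, Icc 0 1 t /\ gamma t = z.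

Definition closed_contour (Gamma : list (R -> R * R)) : Prop :=
  (forall gamma, In gamma Gamma ->
     simple_closed_curve gamma /\ piecewise_C1_regular gamma) /\
  ForallOrdPairs
    (fun gamma gamma' => forall z, ~ (on_curve gamma z /\ on_curve gamma' z))
    Gamma.

(* D lies to the left of gamma, and its complement to the right: (- d2, d1) is
   the tangent vector (d1, d2) rotated by a positive right angle. *)
Definition positively_oriented (D : R * R -> Prop) (gamma : R -> R * R)
    : Prop :=
  forall t d1 d2, 0 < t < 1 -> is_derive gamma t (d1, d2) ->
    exists e0, 0 < e0 /\ forall e, 0 < e < e0 ->
      D (plus (gamma t) (scal e (- d2, d1))) /\
      ~ D (minus (gamma t) (scal e (- d2, d1))).

Definition oriented_boundary (D : R * R -> Prop) (Gamma : list (R -> R * R))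
    : Prop :=
  closed_contour Gamma /\
  (forall z, boundary D z <-> exists gamma, In gamma Gamma /\ on_curve gamma z) /\
  (forall gamma, In gamma Gamma -> positively_oriented D gamma).

Definition SLinv (s p : quat) : quat :=
  Hmult
    (Hopp (Hinv (Hplus (Hminus (Hmult p p) (Hmult p (RtoH (2 * Hre s))))
                       (RtoH (Hnorm s ^ 2)))))
    (Hminus p (Hconj s)).

(* ds_j = - j ds along s = slice j (gamma t).  [Derive] takes arbitrary values
   at the corners and at 0, 1, which the integral does not see. *)
Definition dsj (j : quat) (gamma : R -> R * R) (t : R) : quat :=
  Hmult (Hopp j)
    (slice j (Derive (fun r => fst (gamma r)) t,
              Derive (fun r => snd (gamma r)) t)).

Definition cauchy_integral {X : QBanach} (j : quat) (Gamma : list (R -> R * R))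
    (f : quat -> X) (p : quat) : X :=
  scal (/ (2 * PI))
    (fold_right plus zero
       (map (fun gamma =>
          RInt (fun t => lmul (Hmult (SLinv (slice j (gamma t)) p)
                                     (dsj j gamma t))
                              (f (slice j (gamma t)))) 0 1)
          Gamma)).

(* The transform of f, with value 0 at infinity; it is meaningful off the
   boundary over which f is integrated. *)
Definition cauchy_transform {X : QBanach} (j : quat)
    (Gamma : list (R -> R * R)) (f : quat -> X) (p : quat_ext) : X :=
  match p with
  | Some q => cauchy_integral j Gamma f q
  | None => zero
  end.

Definition is_splitting {X : QBanach} (U : quat -> Prop) (f : quat -> X)
    (fp : quat -> X) (fm : quat_ext -> X) : Prop :=
  slice_continuous (closure U) fp /\
  slice_hyperholomorphic U fp /\
  slice_continuous (closure (exterior U)) (fun q => fm (Some q)) /\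
  slice_hyperholomorphic_infty (exterior U) fm /\
  forall q, boundary U q -> f q = plus (fp q) (fm (Some q)).

Definition splits_additively {X : QBanach} (U : quat -> Prop) (f : quat -> X)
    : Prop :=
  exists fp fm, is_splitting U f fp fm.

Definition continuous_extension {X : QBanach} (A : quat -> Prop)
    (F G : quat -> X) : Prop :=
  (forall q, A q -> G q = F q) /\ continuous_on (closure A) G.

Definition extends_plus {X : QBanach} (U : quat -> Prop)
    (F : quat_ext -> X) (G : quat -> X) : Prop :=
  continuous_extension U (fun q => F (Some q)) G.

Definition extends_minus {X : QBanach} (U : quat -> Prop)
    (F G : quat_ext -> X) : Prop :=
  continuous_extension (exterior U)
    (fun q => F (Some q)) (fun q => G (Some q)) /\
  G None = F None.

(* Main.v *)
(* Fix j.  Left multiplication by C_j makes X a complex Banach space, and there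
   the restriction of the Cauchy transform to C_j is the classical Cauchy
   integral of f over the contour.  The slice Cauchy kernel obeys the
   representation formula g(u + i v) = (1 - i j)/2 g(u + j v) + (1 + i j)/2 g(u - j v),
   which carries identities from C_j over to H.

   Given a splitting f = f_+ + f_-, subtract f_+ from the Cauchy integral inside
   U_+, and add f_- outside.  Near a point of the contour, Goursat's theorem on
   a curvilinear rectangle with one side along the contour shows that the result
   continues holomorphically across it; it is then entire with limit f_-(oo), so
   constant by Liouville.  Hence the transform is f_+ + f_-(oo) on U_+ and
   f_-(oo) - f_- on U_-, which gives (ii) and uniqueness.

   Conversely, 1/(s - z_+) - 1/(s - z_-), for z_+ and z_- symmetric with respect
   to the contour, is an approximate identity along it.  So f is the jump of its
   transform at the smooth points of the contour, and at the corners by continuity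
   of f and of the two extensions. *)

From Stdlib Require Import Lra Lia Classical ClassicalEpsilon.
Require Import Defs.

(** * Complex Banach spaces *)

(** The plane theory is done for an abstract [CBanach], a real normed module with an action of [C]
    on top: integrals and derivatives are those of the underlying real space, and every unit j makes
    the same X an instance ([slice_space]). The contours are only piecewise C1 with corners, and
    this shapes the local geometry. Normals need not depend differentiably on the parameter and do
    not match at a corner; so an arc is thickened by translation in one fixed direction, transversal
    to both one-sided tangents. The absence of cusps provides this direction. All level curves then
    have the velocity of the arc, and Goursat's quadrisection runs in the parameter rectangle. No
    Jordan curve theorem, argument function or logarithm enters: winding numbers come from
    arctangents, from local constancy and from the jump of a Cauchy integral. Functions that are
    merely continuous up to the contour are handled by a limit in the transversal parameter. The
    passage between C_j and H rests on one linear identity, [has_repr], which survives sums,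
    integration and closures. *)

Record CBanach : Type := {
  cb_space :> CompleteNormedModule R_AbsRing;
  cs : C -> cb_space -> cb_space;
  cs_plus_r : forall z x y, cs z (plus x y) = plus (cs z x) (cs z y);
  cs_plus_l : forall z w x, cs (z + w)%C x = plus (cs z x) (cs w x);
  cs_mult : forall z w x, cs (z * w)%C x = cs z (cs w x);
  cs_real : forall (a : R) x, cs (RtoC a) x = scal a x;
  norm_cs : forall z x, norm (cs z x) = Cmod z * norm x
}.

Arguments cs {c} _%_C_scope _ : rename.

Section CBanachSolver.
Context {X : CBanach}.
Implicit Types (x y : X) (z w : C).

Lemma cs_one x : cs 1 x = x.
Proof. rewrite cs_real. exact (scal_one (K := R_Ring) x). Qed.

Lemma cs_zero_l x : cs 0 x = zero.
Proof. rewrite cs_real. exact (scal_zero_l (K := R_Ring) x). Qed.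

Lemma cs_zero_r z : cs z (zero : X) = zero.
Proof. rewrite <- (cs_zero_l zero) at 1. rewrite <- cs_mult, Cmult_0_r. apply cs_zero_l. Qed.

Lemma opp_cs x : opp x = cs (- (1)) x.
Proof. rewrite <- RtoC_opp, cs_real. symmetry. exact (scal_opp_one (K := R_Ring) x). Qed.

(* A reflexive normaliser for equations between C-linear combinations. *)
Inductive mexp : Type :=
| MA (n : nat) | M0 | MP (a b : mexp) | MO (a : mexp) | MM (a b : mexp)
| MS (c : C) (a : mexp) | MR (r : R) (a : mexp).

Fixpoint meval (env : list X) (e : mexp) : X :=
  match e with
  | MA n => nth n env zero
  | M0 => zero
  | MP a b => plus (meval env a) (meval env b)
  | MO a => opp (meval env a)
  | MM a b => minus (meval env a) (meval env b)
  | MS c a => cs c (meval env a)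
  | MR r a => scal r (meval env a)
  end.

Fixpoint mcoef (e : mexp) (i : nat) : C :=
  match e with
  | MA n => if Nat.eqb n i then 1%C else 0%C
  | M0 => 0%C
  | MP a b => (mcoef a i + mcoef b i)%C
  | MO a => (- mcoef a i)%C
  | MM a b => (mcoef a i - mcoef b i)%C
  | MS c a => (c * mcoef a i)%C
  | MR r a => (RtoC r * mcoef a i)%C
  end.

Fixpoint lincomb (env : list X) (g : nat -> C) : X :=
  match env with
  | nil => zero
  | cons x l => plus (cs (g 0%nat) x) (lincomb l (fun n => g (S n)))
  end.

Lemma lincomb_ext env g h :
  (forall i, g i = h i) -> lincomb env g = lincomb env h.
Proof.
  revert g h; induction env as [|x l IH]; intros g h E; simpl; auto.
  rewrite E. f_equal. apply IH. auto.
Qed.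

Lemma lincomb_zero env : lincomb env (fun _ => 0%C) = zero.
Proof.
  induction env as [|x l IH]; simpl; auto.
  rewrite IH, cs_zero_l. apply plus_zero_l.
Qed.

Lemma lincomb_cs env c g :
  lincomb env (fun i => c * g i)%C = cs c (lincomb env g).
Proof.
  revert g; induction env as [|x l IH]; intros g; simpl.
  - now rewrite cs_zero_r.
  - now rewrite IH, cs_plus_r, cs_mult.
Qed.

Lemma lincomb_plus env g h :
  lincomb env (fun i => g i + h i)%C = plus (lincomb env g) (lincomb env h).
Proof.
  revert g h; induction env as [|x l IH]; intros g h; simpl.
  - now rewrite plus_zero_l.
  - rewrite IH, cs_plus_l. rewrite !plus_assoc. f_equal.
    rewrite <- !plus_assoc. f_equal. apply plus_comm.
Qed.

Lemma lincomb_atom env n :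
  lincomb env (fun i => if Nat.eqb n i then 1%C else 0%C) = nth n env zero.
Proof.
  revert n; induction env as [|x l IH]; intros [|n]; simpl; auto.
  - rewrite lincomb_zero, cs_one. apply plus_zero_r.
  - rewrite IH, cs_zero_l. apply plus_zero_l.
Qed.

Lemma meval_lincomb env e : meval env e = lincomb env (mcoef e).
Proof.
  induction e as [n| |a IHa b IHb|a IHa|a IHa b IHb|c a IHa|r a IHa]; simpl.
  - now rewrite lincomb_atom.
  - now rewrite lincomb_zero.
  - now rewrite lincomb_plus, IHa, IHb.
  - rewrite opp_cs, IHa, <- lincomb_cs. apply lincomb_ext. intros i.
    ring.
  - unfold minus. rewrite opp_cs, IHa, IHb, <- lincomb_cs, <- lincomb_plus.
    apply lincomb_ext. intros i. ring.
  - now rewrite lincomb_cs, IHa.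
  - now rewrite lincomb_cs, IHa, cs_real.
Qed.

(** Length one is a case of its own, so that unfolding gives a conjunction with exactly one equation
    per atom and no trailing [True]. *)
Fixpoint coefs_eq (n : nat) (g h : nat -> C) : Prop :=
  match n with
  | O => True
  | S O => g 0%nat = h 0%nat
  | S n => g 0%nat = h 0%nat /\ coefs_eq n (fun i => g (S i)) (fun i => h (S i))
  end.

Lemma meval_eq env a b :
  coefs_eq (length env) (mcoef a) (mcoef b) -> meval env a = meval env b.
Proof.
  rewrite !meval_lincomb. generalize (mcoef a) (mcoef b). clear a b.
  induction env as [|x l IH]; intros g h E; simpl; auto.
  destruct l as [|y l].
  - simpl in *. now rewrite E.
  - destruct E as [E1 E2]. rewrite E1. f_equal. apply IH. exact E2.
Qed.
End CBanachSolver.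

Ltac mlookup x l :=
  match l with
  | cons x _ => constr:(0%nat)
  | cons _ ?l' => let n := mlookup x l' in constr:(S n)
  end.
Ltac madd x l :=
  match l with
  | context [cons x _] => l
  | _ => constr:(cons x l)
  end.
Ltac matoms l e :=
  match e with
  | plus ?a ?b => let l := matoms l a in matoms l b
  | minus ?a ?b => let l := matoms l a in matoms l b
  | opp ?a => matoms l a
  | scal _ ?a => matoms l a
  | cs _ ?a => matoms l a
  | zero => l
  | _ => madd e l
  end.
Ltac mreify l e :=
  match e with
  | plus ?a ?b => let a := mreify l a in let b := mreify l b in constr:(MP a b)
  | minus ?a ?b => let a := mreify l a in let b := mreify l b in constr:(MM a b)
  | opp ?a => let a := mreify l a in constr:(MO a)
  | scal ?r ?a => let a := mreify l a in constr:(MR r a)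
  | cs ?c ?a => let a := mreify l a in constr:(MS c a)
  | zero => constr:(M0)
  | _ => let n := mlookup e l in constr:(MA n)
  end.
(** Leaves one equation in [C] per distinct atom. [module] tries ring on them; this variant is
    called directly when a denominator has to be cleared or a scalar to be rewritten first. *)
Ltac module_coefs X :=
  match goal with
  | |- ?a = ?b =>
    let l := constr:(@nil (AbelianGroup.sort X)) in
    let l := matoms l a in
    let l := matoms l b in
    let ea := mreify l a in
    let eb := mreify l b in
    change (@meval X l ea = @meval X l eb);
    apply meval_eq; cbn [coefs_eq mcoef length Nat.eqb];
    repeat match goal with |- _ /\ _ => split end
  end.
(* Points of the plane have type R * R, to which the field structure declared
   for C does not apply directly. *)
Definition RR_field_theory : @field_theory (R * R) (RtoC 0) (RtoC 1)
  Cplus Cmult Cminus Copp Cdiv Cinv eq := C_field_theory.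
Add Field RR_field : RR_field_theory.
Ltac Cring := first [ring | match goal with |- ?a = ?b =>
  first [change (@eq C a b); ring | change (@eq (R * R) a b); ring] end].
Ltac Cfield := first [field | match goal with |- ?a = ?b =>
  first [change (@eq C a b); field | change (@eq (R * R) a b); field] end].
Ltac module X := module_coefs X; try (rewrite ?RtoC_opp, ?RtoC_minus, ?RtoC_plus, ?RtoC_mult; Cring).

(* Restatements at type CBanach, so that rewriting sees a single path through
   Coquelicot's hierarchy. *)
Section Norm.
Context {X : CBanach}.
Implicit Types x y : X.

Lemma nrm_plus x y : norm (plus x y) <= norm x + norm y.
Proof. apply (norm_triangle x y). Qed.

Lemma nrm_opp x : norm (opp x) = norm x.
Proof. apply (norm_opp x). Qed.

Lemma nrm_minus x y : norm (minus x y) <= norm x + norm y.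
Proof. unfold minus. rewrite <- (nrm_opp y). apply nrm_plus. Qed.

Lemma nrm_zero : norm (zero : X) = 0.
Proof. apply (norm_zero (V := X)). Qed.

Lemma nrm_ge_0 x : 0 <= norm x.
Proof. apply (norm_ge_0 x). Qed.

Lemma nrm_eq_0 x : norm x = 0 -> x = zero.
Proof. apply (norm_eq_zero x). Qed.

Lemma nrm_small x : (forall e, 0 < e -> norm x <= e) -> x = zero.
Proof.
  intros H. apply nrm_eq_0. apply Rle_antisym; [|apply nrm_ge_0].
  apply Rnot_lt_le. intros N. specialize (H (norm x / 2)). lra.
Qed.

Lemma nrm_minus_eq_0 x y : (forall e, 0 < e -> norm (minus x y) <= e) -> x = y.
Proof.
  intros H. replace x with (plus (minus x y) y) by module X.
  rewrite (nrm_small _ H). module X.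
Qed.

Lemma continuous_eps {T : UniformSpace} (f : T -> X) a :
  continuous f a <->
  forall eps, 0 < eps -> locally a (fun p => norm (minus (f p) (f a)) < eps).
Proof.
  split.
  - intros H eps He.
    exact (proj1 (filterlim_locally_ball_norm f (f a)) H (mkposreal eps He)).
  - intros H. apply (proj2 (filterlim_locally_ball_norm f (f a))).
    intros eps. apply (H eps (cond_pos eps)).
Qed.

Lemma is_RInt_lin (f g : R -> X) a b u v :
  is_RInt f a b u -> is_RInt g a b v ->
  is_RInt (fun t => plus (f t) (g t)) a b (plus u v).
Proof. apply (is_RInt_plus f g). Qed.

Lemma is_RInt_sub (f g : R -> X) a b u v :
  is_RInt f a b u -> is_RInt g a b v ->
  is_RInt (fun t => minus (f t) (g t)) a b (minus u v).
Proof. apply (is_RInt_minus f g). Qed.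

Lemma RInt_sub (f g : R -> X) a b :
  ex_RInt f a b -> ex_RInt g a b ->
  RInt (fun t => minus (f t) (g t)) a b = minus (RInt f a b) (RInt g a b).
Proof. intros. apply is_RInt_unique, is_RInt_sub; apply RInt_correct; assumption. Qed.

Lemma RInt_add (f g : R -> X) a b :
  ex_RInt f a b -> ex_RInt g a b ->
  RInt (fun t => plus (f t) (g t)) a b = plus (RInt f a b) (RInt g a b).
Proof. intros. apply is_RInt_unique, is_RInt_lin; apply RInt_correct; assumption. Qed.

Lemma RInt_Chas (f : R -> X) a b c :
  ex_RInt f a b -> ex_RInt f b c -> RInt f a c = plus (RInt f a b) (RInt f b c).
Proof. intros. symmetry. apply (RInt_Chasles f); assumption. Qed.

Lemma cont_plus {T : UniformSpace} (f g : T -> X) a :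
  continuous f a -> continuous g a -> continuous (fun t => plus (f t) (g t)) a.
Proof. apply (continuous_plus f g). Qed.

Lemma cont_minus {T : UniformSpace} (f g : T -> X) a :
  continuous f a -> continuous g a -> continuous (fun t => minus (f t) (g t)) a.
Proof. apply (continuous_minus f g). Qed.
End Norm.

(** * Continuity in the plane and of complex scalar multiplication *)

Section Continuity.

Lemma Cmod_comp_bound (w : C) d :
  Rabs (fst w) < d -> Rabs (snd w) < d -> Cmod w < 2 * d.
Proof.
  intros H1 H2. unfold Cmod.
  pose proof (Rabs_pos (fst w)).
  rewrite <- (Rabs_right (2 * d)), <- sqrt_Rsqr_abs by lra.
  apply sqrt_lt_1_alt. unfold Rsqr.
  rewrite <- (pow2_abs (fst w)), <- (pow2_abs (snd w)).
  pose proof (Rabs_pos (snd w)). nra.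
Qed.

Lemma fst_le_Cmod (w : C) : Rabs (fst w) <= Cmod w.
Proof. eapply Rle_trans; [apply Rmax_l|apply Rmax_Cmod]. Qed.

Lemma snd_le_Cmod (w : C) : Rabs (snd w) <= Cmod w.
Proof. eapply Rle_trans; [apply Rmax_r|apply Rmax_Cmod]. Qed.

(** Balls of the product [R * R] are squares; squares and discs are nested in each other up to a
    factor 2. *)
Lemma locally_Cmod (z : R * R) (P : R * R -> Prop) :
  locally z P <-> exists d, 0 < d /\ forall w, Cmod (w - z)%C < d -> P w.
Proof.
  split.
  - intros [d Hd]. exists d. split. apply cond_pos.
    intros w Hw. apply Hd. split.
    + eapply Rle_lt_trans; [|exact Hw]. apply (fst_le_Cmod (w - z)%C).
    + eapply Rle_lt_trans; [|exact Hw]. apply (snd_le_Cmod (w - z)%C).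
  - intros [d [Hd H]]. assert (H0 : 0 < d / 2) by lra. exists (mkposreal _ H0).
    intros w [H1 H2]. apply H. replace d with (2 * (d / 2)) by field.
    apply Cmod_comp_bound; assumption.
Qed.

Lemma continuous_C_iff {T : UniformSpace} (f : T -> R * R) x :
  continuous f x <->
  forall eps, 0 < eps -> locally x (fun y => Cmod (f y - f x)%C < eps).
Proof.
  split.
  - intros H eps He. apply (H (fun w => Cmod (w - f x)%C < eps)).
    apply locally_Cmod. exists eps. auto.
  - intros H P HP. apply locally_Cmod in HP. destruct HP as [d [Hd HP]].
    unfold filtermap. apply (filter_imp _ _ (fun y => HP (f y)) (H d Hd)).
Qed.

Lemma continuous_pair_iff {T : UniformSpace} (f : T -> R * R) x :
  continuous f x <->
  continuous (fun t => fst (f t)) x /\ continuous (fun t => snd (f t)) x.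
Proof.
  split.
  - intros H. split; apply (continuous_comp f _); auto.
    apply continuous_fst. apply continuous_snd.
  - intros [H1 H2]. intros P [d Hd]. unfold filtermap.
    assert (L1 := H1 (fun y => ball (fst (f x)) d y) (locally_ball _ d)).
    assert (L2 := H2 (fun y => ball (snd (f x)) d y) (locally_ball _ d)).
    unfold filtermap in *. generalize (filter_and _ _ L1 L2).
    apply filter_imp. intros y [A B]. apply Hd. split; assumption.
Qed.

Context {T : UniformSpace}.
Implicit Types f g : T -> R * R.

Lemma continuous_Cplus f g x :
  continuous f x -> continuous g x -> continuous (fun t => (f t + g t)%C : R * R) x.
Proof.
  rewrite !continuous_pair_iff. intros [H1 H2] [H3 H4]. split; simpl.
  - apply (continuous_plus (fun t => fst (f t)) (fun t => fst (g t))); auto.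
  - apply (continuous_plus (fun t => snd (f t)) (fun t => snd (g t))); auto.
Qed.

Lemma continuous_Copp f x :
  continuous f x -> continuous (fun t => (- f t)%C : R * R) x.
Proof.
  rewrite !continuous_pair_iff. intros [H1 H2]. split; simpl.
  - apply (continuous_opp (fun t => fst (f t))); auto.
  - apply (continuous_opp (fun t => snd (f t))); auto.
Qed.

Lemma continuous_Cminus f g x :
  continuous f x -> continuous g x -> continuous (fun t => (f t - g t)%C : R * R) x.
Proof. intros; apply continuous_Cplus; [|apply continuous_Copp]; auto. Qed.

Lemma continuous_Cmult f g x :
  continuous f x -> continuous g x -> continuous (fun t => (f t * g t)%C : R * R) x.
Proof.
  rewrite !continuous_pair_iff. intros [H1 H2] [H3 H4].
  assert (M : forall a b : T -> R, continuous a x -> continuous b x ->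
    continuous (fun t => a t * b t) x)
   by (intros a b; apply (continuous_mult a b)).
  split; simpl.
  - apply (continuous_minus (fun t => fst (f t) * fst (g t)) (fun t => snd (f t) * snd (g t)));
     apply M; auto.
  - apply (continuous_plus (fun t => fst (f t) * snd (g t)) (fun t => snd (f t) * fst (g t)));
     apply M; auto.
Qed.

Lemma continuous_Cinv f x :
  continuous f x -> f x <> RtoC 0 -> continuous (fun t => (/ f t)%C : R * R) x.
Proof.
  rewrite !continuous_pair_iff. intros [H1 H2] N.
  assert (M : forall a b : T -> R, continuous a x -> continuous b x ->
    continuous (fun t => a t * b t) x)
   by (intros a b; apply (continuous_mult a b)).
  assert (D : continuous (fun t => / (fst (f t) ^ 2 + snd (f t) ^ 2)) x).
  { apply (continuous_comp (fun t => fst (f t) ^ 2 + snd (f t) ^ 2) Rinv).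
    - apply (continuous_plus (fun t => fst (f t) ^ 2) (fun t => snd (f t) ^ 2)); simpl;
      repeat (apply M; auto); apply continuous_const.
    - apply continuous_Rinv. intros E. apply N.
      destruct (f x) as [a b]. simpl in E. unfold RtoC.
      f_equal; nra. }
  split; simpl; unfold Rdiv; apply M; auto.
  apply (continuous_opp (fun t => snd (f t))); auto.
Qed.

Context {X : CBanach}.

(** Joint continuity is not an axiom of [CBanach]. Splitting the scalar into real and imaginary part
    leaves real scalings and the multiplication by [Ci], which is an isometry by [norm_cs]. *)
Lemma continuous_cs (f : T -> R * R) (F : T -> X) x :
  continuous f x -> continuous F x -> continuous (fun t => cs (f t) (F t)) x.
Proof.
  intros Hf HF. rewrite continuous_pair_iff in Hf. destruct Hf as [H1 H2].
  apply (continuous_ext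
    (fun t => plus (scal (fst (f t)) (F t)) (scal (snd (f t)) (cs Ci (F t))))).
  { intros t. module_coefs X.
    destruct (f t) as [a b]. unfold Cplus, Cmult, RtoC, Ci; simpl. f_equal; ring. }
  apply (continuous_plus (fun t => scal (fst (f t)) (F t))
           (fun t => scal (snd (f t)) (cs Ci (F t)))).
  - apply (continuous_scal (fun t => fst (f t)) F); auto.
  - apply (continuous_scal (fun t => snd (f t)) (fun t => cs Ci (F t))); auto.
    apply continuous_eps. intros eps He. rewrite continuous_eps in HF.
    generalize (HF eps He). apply filter_imp. intros y Hy.
    replace (minus (cs Ci (F y)) (cs Ci (F x))) with (cs Ci (minus (F y) (F x)))
      by module X.
    rewrite norm_cs. rewrite Cmod_Ci. lra.
Qed.

End Continuity.

Lemma continuous_RtoC {T : UniformSpace} (f : T -> R) x :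
  continuous f x -> continuous (fun t => RtoC (f t) : R * R) x.
Proof.
  intros H. apply continuous_pair_iff. split; simpl; auto. apply continuous_const.
Qed.

Lemma norm_cs_lt {X : CBanach} z (x : X) a b :
  Cmod z <= a -> norm x <= b -> norm (cs z x) <= a * b.
Proof.
  intros. rewrite norm_cs. apply Rmult_le_compat; auto.
  apply Cmod_ge_0. apply nrm_ge_0.
Qed.

(** * Vector-valued Riemann integrals and their dependence on a parameter *)

Section Integral.
Context {X : CBanach}.
Implicit Types (f g : R -> X).

Lemma Riemann_sum_cs c f ptd :
  Riemann_sum (fun t => cs c (f t)) ptd = cs c (Riemann_sum f ptd).
Proof.
  apply (SF_cons_ind (fun ptd =>
    Riemann_sum (fun t => cs c (f t)) ptd = cs c (Riemann_sum f ptd))).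
  - intros x. exact (eq_sym (cs_zero_r c)).
  - intros h s IH. rewrite !Riemann_sum_cons, IH. module X.
Qed.

Lemma is_RInt_cs c f a b l :
  is_RInt f a b l -> is_RInt (fun t => cs c (f t)) a b (cs c l).
Proof.
  unfold is_RInt. intros H.
  apply (filterlim_ext (fun ptd => cs c (scal (sign (b - a)) (Riemann_sum f ptd)))).
  { intros ptd. rewrite Riemann_sum_cs. module X. }
  apply (filterlim_comp _ _ _ _ (cs c) _ (locally l)). exact H.
  apply (continuous_cs (fun _ => c) (fun x => x)).
  apply continuous_const. apply continuous_id.
Qed.

Lemma RInt_cs c f a b :
  ex_RInt f a b -> RInt (fun t => cs c (f t)) a b = cs c (RInt f a b).
Proof. intros H. apply is_RInt_unique, is_RInt_cs, RInt_correct, H. Qed.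

Lemma ex_RInt_cont f a b :
  (forall t, continuous f t) -> ex_RInt f a b.
Proof. intros H. apply ex_RInt_continuous. auto. Qed.

Lemma RInt_norm_bound f a b M :
  a <= b -> ex_RInt f a b -> (forall t, a <= t <= b -> norm (f t) <= M) ->
  norm (RInt f a b) <= M * (b - a).
Proof.
  intros Hab Hf HM.
  apply (norm_RInt_le f (fun _ => M) a b (RInt f a b)); auto.
  - apply RInt_correct, Hf.
  - evar_last. apply (is_RInt_const a b M). unfold scal; simpl; unfold mult; simpl; ring.
Qed.

(** Compactness of [a, b] makes the continuity of K at the points (z, t) uniform in t. *)
Lemma param_cont {T : UniformSpace} (K : T -> R -> X) z a b :
  a <= b ->
  (forall t, a <= t <= b -> continuous (fun p : T * R => K (fst p) (snd p)) (z, t)) ->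
  locally z (fun w => ex_RInt (K w) a b) ->
  continuous (fun w => RInt (K w) a b) z.
Proof.
  intros Hab HK Hex. apply continuous_eps. intros eps He.
  (* The added 1 keeps the denominator positive when a = b; eta (b - a) still stays below eps. *)
  set (eta := eps / (2 * (b - a + 1))).
  assert (Heta : 0 < eta) by (unfold eta; apply Rdiv_lt_0_compat; lra).
  assert (L : forall t, exists d : posreal, a <= t <= b ->
    forall w s, ball z d w -> ball t d s -> norm (minus (K w s) (K z t)) < eta / 2).
  { intros t. destruct (classic (a <= t <= b)) as [Ht|Ht].
    - generalize (HK t Ht). rewrite continuous_eps. intros H.
      destruct (H (eta / 2)) as [d Hd]. lra. exists d. intros _ w s Hw Hs.
      apply (Hd (w, s)). split; assumption.
    - exists (mkposreal 1 Rlt_0_1). tauto. }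
  pose (delta := fun t => proj1_sig (constructive_indefinite_description _ (L t))).
  assert (Hdelta : forall t, a <= t <= b -> forall w s, ball z (delta t) w ->
    ball t (delta t) s -> norm (minus (K w s) (K z t)) < eta / 2).
  { intros t. unfold delta. destruct (constructive_indefinite_description _ (L t)). auto. }
  (* One radius for all t: every t lies within [delta t0] of some t0 with d at most [delta t0]. The
     existence is doubly negated, hence the argument by contradiction below. *)
  destruct (compactness_value_1d a b delta) as [d Hd].
  assert (Hb : locally z (fun w => ball z d w)) by apply locally_ball.
  assert (Hz := locally_singleton _ _ Hex).
  generalize (filter_and _ _ Hb Hex). apply filter_imp. intros w [Hw Hew].
  rewrite <- RInt_sub by assumption.
  apply Rle_lt_trans with (eta * (b - a)).
  - apply RInt_norm_bound; auto.
    + apply (ex_RInt_minus (K w) (K z)); assumption.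
    + intros t Ht. apply Rnot_lt_le. intros N. apply (Hd t Ht).
      intros [t0 [Ht0 [H1 H2]]]. apply (Rlt_not_le _ _ N), Rlt_le.
      replace (minus (K w t) (K z t)) with
        (minus (minus (K w t) (K z t0)) (minus (K z t) (K z t0))) by module X.
      replace eta with (eta / 2 + eta / 2) by field.
      eapply Rle_lt_trans. apply nrm_minus.
      apply Rplus_lt_compat; apply Hdelta; auto.
      apply ball_le with d; auto. apply ball_center.
  - unfold eta. apply Rlt_le_trans with (eps / (2 * (b - a + 1)) * (2 * (b - a + 1))).
    apply Rmult_lt_compat_l; auto. lra. right. field. lra.
Qed.

End Integral.

(** * Holomorphic functions *)

(** Caratheodory's form of the complex derivative: a difference quotient Q that is continuous at z.
    Sums, division by w - z0 and differentiation under the integral become algebra on quotients. *)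
Definition hasderiv {X : CBanach} (F : R * R -> X) (z : R * R) (d : X) : Prop :=
  exists Q : R * R -> X, continuous Q z /\ Q z = d /\
    locally z (fun w => minus (F w) (F z) = cs (w - z)%C (Q w)).

Definition hol {X : CBanach} (F : R * R -> X) (z : R * R) : Prop :=
  exists d, hasderiv F z d.

(** Arcs are C1 on the whole line, beyond the interval over which they are integrated, so that
    translations and limits at the ends need no one-sided derivatives. *)
Definition C1 (al ad : R -> R * R) : Prop :=
  forall t, continuous ad t /\
    is_derive (fun t => fst (al t)) t (fst (ad t)) /\
    is_derive (fun t => snd (al t)) t (snd (ad t)).

Lemma C1_continuous al ad t : C1 al ad -> continuous al t.
Proof.
  intros H. apply continuous_pair_iff. destruct (H t) as [_ [H1 H2]].
  split; apply (ex_derive_continuous (V := R_NormedModule)); eexists; eassumption.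
Qed.

Lemma C1_shift al ad c : C1 al ad -> C1 (fun t => (al t + c)%C) ad.
Proof.
  intros H t. destruct (H t) as [H0 [H1 H2]]. split; [|split]; simpl; auto.
  - rewrite <- (plus_zero_r (fst (ad t))).
    apply (is_derive_plus (V := R_NormedModule) (fun t => fst (al t)) (fun _ => fst c)); auto.
    apply (is_derive_const (V := R_NormedModule)).
  - rewrite <- (plus_zero_r (snd (ad t))).
    apply (is_derive_plus (V := R_NormedModule) (fun t => snd (al t)) (fun _ => snd c)); auto.
    apply (is_derive_const (V := R_NormedModule)).
Qed.

Lemma C1_line z0 nu : C1 (fun e => (z0 + RtoC e * nu)%C) (fun _ => nu).
Proof.
  intros t. destruct z0 as [x y], nu as [u v]. split; [|split]; simpl.
  - apply continuous_const.
  - auto_derive; auto. ring.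
  - auto_derive; auto. ring.
Qed.

Lemma continuous_bounded (f : R -> R) a b :
  (forall t, continuous f t) -> exists M, 0 < M /\ forall t, a <= t <= b -> f t <= M.
Proof.
  intros Hf. destruct (Rle_dec a b) as [Hab|Hab].
  - destruct (continuity_ab_maj f a b Hab) as [m Hm].
    { intros c _. apply continuity_pt_filterlim, Hf. }
    exists (Rmax 1 (f m)). split. apply Rlt_le_trans with 1. lra. apply Rmax_l.
    intros t Ht. eapply Rle_trans; [apply Hm, Ht|apply Rmax_r].
  - exists 1. split. lra. intros t Ht. lra.
Qed.

Lemma continuous_Cmod {T : UniformSpace} (f : T -> R * R) x :
  continuous f x -> continuous (fun t => Cmod (f t)) x.
Proof.
  intros H P [e He].
  unfold filtermap. generalize (proj1 (continuous_C_iff f x) H e (cond_pos e)).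
  apply filter_imp. intros y Hy. apply He.
  unfold ball; simpl; unfold AbsRing_ball, abs, minus, plus, opp; simpl.
  apply Rabs_def1.
  - assert (Cmod (f y) <= Cmod (f y - f x)%C + Cmod (f x)); [|lra].
    eapply Rle_trans; [|apply Cmod_triangle]. right. f_equal. ring.
  - assert (Cmod (f x) <= Cmod (f x - f y)%C + Cmod (f y)).
    { eapply Rle_trans; [|apply Cmod_triangle]. right. f_equal. ring. }
    assert (Cmod (f x - f y)%C = Cmod (f y - f x)%C)
      by (rewrite <- Cmod_opp; f_equal; ring).
    lra.
Qed.

Lemma continuous_norm {T : UniformSpace} {X : CBanach} (f : T -> X) x :
  continuous f x -> continuous (fun t => norm (f t)) x.
Proof.
  intros H. apply (continuous_comp f (fun y : X => norm y)). exact H.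
  apply (filterlim_norm (K := R_AbsRing) (V := X)).
Qed.

Lemma C1_eps al ad t : C1 al ad -> forall eps, 0 < eps ->
  locally t (fun s => Cmod (al s - al t - RtoC (s - t) * ad t)%C <= eps * Rabs (s - t)).
Proof.
  intros H eps He. destruct (H t) as [_ [[_ H1] [_ H2]]].
  assert (He2 : 0 < eps / 2) by lra.
  generalize (filter_and _ _ (H1 t (fun P h => h) (mkposreal _ He2))
                             (H2 t (fun P h => h) (mkposreal _ He2))).
  apply filter_imp. intros s [A B].
  set (w := (al s - al t - RtoC (s - t) * ad t)%C).
  assert (A' : Rabs (fst w) <= eps / 2 * Rabs (s - t)).
  { eapply Rle_trans; [|exact A]. right.
    unfold norm; simpl; unfold abs; simpl. f_equal. unfold w; simpl.
    unfold minus, plus, opp, scal; simpl; unfold mult; simpl. ring. }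
  assert (B' : Rabs (snd w) <= eps / 2 * Rabs (s - t)).
  { eapply Rle_trans; [|exact B]. right.
    unfold norm; simpl; unfold abs; simpl. f_equal. unfold w; simpl.
    unfold minus, plus, opp, scal; simpl; unfold mult; simpl. ring. }
  clearbody w. apply Rnot_lt_le. intros N.
  assert (C : Cmod w < Cmod w); [|lra].
  replace (Cmod w) with (2 * (Cmod w / 2)) at 2 by field.
  apply Cmod_comp_bound; lra.
Qed.

(** The mean value theorem is available coordinatewise, which costs a factor 2 in L. *)
Lemma C1_lipschitz al ad a b : C1 al ad -> exists L, 0 < L /\
  (forall t, a <= t <= b -> Cmod (ad t) <= L) /\
  forall s t, a <= s <= b -> a <= t <= b -> Cmod (al s - al t)%C <= L * Rabs (s - t).
Proof.
  intros H. destruct (continuous_bounded (fun t => Cmod (ad t)) a b) as [M [HM0 HM]].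
  { intros t. apply continuous_Cmod. apply H. }
  exists (2 * M). split. lra. split.
  { intros t Ht. specialize (HM t Ht). lra. }
  intros s t Hs Ht.
  assert (B : forall f df, (forall u, is_derive f u (df u)) ->
     (forall u, a <= u <= b -> Rabs (df u) <= M) -> Rabs (f s - f t) <= M * Rabs (s - t)).
  { intros f df Hf Hdf. destruct (MVT_gen f t s df) as [c [Hc E]].
    - intros; apply Hf.
    - intros u Hu. apply continuity_pt_filterlim.
      apply (ex_derive_continuous (V := R_NormedModule)). eexists; apply Hf.
    - rewrite E, Rabs_mult. apply Rmult_le_compat_r. apply Rabs_pos. apply Hdf.
      split. eapply Rle_trans; [|apply Hc]. apply Rmin_glb; tauto.
      eapply Rle_trans; [apply Hc|]. apply Rmax_lub; tauto. }
  assert (B1 := B (fun t => fst (al t)) (fun t => fst (ad t)) (fun u => proj1 (proj2 (H u)))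
    (fun u Hu => Rle_trans _ _ _ (fst_le_Cmod _) (HM u Hu))).
  assert (B2 := B (fun t => snd (al t)) (fun t => snd (ad t)) (fun u => proj2 (proj2 (H u)))
    (fun u Hu => Rle_trans _ _ _ (snd_le_Cmod _) (HM u Hu))).
  apply Rnot_lt_le. intros N. set (w := (al s - al t)%C) in *.
  change (Rabs (fst w) <= M * Rabs (s - t)) in B1.
  change (Rabs (snd w) <= M * Rabs (s - t)) in B2.
  assert (C : Cmod w < Cmod w); [|lra].
  replace (Cmod w) with (2 * (Cmod w / 2)) at 2 by field.
  apply Cmod_comp_bound; lra.
Qed.

Section Hol.
Context {X : CBanach}.
Implicit Types F G K P : R * R -> X.

Lemma is_derive_eps (f : R -> X) t l :
  (forall eps, 0 < eps ->
    locally t (fun s => norm (minus (minus (f s) (f t)) (scal (s - t) l)) <= eps * Rabs (s - t))) ->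
  is_derive f t l.
Proof.
  intros H. split. apply is_linear_scal_l.
  intros y Hy. rewrite <- (is_filter_lim_locally_unique (V := R_NormedModule) t y Hy).
  intros eps. apply H. apply cond_pos.
Qed.

Lemma hasderiv_continuous F z d : hasderiv F z d -> continuous F z.
Proof.
  intros [Q [HQ [E L]]].
  apply (continuous_ext_loc F (fun w => plus (F z) (cs (w - z)%C (Q w)))).
  - generalize L. apply filter_imp. intros w Hw. rewrite <- Hw. module X.
  - apply (continuous_plus (fun _ => F z) (fun w => cs (w - z)%C (Q w))).
    apply continuous_const. apply continuous_cs; auto.
    apply continuous_Cminus. apply continuous_id. apply continuous_const.
Qed.

Lemma hol_continuous F z : hol F z -> continuous F z.
Proof. intros [d H]. eapply hasderiv_continuous, H. Qed.

Lemma hasderiv_chain F al ad t d :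
  C1 al ad -> hasderiv F (al t) d -> is_derive (fun s => F (al s)) t (cs (ad t) d).
Proof.
  intros Ha [Q [HQ [E L]]]. apply is_derive_eps. intros eps He.
  (* M adds up the two factors that multiply e1 below: [norm d + 1] bounds Q near [al t], and
     [Cmod (ad t)] multiplies the oscillation of Q. *)
  set (M := norm d + 1 + Cmod (ad t)).
  assert (HM : 0 < M) by (unfold M; pose proof (nrm_ge_0 d); pose proof (Cmod_ge_0 (ad t)); lra).
  set (e1 := Rmin 1 (eps / M)).
  assert (He1 : 0 < e1) by (apply Rmin_glb_lt; [lra|apply Rdiv_lt_0_compat; lra]).
  assert (Hc := C1_continuous al ad t Ha).
  assert (HQ' : continuous (fun s => Q (al s)) t) by (apply (continuous_comp al Q); auto).
  assert (L' := Hc _ L). unfold filtermap in L'.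
  generalize (filter_and _ _ L' (filter_and _ _ (proj1 (continuous_eps _ _) HQ' e1 He1)
      (C1_eps al ad t Ha e1 He1))).
  apply filter_imp. intros s [A [B C]].
  rewrite A.
  replace (minus (cs (al s - al t)%C (Q (al s))) (scal (s - t) (cs (ad t) d)))
    with (plus (cs (al s - al t - RtoC (s - t) * ad t)%C (Q (al s)))
               (cs (RtoC (s - t) * ad t)%C (minus (Q (al s)) (Q (al t))))).
  2: { rewrite E. module X. }
  eapply Rle_trans. apply nrm_plus. rewrite !norm_cs, Cmod_mult, Cmod_R.
  assert (B' : norm (Q (al s)) <= norm d + 1).
  { replace (Q (al s)) with (plus (minus (Q (al s)) (Q (al t))) (Q (al t))) by module X.
    eapply Rle_trans. apply nrm_plus. rewrite E. rewrite E in B.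
    assert (e1 <= 1) by apply Rmin_l. lra. }
  apply Rle_trans with (e1 * Rabs (s - t) * (norm d + 1) + Rabs (s - t) * Cmod (ad t) * e1).
  - apply Rplus_le_compat.
    + apply Rmult_le_compat; auto. apply Cmod_ge_0. apply nrm_ge_0.
    + apply Rmult_le_compat_l. apply Rmult_le_pos. apply Rabs_pos. apply Cmod_ge_0. lra.
  - replace (e1 * Rabs (s - t) * (norm d + 1) + Rabs (s - t) * Cmod (ad t) * e1)
      with (e1 * M * Rabs (s - t)) by (unfold M; ring).
    apply Rmult_le_compat_r. apply Rabs_pos.
    apply Rle_trans with (eps / M * M). apply Rmult_le_compat_r. lra. apply Rmin_r.
    right. field. lra.
Qed.

Definition cint (al ad : R -> R * R) (K : R * R -> X) (a b : R) : X :=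
  RInt (fun t => cs (ad t) (K (al t))) a b.

Lemma FTC_curve P K al ad a b :
  C1 al ad -> a <= b ->
  (forall t, a <= t <= b -> hasderiv P (al t) (K (al t))) ->
  (forall t, a <= t <= b -> continuous (fun t => K (al t)) t) ->
  cint al ad K a b = minus (P (al b)) (P (al a)).
Proof.
  intros Ha Hab HP HK. unfold cint. apply is_RInt_unique.
  apply (is_RInt_derive (fun t => P (al t)) (fun t => cs (ad t) (K (al t)))).
  - rewrite Rmin_left, Rmax_right by auto. intros t Ht.
    apply hasderiv_chain; auto.
  - rewrite Rmin_left, Rmax_right by auto. intros t Ht. apply continuous_cs.
    apply Ha. apply HK. auto.
Qed.

(** The primitive by which the affine part of a function integrates to zero around a closed box, as
    needed in Goursat's argument. *)
Lemma hasderiv_affine_primitive z0 z (x k : X) :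
  hasderiv (fun w => plus (cs (w - z0)%C x) (cs (/ 2 * (w - z0) * (w - z0))%C k)) z
    (plus x (cs (z - z0)%C k)).
Proof.
  exists (fun w => plus x (cs (/ 2 * ((w - z0) + (z - z0)))%C k)). split; [|split].
  - apply cont_plus.
    apply continuous_const. apply continuous_cs; [|apply continuous_const].
    apply continuous_Cmult. apply continuous_const.
    apply continuous_Cplus; [|apply continuous_const].
    apply continuous_Cminus. apply continuous_id. apply continuous_const.
  - f_equal. f_equal. field.
  - exists (mkposreal 1 Rlt_0_1). intros w _. module_coefs X; field.
Qed.

(** With a fixed direction nu every level curve has the velocity [ad] of the arc and is again C1.
    Translates along the normal of a C1 arc are in general only continuous. *)
Definition curtain (al : R -> R * R) (nu : C) (t e : R) : R * R :=
  (al t + RtoC e * nu)%C.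

(* The integral of K along the positively oriented boundary of the image of
   [a, b] x [c, d] under the map [curtain al nu]. *)
Definition bint (al ad : R -> R * R) (nu : C) (K : R * R -> X) (a b c d : R) : X :=
  minus (plus (cint (fun t => curtain al nu t c) ad K a b)
              (cint (fun e => curtain al nu b e) (fun _ => nu) K c d))
        (plus (cint (fun t => curtain al nu t d) ad K a b)
              (cint (fun e => curtain al nu a e) (fun _ => nu) K c d)).

(** If P failed, a failing quarter could be chosen again and again, and the nested boxes would
    shrink to a point where the local hypothesis contradicts the failure. Width or height zero is
    allowed, so the lemma also serves as bisection of an interval. *)
Lemma quadrisection (P : R -> R -> R -> Prop) a c w h :
  0 <= w -> 0 <= h ->
  (forall x y s, 0 < s -> P x y (s / 2) -> P (x + s / 2 * w) y (s / 2) ->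
     P x (y + s / 2 * h) (s / 2) -> P (x + s / 2 * w) (y + s / 2 * h) (s / 2) -> P x y s) ->
  (forall x0 y0, a <= x0 <= a + w -> c <= y0 <= c + h -> exists delta, 0 < delta /\
     forall x y s, 0 < s < delta -> x <= x0 <= x + s * w -> y <= y0 <= y + s * h ->
     P x y s) ->
  P a c 1.
Proof.
  intros Hw Hh Hstep Hloc. apply NNPP. intros N.
  set (s := fun n => / 2 ^ n).
  assert (Hs : forall n, 0 < s n) by (intros n; apply Rinv_0_lt_compat, pow_lt; lra).
  assert (HsS : forall n, s (S n) = s n / 2) by (intros n; unfold s; simpl; field; apply pow_nonzero; lra).
  assert (child : forall n (p : {p : R * R | ~ P (fst p) (snd p) (s n)}),
    exists q : {q : R * R | ~ P (fst q) (snd q) (s (S n))},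
      fst (proj1_sig p) <= fst (proj1_sig q) <= fst (proj1_sig p) + s n / 2 * w /\
      snd (proj1_sig p) <= snd (proj1_sig q) <= snd (proj1_sig p) + s n / 2 * h).
  { intros n [[x y] Hp]. simpl in *. rewrite HsS. specialize (Hs n).
    assert (0 <= s n / 2 * w) by (apply Rmult_le_pos; lra).
    assert (0 <= s n / 2 * h) by (apply Rmult_le_pos; lra).
    destruct (classic (P x y (s n / 2))) as [P1|P1].
    2: { exists (exist _ (x, y) P1). simpl. lra. }
    destruct (classic (P (x + s n / 2 * w) y (s n / 2))) as [P2|P2].
    2: { exists (exist _ (x + s n / 2 * w, y) P2). simpl. lra. }
    destruct (classic (P x (y + s n / 2 * h) (s n / 2))) as [P3|P3].
    2: { exists (exist _ (x, y + s n / 2 * h) P3). simpl. lra. }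
    destruct (classic (P (x + s n / 2 * w) (y + s n / 2 * h) (s n / 2))) as [P4|P4].
    2: { exists (exist _ (x + s n / 2 * w, y + s n / 2 * h) P4). simpl. lra. }
    elim Hp. apply Hstep; auto. }
  assert (N0 : ~ P (fst (a, c)) (snd (a, c)) (s 0%nat)).
  { unfold s. simpl. rewrite Rinv_1. exact N. }
  (* Dependent choice of a failing quarter at each stage; the failure is carried in the type. *)
  set (u := nat_rect (fun n => {p : R * R | ~ P (fst p) (snd p) (s n)}) (exist _ (a, c) N0)
     (fun n p => proj1_sig (constructive_indefinite_description _ (child n p)))).
  assert (Hu : forall n,
      fst (proj1_sig (u n)) <= fst (proj1_sig (u (S n))) <= fst (proj1_sig (u n)) + s n / 2 * w /\
      snd (proj1_sig (u n)) <= snd (proj1_sig (u (S n))) <= snd (proj1_sig (u n)) + s n / 2 * h).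
  { intros n. simpl. destruct (constructive_indefinite_description _ _) as [q Hq]. exact Hq. }
  assert (lim : forall (x : nat -> R) k, 0 <= k ->
    (forall n, x n <= x (S n) <= x n + s n / 2 * k) ->
    exists l, forall n, x n <= l <= x n + s n * k).
  { intros x k Hk Hx.
    (* The increments telescope because s i / 2 = s i - s (i + 1). *)
    assert (M : forall n m, x n <= x (n + m)%nat <= x n + s n * k - s (n + m)%nat * k).
    { intros n m. induction m as [|m IH].
      - rewrite Nat.add_0_r. lra.
      - rewrite Nat.add_succ_r. specialize (Hx (n + m)%nat). rewrite HsS.
        assert (0 <= s (n + m)%nat * k) by (apply Rmult_le_pos; auto; left; apply Hs). lra. }
    assert (U : forall n m, x m <= x n + s n * k).
    { intros n m. destruct (Nat.le_ge_cases n m) as [H|H].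
      - destruct (M n (m - n)%nat) as [_ M2]. replace (n + (m - n))%nat with m in M2 by lia.
        assert (0 <= s m * k) by (apply Rmult_le_pos; auto; left; apply Hs). lra.
      - destruct (M m (n - m)%nat) as [M1 _]. replace (m + (n - m))%nat with n in M1 by lia.
        assert (0 <= s n * k) by (apply Rmult_le_pos; auto; left; apply Hs). lra. }
    destruct (completeness (fun r => exists n, r = x n)) as [l [L1 L2]].
    - exists (x 0%nat + s 0%nat * k). intros r [n ->]. apply U.
    - exists (x 0%nat). eauto.
    - exists l. intros n. split. apply L1. eauto. apply L2. intros r [m ->]. apply U. }
  destruct (lim (fun n => fst (proj1_sig (u n))) w Hw (fun n => proj1 (Hu n))) as [x0 Hx0].
  destruct (lim (fun n => snd (proj1_sig (u n))) h Hh (fun n => proj2 (Hu n))) as [y0 Hy0].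
  destruct (Hloc x0 y0) as [delta [Hd HP]].
  { specialize (Hx0 0%nat). unfold s in Hx0. simpl in Hx0. rewrite Rinv_1 in Hx0. lra. }
  { specialize (Hy0 0%nat). unfold s in Hy0. simpl in Hy0. rewrite Rinv_1 in Hy0. lra. }
  destruct (pow_lt_1_zero (/ 2)) with (y := delta) as [n Hn]; auto.
  { rewrite Rabs_right; lra. }
  specialize (Hn n (Nat.le_refl n)). rewrite pow_inv in Hn.
  rewrite Rabs_right in Hn by (left; apply Hs).
  apply (proj2_sig (u n)). apply HP; auto.
Qed.

End Hol.

(** * Goursat's theorem *)

Section Goursat.
Context {X : CBanach}.
Implicit Types F G K P : R * R -> X.

Lemma ex_cint al ad K a b :
  C1 al ad -> a <= b -> (forall t, a <= t <= b -> continuous (fun s => K (al s)) t) ->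
  ex_RInt (fun t => cs (ad t) (K (al t))) a b.
Proof.
  intros Ha Hab HK. apply (ex_RInt_continuous (V := X)).
  rewrite Rmin_left, Rmax_right by auto. intros t Ht. apply continuous_cs; auto. apply Ha.
Qed.

Lemma cint_minus al ad K1 K2 a b :
  ex_RInt (fun t => cs (ad t) (K1 (al t))) a b ->
  ex_RInt (fun t => cs (ad t) (K2 (al t))) a b ->
  cint al ad (fun w => minus (K1 w) (K2 w)) a b = minus (cint al ad K1 a b) (cint al ad K2 a b).
Proof.
  intros H1 H2. unfold cint. rewrite <- RInt_sub by assumption.
  apply (RInt_ext (V := X)). intros t _. module X.
Qed.

Lemma cint_ext al ad K1 K2 a b :
  a <= b -> (forall t, a <= t <= b -> K1 (al t) = K2 (al t)) ->
  cint al ad K1 a b = cint al ad K2 a b.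
Proof.
  intros Hab H. apply (RInt_ext (V := X)). rewrite Rmin_left, Rmax_right by auto.
  intros t Ht. rewrite H. auto. lra.
Qed.

Lemma cint_bound al ad K a b L M :
  a <= b -> 0 <= L -> 0 <= M ->
  ex_RInt (fun t => cs (ad t) (K (al t))) a b ->
  (forall t, a <= t <= b -> Cmod (ad t) <= L) ->
  (forall t, a <= t <= b -> norm (K (al t)) <= M) ->
  norm (cint al ad K a b) <= L * M * (b - a).
Proof.
  intros Hab HL HM Hex H1 H2. apply RInt_norm_bound; auto.
  intros t Ht. apply norm_cs_lt; auto.
Qed.

Lemma continuous_curtain al ad nu p :
  C1 al ad -> continuous (fun q : R * R => curtain al nu (fst q) (snd q)) p.
Proof.
  intros Ha. unfold curtain. apply continuous_Cplus.
  - apply (continuous_comp (fun q : R * R => fst q) al). apply continuous_fst.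
    eapply C1_continuous, Ha.
  - apply continuous_Cmult. apply continuous_RtoC. apply continuous_snd.
    apply continuous_const.
Qed.

Lemma C1_horizontal al ad nu e : C1 al ad -> C1 (fun t => curtain al nu t e) ad.
Proof. apply (C1_shift al ad (RtoC e * nu)%C). Qed.

Lemma C1_vertical al nu t : C1 (fun e => curtain al nu t e) (fun _ => nu).
Proof. apply (C1_line (al t) nu). Qed.

Section Box.
Variables (al ad : R -> R * R) (nu : C).
Hypothesis Hal : C1 al ad.
Variables a b c d : R.
Hypotheses (Hab : a <= b) (Hcd : c <= d).

Lemma ex_horizontal K e a' b' :
  a <= a' <= b' -> b' <= b -> c <= e <= d ->
  (forall t s, a <= t <= b -> c <= s <= d -> continuous K (curtain al nu t s)) ->
  ex_RInt (fun t => cs (ad t) (K (curtain al nu t e))) a' b'.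
Proof.
  intros H1 H2 H3 HK.
  apply (ex_cint (fun t => curtain al nu t e) ad K a' b'); [|tauto|].
  - apply C1_horizontal, Hal.
  - intros t Ht. apply (continuous_comp (fun s => curtain al nu s e) K).
    eapply C1_continuous, C1_horizontal, Hal. apply HK; lra.
Qed.

Lemma ex_vertical K t c' d' :
  c <= c' <= d' -> d' <= d -> a <= t <= b ->
  (forall t s, a <= t <= b -> c <= s <= d -> continuous K (curtain al nu t s)) ->
  ex_RInt (fun e => cs nu (K (curtain al nu t e))) c' d'.
Proof.
  intros H1 H2 H3 HK.
  apply (ex_cint (fun e => curtain al nu t e) (fun _ => nu) K c' d'); [|tauto|].
  - apply C1_vertical.
  - intros s Hs. apply (continuous_comp (fun s => curtain al nu t s) K).
    eapply C1_continuous, C1_vertical. apply HK; lra.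
Qed.

Lemma bint_split K m n :
  a <= m <= b -> c <= n <= d ->
  (forall t s, a <= t <= b -> c <= s <= d -> continuous K (curtain al nu t s)) ->
  bint al ad nu K a b c d =
  plus (plus (bint al ad nu K a m c n) (bint al ad nu K m b c n))
       (plus (bint al ad nu K a m n d) (bint al ad nu K m b n d)).
Proof.
  intros Hm Hn HK. unfold bint, cint.
  rewrite (RInt_Chas (fun t => cs (ad t) (K (curtain al nu t c))) a m b)
    by (apply ex_horizontal; auto; lra).
  rewrite (RInt_Chas (fun t => cs (ad t) (K (curtain al nu t d))) a m b)
    by (apply ex_horizontal; auto; lra).
  rewrite (RInt_Chas (fun e => cs nu (K (curtain al nu b e))) c n d)
    by (apply ex_vertical; auto; lra).
  rewrite (RInt_Chas (fun e => cs nu (K (curtain al nu a e))) c n d)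
    by (apply ex_vertical; auto; lra).
  module X.
Qed.

Lemma bint_minus K1 K2 :
  (forall t s, a <= t <= b -> c <= s <= d -> continuous K1 (curtain al nu t s)) ->
  (forall t s, a <= t <= b -> c <= s <= d -> continuous K2 (curtain al nu t s)) ->
  bint al ad nu (fun w => minus (K1 w) (K2 w)) a b c d =
  minus (bint al ad nu K1 a b c d) (bint al ad nu K2 a b c d).
Proof.
  intros H1 H2. unfold bint.
  rewrite !cint_minus by (first [apply ex_horizontal | apply ex_vertical]; auto; lra).
  module X.
Qed.

Lemma bint_bound K L M :
  0 <= L -> 0 <= M ->
  (forall t s, a <= t <= b -> c <= s <= d -> continuous K (curtain al nu t s)) ->
  (forall t, a <= t <= b -> Cmod (ad t) <= L) ->
  (forall t s, a <= t <= b -> c <= s <= d -> norm (K (curtain al nu t s)) <= M) ->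
  norm (bint al ad nu K a b c d) <= 2 * M * (L * (b - a) + Cmod nu * (d - c)).
Proof.
  intros HL HM HK H1 H2. unfold bint. eapply Rle_trans. apply nrm_minus.
  assert (Hh : forall e, c <= e <= d ->
    norm (cint (fun t => curtain al nu t e) ad K a b) <= L * M * (b - a)).
  { intros e He. apply cint_bound; auto. apply ex_horizontal; auto; lra. }
  assert (Hv : forall t, a <= t <= b ->
    norm (cint (fun e => curtain al nu t e) (fun _ => nu) K c d) <= Cmod nu * M * (d - c)).
  { intros t Ht. apply cint_bound; auto. apply Cmod_ge_0. apply ex_vertical; auto; lra.
    intros; lra. }
  pose proof (nrm_plus (cint (fun t => curtain al nu t c) ad K a b)
     (cint (fun e => curtain al nu b e) (fun _ => nu) K c d)).
  pose proof (nrm_plus (cint (fun t => curtain al nu t d) ad K a b)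
     (cint (fun e => curtain al nu a e) (fun _ => nu) K c d)).
  assert (c <= c <= d) by lra. assert (c <= d <= d) by lra.
  assert (a <= a <= b) by lra. assert (a <= b <= b) by lra.
  pose proof (Hh c ltac:(assumption)). pose proof (Hh d ltac:(assumption)).
  pose proof (Hv a ltac:(assumption)). pose proof (Hv b ltac:(assumption)).
  lra.
Qed.

Lemma bint_primitive P K :
  (forall t s, a <= t <= b -> c <= s <= d -> hasderiv P (curtain al nu t s) (K (curtain al nu t s))) ->
  (forall t s, a <= t <= b -> c <= s <= d -> continuous K (curtain al nu t s)) ->
  bint al ad nu K a b c d = zero.
Proof.
  intros HP HK. unfold bint.
  assert (Hh : forall e, c <= e <= d ->
    cint (fun t => curtain al nu t e) ad K a b
      = minus (P (curtain al nu b e)) (P (curtain al nu a e))).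
  { intros e He. apply (FTC_curve P K (fun t => curtain al nu t e)); auto.
    apply C1_horizontal, Hal. intros t Ht.
    apply (continuous_comp (fun s => curtain al nu s e) K); auto.
    eapply C1_continuous, C1_horizontal, Hal. }
  assert (Hv : forall t, a <= t <= b ->
    cint (fun e => curtain al nu t e) (fun _ => nu) K c d
      = minus (P (curtain al nu t d)) (P (curtain al nu t c))).
  { intros t Ht. apply (FTC_curve P K (fun e => curtain al nu t e)); auto.
    apply C1_vertical. intros s Hs.
    apply (continuous_comp (fun s => curtain al nu t s) K); auto.
    eapply C1_continuous, C1_vertical. }
  rewrite !Hh, !Hv by lra. module X.
Qed.
End Box.

(** The subdivision takes place in the parameter rectangle, so the arc matters only through its
    Lipschitz constant. *)
Lemma goursat al ad nu K a b c d :
  C1 al ad -> a <= b -> c <= d ->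
  (forall t e, a <= t <= b -> c <= e <= d -> hol K (curtain al nu t e)) ->
  bint al ad nu K a b c d = zero.
Proof.
  intros Hal Hab Hcd HK.
  assert (HKc : forall t e, a <= t <= b -> c <= e <= d -> continuous K (curtain al nu t e))
    by (intros; apply hol_continuous; auto).
  destruct (C1_lipschitz al ad a b Hal) as [L [HL [HL1 HL2]]].
  (* C bounds half the length of the boundary of the image, and also the distance between any two of
     its points; for a sub-box both bounds scale by s. *)
  set (C := L * (b - a) + Cmod nu * (d - c)).
  assert (HC : 0 <= C).
  { apply Rplus_le_le_0_compat; apply Rmult_le_pos; try lra. apply Cmod_ge_0. }
  apply nrm_small.
  intros eta Heta.
  replace (minus (bint al ad nu K a b c d) zero) with (bint al ad nu K a b c d) by module X.
  set (P := fun x y s => a <= x /\ x + s * (b - a) <= b -> c <= y /\ y + s * (d - c) <= d ->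
     norm (bint al ad nu K x (x + s * (b - a)) y (y + s * (d - c))) <= eta * s ^ 2).
  assert (Q : P a c 1).
  2: { unfold P in Q. replace (a + 1 * (b - a)) with b in Q by ring.
       replace (c + 1 * (d - c)) with d in Q by ring.
       replace (eta * 1 ^ 2) with eta in Q by ring.
       apply Q; lra. }
  apply (quadrisection P a c (b - a) (d - c)); try lra.
  - intros x y s Hs P1 P2 P3 P4 Hx Hy.
    assert (0 <= s * (b - a)) by (apply Rmult_le_pos; lra).
    assert (0 <= s * (d - c)) by (apply Rmult_le_pos; lra).
    rewrite (bint_split al ad nu Hal x (x + s * (b - a)) y (y + s * (d - c)))
      with (m := x + s / 2 * (b - a)) (n := y + s / 2 * (d - c)); try lra.
    2: { intros; apply HKc; lra. }
    assert (Q1 := P1 ltac:(lra) ltac:(lra)). assert (Q2 := P2 ltac:(lra) ltac:(lra)).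
    assert (Q3 := P3 ltac:(lra) ltac:(lra)). assert (Q4 := P4 ltac:(lra) ltac:(lra)).
    replace (x + s / 2 * (b - a) + s / 2 * (b - a)) with (x + s * (b - a)) in * by field.
    replace (y + s / 2 * (d - c) + s / 2 * (d - c)) with (y + s * (d - c)) in * by field.
    replace (eta * s ^ 2) with ((eta * (s / 2) ^ 2 + eta * (s / 2) ^ 2) + (eta * (s / 2) ^ 2 + eta * (s / 2) ^ 2)) by field.
    eapply Rle_trans; [apply nrm_plus|].
    apply Rplus_le_compat; (eapply Rle_trans; [apply nrm_plus|]); apply Rplus_le_compat; auto.
  - intros t0 e0 Ht0 He0.
    destruct (HK t0 e0 ltac:(lra) ltac:(lra)) as [k [Q [HQ [Ek HL']]]].
    set (z0 := curtain al nu t0 e0) in *.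
    (* Made for the final estimate 2 (C s eta') (C s) <= eta s^2; the added 1 covers C = 0. *)
    set (eta' := eta / (2 * C ^ 2 + 1)).
    assert (Heta' : 0 < eta') by (apply Rdiv_lt_0_compat; nra).
    generalize (filter_and _ _ HL' (proj1 (continuous_eps _ _) HQ eta' Heta')). intros HL2'.
    apply locally_Cmod in HL2'. destruct HL2' as [rho [Hrho Hloc]].
    exists (rho / (C + 1)). split. apply Rdiv_lt_0_compat; lra.
    intros x y s [Hs Hs'] Htx Hey Hx Hy.
    assert (HCs : C * s < rho).
    { apply Rle_lt_trans with ((C + 1) * s). nra.
      apply Rlt_le_trans with ((C + 1) * (rho / (C + 1))).
      apply Rmult_lt_compat_l; lra. right; field; lra. }
    assert (near : forall t e, x <= t <= x + s * (b - a) -> y <= e <= y + s * (d - c) ->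
      Cmod (curtain al nu t e - z0)%C <= C * s).
    { intros t e Ht He. unfold z0, curtain.
      replace (al t + RtoC e * nu - (al t0 + RtoC e0 * nu))%C
        with ((al t - al t0) + RtoC (e - e0) * nu)%C by (rewrite RtoC_minus; ring).
      eapply Rle_trans; [apply Cmod_triangle|]. rewrite Cmod_mult, Cmod_R.
      apply Rle_trans with (L * (s * (b - a)) + (s * (d - c)) * Cmod nu); [|unfold C; right; ring].
      apply Rplus_le_compat.
      - eapply Rle_trans; [apply HL2; lra|]. apply Rmult_le_compat_l. lra.
        apply Rabs_le. lra.
      - apply Rmult_le_compat_r. apply Cmod_ge_0. apply Rabs_le. lra. }
    (* The first order part at z0 has a primitive, so its integral vanishes and may be subtracted;
       what is left is (w - z0) (Q w - Q z0). *)
    set (A := fun w : R * R => plus (K z0) (cs (w - z0)%C k)).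
    assert (HA : forall w, continuous A w).
    { intros w. apply cont_plus. apply continuous_const. apply continuous_cs.
      apply continuous_Cminus. apply continuous_id. apply continuous_const.
      apply continuous_const. }
    assert (0 <= s * (b - a)) by (apply Rmult_le_pos; lra).
    assert (0 <= s * (d - c)) by (apply Rmult_le_pos; lra).
    replace (bint al ad nu K x (x + s * (b - a)) y (y + s * (d - c))) with
      (minus (bint al ad nu K x (x + s * (b - a)) y (y + s * (d - c)))
             (bint al ad nu A x (x + s * (b - a)) y (y + s * (d - c)))).
    2: { rewrite (bint_primitive al ad nu Hal x (x + s * (b - a)) y (y + s * (d - c))
           ltac:(lra) ltac:(lra)
           (fun w => plus (cs (w - z0)%C (K z0)) (cs (/ 2 * (w - z0) * (w - z0))%C k)) A).
         module X. intros; apply hasderiv_affine_primitive. intros; apply HA. }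
    rewrite <- bint_minus; auto; try lra.
    2: { intros; apply HKc; lra. }
    eapply Rle_trans.
    + apply bint_bound with (L := L) (M := C * s * eta'); auto; try lra.
      * apply Rmult_le_pos; [apply Rmult_le_pos|]; lra.
      * intros t e Ht He. apply cont_minus. apply HKc; lra. apply HA.
      * intros; apply HL1; lra.
      * intros t e Ht He. set (w := curtain al nu t e).
        assert (Hw : Cmod (w - z0)%C <= C * s) by (apply near; auto).
        destruct (Hloc w) as [E1 E2]. lra.
        replace (minus (K w) (A w)) with (cs (w - z0)%C (minus (Q w) (Q z0))).
        2: { unfold A. rewrite Ek.
             replace (K w) with (plus (K z0) (minus (K w) (K z0))) by module X.
             rewrite E1. module X. }
        apply norm_cs_lt; auto. lra.
    + replace (x + s * (b - a) - x) with (s * (b - a)) by ring.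
      replace (y + s * (d - c) - y) with (s * (d - c)) by ring.
      replace (2 * (C * s * eta') * (L * (s * (b - a)) + Cmod nu * (s * (d - c))))
        with (2 * C ^ 2 * eta' * s ^ 2) by (unfold C; ring).
      apply Rmult_le_compat_r. nra.
      apply Rle_trans with ((2 * C ^ 2 + 1) * eta'). nra.
      unfold eta'. right. field. nra.
Qed.
End Goursat.

(** * Holomorphic functions: algebra, difference quotients, continuous boundary values *)

Lemma Cminus_neq_0 (w z : C) : w <> z -> (w - z)%C <> RtoC 0.
Proof. intros N E. apply N. replace w with ((w - z) + z)%C by ring. rewrite E. ring. Qed.

Lemma Cmod_minus_gt (w z : C) : w <> z -> 0 < Cmod (w - z)%C.
Proof. intros N. apply Cmod_gt_0. apply Cminus_neq_0, N. Qed.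

Lemma Cmod_minus_sym (w z : C) : Cmod (w - z)%C = Cmod (z - w)%C.
Proof. rewrite <- Cmod_opp. f_equal. ring. Qed.

Lemma locally_neq (w z : R * R) : w <> z -> locally w (fun s : R * R => s <> z).
Proof.
  intros N. apply locally_Cmod. exists (Cmod (w - z)%C). split.
  apply Cmod_minus_gt, N. intros s Hs E. subst s. rewrite Cmod_minus_sym in Hs. lra.
Qed.

Section HolAlgebra.
Context {X : CBanach}.
Implicit Types F G K P : R * R -> X.

Lemma hol_ext_loc F G z : locally z (fun w => F w = G w) -> hol F z -> hol G z.
Proof.
  intros L [d [Q [HQ [E H]]]]. exists d, Q. repeat split; auto.
  generalize (filter_and _ _ L H). apply filter_imp. intros w [A B].
  rewrite <- A. rewrite <- (locally_singleton _ _ L). exact B.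
Qed.

Lemma hol_plus F G z : hol F z -> hol G z -> hol (fun w => plus (F w) (G w)) z.
Proof.
  intros [d [Q [HQ [E H]]]] [d' [Q' [HQ' [E' H']]]].
  exists (plus d d'), (fun w => plus (Q w) (Q' w)). split; [|split].
  - apply cont_plus; auto.
  - now rewrite E, E'.
  - generalize (filter_and _ _ H H'). apply filter_imp. intros w [A B].
    rewrite cs_plus_r, <- A, <- B. module X.
Qed.

Lemma hol_const x z : hol (fun _ => x : X) z.
Proof.
  exists zero, (fun _ => zero). split; [|split]; auto. apply continuous_const.
  exists (mkposreal 1 Rlt_0_1). intros w _. rewrite cs_zero_r. module X.
Qed.

Lemma hol_cs c F z : hol F z -> hol (fun w => cs c (F w)) z.
Proof.
  intros [d [Q [HQ [E H]]]].
  exists (cs c d), (fun w => cs c (Q w)). split; [|split].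
  - apply continuous_cs; auto. apply continuous_const.
  - now rewrite E.
  - revert H. apply filter_imp. intros w A.
    replace (cs (w - z)%C (cs c (Q w))) with (cs c (cs (w - z)%C (Q w))) by module X.
    rewrite <- A. module X.
Qed.

Lemma hol_opp F z : hol F z -> hol (fun w => opp (F w)) z.
Proof.
  intros H. apply (hol_ext_loc (fun w => cs (- (1))%C (F w))).
  apply filter_forall. intros w. module X. apply hol_cs, H.
Qed.

Lemma hol_minus F G z : hol F z -> hol G z -> hol (fun w => minus (F w) (G w)) z.
Proof. intros HF HG. apply (hol_plus F (fun w => opp (G w))); auto. apply hol_opp, HG. Qed.

Lemma hol_cauchy_kernel F z0 w0 :
  hol F w0 -> w0 <> z0 -> hol (fun w => cs (/ (w - z0))%C (F w)) w0.
Proof.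
  intros [d [Q [HQ [E H]]]] N.
  (* The difference quotient at w0 of F w / (w - z0), expressed through the quotient Q of F. *)
  set (Q' := fun w : R * R => minus (cs (/ (w - z0))%C (Q w))
     (cs (/ ((w - z0) * (w0 - z0)))%C (F w0))).
  exists (Q' w0), Q'. split; [|split]; auto.
  - assert (Cw : continuous (fun w : R * R => (w - z0)%C : R * R) w0).
    { apply continuous_Cminus. apply continuous_id. apply continuous_const. }
    apply cont_minus; apply continuous_cs; auto; try apply continuous_const;
      apply continuous_Cinv; auto; try apply continuous_Cmult; auto;
      try apply continuous_const; try apply Cmult_neq_0; apply Cminus_neq_0, N.
  - generalize (filter_and _ _ H (locally_neq w0 z0 N)). apply filter_imp. intros w [A B].
    unfold Q'. replace (F w) with (plus (F w0) (minus (F w) (F w0))) by module X.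
    rewrite A. module_coefs X; field; try split; apply Cminus_neq_0; auto.
Qed.

(** With the derivative as its value at z the quotient is continuous there. Holomorphy at z would
    amount to a removable singularity theorem; [curtain_zero] gets by with continuity on the level
    of z. *)
Definition dquot F (z : C) (d : X) (w : R * R) : X :=
  if Req_EM_T (Cmod (w - z)%C) 0 then d
  else cs (/ (w - z))%C (minus (F w) (F z)).

Lemma dquot_neq F z d w : w <> z -> dquot F z d w = cs (/ (w - z))%C (minus (F w) (F z)).
Proof.
  intros N. unfold dquot. destruct Req_EM_T as [E|E]; auto.
  pose proof (Cmod_minus_gt w z N). lra.
Qed.

Lemma continuous_dquot F z d : hasderiv F z d -> continuous (dquot F z d) z.
Proof.
  intros [Q [HQ [E H]]]. apply (continuous_ext_loc _ Q); auto.
  revert H. apply filter_imp. intros w A. unfold dquot.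
  destruct Req_EM_T as [E0|E0].
  - apply Cmod_eq_0 in E0. replace w with z. auto.
    replace w with ((w - z) + z)%C by ring. rewrite E0. ring.
  - rewrite A. module_coefs X. field. intros E1. apply E0. rewrite E1. apply Cmod_0.
Qed.

Lemma hol_dquot F z d w : w <> z -> hol F w -> hol (dquot F z d) w.
Proof.
  intros N H. apply (hol_ext_loc (fun w => cs (/ (w - z))%C (minus (F w) (F z)))).
  - generalize (locally_neq w z N). apply filter_imp. intros s Hs. now rewrite dquot_neq.
  - apply (hol_cauchy_kernel (fun w => minus (F w) (F z))); auto.
    apply hol_minus; auto. apply hol_const.
Qed.

Lemma continuous_cauchy_kernel F z0 w0 :
  continuous F w0 -> w0 <> z0 -> continuous (fun w => cs (/ (w - z0))%C (F w)) w0.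
Proof.
  intros HF N. apply continuous_cs; auto. apply continuous_Cinv.
  apply continuous_Cminus. apply continuous_id. apply continuous_const.
  apply Cminus_neq_0, N.
Qed.

(** Carries an identity known at interior levels to the two ends, where only continuity is
    available. *)
Lemma eq_of_constant_inside (E : R -> X) p q :
  p < q -> continuous E p -> continuous E q ->
  (forall x y, p < x -> x <= y -> y < q -> E x = E y) -> E p = E q.
Proof.
  intros Hpq Hp Hq HE. apply nrm_minus_eq_0. intros e He.
  assert (He2 : 0 < e / 2) by lra.
  destruct (proj1 (continuous_eps _ _) Hp _ He2) as [d1 H1].
  destruct (proj1 (continuous_eps _ _) Hq _ He2) as [d2 H2].
  set (r := Rmin (Rmin d1 d2) (q - p) / 3).
  assert (0 < Rmin (Rmin d1 d2) (q - p)).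
  { apply Rmin_glb_lt; [apply Rmin_glb_lt; apply cond_pos|lra]. }
  assert (Rmin (Rmin d1 d2) (q - p) <= d1) by (eapply Rle_trans; [apply Rmin_l|apply Rmin_l]).
  assert (Rmin (Rmin d1 d2) (q - p) <= d2) by (eapply Rle_trans; [apply Rmin_l|apply Rmin_r]).
  assert (Rmin (Rmin d1 d2) (q - p) <= q - p) by apply Rmin_r.
  assert (B1 : norm (minus (E (p + r)) (E p)) < e / 2).
  { apply H1. unfold ball; simpl; unfold AbsRing_ball, abs, minus, plus, opp; simpl.
    rewrite Rabs_right; unfold r; lra. }
  assert (B2 : norm (minus (E (q - r)) (E q)) < e / 2).
  { apply H2. unfold ball; simpl; unfold AbsRing_ball, abs, minus, plus, opp; simpl.
    rewrite Rabs_left; unfold r; lra. }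
  rewrite <- (HE (p + r) (q - r)) in B2 by (unfold r; lra).
  replace (minus (E p) (E q)) with
    (minus (minus (E (p + r)) (E q)) (minus (E (p + r)) (E p))) by module X.
  eapply Rle_trans. apply nrm_minus. lra.
Qed.

Lemma cint_vertical al nu K t c d :
  ex_RInt (fun e => K (curtain al nu t e)) c d ->
  cint (fun e => curtain al nu t e) (fun _ => nu) K c d =
  cs nu (RInt (fun e => K (curtain al nu t e)) c d).
Proof. intros H. apply (RInt_cs nu (fun e => K (curtain al nu t e))), H. Qed.

(* Goursat's theorem with K only continuous (through an extension Kc of its
   pullback) on the two horizontal sides and along one exceptional level. *)
Lemma curtain_zero al ad nu K (Kc : R -> R -> X) a b c d es :
  C1 al ad -> a <= b -> c < d ->
  (forall p : R * R, continuous (fun p => Kc (fst p) (snd p)) p) ->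
  (forall t e, a <= t <= b -> c <= e <= d -> Kc t e = K (curtain al nu t e)) ->
  (forall t e, a <= t <= b -> c < e < d -> e <> es -> hol K (curtain al nu t e)) ->
  bint al ad nu K a b c d = zero.
Proof.
  intros Hal Hab Hcd HKc HK Hhol.
  assert (Ct : forall t e, continuous (fun t => Kc t e) t).
  { intros t e. apply (continuous_comp_2 (fun t => t) (fun _ => e) Kc).
    apply continuous_id. apply continuous_const. apply (HKc (t, e)). }
  assert (Ce : forall t e, continuous (fun e => Kc t e) e).
  { intros t e. apply (continuous_comp_2 (fun _ => t) (fun e => e) Kc).
    apply continuous_const. apply continuous_id. apply (HKc (t, e)). }
  assert (Ev : forall t p q, ex_RInt (fun e => Kc t e) p q)
    by (intros; apply ex_RInt_cont; auto).
  assert (Eh : forall e p q, ex_RInt (fun t => cs (ad t) (Kc t e)) p q).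
  { intros; apply ex_RInt_cont. intros t. apply continuous_cs; auto. apply Hal. }
  (* E e is the integral along level e minus the net contribution of the vertical sides below it, so
     the box between levels p and q has integral E p - E q. Goursat makes E constant inside, and
     continuity does the rest. *)
  set (E := fun e => minus (RInt (fun t => cs (ad t) (Kc t e)) a b)
     (cs nu (RInt (fun s => minus (Kc b s) (Kc a s)) c e))).
  assert (CE : forall e, continuous E e).
  { intros e. apply cont_minus.
    - apply (param_cont (fun e t => cs (ad t) (Kc t e))); auto.
      + intros t Ht. apply continuous_cs.
        * apply (continuous_comp (fun p : R * R => snd p) ad). apply continuous_snd. apply Hal.
        * apply (continuous_comp_2 (fun p : R * R => snd p) (fun p : R * R => fst p) Kc).
          apply continuous_snd. apply continuous_fst. apply (HKc (t, e)).
      + apply filter_forall. intros w. apply Eh.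
    - apply continuous_cs. apply continuous_const.
      apply (continuous_RInt_1 (fun s => minus (Kc b s) (Kc a s)) c e).
      apply filter_forall. intros z. apply RInt_correct.
      apply ex_RInt_cont. intros t. apply cont_minus; auto. }
  assert (BE : forall p q, c <= p -> p <= q -> q <= d ->
    bint al ad nu K a b p q = minus (E p) (E q)).
  { intros p q Hp Hpq Hq. unfold bint.
    assert (Ex : forall t, a <= t <= b -> ex_RInt (fun e => K (curtain al nu t e)) p q).
    { intros t Ht. apply (ex_RInt_ext (fun e => Kc t e)); auto.
      rewrite Rmin_left, Rmax_right by auto. intros s Hs. apply HK; lra. }
    rewrite !cint_vertical by (apply Ex; lra).
    unfold E, cint.
    assert (Hh : forall e, c <= e <= d -> RInt (fun t => cs (ad t) (K (curtain al nu t e))) a b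
       = RInt (fun t => cs (ad t) (Kc t e)) a b).
    { intros e He. apply (RInt_ext (V := X)). rewrite Rmin_left, Rmax_right by auto.
      intros t Ht. rewrite HK; auto. lra. }
    assert (Hv : forall t, a <= t <= b -> RInt (fun e => K (curtain al nu t e)) p q
       = RInt (fun e => Kc t e) p q).
    { intros t Ht. apply (RInt_ext (V := X)). rewrite Rmin_left, Rmax_right by auto.
      intros e He. rewrite HK; auto. lra. }
    rewrite !Hh, !Hv by lra.
    rewrite !RInt_sub by auto.
    change (fun e => Kc b e) with (Kc b). change (fun e => Kc a e) with (Kc a).
    rewrite (RInt_Chas (Kc b) c p q), (RInt_Chas (Kc a) c p q) by (first [apply (Ev b) | apply (Ev a)]).
    module X. }
  rewrite BE by lra.
  assert (EE : forall x y, c < x -> x <= y -> y < d -> (es < x \/ y < es) -> E x = E y).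
  { intros x y Hx Hxy Hy Hes.
    assert (Z : minus (E x) (E y) = zero).
    { rewrite <- BE by lra. apply goursat; auto. intros t e Ht He. apply Hhol; lra. }
    replace (E x) with (plus (minus (E x) (E y)) (E y)) by module X. rewrite Z. module X. }
  assert (F : E c = E d).
  (* An exceptional level strictly inside cuts the interval in two; E is continuous at the cut as
     well. *)
  { destruct (Rle_dec es c) as [H1|H1]; [|destruct (Rle_dec d es) as [H2|H2]].
    - apply eq_of_constant_inside; auto; intros; apply EE; lra.
    - apply eq_of_constant_inside; auto; intros; apply EE; lra.
    - transitivity (E es); (apply eq_of_constant_inside; auto; [lra|intros; apply EE; lra]). }
  rewrite F. module X.
Qed.

End HolAlgebra.

(** * Liouville's theorem *)

Section Liouville.
Context {X : CBanach}.
Implicit Types F G K P : R * R -> X.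

(** The Poisson kernel, with an arctangent as primitive. It evaluates both the winding number of a
    square and the jump across an arc. *)
Lemma is_RInt_poisson (x : X) e lo hi :
  0 < e ->
  is_RInt (fun t => scal (e / (t ^ 2 + e ^ 2)) x) lo hi
    (scal (atan (hi / e) - atan (lo / e)) x).
Proof.
  intros He.
  replace (scal (atan (hi / e) - atan (lo / e)) x)
    with (minus (scal (atan (hi / e)) x) (scal (atan (lo / e)) x)) by module X.
  assert (N : forall t, t ^ 2 + e ^ 2 <> 0) by (intros; nra).
  apply (is_RInt_derive (V := X) (fun t => scal (atan (t / e)) x)).
  - intros t _. apply (is_derive_scal_l (V := X) (fun t => atan (t / e))).
    auto_derive; auto. field. repeat split; nra.
  - intros t _. apply (continuous_scal_l (V := X) (fun t => e / (t ^ 2 + e ^ 2))).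
    apply (ex_derive_continuous (V := R_NormedModule) (fun t => e / (t ^ 2 + e ^ 2))).
    auto_derive. exact (N t).
Qed.

(** Since i / (r + i t) = 1 / (t - i r) and i / (- r + i t) = 1 / (t + i r), the vertical sides of a
    square repeat the horizontal ones, and the sum is twice 1 / (t - i r) - 1 / (t + i r). *)
Lemma square_kernel_sum (t r : R) : 0 < r ->
  (1 * / (RtoC t - Ci * r) + Ci * / (RtoC r + Ci * t)
   - (1 * / (RtoC t + Ci * r) + Ci * / (- RtoC r + Ci * t)) = 4 * Ci * RtoC (r / (t ^ 2 + r ^ 2)))%C.
Proof.
  intros Hr. assert (0 < t * t + r * r) by nra.
  unfold Cinv, Cmult, Cplus, Cminus, Copp, RtoC, Ci. simpl.
  apply injective_projections; simpl; field; repeat split; nra.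
Qed.

(** The winding number of a square about its centre, read off from atan 1 = PI / 4. *)
Lemma bint_square_kernel (z0 : C) r (x : X) :
  0 < r ->
  bint (fun t => (z0 + RtoC t * 1)%C) (fun _ => RtoC 1) Ci
    (fun w => cs (/ (w - z0))%C x) (- r) r (- r) r = cs (RtoC (2 * PI) * Ci)%C x.
Proof.
  intros Hr.
  assert (Ex : forall (u : C) (g : R -> C), C1 g (fun _ => u) -> (forall t, g t <> z0) ->
    ex_RInt (fun t => cs u (cs (/ (g t - z0))%C x)) (- r) r).
  { intros u g Hg Hn. apply (ex_cint g (fun _ => u) (fun w => cs (/ (w - z0))%C x)); auto.
    lra. intros t _. apply (continuous_comp g (fun w => cs (/ (w - z0))%C x)).
    eapply C1_continuous, Hg. apply continuous_cauchy_kernel; auto. apply continuous_const. }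
  assert (Hline := C1_line z0 1).
  assert (Nh : forall e t, e <> 0 -> curtain (fun t => (z0 + RtoC t * 1)%C) Ci t e <> z0).
  { intros e t He E. apply He. apply (f_equal snd) in E. destruct z0. unfold curtain in E. simpl in E. lra. }
  assert (Nv : forall e t, t <> 0 -> curtain (fun t => (z0 + RtoC t * 1)%C) Ci t e <> z0).
  { intros e t He E. apply He. apply (f_equal fst) in E. destruct z0. unfold curtain in E. simpl in E. lra. }
  assert (E1 := Ex 1%C (fun t => curtain (fun t => (z0 + RtoC t * 1)%C) Ci t (- r))
    (C1_horizontal _ _ _ _ Hline) (fun t => Nh (- r) t ltac:(lra))).
  assert (E2 := Ex 1%C (fun t => curtain (fun t => (z0 + RtoC t * 1)%C) Ci t r)
    (C1_horizontal _ _ _ _ Hline) (fun t => Nh r t ltac:(lra))).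
  assert (E3 := Ex Ci (fun e => curtain (fun t => (z0 + RtoC t * 1)%C) Ci r e)
    (C1_vertical _ _ _) (fun e => Nv e r ltac:(lra))).
  assert (E4 := Ex Ci (fun e => curtain (fun t => (z0 + RtoC t * 1)%C) Ci (- r) e)
    (C1_vertical _ _ _) (fun e => Nv e (- r) ltac:(lra))).
  unfold bint, cint.
  set (f1 := fun t : R => cs _ _) in E1. set (f2 := fun t : R => cs _ _) in E2.
  set (f3 := fun t : R => cs _ _) in E3. set (f4 := fun t : R => cs _ _) in E4.
  change (minus (plus (RInt f1 (- r) r) (RInt f3 (- r) r)) (plus (RInt f2 (- r) r) (RInt f4 (- r) r))
    = cs (RtoC (2 * PI) * Ci)%C x).
  rewrite <- !RInt_add by assumption.
  rewrite <- RInt_sub.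
  2: { exists (plus (RInt f1 (- r) r) (RInt f3 (- r) r)). apply is_RInt_lin; apply RInt_correct; assumption. }
  2: { exists (plus (RInt f2 (- r) r) (RInt f4 (- r) r)). apply is_RInt_lin; apply RInt_correct; assumption. }
  apply is_RInt_unique.
  apply (is_RInt_ext (fun t => cs (4 * Ci)%C (scal (r / (t ^ 2 + r ^ 2)) x))).
  - intros t _. unfold f1, f2, f3, f4, curtain. module_coefs X.
    replace (z0 + RtoC t * 1 + RtoC (- r) * Ci - z0)%C with (RtoC t - Ci * r)%C
      by (rewrite RtoC_opp; ring).
    replace (z0 + RtoC t * 1 + RtoC r * Ci - z0)%C with (RtoC t + Ci * r)%C by ring.
    replace (z0 + RtoC r * 1 + RtoC t * Ci - z0)%C with (RtoC r + Ci * t)%C by ring.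
    replace (z0 + RtoC (- r) * 1 + RtoC t * Ci - z0)%C with (- RtoC r + Ci * t)%C
      by (rewrite RtoC_opp; ring).
    transitivity (4 * Ci * RtoC (r / (t ^ 2 + r ^ 2)))%C. ring.
    rewrite <- (square_kernel_sum t r Hr). ring.
  - replace (cs (RtoC (2 * PI) * Ci)%C x)
      with (cs (4 * Ci)%C (scal (atan (r / r) - atan (- r / r)) x)).
    + apply is_RInt_cs. apply is_RInt_poisson, Hr.
    + replace (r / r) with 1 by (field; lra). replace (- r / r) with (- (1)) by (field; lra).
      rewrite atan_opp, atan_1. module_coefs X.
      replace (PI / 4 - - (PI / 4)) with (PI / 2) by field.
      replace (2 * PI) with (4 * (PI / 2)) by field. rewrite RtoC_mult. ring.
Qed.

(** Cauchy's formula on a large square centred at z0, where each side contributes at most eps to 2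
    PI i G z0. The formula comes from [curtain_zero] for the difference quotient and from
    [bint_square_kernel] for the constant part. *)
Lemma liouville G :
  (forall z, hol G z) ->
  (forall eps, 0 < eps -> exists M, forall w, M <= Cmod w -> norm (G w) <= eps) ->
  forall z, G z = zero.
Proof.
  intros Hol Hinf z0. apply nrm_small. intros eps Heps.
  destruct (Hinf (eps / 2)) as [M HM]. lra.
  (* Half the side of the square: |w - z0| >= r forces |w| >= M. *)
  set (r := Rabs M + Cmod z0 + 1).
  assert (Hr : 0 < r) by (unfold r; pose proof (Rabs_pos M); pose proof (Cmod_ge_0 z0); lra).
  destruct (Hol z0) as [d Hd].
  set (al := fun t => (z0 + RtoC t * 1)%C : R * R).
  assert (Hal : C1 al (fun _ => RtoC 1)) by apply C1_line.
  assert (Hcur : forall t e, curtain al Ci t e = (z0 + (RtoC t + RtoC e * Ci))%C).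
  { intros. unfold curtain, al. Cring. }
  assert (Dcur : forall t e, Rabs t <= Cmod (curtain al Ci t e - z0)%C /\
      Rabs e <= Cmod (curtain al Ci t e - z0)%C).
  { intros t e. rewrite Hcur.
    replace (z0 + (RtoC t + RtoC e * Ci) - z0)%C with ((t, e) : C).
    split. apply (fst_le_Cmod (t, e)). apply (snd_le_Cmod (t, e)).
    destruct z0; apply injective_projections; simpl; Cring. }
  assert (Z : bint al (fun _ => RtoC 1) Ci (dquot G z0 d) (- r) r (- r) r = zero).
  (* The exceptional level is 0, the level of the centre z0. *)
  { apply (curtain_zero al (fun _ => RtoC 1) Ci (dquot G z0 d)
      (fun t e => dquot G z0 d (curtain al Ci t e)) _ _ _ _ 0); auto; try lra.
    - intros p. apply (continuous_comp (fun p : R * R => curtain al Ci (fst p) (snd p)) (dquot G z0 d)).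
      eapply continuous_curtain, Hal.
      destruct (Req_EM_T (Cmod (curtain al Ci (fst p) (snd p) - z0)%C) 0) as [E|E].
      + apply Cmod_eq_0 in E.
        replace (curtain al Ci (fst p) (snd p)) with z0. apply continuous_dquot, Hd.
        replace z0 with (curtain al Ci (fst p) (snd p) - (curtain al Ci (fst p) (snd p) - z0))%C at 1 by Cring.
        rewrite E. Cring.
      + apply hol_continuous, hol_dquot; auto. intros N. apply E. rewrite N.
        rewrite <- Cmod_0. f_equal. Cring.
    - intros t e Ht He Ne. apply hol_dquot; auto. intros N.
      destruct (Dcur t e) as [_ D]. rewrite N in D.
      replace (z0 - z0)%C with (RtoC 0) in D by Cring. rewrite Cmod_0 in D.
      apply Ne. apply Rabs_eq_0. pose proof (Rabs_pos e). lra. }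
  (* On the boundary of the square the difference quotient splits. *)
  set (K1 := fun w : R * R => cs (/ (w - z0))%C (G w)).
  set (K2 := fun w : R * R => cs (/ (w - z0))%C (G z0)).
  assert (far : forall t e, (Rabs t = r \/ Rabs e = r) -> r <= Cmod (curtain al Ci t e - z0)%C).
  { intros t e H. destruct (Dcur t e). destruct H; lra. }
  assert (Nz : forall t e, (Rabs t = r \/ Rabs e = r) -> curtain al Ci t e <> z0).
  { intros t e H N. generalize (far t e H). rewrite N.
    replace (z0 - z0)%C with (RtoC 0) by Cring. rewrite Cmod_0. lra. }
  assert (Rr : Rabs r = r) by (apply Rabs_right; lra).
  assert (Rr' : Rabs (- r) = r) by (rewrite Rabs_Ropp; auto).
  assert (CK : forall F t e, (Rabs t = r \/ Rabs e = r) -> (forall w, continuous F w) ->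
     continuous (fun w => cs (/ (w - z0))%C (F w)) (curtain al Ci t e)).
  { intros F t e H HF. apply continuous_cauchy_kernel; auto. }
  assert (CG : forall w, continuous G w) by (intros; apply hol_continuous; auto).
  (* A side has length 2 r and the kernel is at most 1 / r on it, whence the bound 2 r (1 / r) (eps
     / 2) = eps. *)
  assert (side : forall ga gd, C1 ga gd -> (forall t, Cmod (gd t) <= 1) ->
    (forall t, r <= Cmod (ga t - z0)%C) ->
    cint ga gd (dquot G z0 d) (- r) r = minus (cint ga gd K1 (- r) r) (cint ga gd K2 (- r) r)
    /\ norm (cint ga gd K1 (- r) r) <= eps).
  { intros ga gd Hga Hgd Hfar.
    assert (Hn : forall t, ga t <> z0).
    { intros t N. specialize (Hfar t). rewrite N in Hfar.
      replace (z0 - z0)%C with (RtoC 0) in Hfar by Cring. rewrite Cmod_0 in Hfar. lra. }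
    assert (ExK : forall F, (forall w, continuous F w) ->
       ex_RInt (fun t => cs (gd t) (cs (/ (ga t - z0))%C (F (ga t)))) (- r) r).
    { intros F HF. apply (ex_cint ga gd (fun w => cs (/ (w - z0))%C (F w))); auto. lra.
      intros t _. apply (continuous_comp ga (fun w => cs (/ (w - z0))%C (F w))).
      eapply C1_continuous, Hga. apply continuous_cauchy_kernel; auto. }
    split.
    - rewrite <- cint_minus.
      2: apply ExK, CG. 2: apply (ExK (fun _ => G z0)); intros; apply continuous_const.
      apply cint_ext. lra. intros t _. rewrite dquot_neq by auto. unfold K1, K2. module X.
    - replace eps with (1 * (/ r * (eps / 2)) * (r - - r)) by (field; lra).
      apply cint_bound; auto; try lra.
      + apply Rmult_le_pos; [|lra]. left. apply Rinv_0_lt_compat, Hr.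
      + apply ExK, CG.
      + intros t _. apply norm_cs_lt.
        * rewrite Cmod_inv by (apply Cminus_neq_0; auto).
          apply Rinv_le_contravar; auto.
        * apply HM. specialize (Hfar t).
          assert (Cmod (ga t - z0)%C <= Cmod (ga t) + Cmod z0).
          { eapply Rle_trans. apply Cmod_triangle. rewrite Cmod_opp. lra. }
          pose proof (Rle_abs M). unfold r in Hfar. lra. }
  pose proof (fun e (He : Rabs e = r) => side (fun t => curtain al Ci t e) (fun _ => RtoC 1)
     (C1_horizontal _ _ _ _ Hal) (fun t => Req_le _ _ Cmod_1) (fun t => far t e (or_intror He))) as Hh.
  pose proof (fun t (Ht : Rabs t = r) => side (fun e => curtain al Ci t e) (fun _ => Ci)
     (C1_vertical _ _ _) (fun t => Req_le _ _ Cmod_Ci) (fun e => far t e (or_introl Ht))) as Hv.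
  assert (W := bint_square_kernel z0 r (G z0) Hr).
  destruct (Hh r Rr) as [A1 B1]. destruct (Hh (- r) Rr') as [A2 B2].
  destruct (Hv r Rr) as [A3 B3]. destruct (Hv (- r) Rr') as [A4 B4].
  unfold bint in Z, W. rewrite A1, A2, A3, A4 in Z.
  fold al in W. change (fun w : R * R => cs (/ (w - z0))%C (G z0)) with K2 in W.
  clear A1 A2 A3 A4.
  match type of B1 with norm ?x <= _ => set (a1 := x) in B1, Z end.
  match type of B2 with norm ?x <= _ => set (a2 := x) in B2, Z end.
  match type of B3 with norm ?x <= _ => set (a3 := x) in B3, Z end.
  match type of B4 with norm ?x <= _ => set (a4 := x) in B4, Z end.
  assert (E : cs (RtoC (2 * PI) * Ci)%C (G z0) = minus (plus a2 a3) (plus a1 a4)).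
  { rewrite <- W. match type of Z with ?l = _ =>
      match goal with |- ?u = ?v => replace v with (plus u l) by module X end end.
    rewrite Z. module X. }
  apply (f_equal norm) in E. rewrite norm_cs, Cmod_mult, Cmod_R, Cmod_Ci in E.
  pose proof PI2_3_2. rewrite Rabs_right in E by lra.
  pose proof (nrm_minus (plus a2 a3) (plus a1 a4)).
  pose proof (nrm_plus a2 a3). pose proof (nrm_plus a1 a4).
  pose proof (nrm_ge_0 (G z0)).
  unfold PI2 in *. nra.
Qed.
End Liouville.

(** * Cauchy integrals over arcs *)

Section CauchyArc.
Context {X : CBanach}.

(** In Caratheodory's form no limits are interchanged: the quotient of the integral is the integral
    of the quotient q of the kernel, and [param_cont] makes it continuous. *)
Lemma hasderiv_param (k q : R * R -> R -> R * R) (phi : R -> X) lo hi z :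
  lo <= hi -> (forall t, continuous phi t) ->
  (forall t, lo <= t <= hi ->
     continuous (fun p : (R * R) * R => q (fst p) (snd p)) (z, t)) ->
  locally z (fun w => forall t, lo <= t <= hi ->
     continuous (k w) t /\ continuous (q w) t /\ (k w t - k z t = (w - z) * q w t)%C) ->
  hasderiv (fun w => RInt (fun t => cs (k w t) (phi t)) lo hi) z
    (RInt (fun t => cs (q z t) (phi t)) lo hi).
Proof.
  intros Hlh Hphi Hq Hk.
  assert (Hz := locally_singleton _ _ Hk).
  assert (Ex : forall g, (forall t, lo <= t <= hi -> continuous g t) ->
    ex_RInt (fun t => cs (g t) (phi t)) lo hi).
  { intros g Hg. apply (ex_RInt_continuous (V := X)). rewrite Rmin_left, Rmax_right by auto.
    intros t Ht. apply continuous_cs; auto. }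
  set (Q := fun w => RInt (fun t => cs (q w t) (phi t)) lo hi).
  exists Q. split; [|split]; auto.
  - apply (param_cont (fun w t => cs (q w t) (phi t))); auto.
    + intros t Ht. apply continuous_cs. apply Hq, Ht.
      apply (continuous_comp (fun p : (R * R) * R => snd p) phi). apply continuous_snd. apply Hphi.
    + revert Hk. apply filter_imp. intros w Hw. apply Ex. intros t Ht. apply Hw, Ht.
  - revert Hk. apply filter_imp. intros w Hw. unfold Q.
    rewrite <- RInt_sub.
    2, 3: apply Ex; intros; apply Hw || apply Hz; auto.
    rewrite <- RInt_cs by (apply Ex; intros; apply Hw; auto).
    apply (RInt_ext (V := X)). rewrite Rmin_left, Rmax_right by auto. intros t Ht.
    rewrite <- cs_mult. destruct (Hw t) as [_ [_ E]]. lra. rewrite <- E. module X.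
Qed.

Definition ci (al ad : R -> R * R) (phi : R -> X) (lo hi : R) (z : R * R) : X :=
  RInt (fun t => cs (ad t * / (al t - z))%C (phi t)) lo hi.

(** This is [ci] at 1 / w with the fraction cleared, as 1 / (a - 1 / w) = w / (w a - 1). The new
    form is regular at w = 0, that is, at infinity. *)
Definition ci_infty (al ad : R -> R * R) (phi : R -> X) (lo hi : R) (w : R * R) : X :=
  RInt (fun t => cs (ad t * (w * / (w * al t - 1)))%C (phi t)) lo hi.

Lemma curve_distance al ad lo hi z :
  C1 al ad -> (forall t, lo <= t <= hi -> al t <> z) ->
  exists rho, 0 < rho /\ forall t, lo <= t <= hi -> rho <= Cmod (al t - z)%C.
Proof.
  intros Ha N. destruct (Rle_dec lo hi) as [H|H].
  - destruct (continuity_ab_min (fun t => Cmod (al t - z)%C) lo hi H) as [m [Hm Hm']].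
    + intros c _. apply continuity_pt_filterlim. apply (continuous_Cmod (fun t => (al t - z)%C : R * R)).
      apply (continuous_Cminus al (fun _ => z)). eapply C1_continuous, Ha. apply continuous_const.
    + exists (Cmod (al m - z)%C). split. apply Cmod_minus_gt, N, Hm'. exact Hm.
  - exists 1. split. lra. intros; lra.
Qed.

Lemma continuous_cauchy_factor {T : UniformSpace} (a b c : T -> R * R) x :
  continuous a x -> continuous b x -> continuous c x -> b x <> c x ->
  continuous (fun t => (a t * / (b t - c t))%C : R * R) x.
Proof.
  intros Ha Hb Hc N. apply continuous_Cmult; auto.
  apply continuous_Cinv. apply continuous_Cminus; auto. apply Cminus_neq_0, N.
Qed.

Lemma continuous_ci_integrand al ad (phi : R -> X) z t :
  C1 al ad -> (forall t, continuous phi t) -> al t <> z ->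
  continuous (fun t => cs (ad t * / (al t - z))%C (phi t)) t.
Proof.
  intros Ha Hp N. apply continuous_cs; auto.
  apply (continuous_cauchy_factor ad al (fun _ => z)); auto. apply Ha.
  eapply C1_continuous, Ha. apply continuous_const.
Qed.

Lemma ex_ci al ad phi lo hi z :
  C1 al ad -> lo <= hi -> (forall t, continuous phi t) ->
  (forall t, lo <= t <= hi -> al t <> z) ->
  ex_RInt (fun t => cs (ad t * / (al t - z))%C (phi t) : X) lo hi.
Proof.
  intros Ha Hlh Hp N. apply (ex_RInt_continuous (V := X)).
  rewrite Rmin_left, Rmax_right by auto. intros t Ht. apply continuous_ci_integrand; auto.
Qed.

Lemma hasderiv_ci al ad phi lo hi z :
  C1 al ad -> lo <= hi -> (forall t, continuous phi t) ->
  (forall t, lo <= t <= hi -> al t <> z) -> hasderiv (ci al ad phi lo hi) z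
    (RInt (fun t => cs (ad t * / (al t - z) * / (al t - z))%C (phi t)) lo hi).
Proof.
  intros Ha Hlh Hp N.
  apply (hasderiv_param (fun w t => (ad t * / (al t - w))%C)
    (fun w t => (ad t * / (al t - z) * / (al t - w))%C)); auto.
  - intros t Ht.
    assert (S : continuous (fun p : (R * R) * R => snd p) (z, t)) by apply continuous_snd.
    assert (A : continuous (fun p : (R * R) * R => al (snd p)) (z, t)).
    { apply (continuous_comp (fun p : (R * R) * R => snd p) al); auto. eapply C1_continuous, Ha. }
    assert (B : continuous (fun p : (R * R) * R => ad (snd p)) (z, t)).
    { apply (continuous_comp (fun p : (R * R) * R => snd p) ad); auto. apply Ha. }
    apply (continuous_cauchy_factor (fun p : (R * R) * R => (ad (snd p) * / (al (snd p) - z))%C)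
      (fun p : (R * R) * R => al (snd p)) (fun p : (R * R) * R => fst p)); auto.
    + apply (continuous_cauchy_factor (fun p : (R * R) * R => ad (snd p))
       (fun p : (R * R) * R => al (snd p)) (fun p : (R * R) * R => z)); auto.
      apply continuous_const. simpl; auto.
    + apply continuous_fst.
    + simpl; auto.
  - destruct (curve_distance al ad lo hi z Ha N) as [rho [Hrho Hd]].
    apply locally_Cmod. exists rho. split. exact Hrho. intros w Hw t Ht.
    assert (Nw : al t <> w).
    { intros E. specialize (Hd t Ht). rewrite E in Hd. lra. }
    assert (Ca : continuous al t) by (eapply C1_continuous, Ha).
    split; [|split].
    + apply (continuous_cauchy_factor ad al (fun _ => w)); auto. apply Ha. apply continuous_const.
    + apply (continuous_cauchy_factor (fun t => (ad t * / (al t - z))%C) al (fun _ => w)); auto.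
      apply (continuous_cauchy_factor ad al (fun _ => z)); auto. apply Ha.
      apply continuous_const. apply continuous_const.
    + field. split; apply Cminus_neq_0; auto.
Qed.

Lemma hol_ci al ad phi lo hi z :
  C1 al ad -> lo <= hi -> (forall t, continuous phi t) ->
  (forall t, lo <= t <= hi -> al t <> z) -> hol (ci al ad phi lo hi) z.
Proof. intros. eexists. apply hasderiv_ci; auto. Qed.

Lemma hol_ci_infty al ad phi lo hi z :
  C1 al ad -> lo <= hi -> (forall t, continuous phi t) ->
  (forall t, lo <= t <= hi -> (z * al t)%C <> 1%C) -> hol (ci_infty al ad phi lo hi) z.
Proof.
  intros Ha Hlh Hp N.
  assert (Ca : forall t, continuous al t) by (intros; eapply C1_continuous, Ha).
  (* From w / (w a - 1) - z / (z a - 1) = - (w - z) / ((z a - 1) (w a - 1)). *)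
  eexists. apply (hasderiv_param (fun w t => (ad t * (w * / (w * al t - 1)))%C)
    (fun w t => (- ad t * / (z * al t - 1) * / (w * al t - 1))%C)); auto.
  - intros t Ht.
    assert (S : continuous (fun p : (R * R) * R => snd p) (z, t)) by apply continuous_snd.
    assert (A : continuous (fun p : (R * R) * R => al (snd p)) (z, t)).
    { apply (continuous_comp (fun p : (R * R) * R => snd p) al); auto. }
    assert (B : continuous (fun p : (R * R) * R => ad (snd p)) (z, t)).
    { apply (continuous_comp (fun p : (R * R) * R => snd p) ad); auto. apply Ha. }
    apply (continuous_cauchy_factor (fun p : (R * R) * R => (- ad (snd p) * / (z * al (snd p) - 1))%C)
      (fun p : (R * R) * R => (fst p * al (snd p))%C) (fun p : (R * R) * R => RtoC 1)); auto.
    + apply (continuous_cauchy_factor (fun p : (R * R) * R => (- ad (snd p))%C)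
       (fun p : (R * R) * R => (z * al (snd p))%C) (fun p : (R * R) * R => RtoC 1)); auto.
      apply continuous_Copp; auto. apply continuous_Cmult; auto. apply continuous_const. apply continuous_const.
      simpl; auto.
    + apply continuous_Cmult; auto. apply continuous_fst.
    + apply continuous_const.
    + simpl; auto.
  - assert (L : locally z (fun w => forall t, lo <= t <= hi -> (w * al t)%C <> 1%C)).
    { destruct (curve_distance (fun t => (z * al t)%C) (fun t => (z * ad t)%C) lo hi (RtoC 1))
        as [rho [Hrho Hd]]; auto.
      - intros t. destruct (Ha t) as [H0 [H1 H2]]. split; [|split].
        + apply continuous_Cmult; auto. apply continuous_const.
        + destruct z as [u v]. simpl. unfold minus.
          apply (is_derive_minus (V := R_NormedModule) (fun t => u * fst (al t)) (fun t => v * snd (al t)));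
            apply is_derive_scal; auto.
        + destruct z as [u v]. simpl.
          apply (is_derive_plus (V := R_NormedModule) (fun t => u * snd (al t)) (fun t => v * fst (al t)));
            apply is_derive_scal; auto.
      - destruct (continuous_bounded (fun t => Cmod (al t)) lo hi) as [M [HM HM']].
        { intros t. apply continuous_Cmod; auto. }
        apply locally_Cmod. exists (rho / (M + 1)). split. apply Rdiv_lt_0_compat; lra.
        intros w Hw t Ht E. specialize (Hd t Ht). specialize (HM' t Ht).
        assert (Cmod (z * al t - 1)%C <= rho / (M + 1) * M); [|].
        { replace (z * al t - 1)%C with ((z - w) * al t)%C by (rewrite <- E; Cring).
          rewrite Cmod_mult. apply Rmult_le_compat; try apply Cmod_ge_0; auto.
          rewrite Cmod_minus_sym. lra. }
        assert (rho / (M + 1) * M < rho); [|lra].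
        apply Rlt_le_trans with (rho / (M + 1) * (M + 1)).
        apply Rmult_lt_compat_l. apply Rdiv_lt_0_compat; lra. lra. right. field. lra. }
    revert L. apply filter_imp. intros w Nw t Ht. specialize (Nw t Ht). specialize (N t Ht).
    assert (Cw : forall u : C, continuous (fun t => (u * al t)%C : R * R) t).
    { intros u. apply continuous_Cmult; auto. apply continuous_const. }
    split; [|split].
    + apply continuous_Cmult. apply Ha.
      apply (continuous_cauchy_factor (fun _ => w) (fun t => (w * al t)%C) (fun _ => RtoC 1)); auto;
      apply continuous_const.
    + apply (continuous_cauchy_factor (fun t => (- ad t * / (z * al t - 1))%C)
        (fun t => (w * al t)%C) (fun _ => RtoC 1)); auto; try apply continuous_const.
      apply (continuous_cauchy_factor (fun t => (- ad t)%C) (fun t => (z * al t)%C) (fun _ => RtoC 1)); auto;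
      try apply continuous_const. apply continuous_Copp, Ha.
    + field. split; apply Cminus_neq_0; auto.
Qed.

Lemma ci_infty_inv al ad phi lo hi w :
  w <> RtoC 0 -> lo <= hi -> (forall t, lo <= t <= hi -> al t <> (/ w)%C) ->
  ci_infty al ad phi lo hi w = ci al ad phi lo hi (/ w)%C.
Proof.
  intros Hw Hlh N. apply (RInt_ext (V := X)). rewrite Rmin_left, Rmax_right by auto.
  intros t Ht. f_equal.
  assert (N' : (al t - / w)%C <> RtoC 0) by (apply Cminus_neq_0, N; lra).
  replace (w * al t - 1)%C with (w * (al t - / w))%C by (Cfield; auto).
  revert N'. generalize (al t - / w)%C. intros u Hu. Cfield. split; auto.
Qed.

Lemma ci_infty_0 al ad phi lo hi : ci_infty al ad phi lo hi (RtoC 0) = zero.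
Proof.
  unfold ci_infty. rewrite <- (cs_zero_l (RInt (fun _ => zero) lo hi)).
  rewrite <- RInt_cs by (apply ex_RInt_cont; intros; apply continuous_const).
  apply (RInt_ext (V := X)). intros t _. module_coefs X; Cring.
Qed.

Lemma ci_vanishes al ad phi lo hi :
  C1 al ad -> lo <= hi -> (forall t, continuous phi t) ->
  forall eps, 0 < eps -> exists M, forall w, M <= Cmod w -> norm (ci al ad phi lo hi w) <= eps.
Proof.
  intros Ha Hlh Hp eps He.
  assert (Ca : forall t, continuous al t) by (intros; eapply C1_continuous, Ha).
  destruct (continuous_bounded (fun t => Cmod (al t)) lo hi) as [A [HA HA']].
  { intros t. apply continuous_Cmod; auto. }
  destruct (continuous_bounded (fun t => Cmod (ad t)) lo hi) as [B [HB HB']].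
  { intros t. apply continuous_Cmod, Ha. }
  destruct (continuous_bounded (fun t => norm (phi t)) lo hi) as [C [HC HC']].
  { intros t. apply continuous_norm; auto. }
  (* At distance at least k from the arc the integral is at most B C (hi - lo) / k, and k eps
     exceeds B C (hi - lo + 1). *)
  set (k := B * C * (hi - lo + 1) / eps + 1).
  assert (Hk : 0 < k).
  { unfold k. assert (0 < B * C * (hi - lo + 1) / eps); [|lra].
    apply Rdiv_lt_0_compat; auto. apply Rmult_lt_0_compat; [|lra]. apply Rmult_lt_0_compat; lra. }
  exists (A + k). intros w Hw.
  assert (D : forall t, lo <= t <= hi -> k <= Cmod (al t - w)%C).
  { intros t Ht. specialize (HA' t Ht).
    assert (Cmod w <= Cmod (al t - w)%C + Cmod (al t)); [|lra].
    rewrite (Cmod_minus_sym (al t) w). eapply Rle_trans; [|apply Cmod_triangle].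
    right. f_equal. Cring. }
  assert (N : forall t, lo <= t <= hi -> al t <> w).
  { intros t Ht E. specialize (D t Ht). rewrite E in D.
    replace (w - w)%C with (RtoC 0) in D by Cring. rewrite Cmod_0 in D. lra. }
  eapply Rle_trans.
  - apply RInt_norm_bound with (M := B * / k * C); auto. apply ex_ci; auto.
    intros t Ht. apply norm_cs_lt; auto. rewrite Cmod_mult.
    apply Rmult_le_compat; auto; try apply Cmod_ge_0.
    rewrite Cmod_inv by (apply Cminus_neq_0; auto). apply Rinv_le_contravar; auto.
  - apply Rle_trans with (/ k * (B * C * (hi - lo + 1))).
    { replace (B * / k * C * (hi - lo)) with (/ k * (B * C * (hi - lo))) by ring.
      apply Rmult_le_compat_l. left; apply Rinv_0_lt_compat, Hk.
      apply Rmult_le_compat_l; [|lra]. apply Rmult_le_pos; lra. }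
    apply Rmult_le_reg_l with k; auto. rewrite <- Rmult_assoc, Rinv_r, Rmult_1_l by lra.
    unfold k. replace ((B * C * (hi - lo + 1) / eps + 1) * eps)
      with (B * C * (hi - lo + 1) + eps) by (field; lra). lra.
Qed.
End CauchyArc.

(** * The jump of a Cauchy integral *)

(** Divided by its velocity at the point, the arc is t + [de] with velocity 1 + [r2], both
    perturbations being small. The two denominators multiply to (t + de)^2 + e^2, so the kernel
    difference is 2 i e (1 + r2) over this product, a small relative perturbation of 2 i times the
    Poisson kernel. *)
Lemma jump_kernel_bound (t e rho : R) (de r2 : C) :
  0 < e -> 0 <= rho <= / 6 -> Cmod de <= rho * Rabs t -> Cmod r2 <= rho ->
  (RtoC t + de - Ci * e)%C <> RtoC 0 /\ (RtoC t + de + Ci * e)%C <> RtoC 0 /\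
  Cmod ((1 + r2) * / (RtoC t + de - Ci * e) - (1 + r2) * / (RtoC t + de + Ci * e)
        - 2 * Ci * RtoC (e / (t ^ 2 + e ^ 2)))%C <= 16 * rho * (e / (t ^ 2 + e ^ 2)).
Proof.
  intros He Hrho Hde Hr2.
  set (N := t ^ 2 + e ^ 2). assert (HN : 0 < N) by (unfold N; nra).
  set (den := ((RtoC t + de) * (RtoC t + de) + RtoC e * RtoC e)%C).
  assert (HN' : RtoC N = (RtoC t * RtoC t + RtoC e * RtoC e)%C).
  { unfold N. rewrite <- !RtoC_mult, <- RtoC_plus. f_equal. ring. }
  assert (Cii : (Ci * Ci = - (1))%C) by (unfold Ci, Cmult, Copp, RtoC; simpl; f_equal; ring).
  assert (Fac : den = ((RtoC t + de - Ci * e) * (RtoC t + de + Ci * e))%C).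
  { unfold den. replace ((RtoC t + de - Ci * e) * (RtoC t + de + Ci * e))%C
      with ((RtoC t + de) * (RtoC t + de) - (Ci * Ci) * (RtoC e * RtoC e))%C by ring.
    rewrite Cii. ring. }
  assert (HD : Cmod (RtoC N - den)%C <= 3 * rho * N).
  { rewrite HN'. unfold den.
    replace (RtoC t * RtoC t + RtoC e * RtoC e - ((RtoC t + de) * (RtoC t + de) + RtoC e * RtoC e))%C
      with (- (2 * RtoC t * de + de * de))%C by ring.
    rewrite Cmod_opp. eapply Rle_trans. apply Cmod_triangle. rewrite !Cmod_mult, !Cmod_R.
    rewrite (Rabs_right 2) by lra.
    pose proof (Cmod_ge_0 de). pose proof (Rabs_pos t).
    assert (Rabs t * Rabs t <= N). { rewrite <- Rabs_mult, Rabs_right; unfold N; nra. }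
    assert (rho * (Rabs t * Rabs t) <= rho * N) by (apply Rmult_le_compat_l; lra).
    assert (Cmod de * Rabs t <= rho * Rabs t * Rabs t) by (apply Rmult_le_compat_r; lra).
    assert (Cmod de * Cmod de <= (rho * Rabs t) * (rho * Rabs t)) by (apply Rmult_le_compat; lra).
    assert (rho * (rho * (Rabs t * Rabs t)) <= 1 * (rho * (Rabs t * Rabs t))).
    { apply Rmult_le_compat_r; [|lra]. apply Rmult_le_pos; nra. }
    nra. }
  (* Here rho <= 1 / 6 enters: the perturbation 3 rho N is at most N / 2. *)
  assert (Dlow : N / 2 <= Cmod den).
  { assert (Cmod (RtoC N) <= Cmod (RtoC N - den)%C + Cmod den).
    { eapply Rle_trans; [|apply Cmod_triangle]. right. f_equal. ring. }
    rewrite Cmod_R, Rabs_right in H by lra. nra. }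
  assert (Nden : den <> RtoC 0).
  { intros E. rewrite E, Cmod_0 in Dlow. lra. }
  assert (N1 : (RtoC t + de - Ci * e)%C <> RtoC 0).
  { intros E. apply Nden. rewrite Fac, E. ring. }
  assert (N2 : (RtoC t + de + Ci * e)%C <> RtoC 0).
  { intros E. apply Nden. rewrite Fac, E. ring. }
  assert (NN : RtoC N <> RtoC 0) by (intros E; apply RtoC_inj in E; lra).
  split; [|split]; auto.
  replace ((1 + r2) * / (RtoC t + de - Ci * e) - (1 + r2) * / (RtoC t + de + Ci * e)
        - 2 * Ci * RtoC (e / N))%C
    with (2 * Ci * RtoC (e / N) * ((r2 * RtoC N + (RtoC N - den)) * / den))%C.
  - rewrite !Cmod_mult, Cmod_inv, !Cmod_R, Cmod_Ci by auto.
    rewrite (Rabs_right 2) by lra.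
    assert (HeN : 0 < e / N) by (apply Rdiv_lt_0_compat; lra).
    rewrite (Rabs_right (e / N)) by lra.
    assert (Num : Cmod (r2 * RtoC N + (RtoC N - den))%C <= 4 * rho * N).
    { eapply Rle_trans. apply Cmod_triangle. rewrite Cmod_mult, Cmod_R, (Rabs_right N) by lra.
      assert (Cmod r2 * N <= rho * N) by (apply Rmult_le_compat_r; lra). lra. }
    assert (Inv : / Cmod den <= / (N / 2)) by (apply Rinv_le_contravar; lra).
    (* 4 rho N from the numerator over N / 2 from the denominator; the prefactor 2 e / N then turns
       8 into the 16 of the statement. *)
    assert (P : Cmod (r2 * RtoC N + (RtoC N - den))%C * / Cmod den <= 8 * rho).
    { replace (8 * rho) with (4 * rho * N * / (N / 2)) by (field; lra).
      apply Rmult_le_compat; auto. apply Cmod_ge_0.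
      left. apply Rinv_0_lt_compat. lra. }
    replace (16 * rho * (e / N)) with (2 * 1 * (e / N) * (8 * rho)) by ring.
    apply Rmult_le_compat_l; auto. lra.
  - unfold Rdiv. rewrite RtoC_mult, RtoC_inv by lra.
    replace ((1 + r2) * / (RtoC t + de - Ci * e) - (1 + r2) * / (RtoC t + de + Ci * e))%C
      with ((1 + r2) * (2 * Ci * e) * / den)%C.
    + Cfield. split; auto.
    + rewrite Fac. Cfield. split; auto.
Qed.

Section Jump.
Context {X : CBanach}.

(** The error is a small multiple of the integral of the Poisson kernel, which stays below PI. Hence
    one eta serves for all lo and hi within it and for all heights e, however small. *)
Lemma jump_estimate al ad (phi : R -> X) :
  C1 al ad -> (forall t, continuous phi t) -> ad 0 <> RtoC 0 ->
  forall eps, 0 < eps -> exists eta, 0 < eta /\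
  forall lo hi e, - eta <= lo -> lo <= hi -> hi <= eta -> 0 < e ->
  let zp := (al 0 + RtoC e * (Ci * ad 0))%C in
  let zm := (al 0 - RtoC e * (Ci * ad 0))%C in
  (forall t, lo <= t <= hi -> al t <> zp /\ al t <> zm) /\
  norm (minus (minus (ci al ad phi lo hi zp) (ci al ad phi lo hi zm))
     (cs (2 * Ci)%C (scal (atan (hi / e) - atan (lo / e)) (phi 0)))) <= eps.
Proof.
  intros Ha Hphi Nd eps Heps. set (d := ad 0) in *.
  assert (Hd : 0 < Cmod d) by (apply Cmod_gt_0, Nd).
  set (P0 := norm (phi 0) + 1). assert (HP0 : 1 <= P0) by (unfold P0; pose proof (nrm_ge_0 (phi 0)); lra).
  (* The quantities 16 rho P0 and 2 om are each at most eps / 8; the integrand is then at most eps /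
     4 times the Poisson kernel, whose integral is below PI <= 4. *)
  set (rho := Rmin (/ 6) (eps / (128 * P0))).
  assert (Hrho0 : 0 < rho) by (apply Rmin_glb_lt; [lra|apply Rdiv_lt_0_compat; lra]).
  assert (Hrho6 : rho <= / 6) by apply Rmin_l.
  assert (HrhoP : 16 * rho * P0 <= eps / 8).
  { apply Rle_trans with (16 * (eps / (128 * P0)) * P0).
    apply Rmult_le_compat_r. lra. apply Rmult_le_compat_l. lra. apply Rmin_r.
    right. field. lra. }
  set (om := Rmin 1 (eps / 16)).
  assert (Hom : 0 < om) by (apply Rmin_glb_lt; lra).
  assert (Hrd : 0 < rho * Cmod d) by (apply Rmult_lt_0_compat; auto).
  destruct (proj1 (continuous_eps phi 0) (Hphi 0) om Hom) as [e1 H1].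
  destruct (proj1 (continuous_C_iff ad 0) (proj1 (Ha 0)) _ Hrd) as [e2 H2].
  destruct (C1_eps al ad 0 Ha _ Hrd) as [e3 H3].
  set (eta := Rmin (Rmin e1 e2) e3 / 2).
  assert (He0 : 0 < Rmin (Rmin e1 e2) e3).
  { repeat apply Rmin_glb_lt; apply cond_pos. }
  assert (Heta : 0 < eta) by (unfold eta; lra).
  exists eta. split; auto.
  intros lo hi e Hlo Hlh Hhi He zp zm.
  assert (near : forall t, lo <= t <= hi -> Rabs t < e1 /\ Rabs t < e2 /\ Rabs t < e3).
  { intros t Ht. assert (Rabs t <= eta) by (apply Rabs_le; lra).
    pose proof (Rmin_l (Rmin e1 e2) e3). pose proof (Rmin_r (Rmin e1 e2) e3).
    pose proof (Rmin_l e1 e2). pose proof (Rmin_r e1 e2). unfold eta in *. lra. }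
  set (de := fun t => ((al t - al 0) * / d - RtoC t)%C).
  set (r2 := fun t => ((ad t - d) * / d)%C).
  assert (B : forall t, lo <= t <= hi -> norm (minus (phi t) (phi 0)) <= om /\
    Cmod (de t) <= rho * Rabs t /\ Cmod (r2 t) <= rho).
  { intros t Ht. destruct (near t Ht) as [T1 [T2 T3]].
    assert (Bt : forall ep : posreal, Rabs t < ep -> ball 0 ep t).
    { intros ep Hep. unfold ball; simpl; unfold AbsRing_ball, abs, minus, plus, opp; simpl.
      now rewrite Ropp_0, Rplus_0_r. }
    split; [|split].
    - left. apply H1, Bt, T1.
    - unfold de. replace ((al t - al 0) * / d - RtoC t)%C
        with ((al t - al 0 - RtoC (t - 0) * d) * / d)%C
        by (rewrite RtoC_minus; Cfield; auto).
      rewrite Cmod_mult, Cmod_inv by auto.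
      apply Rmult_le_reg_r with (Cmod d); auto.
      rewrite Rmult_assoc, Rinv_l, Rmult_1_r by lra.
      eapply Rle_trans. apply H3, Bt, T3. rewrite Rminus_0_r. right. ring.
    - unfold r2. rewrite Cmod_mult, Cmod_inv by auto.
      apply Rmult_le_reg_r with (Cmod d); auto.
      rewrite Rmult_assoc, Rinv_l, Rmult_1_r by lra. left. apply H2, Bt, T2. }
  assert (Fp : forall t, (al t - zp)%C = (d * (RtoC t + de t - Ci * e))%C).
  { intros t. unfold zp, de. Cfield. auto. }
  assert (Fm : forall t, (al t - zm)%C = (d * (RtoC t + de t + Ci * e))%C).
  { intros t. unfold zm, de. Cfield. auto. }
  assert (Nz : forall t, lo <= t <= hi -> al t <> zp /\ al t <> zm).
  { intros t Ht. destruct (B t Ht) as [_ [B2 B3]].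
    destruct (jump_kernel_bound t e rho (de t) (r2 t)) as [J1 [J2 _]]; auto; try lra.
    split; intros E.
    - apply (Cmult_neq_0 _ _ Nd J1). rewrite <- Fp, E. ring.
    - apply (Cmult_neq_0 _ _ Nd J2). rewrite <- Fm, E. ring. }
  split; auto.
  assert (E1 := ex_ci al ad phi lo hi zp Ha Hlh Hphi (fun t Ht => proj1 (Nz t Ht))).
  assert (E2 := ex_ci al ad phi lo hi zm Ha Hlh Hphi (fun t Ht => proj2 (Nz t Ht))).
  assert (I3 := is_RInt_cs (2 * Ci)%C _ lo hi _ (is_RInt_poisson (phi 0) e lo hi He)).
  set (Bd := 16 * rho * P0 + 2 * om).
  apply Rle_trans with (Bd * (atan (hi / e) - atan (lo / e))).
  - apply (norm_RInt_le (V := X)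
      (fun t => minus (minus (cs (ad t * / (al t - zp))%C (phi t)) (cs (ad t * / (al t - zm))%C (phi t)))
                  (cs (2 * Ci)%C (scal (e / (t ^ 2 + e ^ 2)) (phi 0))))
      (fun t => Bd * (e / (t ^ 2 + e ^ 2))) lo hi); auto.
    + intros t Ht. destruct (B t Ht) as [B1 [B2 B3]].
      destruct (jump_kernel_bound t e rho (de t) (r2 t)) as [J1 [J2 J3]]; auto; try lra.
      set (k0 := (2 * Ci * RtoC (e / (t ^ 2 + e ^ 2)))%C) in *.
      set (kf := (ad t * / (al t - zp) - ad t * / (al t - zm))%C).
      assert (Ek : Cmod (kf - k0)%C <= 16 * rho * (e / (t ^ 2 + e ^ 2))).
      { replace (kf - k0)%C with ((1 + r2 t) * / (RtoC t + de t - Ci * e) -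
            (1 + r2 t) * / (RtoC t + de t + Ci * e) - k0)%C. exact J3.
        f_equal. unfold kf. rewrite Fp, Fm. unfold r2. Cfield. repeat split; auto. }
      replace (minus (minus (cs (ad t * / (al t - zp))%C (phi t)) (cs (ad t * / (al t - zm))%C (phi t)))
                  (cs (2 * Ci)%C (scal (e / (t ^ 2 + e ^ 2)) (phi 0))))
        with (plus (cs (kf - k0)%C (phi t)) (cs k0 (minus (phi t) (phi 0))))
        by (unfold kf, k0; module X).
      set (q := e / (t ^ 2 + e ^ 2)) in *.
      assert (Hq : 0 < q) by (apply Rdiv_lt_0_compat; nra).
      eapply Rle_trans. apply nrm_plus.
      replace (Bd * q) with (16 * rho * q * P0 + 2 * q * om) by (unfold Bd; ring).
      apply Rplus_le_compat; apply norm_cs_lt; auto.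
      * replace (phi t) with (plus (minus (phi t) (phi 0)) (phi 0)) by module X.
        eapply Rle_trans. apply nrm_plus. pose proof (Rmin_l 1 (eps / 16)).
        unfold P0. fold om in H. lra.
      * unfold k0. rewrite !Cmod_mult, Cmod_Ci, !Cmod_R, !Rabs_right by lra. lra.
    + apply is_RInt_sub. apply is_RInt_sub; apply RInt_correct; assumption. exact I3.
    + evar_last.
      apply (is_RInt_scal (V := R_NormedModule) (fun t => e / (t ^ 2 + e ^ 2)) lo hi Bd).
      apply (is_RInt_derive (V := R_CompleteNormedModule) (fun t => atan (t / e)));
        intros t _.
      * auto_derive; auto. field. repeat split; nra.
      * apply (ex_derive_continuous (V := R_NormedModule) (fun t => e / (t ^ 2 + e ^ 2))).
        auto_derive. nra.
      * reflexivity.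
  - assert (Bd <= eps / 4).
    { unfold Bd. assert (om <= eps / 16) by apply Rmin_r. lra. }
    assert (0 <= Bd) by (unfold Bd; nra).
    pose proof (atan_bound (hi / e)). pose proof (atan_bound (lo / e)). pose proof PI_4.
    assert (Bd * (atan (hi / e) - atan (lo / e)) <= Bd * 4); [|lra].
    apply Rmult_le_compat_l; lra.
Qed.
End Jump.

(** * Charts along the contour *)

(** Connectedness of the unit interval, by bisection in the form of boxes of height 0. Connectedness
    arguments in the plane are reduced to it along images of segments. *)
Lemma path_constant (Q : R -> Prop) :
  (forall l, 0 <= l <= 1 -> exists d, 0 < d /\
     forall m, 0 <= m <= 1 -> Rabs (m - l) < d -> (Q m <-> Q l)) ->
  (Q 0 <-> Q 1).
Proof.
  intros H.
  set (P := fun x y s : R => 0 <= x /\ x + s <= 1 -> (Q x <-> Q (x + s))).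
  assert (HP : P 0 0 1).
  { apply (quadrisection P 0 0 1 0); try lra.
    - intros x y s Hs P1 P2 _ _ Hx. unfold P in *.
      replace (x + s) with (x + s / 2 * 1 + s / 2) by field.
      assert (Q1 := P1 ltac:(lra)). assert (Q2 := P2 ltac:(lra)).
      replace (x + s / 2 * 1) with (x + s / 2) in * by ring. tauto.
    - intros x0 y0 Hx0 Hy0. destruct (H x0) as [d [Hd Hd']]. lra.
      exists d. split; auto. intros x y s Hs Hx Hy Hb.
      rewrite (Hd' x), (Hd' (x + s)). tauto. lra. apply Rabs_def1; lra. lra. apply Rabs_def1; lra. }
  unfold P in HP. replace (0 + 1) with 1 in HP by ring. apply HP. lra.
Qed.

(* Two C1 arcs, running into and out of [zeta], along both of which the
   coordinate in the direction [tau] increases. *)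
Record junction (al1 ad1 al2 ad2 : R -> R * R) (zeta tau : C) (delta c M : R) : Prop := {
  jC1 : C1 al1 ad1;
  jC2 : C1 al2 ad2;
  jz1 : al1 0 = zeta;
  jz2 : al2 0 = zeta;
  jtau : tau <> RtoC 0;
  jdelta : 0 < delta;
  jc : 0 < c;
  jslope1 : forall t, - delta <= t <= delta -> c <= fst (ad1 t * / tau)%C /\ Cmod (ad1 t * / tau)%C <= M;
  jslope2 : forall t, - delta <= t <= delta -> c <= fst (ad2 t * / tau)%C /\ Cmod (ad2 t * / tau)%C <= M
}.

(** Continuity of the velocities preserves half of the component along tau on a short interval. The
    half-length d remains free below d0, because it is shrunk again when the rest of the contour has
    to be kept away. *)
Lemma junction_exists al1 ad1 al2 ad2 (tau : C) :
  C1 al1 ad1 -> C1 al2 ad2 -> al1 0 = al2 0 -> tau <> RtoC 0 ->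
  0 < fst (ad1 0 * / tau)%C -> 0 < fst (ad2 0 * / tau)%C ->
  exists d0 c M, 0 < d0 /\ forall d, 0 < d <= d0 -> junction al1 ad1 al2 ad2 (al1 0) tau d c M.
Proof.
  intros H1 H2 E Nt P1 P2.
  assert (K : forall al ad, C1 al ad -> 0 < fst (ad 0 * / tau)%C ->
    exists d, 0 < d /\ forall t, - d <= t <= d ->
      fst (ad 0 * / tau)%C / 2 <= fst (ad t * / tau)%C /\
      Cmod (ad t * / tau)%C <= Cmod (ad 0 * / tau)%C + 1).
  { intros al ad Ha Hp.
    assert (Cc : continuous (fun t => (ad t * / tau)%C : R * R) 0).
    { apply continuous_Cmult. apply Ha. apply continuous_const. }
    set (ep := Rmin 1 (fst (ad 0%R * / tau)%C / 2)).
    assert (Hep : 0 < ep) by (apply Rmin_glb_lt; lra).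
    destruct (proj1 (continuous_C_iff _ 0) Cc ep Hep) as [d Hd].
    exists (d / 2). split. pose proof (cond_pos d); lra. intros t Ht.
    assert (B : Cmod (ad t * / tau - ad 0%R * / tau)%C < ep).
    { apply Hd. unfold ball; simpl; unfold AbsRing_ball, abs, minus, plus, opp; simpl.
      pose proof (cond_pos d). apply Rabs_def1; lra. }
    pose proof (Rmin_l 1 (fst (ad 0%R * / tau)%C / 2)).
    pose proof (Rmin_r 1 (fst (ad 0%R * / tau)%C / 2)). fold ep in H, H0.
    split.
    - pose proof (fst_le_Cmod (ad t * / tau - ad 0%R * / tau)%C) as F.
      apply Rabs_le_between in F.
      change (fst (ad t * / tau - ad 0%R * / tau)%C) with (fst (ad t * / tau)%C - fst (ad 0%R * / tau)%C) in F.
      lra.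
    - assert (Cmod (ad t * / tau)%C <= Cmod (ad t * / tau - ad 0%R * / tau)%C + Cmod (ad 0%R * / tau)%C).
      { eapply Rle_trans; [|apply Cmod_triangle]. right. f_equal. Cring. }
      lra. }
  destruct (K al1 ad1 H1 P1) as [e1 [He1 K1]]. destruct (K al2 ad2 H2 P2) as [e2 [He2 K2]].
  exists (Rmin e1 e2), (Rmin (fst (ad1 0%R * / tau)%C / 2) (fst (ad2 0%R * / tau)%C / 2)),
    (Rmax (Cmod (ad1 0%R * / tau)%C + 1) (Cmod (ad2 0%R * / tau)%C + 1)).
  split. apply Rmin_glb_lt; auto. intros d Hd.
  pose proof (Rmin_l e1 e2). pose proof (Rmin_r e1 e2).
  split; auto; try lra.
  - apply Rmin_glb_lt; lra.
  - intros t Ht. destruct (K1 t) as [A B]. lra. split.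
    eapply Rle_trans. apply Rmin_l. exact A. eapply Rle_trans. exact B. apply Rmax_l.
  - intros t Ht. destruct (K2 t) as [A B]. lra. split.
    eapply Rle_trans. apply Rmin_r. exact A. eapply Rle_trans. exact B. apply Rmax_r.
Qed.

Section Junction.
Variables (al1 ad1 al2 ad2 : R -> R * R) (zeta tau : C) (delta c M : R).
Hypothesis J : junction al1 ad1 al2 ad2 zeta tau delta c M.

Definition glue (t : R) : R * R := if Rle_dec t 0 then al1 t else al2 t.

Lemma glue_neg t : t <= 0 -> glue t = al1 t.
Proof. intros H. unfold glue. destruct Rle_dec; auto; lra. Qed.

Lemma glue_pos t : 0 <= t -> glue t = al2 t.
Proof.
  intros H. unfold glue. destruct Rle_dec; auto. replace t with 0 by lra.
  rewrite (jz1 _ _ _ _ _ _ _ _ _ J). symmetry. apply (jz2 _ _ _ _ _ _ _ _ _ J).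
Qed.

Lemma continuous_glue t : continuous glue t.
Proof.
  assert (C1' := fun t => C1_continuous _ _ t (jC1 _ _ _ _ _ _ _ _ _ J)).
  assert (C2' := fun t => C1_continuous _ _ t (jC2 _ _ _ _ _ _ _ _ _ J)).
  destruct (Rtotal_order t 0) as [H|[H|H]].
  - apply (continuous_ext_loc _ al1); auto. exists (mkposreal (- t) ltac:(lra)). intros s Hs.
    unfold ball in Hs; simpl in Hs; unfold AbsRing_ball, abs, minus, plus, opp in Hs; simpl in Hs.
    apply Rabs_def2 in Hs. rewrite glue_neg; auto. lra.
  - subst t. apply continuous_C_iff. intros e He.
    generalize (filter_and _ _ (proj1 (continuous_C_iff _ _) (C1' 0) e He)
                               (proj1 (continuous_C_iff _ _) (C2' 0) e He)).
    apply filter_imp. intros s [A B]. rewrite (glue_neg 0) by lra.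
    destruct (Rle_dec s 0). rewrite glue_neg; auto.
    rewrite glue_pos by lra. rewrite (jz1 _ _ _ _ _ _ _ _ _ J), <- (jz2 _ _ _ _ _ _ _ _ _ J). auto.
  - apply (continuous_ext_loc _ al2); auto. exists (mkposreal t ltac:(lra)). intros s Hs.
    unfold ball in Hs; simpl in Hs; unfold AbsRing_ball, abs, minus, plus, opp in Hs; simpl in Hs.
    apply Rabs_def2 in Hs. rewrite glue_pos; auto. lra.
Qed.

(** In this coordinate [zeta] is the origin and tau the positive real direction; the glued arc is a
    Lipschitz graph over the real axis. *)
Definition coord (z : C) : C := ((z - zeta) * / tau)%C.

Lemma coord_inj z w : coord z = coord w -> z = w.
Proof.
  intros E. pose proof (jtau _ _ _ _ _ _ _ _ _ J).
  replace z with (coord z * tau + zeta)%C by (unfold coord; Cfield; auto).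
  rewrite E. unfold coord. Cfield. auto.
Qed.

Lemma arc_increments al ad :
  C1 al ad ->
  (forall t, - delta <= t <= delta -> c <= fst (ad t * / tau)%C /\ Cmod (ad t * / tau)%C <= M) ->
  forall s t, - delta <= s -> s <= t -> t <= delta ->
  c * (t - s) <= fst (coord (al t)) - fst (coord (al s)) /\
  Rabs (snd (coord (al t)) - snd (coord (al s))) <= M * (t - s).
Proof.
  intros Ha Hs s t H1 H2 H3.
  assert (D : forall u, is_derive (fun u => fst (coord (al u))) u (fst (ad u * / tau)%C) /\
                        is_derive (fun u => snd (coord (al u))) u (snd (ad u * / tau)%C)).
  { intros u. destruct (Ha u) as [_ [A B]]. unfold coord. destruct zeta as [zx zy].
    destruct (/ tau)%C as [tx ty]. simpl.
    assert (L : forall (f g : R -> R) df dg p q k l, is_derive f u df -> is_derive g u dg ->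
      is_derive (fun u => (f u + p) * k + (g u + q) * l) u (df * k + dg * l)).
    { intros f g df dg p q k l Hf Hg.
      assert (Ef : ex_derive f u) by (eexists; exact Hf).
      assert (Eg : ex_derive g u) by (eexists; exact Hg).
      auto_derive; auto.
      change (fun x : R => f x) with f. change (fun x : R => g x) with g.
      rewrite (is_derive_unique _ _ _ Hf), (is_derive_unique _ _ _ Hg). ring. }
    split.
    - apply (is_derive_ext (fun u => (fst (al u) + - zx) * tx + (snd (al u) + - zy) * - ty)).
      intros v. change (@eq R ((fst (al v) + - zx) * tx + (snd (al v) + - zy) * - ty)
        ((fst (al v) + - zx) * tx - (snd (al v) + - zy) * ty)). ring.
      replace (fst (ad u) * tx - snd (ad u) * ty) with
        (fst (ad u) * tx + snd (ad u) * - ty) by ring. apply L; auto.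
    - apply (is_derive_ext (fun u => (fst (al u) + - zx) * ty + (snd (al u) + - zy) * tx)).
      reflexivity. apply L; auto. }
  destruct (Req_dec s t) as [->|N].
  { replace (t - t) with 0 by ring. rewrite !Rminus_diag, Rabs_R0. lra. }
  assert (Cc : forall (g dg : R -> R) u, (forall u, is_derive g u (dg u)) -> continuity_pt g u).
  { intros g dg u Hg. apply continuity_pt_filterlim.
    apply (ex_derive_continuous (V := R_NormedModule)). eexists; apply Hg. }
  split.
  - destruct (MVT_gen (fun u => fst (coord (al u))) s t (fun u => fst (ad u * / tau)%C)) as [u [Hu Eu]].
    intros; apply D. intros; eapply Cc; intros; apply D.
    rewrite Eu. rewrite Rmin_left, Rmax_right in Hu by lra.
    apply Rmult_le_compat_r. lra. apply Hs. lra.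
  - destruct (MVT_gen (fun u => snd (coord (al u))) s t (fun u => snd (ad u * / tau)%C)) as [u [Hu Eu]].
    intros; apply D. intros; eapply Cc; intros; apply D.
    rewrite Eu, Rabs_mult. rewrite Rmin_left, Rmax_right in Hu by lra.
    rewrite (Rabs_right (t - s)) by lra.
    apply Rmult_le_compat_r. lra. eapply Rle_trans. apply snd_le_Cmod. apply Hs. lra.
Qed.

(** A corner at 0 does no harm: the increments on its two sides add up. *)
Lemma glue_increments s t :
  - delta <= s -> s <= t -> t <= delta ->
  c * (t - s) <= fst (coord (glue t)) - fst (coord (glue s)) /\
  Rabs (snd (coord (glue t)) - snd (coord (glue s))) <= M * (t - s).
Proof.
  intros H1 H2 H3. pose proof (jdelta _ _ _ _ _ _ _ _ _ J).
  assert (I1 := arc_increments al1 ad1 (jC1 _ _ _ _ _ _ _ _ _ J) (jslope1 _ _ _ _ _ _ _ _ _ J)).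
  assert (I2 := arc_increments al2 ad2 (jC2 _ _ _ _ _ _ _ _ _ J) (jslope2 _ _ _ _ _ _ _ _ _ J)).
  destruct (Rle_dec t 0).
  - rewrite !glue_neg by lra. apply I1; lra.
  - destruct (Rle_dec 0 s).
    + rewrite !glue_pos by lra. apply I2; lra.
    + rewrite (glue_neg s), (glue_pos t) by lra.
      destruct (I1 s 0) as [A B]; try lra. destruct (I2 0 t) as [A' B']; try lra.
      rewrite (jz1 _ _ _ _ _ _ _ _ _ J) in A, B. rewrite (jz2 _ _ _ _ _ _ _ _ _ J) in A', B'.
      split. lra.
      replace (snd (coord (al2 t)) - snd (coord (al1 s))) with
        ((snd (coord (al2 t)) - snd (coord zeta)) + (snd (coord zeta) - snd (coord (al1 s)))) by ring.
      eapply Rle_trans. apply Rabs_triang. lra.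
Qed.

(** Moving along i tau changes only the second coordinate, while the first one increases strictly
    along the arc; so t and then e can be read off from the point. *)
Definition chart (t e : R) : R * R := curtain glue (Ci * tau)%C t e.

Lemma continuous_chart p : continuous (fun q : R * R => chart (fst q) (snd q)) p.
Proof.
  unfold chart, curtain. apply continuous_Cplus.
  - apply (continuous_comp (fun q : R * R => fst q) glue). apply continuous_fst.
    apply continuous_glue.
  - apply continuous_Cmult. apply continuous_RtoC. apply continuous_snd.
    apply continuous_const.
Qed.

Lemma coord_chart t e : coord (chart t e) = (coord (glue t) + Ci * e)%C.
Proof. unfold coord, chart, curtain. Cfield. apply (jtau _ _ _ _ _ _ _ _ _ J). Qed.

Lemma fst_coord_chart t e : fst (coord (chart t e)) = fst (coord (glue t)).
Proof. rewrite coord_chart. simpl. ring. Qed.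

Lemma snd_coord_chart t e : snd (coord (chart t e)) = snd (coord (glue t)) + e.
Proof. rewrite coord_chart. simpl. ring. Qed.

Lemma chart_inj t e t' e' :
  - delta <= t <= delta -> - delta <= t' <= delta -> chart t e = chart t' e' -> t = t' /\ e = e'.
Proof.
  intros H1 H2 E. pose proof (jc _ _ _ _ _ _ _ _ _ J).
  assert (Ex : fst (coord (glue t)) = fst (coord (glue t'))).
  { rewrite <- (fst_coord_chart t e), <- (fst_coord_chart t' e'), E. auto. }
  assert (t = t').
  { destruct (Rle_dec t t').
    - destruct (glue_increments t t') as [A _]; try lra. nra.
    - destruct (glue_increments t' t) as [A _]; try lra. nra. }
  subst t'. split; auto.
  assert (Ey : snd (coord (chart t e)) = snd (coord (chart t e'))) by (rewrite E; auto).
  rewrite !snd_coord_chart in Ey. lra.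
Qed.

Lemma chart_zeta : chart 0 0 = zeta.
Proof.
  unfold chart, curtain. rewrite glue_neg by lra. rewrite (jz1 _ _ _ _ _ _ _ _ _ J). Cring.
Qed.

(** The intermediate value theorem for the first coordinate along the arc gives t, and the remaining
    difference of second coordinates is e. The growth rate c controls the distance from t to t1. *)
Lemma chart_surj_at t1 z :
  - delta < t1 < delta ->
  Rabs (fst (coord z) - fst (coord (glue t1))) <= c * Rmin (t1 + delta) (delta - t1) ->
  exists t e, - delta <= t <= delta /\ z = chart t e /\
    c * Rabs (t - t1) <= Rabs (fst (coord z) - fst (coord (glue t1))) /\
    e = snd (coord z) - snd (coord (glue t)).
Proof.
  intros Ht1 Hx. pose proof (jc _ _ _ _ _ _ _ _ _ J) as Hc.
  pose proof (Rmin_l (t1 + delta) (delta - t1)). pose proof (Rmin_r (t1 + delta) (delta - t1)).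
  assert (Hx1 : Rabs (fst (coord z) - fst (coord (glue t1))) <= c * (t1 + delta)) by nra.
  assert (Hx2 : Rabs (fst (coord z) - fst (coord (glue t1))) <= c * (delta - t1)) by nra.
  clear Hx.
  apply Rabs_le_between in Hx1. apply Rabs_le_between in Hx2.
  destruct (glue_increments (- delta) t1) as [A _]; try lra.
  destruct (glue_increments t1 delta) as [B _]; try lra.
  assert (Cg : forall t, continuous (fun t => fst (coord (glue t))) t).
  { intros t. apply (continuous_comp (fun t => coord (glue t)) fst); [|apply continuous_fst].
    unfold coord. apply continuous_Cmult; [|apply continuous_const].
    apply continuous_Cminus. apply continuous_glue. apply continuous_const. }
  destruct (IVT_gen_consistent (fun t => fst (coord (glue t))) (- delta) delta (fst (coord z))) as [t [Ht Et]].
  { exact Cg. }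
  { rewrite Rmin_left, Rmax_right by lra. lra. }
  rewrite Rmin_left, Rmax_right in Ht by lra.
  exists t, (snd (coord z) - snd (coord (glue t))). split; auto. split; [|split]; auto.
  - apply coord_inj. apply injective_projections.
    + rewrite fst_coord_chart. auto.
    + rewrite snd_coord_chart. ring.
  - rewrite <- Et. destruct (Rle_dec t t1).
    + destruct (glue_increments t t1) as [I _]; try lra.
      rewrite !Rabs_left1 by nra. lra.
    + destruct (glue_increments t1 t) as [I _]; try lra.
      rewrite !Rabs_right by nra. lra.
Qed.

Lemma M_ge_c : c <= M.
Proof.
  pose proof (jdelta _ _ _ _ _ _ _ _ _ J).
  destruct (jslope1 _ _ _ _ _ _ _ _ _ J 0) as [A B]. lra.
  pose proof (fst_le_Cmod (ad1 0%R * / tau)%C). pose proof (Rle_abs (fst (ad1 0%R * / tau)%C)). lra.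
Qed.

Lemma chart_surj d h :
  0 < d <= delta -> 0 < h ->
  exists rho, 0 < rho /\ forall z, Cmod (z - zeta)%C < rho ->
  exists t e, - d < t < d /\ - h < e < h /\ z = chart t e.
Proof.
  intros Hd Hh. pose proof (jc _ _ _ _ _ _ _ _ _ J) as Hc. pose proof M_ge_c.
  pose proof (jtau _ _ _ _ _ _ _ _ _ J) as Nt. assert (Ht := Cmod_gt_0 tau).
  assert (Ht' : 0 < Cmod tau) by (apply Ht; auto).
  (* A point with coordinates below r has |t| < r / c <= d and |e| < r + M r / c <= h. *)
  set (r := Rmin (c * d) (h / (1 + M / c))).
  assert (HMc : 0 < 1 + M / c).
  { assert (0 < M / c) by (apply Rdiv_lt_0_compat; lra). lra. }
  assert (Hr : 0 < r) by (apply Rmin_glb_lt; [nra|apply Rdiv_lt_0_compat; lra]).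
  assert (Hr1 : r <= c * d) by apply Rmin_l.
  assert (Hr2 : r * (1 + M / c) <= h).
  { apply Rle_trans with (h / (1 + M / c) * (1 + M / c)).
    apply Rmult_le_compat_r. lra. apply Rmin_r. right. field. split; lra. }
  exists (r * Cmod tau). split. nra. intros z Hz.
  assert (Hcz : Cmod (coord z) < r).
  { unfold coord. rewrite Cmod_mult, Cmod_inv by auto.
    apply Rmult_lt_reg_r with (Cmod tau); auto. rewrite Rmult_assoc, Rinv_l, Rmult_1_r by lra. auto. }
  assert (Z0 : coord (glue 0) = RtoC 0).
  { rewrite glue_neg by lra. rewrite (jz1 _ _ _ _ _ _ _ _ _ J). unfold coord. Cring. }
  pose proof (fst_le_Cmod (coord z)). pose proof (snd_le_Cmod (coord z)).
  destruct (chart_surj_at 0 z) as [t [e [A [B [D E]]]]].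
  - lra.
  - rewrite Z0. change (fst (RtoC 0)) with 0. rewrite Rminus_0_r.
    replace (Rmin (0 + delta) (delta - 0)) with delta by (rewrite Rmin_left; lra).
    assert (c * d <= c * delta) by (apply Rmult_le_compat_l; lra). lra.
  - rewrite Z0 in D. change (fst (RtoC 0)) with 0 in D. rewrite !Rminus_0_r in D.
    assert (Ht0 : Rabs t < d) by nra.
    assert (Ht1 : Rabs t < r / c).
    { apply Rmult_lt_reg_l with c; auto. replace (c * (r / c)) with r by (field; lra). lra. }
    exists t, e. split. apply Rabs_def2 in Ht0. lra. split; auto.
    assert (Hy : Rabs (snd (coord (glue t))) <= M * Rabs t).
    { destruct (Rle_dec 0 t).
      - destruct (glue_increments 0 t) as [_ I]; try lra. rewrite Z0 in I. change (snd (RtoC 0)) with 0 in I.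
        rewrite Rminus_0_r in I. rewrite (Rabs_right t) by lra. lra.
      - destruct (glue_increments t 0) as [_ I]; try lra. rewrite Z0 in I. change (snd (RtoC 0)) with 0 in I.
        rewrite Rminus_0_l, Rabs_Ropp in I. rewrite (Rabs_left t) by lra. lra. }
    assert (He : Rabs e < h).
    { rewrite E. eapply Rle_lt_trans. apply Rabs_triang. rewrite Rabs_Ropp.
      apply Rlt_le_trans with (r * (1 + M / c)); auto.
      replace (r * (1 + M / c)) with (r + M * (r / c)) by (field; lra). nra. }
    apply Rabs_def2 in He. lra.
Qed.

(** Orientation and jump are measured along normals, charts along i tau. Let x + i y be the velocity
    divided by tau, so x > 0. To first order the normal point with parameter s has e = s (x^2 + y^2)
    / x, of the same sign as s; the rest is control of the remainder. *)
Lemma chart_normal t1 h :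
  0 < t1 < delta -> 0 < h ->
  exists e0, 0 < e0 /\ forall s, s <> 0 -> Rabs s < e0 ->
  exists t e, - delta < t < delta /\ - h < e < h /\ 0 < s * e /\
    (al2 t1 + RtoC s * (Ci * ad2 t1))%C = chart t e.
Proof.
  intros Ht1 Hh. pose proof (jc _ _ _ _ _ _ _ _ _ J) as Hc. pose proof M_ge_c.
  pose proof (jtau _ _ _ _ _ _ _ _ _ J) as Nt.
  assert (Ht' : 0 < Cmod tau) by (apply Cmod_gt_0; auto).
  set (g := (ad2 t1 * / tau)%C). set (x := fst g). set (y := snd g).
  destruct (jslope2 _ _ _ _ _ _ _ _ _ J t1) as [Hx HgM]. lra.
  fold g in Hx, HgM. fold x in Hx.
  pose proof (Rabs_pos y) as Hy.
  (* Solved backwards from [Herr]: with this ka the tangent error (|y| + x) ka |t - t1| is at most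
     |s| x^2 / 2, half of the term s x^2. *)
  set (ka := c * (x * x) / (2 * (Rabs y + 1) * (Rabs y + x))).
  assert (Hka : 0 < ka).
  { apply Rdiv_lt_0_compat; repeat apply Rmult_lt_0_compat; lra. }
  assert (Hkt : 0 < ka * Cmod tau) by nra.
  destruct (C1_eps al2 ad2 t1 (jC2 _ _ _ _ _ _ _ _ _ J) _ Hkt) as [d1 Hd1].
  set (m := Rmin (Rmin t1 (delta - t1)) d1 / 2).
  assert (Hm0 : 0 < Rmin (Rmin t1 (delta - t1)) d1).
  { pose proof (cond_pos d1). repeat apply Rmin_glb_lt; lra. }
  pose proof (Rmin_l (Rmin t1 (delta - t1)) d1). pose proof (Rmin_r (Rmin t1 (delta - t1)) d1).
  pose proof (Rmin_l t1 (delta - t1)). pose proof (Rmin_r t1 (delta - t1)).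
  assert (Hm : 0 < m) by (unfold m; lra).
  set (B := x * x + y * y + x * x).
  assert (HB : 0 < B) by (unfold B; nra).
  (* The first bound keeps |t - t1| within m, where the derivative estimate holds; the second gives
     |x e| <= |s| B < h x. *)
  set (e0 := Rmin (c * m / (Rabs y + 1)) (h * x / B)).
  assert (He0 : 0 < e0).
  { apply Rmin_glb_lt; apply Rdiv_lt_0_compat; try lra; apply Rmult_lt_0_compat; lra. }
  exists e0. split; auto. intros s Ns Hs.
  set (z := (al2 t1 + RtoC s * (Ci * ad2 t1))%C).
  assert (Ez : coord z = (coord (glue t1) + RtoC s * (Ci * g))%C).
  { rewrite glue_pos by lra. unfold z, coord, g. Cfield. auto. }
  assert (Ex : fst (coord z) - fst (coord (glue t1)) = - s * y).
  { rewrite Ez. unfold y. simpl. ring. }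
  assert (Ey : snd (coord z) - snd (coord (glue t1)) = s * x).
  { rewrite Ez. unfold x. simpl. ring. }
  assert (Hsy : Rabs (- s * y) <= c * m).
  { rewrite Rabs_mult, Rabs_Ropp.
    apply Rle_trans with (c * m / (Rabs y + 1) * (Rabs y + 1)); [|right; field; lra].
    apply Rmult_le_compat; try apply Rabs_pos; try lra.
    pose proof (Rmin_l (c * m / (Rabs y + 1)) (h * x / B)). fold e0 in H4. lra. }
  destruct (chart_surj_at t1 z) as [t [e [A1 [A2 [A3 A4]]]]].
  { lra. }
  { rewrite Ex. eapply Rle_trans. exact Hsy. apply Rmult_le_compat_l. lra.
    apply Rmin_glb; unfold m; lra. }
  rewrite Ex in A3.
  assert (Htt : Rabs (t - t1) <= m) by nra.
  assert (Htp : 0 < t) by (apply Rabs_le_between in Htt; unfold m in Htt; lra).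
  set (w := ((al2 t - al2 t1 - RtoC (t - t1) * ad2 t1) * / tau)%C).
  assert (Hw : Cmod w <= ka * Rabs (t - t1)).
  { unfold w. rewrite Cmod_mult, Cmod_inv by auto.
    apply Rmult_le_reg_r with (Cmod tau); auto. rewrite Rmult_assoc, Rinv_l, Rmult_1_r by lra.
    replace (ka * Rabs (t - t1) * Cmod tau) with (ka * Cmod tau * Rabs (t - t1)) by ring.
    apply Hd1. unfold ball; simpl; unfold AbsRing_ball, abs, minus, plus, opp; simpl.
    change (Rabs (t - t1) < d1). unfold m in Htt. lra. }
  assert (Ew : (coord (glue t) - coord (glue t1) = RtoC (t - t1) * g + w)%C).
  { rewrite !glue_pos by lra. unfold w, coord, g. Cfield. auto. }
  pose proof (fst_le_Cmod w) as Wa. pose proof (snd_le_Cmod w) as Wb.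
  assert (Ea : - s * y = (t - t1) * x + fst w).
  { rewrite <- Ex. assert (E1 : fst (coord z) = fst (coord (glue t))).
    { rewrite A2. apply fst_coord_chart. }
    rewrite E1. apply (f_equal fst) in Ew. simpl in Ew. unfold x.
    change (fst (ad2 t1) * fst (/ tau)%C - snd (ad2 t1) * snd (/ tau)%C) with (fst g) in Ew.
    simpl in Ew. simpl. lra. }
  assert (Eb : snd (coord (glue t)) - snd (coord (glue t1)) = (t - t1) * y + snd w).
  { apply (f_equal snd) in Ew. unfold y. simpl in Ew. simpl. lra. }
  (* t - t1 is eliminated between the two real equations [Ea] and [Eb]. *)
  assert (Exe : x * e = s * (x * x + y * y) + (y * fst w - x * snd w)).
  { rewrite A4.
    replace (snd (coord z) - snd (coord (glue t))) with
      (s * x - ((t - t1) * y + snd w)) by lra.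
    replace (x * (s * x - ((t - t1) * y + snd w))) with
      (s * (x * x) - y * ((t - t1) * x) - x * snd w) by ring.
    replace ((t - t1) * x) with (- s * y - fst w) by lra. ring. }
  assert (Herr : Rabs (y * fst w - x * snd w) <= Rabs s * (x * x) / 2).
  { eapply Rle_trans. apply Rabs_triang. rewrite Rabs_Ropp, !Rabs_mult, (Rabs_right x) by lra.
    apply Rle_trans with ((Rabs y + x) * (ka * Rabs (t - t1))).
    { rewrite Rmult_plus_distr_r. apply Rplus_le_compat; apply Rmult_le_compat_l; lra. }
    assert (Rabs (t - t1) <= Rabs s * (Rabs y + 1) / c).
    { apply Rmult_le_reg_l with c; auto.
      replace (c * (Rabs s * (Rabs y + 1) / c)) with (Rabs s * (Rabs y + 1)) by (field; lra).
      rewrite Rabs_mult, Rabs_Ropp in A3. pose proof (Rabs_pos s). nra. }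
    apply Rle_trans with ((Rabs y + x) * (ka * (Rabs s * (Rabs y + 1) / c))).
    { apply Rmult_le_compat_l. lra. apply Rmult_le_compat_l; lra. }
    right. unfold ka. field. repeat split; lra. }
  apply Rabs_le_between in Herr.
  assert (Hxp : 0 < x) by lra.
  assert (Hs2 : Rabs s < h * x / B).
  { eapply Rlt_le_trans. exact Hs. apply Rmin_r. }
  assert (Hs3 : Rabs s * B < h * x).
  { apply Rmult_lt_reg_r with (/ B). apply Rinv_0_lt_compat, HB.
    rewrite Rmult_assoc, Rinv_r, Rmult_1_r by lra. exact Hs2. }
  assert (Hxx : 0 < x * x) by nra. assert (Hyy : 0 <= y * y) by nra.
  exists t, e. split.
  { apply Rabs_le_between in Htt. unfold m in Htt. lra. }
  split; [|split]; auto.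
  - destruct (Rle_dec 0 s).
    + rewrite Rabs_right in Hs3, Herr by lra. unfold B in Hs3. split; nra.
    + rewrite Rabs_left in Hs3, Herr by lra. unfold B in Hs3. split; nra.
  - destruct (Rle_dec 0 s).
    + rewrite Rabs_right in Herr by lra. assert (0 < x * e) by nra. nra.
    + rewrite Rabs_left in Herr by lra. assert (x * e < 0) by nra.
      assert (e < 0) by nra. nra.
Qed.

End Junction.

(** * Limits of Cauchy integrals at an arc; constant densities *)

Lemma atan_le_id x : 0 <= x -> atan x <= x.
Proof.
  intros Hx. destruct (MVT_gen atan 0 x (fun u => / (1 + Rsqr u))) as [u [Hu E]].
  - intros u _. apply is_derive_atan.
  - intros u _. apply continuity_pt_filterlim.
    apply (ex_derive_continuous (V := R_NormedModule)). eexists; apply is_derive_atan.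
  - rewrite atan_0 in E. pose proof (Rle_0_sqr u).
    assert (/ (1 + Rsqr u) <= 1). { rewrite <- Rinv_1. apply Rinv_le_contravar; lra. }
    nra.
Qed.

(** atan (a / e) = PI / 2 - atan (e / a), and atan x <= x for x >= 0. *)
Lemma atan_ratio_limit a eps :
  0 < a -> 0 < eps -> exists e0, 0 < e0 /\ forall e, 0 < e < e0 ->
    PI / 2 - eps <= atan (a / e) <= PI / 2.
Proof.
  intros Ha He. exists (a * eps). split. nra. intros e H.
  replace (a / e) with (/ (e / a)) by (field; lra).
  assert (0 < e / a) by (apply Rdiv_lt_0_compat; lra).
  rewrite atan_inv by auto. pose proof (atan_le_id (e / a)).
  assert (e / a <= eps).
  { apply Rmult_le_reg_r with a; auto. replace (e / a * a) with e by (field; lra). lra. }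
  assert (0 <= atan (e / a)). { rewrite <- atan_0. left. apply atan_increasing. auto. }
  lra.
Qed.

Lemma continuous_on_comp {T U V : UniformSpace} (A : U -> Prop) (F : U -> V) (g : T -> U) x :
  continuous_on A F -> continuous g x -> (forall y, A (g y)) -> continuous (fun y => F (g y)) x.
Proof.
  intros HF Hg HA P HP. specialize (HF (g x) (HA x) P HP). unfold filtermap, within in *.
  specialize (Hg _ HF). unfold filtermap in Hg. revert Hg. apply filter_imp. auto.
Qed.

Lemma C1_translate al ad c : C1 al ad -> C1 (fun t => al (c + t)) (fun t => ad (c + t)).
Proof.
  intros H t. destruct (H (c + t)) as [H0 [H1 H2]].
  assert (K : forall (f : R -> R) l, is_derive f (c + t) l -> is_derive (fun t => f (c + t)) t l).
  { intros f l Hf. replace l with (scal 1 l) by apply (scal_one (K := R_Ring)).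
    apply (is_derive_comp (V := R_NormedModule) f (fun t => c + t)); auto.
    auto_derive; auto. }
  split; [|split].
  - apply (continuous_comp (fun t => c + t) ad); auto.
    apply (continuous_plus (fun _ => c) (fun t => t)). apply continuous_const. apply continuous_id.
  - apply (K (fun t => fst (al t))), H1.
  - apply (K (fun t => snd (al t))), H2.
Qed.

(** Retraction onto [a, b]. Composition with it turns continuity relative to the interval into
    continuity on the whole line, the form that the integrability lemmas take. *)
Definition clamp (a b t : R) : R := Rmax a (Rmin b t).

Lemma clamp_in a b t : a <= b -> a <= clamp a b t <= b.
Proof. intros. unfold clamp. split. apply Rmax_l. apply Rmax_lub; auto. apply Rmin_l. Qed.

Lemma clamp_id a b t : a <= t <= b -> clamp a b t = t.
Proof. intros. unfold clamp. rewrite Rmin_right, Rmax_right; lra. Qed.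

Lemma continuous_clamp a b t : continuous (clamp a b) t.
Proof.
  assert (L : forall s, Rabs (clamp a b s - clamp a b t) <= Rabs (s - t)).
  { intros s. unfold clamp, Rmax, Rmin, Rabs.
    repeat (destruct Rle_dec || destruct Rcase_abs); lra. }
  intros P [e He]. exists e. intros s Hs. apply He.
  unfold ball in *; simpl in *; unfold AbsRing_ball, abs, minus, plus, opp in *; simpl in *.
  eapply Rle_lt_trans; [apply L|exact Hs].
Qed.

Section Local.
Context {X : CBanach}.

Lemma ci_translate al ad (phi : R -> X) c lo hi z :
  C1 al ad -> lo <= hi -> (forall t, continuous phi t) ->
  (forall t, c + lo <= t <= c + hi -> al t <> z) ->
  ci (fun t => al (c + t)) (fun t => ad (c + t)) (fun t => phi (c + t)) lo hi z =
  ci al ad phi (c + lo) (c + hi) z.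
Proof.
  intros Ha Hlh Hp N. unfold ci. apply is_RInt_unique.
  apply (is_RInt_ext (fun y => scal 1 ((fun t => cs (ad t * / (al t - z))%C (phi t)) (1 * y + c)))).
  { intros t _. rewrite Rmult_1_l, (Rplus_comm t c). module X. }
  apply (is_RInt_comp_lin (V := X) (fun t => cs (ad t * / (al t - z))%C (phi t))).
  replace (1 * lo + c) with (c + lo) by ring. replace (1 * hi + c) with (c + hi) by ring.
  apply (RInt_correct (V := X)). apply ex_ci; auto. lra.
Qed.

Lemma ci_Chasles al ad (phi : R -> X) a b c z :
  C1 al ad -> a <= b <= c -> (forall t, continuous phi t) ->
  (forall t, a <= t <= c -> al t <> z) ->
  ci al ad phi a c z = plus (ci al ad phi a b z) (ci al ad phi b c z).
Proof.
  intros Ha H Hp N. apply RInt_Chas; apply ex_ci; auto; try lra; intros; apply N; lra.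
Qed.

(** Only a short piece of the arc feels the singularity; the rest [Rst] of the integral is
    continuous at the point and cancels in the difference. The piece has to shrink with the required
    accuracy, so lo, hi and [Rst] depend on eta. *)
Lemma jump_limit al ad (phi : R -> X) (Phi : R * R -> X) :
  C1 al ad -> (forall t, continuous phi t) -> ad 0 <> RtoC 0 ->
  (forall eta, 0 < eta -> exists lo hi Rst, - eta <= lo < 0 /\ 0 < hi <= eta /\
     continuous Rst (al 0) /\ exists e0, 0 < e0 /\ forall s, s <> 0 -> Rabs s < e0 ->
       Phi (al 0 + RtoC s * (Ci * ad 0))%C =
       plus (ci al ad phi lo hi (al 0 + RtoC s * (Ci * ad 0))%C) (Rst (al 0 + RtoC s * (Ci * ad 0))%C)) ->
  forall eps, 0 < eps -> exists e0, 0 < e0 /\ forall e, 0 < e < e0 ->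
    norm (minus (minus (Phi (al 0 + RtoC e * (Ci * ad 0))%C) (Phi (al 0 - RtoC e * (Ci * ad 0))%C))
       (cs (RtoC (2 * PI) * Ci)%C (phi 0))) <= eps.
Proof.
  intros Ha Hp Nd H eps He.
  destruct (jump_estimate al ad phi Ha Hp Nd (eps / 4)) as [eta [Heta J]]. lra.
  destruct (H eta Heta) as [lo [hi [Rst [Hlo [Hhi [HR [e1 [He1 HPhi]]]]]]]].
  set (P0 := norm (phi 0) + 1). assert (HP0 : 1 <= P0) by (unfold P0; pose proof (nrm_ge_0 (phi 0)); lra).
  (* The difference [th] of arctangents is within 2 k of PI; with the factor 2 i of the kernel this
     costs at most 4 k P0 = eps / 4. *)
  set (k := eps / (16 * P0)). assert (Hk : 0 < k) by (apply Rdiv_lt_0_compat; lra).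
  destruct (atan_ratio_limit hi k) as [e2 [He2 A2]]; try lra.
  destruct (atan_ratio_limit (- lo) k) as [e3 [He3 A3]]; try lra.
  assert (He4 : 0 < eps / 8) by lra.
  assert (L4 := proj1 (locally_Cmod _ _) (proj1 (continuous_eps Rst (al 0)) HR _ He4)).
  destruct L4 as [r [Hr L4]].
  set (e4 := r / (Cmod (ad 0%R) + 1)).
  assert (H4 : 0 < e4) by (apply Rdiv_lt_0_compat; auto; pose proof (Cmod_ge_0 (ad 0%R)); lra).
  exists (Rmin (Rmin e1 e2) (Rmin e3 e4)). split. repeat apply Rmin_glb_lt; auto.
  intros e Hee.
  pose proof (Rmin_l (Rmin e1 e2) (Rmin e3 e4)). pose proof (Rmin_r (Rmin e1 e2) (Rmin e3 e4)).
  pose proof (Rmin_l e1 e2). pose proof (Rmin_r e1 e2).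
  pose proof (Rmin_l e3 e4). pose proof (Rmin_r e3 e4).
  assert (Em : (al 0%R - RtoC e * (Ci * ad 0%R))%C = (al 0%R + RtoC (- e) * (Ci * ad 0%R))%C)
    by (rewrite RtoC_opp; Cring).
  assert (Pp := HPhi e ltac:(lra) ltac:(rewrite Rabs_right; lra)).
  assert (Pm := HPhi (- e) ltac:(lra) ltac:(rewrite Rabs_left; lra)).
  rewrite <- Em in Pm.
  destruct (J lo hi e) as [_ JJ]; try lra.
  set (zp := (al 0%R + RtoC e * (Ci * ad 0%R))%C) in *.
  set (zm := (al 0%R - RtoC e * (Ci * ad 0%R))%C) in *.
  assert (Bd : Cmod (RtoC e * (Ci * ad 0%R))%C < r).
  { rewrite !Cmod_mult, Cmod_R, Cmod_Ci, Rabs_right by lra. rewrite Rmult_1_l.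
    assert (e < e4) by lra. pose proof (Cmod_ge_0 (ad 0%R)).
    apply Rle_lt_trans with (e * (Cmod (ad 0%R) + 1)). nra.
    apply Rlt_le_trans with (e4 * (Cmod (ad 0%R) + 1)). nra. unfold e4. right. field. lra. }
  assert (Bp : norm (minus (Rst zp) (Rst (al 0))) < eps / 8).
  { apply L4. unfold zp. replace (al 0%R + RtoC e * (Ci * ad 0%R) - al 0%R)%C
      with (RtoC e * (Ci * ad 0%R))%C by Cring. auto. }
  assert (Bm : norm (minus (Rst zm) (Rst (al 0))) < eps / 8).
  { apply L4. unfold zm. replace (al 0%R - RtoC e * (Ci * ad 0%R) - al 0%R)%C
      with (- (RtoC e * (Ci * ad 0%R)))%C by Cring. rewrite Cmod_opp. auto. }
  set (th := atan (hi / e) - atan (lo / e)) in *.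
  rewrite Pp, Pm.
  match goal with |- norm ?v <= _ => replace v with
    (plus (plus (minus (minus (ci al ad phi lo hi zp) (ci al ad phi lo hi zm)) (cs (2 * Ci)%C (scal th (phi 0))))
                (minus (minus (Rst zp) (Rst (al 0))) (minus (Rst zm) (Rst (al 0)))))
          (cs (2 * Ci * RtoC (th - PI))%C (phi 0))) end.
  2: { module_coefs X; rewrite ?RtoC_minus, ?RtoC_mult; Cring. }
  assert (Hth : Rabs (th - PI) <= 2 * k).
  { destruct (A2 e) as [A2l A2u]. lra. destruct (A3 e) as [A3l A3u]. lra.
    replace (- lo / e) with (- (lo / e)) in A3l, A3u by (field; lra).
    rewrite atan_opp in A3l, A3u. unfold th. apply Rabs_le. lra. }
  eapply Rle_trans. apply nrm_plus.
  assert (T3 : norm (cs (2 * Ci * RtoC (th - PI))%C (phi 0)) <= eps / 4).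
  { replace (eps / 4) with (4 * k * P0) by (unfold k; field; lra).
    apply norm_cs_lt. rewrite !Cmod_mult, Cmod_Ci, !Cmod_R, (Rabs_right 2) by lra. lra.
    unfold P0. lra. }
  apply Rle_trans with ((eps / 4 + (eps / 8 + eps / 8)) + eps / 4); [|lra].
  apply Rplus_le_compat; [|exact T3].
  eapply Rle_trans; [apply nrm_plus|]. apply Rplus_le_compat; [exact JJ|].
  eapply Rle_trans; [apply nrm_minus|]. apply Rplus_le_compat; left; assumption.
Qed.

Lemma hasderiv_zero_constant (W : R * R -> X) z rho :
  (forall w, Cmod (w - z)%C < rho -> hasderiv W w zero) ->
  forall w, Cmod (w - z)%C < rho -> W w = W z.
Proof.
  intros H w Hw.
  assert (E : (fun s => W (z + RtoC s * (w - z))%C) 0 = (fun s => W (z + RtoC s * (w - z))%C) 1).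
  { apply (eq_is_derive (V := X) (fun s => W (z + RtoC s * (w - z))%C) 0 1); [|lra]. intros s Hs.
    assert (D := hasderiv_chain W (fun s => (z + RtoC s * (w - z))%C) (fun _ => (w - z)%C) s
      zero (C1_line _ _)).
    rewrite cs_zero_r in D. apply D, H.
    replace (z + RtoC s * (w - z) - z)%C with (RtoC s * (w - z))%C by Cring.
    rewrite Cmod_mult, Cmod_R, Rabs_right by lra. pose proof (Cmod_ge_0 (w - z)%C). nra. }
  simpl in E. replace (z + 0%R * (w - z))%C with z in E by Cring.
  replace (z + 1%R * (w - z))%C with w in E by Cring. auto.
Qed.

Lemma hasderiv_minus (F G : R * R -> X) z a b :
  hasderiv F z a -> hasderiv G z b -> hasderiv (fun w => minus (F w) (G w)) z (minus a b).
Proof.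
  intros [Q [HQ [E H]]] [Q' [HQ' [E' H']]].
  exists (fun w => minus (Q w) (Q' w)). split; [|split].
  - apply cont_minus; auto.
  - now rewrite E, E'.
  - generalize (filter_and _ _ H H'). apply filter_imp. intros w [A B].
    replace (cs (w - z)%C (minus (Q w) (Q' w)))
      with (minus (cs (w - z)%C (Q w)) (cs (w - z)%C (Q' w))) by module X.
    rewrite <- A, <- B. module X.
Qed.

Lemma hasderiv_plus (F G : R * R -> X) z a b :
  hasderiv F z a -> hasderiv G z b -> hasderiv (fun w => plus (F w) (G w)) z (plus a b).
Proof.
  intros [Q [HQ [E H]]] [Q' [HQ' [E' H']]].
  exists (fun w => plus (Q w) (Q' w)). split; [|split].
  - apply cont_plus; auto.
  - now rewrite E, E'.
  - generalize (filter_and _ _ H H'). apply filter_imp. intros w [A B].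
    rewrite cs_plus_r, <- A, <- B. module X.
Qed.

(** 1 / (s - z)^2 has the primitive - 1 / (s - z) in s, so only the end points survive; around a
    closed loop such terms telescope. *)
Lemma hasderiv_ci_const al ad (x : X) lo hi z :
  C1 al ad -> lo <= hi -> (forall t, lo <= t <= hi -> al t <> z) ->
  hasderiv (ci al ad (fun _ => x) lo hi) z
    (minus (cs (/ (al lo - z))%C x) (cs (/ (al hi - z))%C x)).
Proof.
  intros Ha Hlh N.
  replace (minus (cs (/ (al lo - z))%C x) (cs (/ (al hi - z))%C x)) with
    (RInt (fun t => cs (ad t * / (al t - z) * / (al t - z))%C x) lo hi).
  { apply hasderiv_ci; auto. intros; apply continuous_const. }
  set (K := fun w : R * R => cs (/ (w - z) * / (w - z))%C x).
  set (P := fun w : R * R => cs (- / (w - z))%C x).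
  transitivity (cint al ad K lo hi).
  { apply (RInt_ext (V := X)). intros t _. unfold K. module X. }
  assert (CK : forall w : R * R, w <> z -> continuous (fun w : R * R => (/ (w - z))%C : R * R) w).
  { intros w Nw. apply continuous_Cinv. apply continuous_Cminus. apply continuous_id.
    apply continuous_const. apply Cminus_neq_0, Nw. }
  rewrite (FTC_curve P K al ad lo hi); auto.
  - unfold P. module X.
  - intros t Ht. specialize (N t Ht). exists (fun w : R * R => cs (/ (w - z) * / (al t - z))%C x).
    split; [|split]; auto.
    + apply continuous_cs; [|apply continuous_const]. apply continuous_Cmult; auto. apply continuous_const.
    + generalize (locally_neq _ _ N). apply filter_imp. intros w Hw. unfold P.
      module_coefs X. Cfield. split; apply Cminus_neq_0; auto.
  - intros t Ht. apply (continuous_comp al K). eapply C1_continuous, Ha.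
    apply continuous_cs; [|apply continuous_const]. apply continuous_Cmult; apply CK; auto.
Qed.

Lemma cint_ci (F : R * R -> X) al ad a b z :
  a <= b -> cint al ad (fun s => cs (/ (s - z))%C (F s)) a b =
  ci al ad (fun t => F (al (clamp a b t))) a b z.
Proof.
  intros Hab. apply (RInt_ext (V := X)). rewrite Rmin_left, Rmax_right by auto.
  intros t Ht. rewrite clamp_id by lra. module X.
Qed.

Lemma continuous_clamped (A : R * R -> Prop) (F : R * R -> X) al ad a b t :
  a <= b -> C1 al ad -> continuous_on A F -> (forall t, a <= t <= b -> A (al t)) ->
  continuous (fun t => F (al (clamp a b t))) t.
Proof.
  intros Hab Ha HF HA. apply (continuous_on_comp A F (fun t => al (clamp a b t))); auto.
  - apply (continuous_comp (clamp a b) al). apply continuous_clamp. eapply C1_continuous, Ha.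
  - intros y. apply HA, clamp_in, Hab.
Qed.

End Local.

Lemma curve_off_open al ad lo hi (z : R * R) :
  C1 al ad -> (forall t, lo <= t <= hi -> al t <> z) ->
  locally z (fun w : R * R => forall t, lo <= t <= hi -> al t <> w).
Proof.
  intros Ha N. destruct (curve_distance al ad lo hi z Ha N) as [rho [Hrho Hd]].
  apply locally_Cmod. exists rho. split; auto. intros w Hw t Ht E.
  specialize (Hd t Ht). rewrite E in Hd. lra.
Qed.

(** * Cauchy's formula on one side of a piece of the contour *)

Section LocalCauchy.
Context {X : CBanach}.
Variables (al1 ad1 al2 ad2 : R -> R * R) (zeta tau : C) (delta c M : R).
Hypothesis J : junction al1 ad1 al2 ad2 zeta tau delta c M.
Variables (sigma h : R).
Hypotheses (Hsigma : sigma = 1 \/ sigma = -1) (Hh : 0 < h).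

Let ch := chart al1 al2 tau.
Let nu : C := (RtoC sigma * (Ci * tau))%C.

(** sigma = 1 gives the half to the left of the arc, sigma = -1 the half to its right; e is
    nonnegative in both cases. *)
Definition half_chart (z : R * R) : Prop :=
  exists t e, - delta <= t <= delta /\ 0 <= e <= h /\ z = chart al1 al2 tau t (sigma * e).

Let Hd : 0 < delta := jdelta _ _ _ _ _ _ _ _ _ J.
Let D1 : C1 al1 ad1 := jC1 _ _ _ _ _ _ _ _ _ J.
Let D2 : C1 al2 ad2 := jC2 _ _ _ _ _ _ _ _ _ J.

Lemma half_curtain1 t e : t <= 0 -> curtain al1 nu t e = ch t (sigma * e).
Proof.
  intros Ht. unfold ch, chart, curtain, nu. rewrite (glue_neg al1 al2) by auto.
  rewrite RtoC_mult. Cring.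
Qed.

Lemma half_curtain2 t e : 0 <= t -> curtain al2 nu t e = ch t (sigma * e).
Proof.
  intros Ht. unfold ch, chart, curtain, nu. rewrite (glue_pos _ _ _ _ _ _ _ _ _ J) by auto.
  rewrite RtoC_mult. Cring.
Qed.

Lemma curtain_0 al t : curtain al nu t 0 = al t.
Proof. unfold curtain. Cring. Qed.

Lemma sigma_cancel a b : sigma * a = sigma * b -> a = b.
Proof. destruct Hsigma as [->| ->]; lra. Qed.

Let top1 (t : R) : R * R := curtain al1 nu t h.
Let top2 (t : R) : R * R := curtain al2 nu t h.
Let left_ (e : R) : R * R := curtain al1 nu (- delta) e.
Let right_ (e : R) : R * R := curtain al2 nu delta e.

Lemma C1_top1 : C1 top1 ad1. Proof. apply C1_horizontal, D1. Qed.
Lemma C1_top2 : C1 top2 ad2. Proof. apply C1_horizontal, D2. Qed.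
Lemma C1_left : C1 left_ (fun _ => nu). Proof. apply C1_vertical. Qed.
Lemma C1_right : C1 right_ (fun _ => nu). Proof. apply C1_vertical. Qed.

(** Oriented as a path from the beginning of the arc to its end along the three far sides, so that
    it can replace the arc ([loop_zero]). *)
Definition sides (K : R * R -> X) : X :=
  minus (plus (plus (cint top1 ad1 K (- delta) 0) (cint top2 ad2 K 0 delta))
              (cint left_ (fun _ => nu) K 0 h))
        (cint right_ (fun _ => nu) K 0 h).

(** A Cauchy integral over the far sides alone, hence holomorphic across the arc: this is what
    continues boundary values. *)
Definition sides_ci (F : R * R -> X) (z : R * R) : X :=
  minus (plus (plus (ci top1 ad1 (fun t => F (top1 (clamp (- delta) 0 t))) (- delta) 0 z)
                    (ci top2 ad2 (fun t => F (top2 (clamp 0 delta t))) 0 delta z))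
              (ci left_ (fun _ => nu) (fun t => F (left_ (clamp 0 h t))) 0 h z))
        (ci right_ (fun _ => nu) (fun t => F (right_ (clamp 0 h t))) 0 h z).

Lemma sides_cauchy F z : sides (fun s => cs (/ (s - z))%C (F s)) = sides_ci F z.
Proof. unfold sides, sides_ci. rewrite !cint_ci by lra. reflexivity. Qed.

Definition off_sides (z : R * R) : Prop :=
  ((forall t, - delta <= t <= 0 -> top1 t <> z) /\ (forall t, 0 <= t <= delta -> top2 t <> z)) /\
  ((forall e, 0 <= e <= h -> left_ e <> z) /\ (forall e, 0 <= e <= h -> right_ e <> z)).

Definition off_arcs (z : R * R) : Prop :=
  (forall t, - delta <= t <= 0 -> al1 t <> z) /\ (forall t, 0 <= t <= delta -> al2 t <> z).

Lemma off_sides_chart t e : - delta < t < delta -> e < h -> off_sides (ch t (sigma * e)).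
Proof.
  intros Ht He. split; split; intros u Hu E.
  - unfold top1 in E. rewrite half_curtain1 in E by lra.
    apply (chart_inj _ _ _ _ _ _ _ _ _ J) in E; try lra. destruct E as [_ E].
    apply sigma_cancel in E. lra.
  - unfold top2 in E. rewrite half_curtain2 in E by lra.
    apply (chart_inj _ _ _ _ _ _ _ _ _ J) in E; try lra. destruct E as [_ E].
    apply sigma_cancel in E. lra.
  - unfold left_ in E. rewrite half_curtain1 in E by lra.
    apply (chart_inj _ _ _ _ _ _ _ _ _ J) in E; lra.
  - unfold right_ in E. rewrite half_curtain2 in E by lra.
    apply (chart_inj _ _ _ _ _ _ _ _ _ J) in E; lra.
Qed.

Lemma off_arcs_chart t e : - delta <= t <= delta -> e <> 0 -> off_arcs (ch t (sigma * e)).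
Proof.
  intros Ht He. split; intros u Hu E.
  - rewrite <- (curtain_0 al1 u), half_curtain1 in E by lra.
    apply (chart_inj _ _ _ _ _ _ _ _ _ J) in E; try lra. destruct E as [_ E].
    apply sigma_cancel in E. lra.
  - rewrite <- (curtain_0 al2 u), half_curtain2 in E by lra.
    apply (chart_inj _ _ _ _ _ _ _ _ _ J) in E; try lra. destruct E as [_ E].
    apply sigma_cancel in E. lra.
Qed.

Lemma off_sides_open z : off_sides z -> locally z off_sides.
Proof.
  intros [[A B] [C D]]. apply filter_and; apply filter_and.
  - eapply curve_off_open; [apply C1_top1|exact A].
  - eapply curve_off_open; [apply C1_top2|exact B].
  - eapply curve_off_open; [apply C1_left|exact C].
  - eapply curve_off_open; [apply C1_right|exact D].
Qed.

Lemma off_arcs_open z : off_arcs z -> locally z off_arcs.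
Proof.
  intros [A B]. apply filter_and.
  - eapply curve_off_open; [apply D1|exact A].
  - eapply curve_off_open; [apply D2|exact B].
Qed.

Lemma half_chart_sides F z :
  continuous_on half_chart F -> off_sides z -> hol (sides_ci F) z.
Proof.
  intros HF [[A B] [C D]]. unfold sides_ci.
  assert (In1 : forall t e, - delta <= t <= 0 -> 0 <= e <= h -> half_chart (curtain al1 nu t e)).
  { intros t e Ht He. exists t, e. split; [|split]; auto. lra. apply half_curtain1. lra. }
  assert (In2 : forall t e, 0 <= t <= delta -> 0 <= e <= h -> half_chart (curtain al2 nu t e)).
  { intros t e Ht He. exists t, e. split; [|split]; auto. lra. apply half_curtain2. lra. }
  assert (Hci : forall ga gd a b, a <= b -> C1 ga gd -> (forall t, a <= t <= b -> half_chart (ga t)) ->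
    (forall t, a <= t <= b -> ga t <> z) -> hol (ci ga gd (fun t => F (ga (clamp a b t))) a b) z).
  { intros ga gd a b Hab Hg Hin Hoff. apply hol_ci; auto.
    intros t. exact (continuous_clamped half_chart F ga gd a b t Hab Hg HF Hin). }
  apply hol_minus; [apply hol_plus; [apply hol_plus|]|].
  - apply (Hci top1 ad1); [lra|apply C1_top1| |exact A]. intros t Ht. apply In1; lra.
  - apply (Hci top2 ad2); [lra|apply C1_top2| |exact B]. intros t Ht. apply In2; lra.
  - apply (Hci left_ (fun _ => nu)); [lra|apply C1_left| |exact C]. intros t Ht. apply In1; lra.
  - apply (Hci right_ (fun _ => nu)); [lra|apply C1_right| |exact D]. intros t Ht. apply In2; lra.
Qed.

(** One box on either side of the corner; the transversal segment at t = 0 is common to both and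
    cancels. *)
Lemma loop_zero K es :
  continuous_on half_chart K ->
  (forall t e, - delta <= t <= delta -> 0 < e < h -> e <> es -> hol K (ch t (sigma * e))) ->
  plus (cint al1 ad1 K (- delta) 0) (cint al2 ad2 K 0 delta) = sides K.
Proof.
  intros HK Hhol.
  assert (B1 : bint al1 ad1 nu K (- delta) 0 0 h = zero).
  { apply (curtain_zero al1 ad1 nu K
      (fun t e => K (curtain al1 nu (clamp (- delta) 0 t) (clamp 0 h e))) (- delta) 0 0 h es); auto; try lra.
    - intros p. apply (continuous_on_comp half_chart K
        (fun p : R * R => curtain al1 nu (clamp (- delta) 0 (fst p)) (clamp 0 h (snd p)))); auto.
      + apply (continuous_comp_2 (fun p : R * R => clamp (- delta) 0 (fst p))
          (fun p : R * R => clamp 0 h (snd p)) (curtain al1 nu)).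
        * apply (continuous_comp (fun p : R * R => fst p) (clamp (- delta) 0)).
          apply continuous_fst. apply continuous_clamp.
        * apply (continuous_comp (fun p : R * R => snd p) (clamp 0 h)).
          apply continuous_snd. apply continuous_clamp.
        * eapply (continuous_curtain al1 ad1 nu), D1.
      + intros q. pose proof (clamp_in (- delta) 0 (fst q) ltac:(lra)).
        pose proof (clamp_in 0 h (snd q) ltac:(lra)).
        exists (clamp (- delta) 0 (fst q)), (clamp 0 h (snd q)).
        split; [lra|split; [lra|apply half_curtain1; lra]].
    - intros t e Ht He. now rewrite !clamp_id by lra.
    - intros t e Ht He Ne. rewrite half_curtain1 by lra. apply Hhol; auto. lra. }
  assert (B2 : bint al2 ad2 nu K 0 delta 0 h = zero).
  { apply (curtain_zero al2 ad2 nu K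
      (fun t e => K (curtain al2 nu (clamp 0 delta t) (clamp 0 h e))) 0 delta 0 h es); auto; try lra.
    - intros p. apply (continuous_on_comp half_chart K
        (fun p : R * R => curtain al2 nu (clamp 0 delta (fst p)) (clamp 0 h (snd p)))); auto.
      + apply (continuous_comp_2 (fun p : R * R => clamp 0 delta (fst p))
          (fun p : R * R => clamp 0 h (snd p)) (curtain al2 nu)).
        * apply (continuous_comp (fun p : R * R => fst p) (clamp 0 delta)).
          apply continuous_fst. apply continuous_clamp.
        * apply (continuous_comp (fun p : R * R => snd p) (clamp 0 h)).
          apply continuous_snd. apply continuous_clamp.
        * eapply (continuous_curtain al2 ad2 nu), D2.
      + intros q. pose proof (clamp_in 0 delta (fst q) ltac:(lra)).
        pose proof (clamp_in 0 h (snd q) ltac:(lra)).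
        exists (clamp 0 delta (fst q)), (clamp 0 h (snd q)).
        split; [lra|split; [lra|apply half_curtain2; lra]].
    - intros t e Ht He. now rewrite !clamp_id by lra.
    - intros t e Ht He Ne. rewrite half_curtain2 by lra. apply Hhol; auto. lra. }
  unfold bint in B1, B2. unfold sides.
  assert (Emid : cint (fun e => curtain al1 nu 0 e) (fun _ => nu) K 0 h =
                 cint (fun e => curtain al2 nu 0 e) (fun _ => nu) K 0 h).
  { apply (RInt_ext (V := X)). intros e _. rewrite half_curtain1, half_curtain2 by lra. auto. }
  assert (E1 : cint (fun t => curtain al1 nu t 0) ad1 K (- delta) 0 = cint al1 ad1 K (- delta) 0).
  { apply (RInt_ext (V := X)). intros e _. now rewrite curtain_0. }
  assert (E2 : cint (fun t => curtain al2 nu t 0) ad2 K 0 delta = cint al2 ad2 K 0 delta).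
  { apply (RInt_ext (V := X)). intros e _. now rewrite curtain_0. }
  rewrite E1, Emid in B1. rewrite E2 in B2. fold top1 in B1. fold top2 in B2.
  fold left_ in B1. fold right_ in B2.
  change (fun t => curtain al1 nu t h) with top1 in B1.
  change (fun t => curtain al2 nu t h) with top2 in B2.
  change (fun e => curtain al1 nu (- delta) e) with left_ in B1.
  change (fun e => curtain al2 nu delta e) with right_ in B2.
  match goal with |- ?u = ?v => match type of B1 with ?l1 = _ => match type of B2 with ?l2 = _ =>
    replace u with (plus v (plus l1 l2)) by module X end end end.
  rewrite B1, B2. module X.
Qed.

Lemma continuous_on_cauchy_kernel (A : R * R -> Prop) (F : R * R -> X) (z : R * R) :
  continuous_on A F -> ~ A z -> continuous_on A (fun s => cs (/ (s - z))%C (F s)).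
Proof.
  intros HF Nz w Hw.
  assert (Nw : w <> z) by (intros ->; auto).
  apply (filterlim_comp_2 (G := locally ((/ (w - z))%C : R * R)) (H := locally (F w))
    (fun s : R * R => (/ (s - z))%C : R * R) F (fun a b => cs a b)).
  - intros P HP. unfold filtermap, within.
    assert (Cc : continuous (fun s : R * R => (/ (s - z))%C : R * R) w).
    { apply continuous_Cinv. apply continuous_Cminus. apply continuous_id.
      apply continuous_const. apply Cminus_neq_0, Nw. }
    generalize (Cc P HP). unfold filtermap. apply filter_imp. auto.
  - apply HF, Hw.
  - intros P HP.
    assert (Cc : continuous (fun p : (R * R) * X => cs (fst p) (snd p)) ((/ (w - z))%C : R * R, F w)).
    { apply continuous_cs. apply continuous_fst. apply continuous_snd. }
    destruct (Cc P HP) as [e He].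
    exists (ball ((/ (w - z))%C : R * R) e) (ball (F w) e); try apply locally_ball.
    intros a b Ha Hb. apply (He (a, b)). split; assumption.
Qed.

Lemma continuous_on_dquot (A : R * R -> Prop) (F : R * R -> X) (z : R * R) d :
  continuous_on A F -> hasderiv F z d -> continuous_on A (dquot F z d).
Proof.
  intros HF Hz w Hw. destruct (classic (w = z)) as [->|Nw].
  - intros P HP. generalize (continuous_dquot F z d Hz P HP). unfold filtermap, within.
    apply filter_imp. auto.
  - assert (CK : continuous_on (fun s => A s /\ s <> z) (fun s => cs (/ (s - z))%C (minus (F s) (F z)))).
    { apply (continuous_on_cauchy_kernel _ (fun s => minus (F s) (F z))); [|tauto].
      intros v [Hv _]. intros P HP.
      assert (Cc : continuous (fun x : X => minus x (F z)) (F v)).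
      { apply cont_minus. apply continuous_id. apply continuous_const. }
      generalize (HF v Hv _ (Cc P HP)). unfold filtermap, within.
      apply filter_imp. tauto. }
    intros P HP. rewrite dquot_neq in HP by auto.
    generalize (filter_and _ _ (locally_neq w z Nw) (CK w (conj Hw Nw) P HP)).
    unfold filtermap, within. apply filter_imp. intros s [H1 H2] As.
    rewrite dquot_neq by auto. apply H2. auto.
Qed.

(** The integral of x / (s - z) around the loop made of the arc and the reversed far sides: 2 PI i x
    times a winding number, which is sigma inside. *)
Definition winding (x : X) (z : R * R) : X :=
  minus (plus (ci al1 ad1 (fun _ => x) (- delta) 0 z) (ci al2 ad2 (fun _ => x) 0 delta z))
        (sides_ci (fun _ => x) z).

Lemma hasderiv_winding x z : off_arcs z -> off_sides z -> hasderiv (winding x) z zero.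
Proof.
  intros [A1 A2] [[T1 T2] [L R]].
  assert (E1 := hasderiv_ci_const al1 ad1 x (- delta) 0 z D1 ltac:(lra) A1).
  assert (E2 := hasderiv_ci_const al2 ad2 x 0 delta z D2 ltac:(lra) A2).
  assert (E3 := hasderiv_ci_const top1 ad1 x (- delta) 0 z C1_top1 ltac:(lra) T1).
  assert (E4 := hasderiv_ci_const top2 ad2 x 0 delta z C1_top2 ltac:(lra) T2).
  assert (E5 := hasderiv_ci_const left_ (fun _ => nu) x 0 h z C1_left ltac:(lra) L).
  assert (E6 := hasderiv_ci_const right_ (fun _ => nu) x 0 h z C1_right ltac:(lra) R).
  assert (E := hasderiv_minus _ _ _ _ _ (hasderiv_plus _ _ _ _ _ E1 E2)
    (hasderiv_minus _ _ _ _ _ (hasderiv_plus _ _ _ _ _ (hasderiv_plus _ _ _ _ _ E3 E4) E5) E6)).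
  match type of E with hasderiv _ _ ?d => assert (Z : d = zero) end.
  { assert (V0 : al1 0 = al2 0).
    { rewrite (jz1 _ _ _ _ _ _ _ _ _ J), (jz2 _ _ _ _ _ _ _ _ _ J). auto. }
    assert (Vh : top1 0 = top2 0).
    { unfold top1, top2. rewrite half_curtain1, half_curtain2 by lra. auto. }
    assert (Vl : left_ 0 = al1 (- delta)) by apply curtain_0.
    assert (Vr : right_ 0 = al2 delta) by apply curtain_0.
    assert (Vlh : left_ h = top1 (- delta)) by reflexivity.
    assert (Vrh : right_ h = top2 delta) by reflexivity.
    rewrite V0, Vh, Vl, Vr, Vlh, Vrh. module X. }
  rewrite Z in E. exact E.
Qed.

Lemma winding_zero x t e : - delta <= t <= delta -> e < 0 -> winding x (ch t (sigma * e)) = zero.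
Proof.
  intros Ht He. set (z := ch t (sigma * e)).
  assert (Nz : ~ half_chart z).
  { intros [t' [e' [Ht' [He' E]]]]. unfold z in E.
    apply (chart_inj _ _ _ _ _ _ _ _ _ J) in E; auto. destruct E as [_ E].
    apply sigma_cancel in E. lra. }
  assert (L := loop_zero (fun s => cs (/ (s - z))%C x) 0).
  rewrite sides_cauchy in L. rewrite !cint_ci in L by lra.
  unfold winding. rewrite L. module X.
  - apply (continuous_on_cauchy_kernel half_chart (fun _ => x)); auto.
    intros w _. intros P HP. unfold filtermap, within. apply filter_forall.
    intros y _. apply locally_singleton in HP. exact HP.
  - intros t' e' Ht' He' _. apply (hol_cauchy_kernel (fun _ => x)). apply hol_const.
    intros E. apply Nz. rewrite <- E. exists t', e'. repeat split; lra.
Qed.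

(** The chart image of a parameter segment joins the two points off the loop, and along it local
    constancy is enough. *)
Lemma winding_constant x t e t' e' :
  - delta < t < delta -> 0 < e < h -> - delta < t' < delta -> 0 < e' < h ->
  winding x (ch t' (sigma * e')) = winding x (ch t (sigma * e)).
Proof.
  intros Ht He Ht' He'.
  set (pt := fun l => (1 - l) * t + l * t'). set (pe := fun l => (1 - l) * e + l * e').
  set (z := fun l => ch (pt l) (sigma * pe l)).
  assert (Hp : forall l, 0 <= l <= 1 -> - delta < pt l < delta /\ 0 < pe l < h).
  { intros l Hl.
    assert (Cv : forall a p q, a < p -> a < q -> a < (1 - l) * p + l * q).
    { intros a p q H1 H2. assert (0 <= (1 - l) * (p - a)) by (apply Rmult_le_pos; lra).
      assert (0 <= l * (q - a)) by (apply Rmult_le_pos; lra).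
      destruct (Rle_dec l (1 / 2)).
      - assert (0 < (1 - l) * (p - a)) by (apply Rmult_lt_0_compat; lra). lra.
      - assert (0 < l * (q - a)) by (apply Rmult_lt_0_compat; lra). lra. }
    unfold pt, pe. split; split; try (apply Cv; lra).
    - pose proof (Cv (- delta) (- t) (- t')). lra.
    - pose proof (Cv (- h) (- e) (- e')). lra. }
  assert (Q := path_constant (fun l => winding x (z l) = winding x (z 0))).
  replace (ch t' (sigma * e')) with (z 1).
  2: { unfold z, pt, pe. f_equal; [|f_equal]; ring. }
  replace (ch t (sigma * e)) with (z 0).
  2: { unfold z, pt, pe. f_equal; [|f_equal]; ring. }
  apply Q; auto.
  intros l Hl. destruct (Hp l Hl) as [P1 P2].
  assert (Loc : locally (z l) (fun w => off_arcs w /\ off_sides w)).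
  { apply filter_and. apply off_arcs_open, off_arcs_chart; lra.
    apply off_sides_open, off_sides_chart; lra. }
  apply locally_Cmod in Loc. destruct Loc as [rho [Hrho Loc]].
  assert (Cz : continuous z l).
  { apply (continuous_comp_2 pt (fun l => sigma * pe l) ch).
    - apply (ex_derive_continuous (V := R_NormedModule)). unfold pt. auto_derive. auto.
    - apply (ex_derive_continuous (V := R_NormedModule)). unfold pe. auto_derive. auto.
    - apply (continuous_chart _ _ _ _ _ _ _ _ _ J). }
  destruct (proj1 (continuous_C_iff z l) Cz rho Hrho) as [d Hdl].
  exists d. split. apply cond_pos. intros m Hm Hml.
  assert (Em : winding x (z m) = winding x (z l)).
  { apply (hasderiv_zero_constant (winding x) (z l) rho).
    - intros w Hw. destruct (Loc w Hw). apply hasderiv_winding; auto.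
    - apply Hdl. exact Hml. }
  rewrite Em. tauto.
Qed.

(** No angle is measured. [winding x] is constant inside, zero beyond the arc, and jumps by 2 PI i x
    across the arc at its smooth point t1; so the inner value is that jump, signed by the side. *)
Lemma winding_value x t e :
  - delta < t < delta -> 0 < e < h ->
  winding x (ch t (sigma * e)) = cs (RtoC (sigma * (2 * PI)) * Ci)%C x.
Proof.
  intros Ht He. set (t1 := delta / 2).
  assert (Nd2 : ad2 t1 <> RtoC 0).
  { intros E. destruct (jslope2 _ _ _ _ _ _ _ _ _ J t1) as [B _]. unfold t1; lra.
    pose proof (jc _ _ _ _ _ _ _ _ _ J). rewrite E in B.
    replace (RtoC 0 * / tau)%C with (RtoC 0) in B by Cring. simpl in B. lra. }
  destruct (chart_normal _ _ _ _ _ _ _ _ _ J t1 h) as [e0 [He0 Hn]]; auto. unfold t1; lra.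
  assert (Hsub : forall s, s <> 0 -> Rabs s < e0 -> exists t' e', - delta < t' < delta /\
    - h < e' < h /\ 0 < s * (sigma * e') /\
    (al2 t1 + RtoC s * (Ci * ad2 t1))%C = ch t' (sigma * e')).
  { intros s Ns Hs. destruct (Hn s Ns Hs) as [t' [e' [A [B [C D]]]]].
    exists t', (sigma * e'). split; auto. destruct Hsigma as [->| ->].
    - rewrite !Rmult_1_l. auto.
    - split. lra. split. nra. rewrite D.
      replace (-1 * (-1 * e')) with e' by ring. reflexivity. }
  assert (Jl := jump_limit (fun u => al2 (t1 + u)) (fun u => ad2 (t1 + u)) (fun _ => x) (winding x)
    (C1_translate _ _ t1 D2) (fun t => continuous_const x t)).
  simpl in Jl. rewrite Rplus_0_r in Jl. specialize (Jl Nd2).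
  assert (Lim : forall eps, 0 < eps -> exists e1, 0 < e1 /\ forall s, 0 < s < e1 ->
    norm (minus (minus (winding x (al2 t1 + RtoC s * (Ci * ad2 t1))%C)
       (winding x (al2 t1 - RtoC s * (Ci * ad2 t1))%C)) (cs (RtoC (2 * PI) * Ci)%C x)) <= eps).
  { apply Jl. clear Jl. intros eta Heta.
    set (m := Rmin eta (delta / 4)).
    assert (Hm : 0 < m) by (apply Rmin_glb_lt; lra).
    assert (m <= eta) by apply Rmin_l. assert (m <= delta / 4) by apply Rmin_r.
    set (Rst := fun z => minus (plus (ci al1 ad1 (fun _ => x) (- delta) 0 z)
      (plus (ci al2 ad2 (fun _ => x) 0 (t1 - m) z) (ci al2 ad2 (fun _ => x) (t1 + m) delta z)))
      (sides_ci (fun _ => x) z)).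
    exists (- m), m, Rst. split. lra. split. lra. split.
    - assert (E0 : al2 t1 = ch t1 (sigma * 0)).
      { rewrite <- half_curtain2, curtain_0 by (unfold t1; lra). auto. }
      assert (N2 : forall u, 0 <= u <= delta -> u <> t1 -> al2 u <> al2 t1).
      { intros u Hu Nu E. apply Nu.
        rewrite <- (curtain_0 al2 u), <- (curtain_0 al2 t1), !half_curtain2 in E by (unfold t1; lra).
        apply (chart_inj _ _ _ _ _ _ _ _ _ J) in E; unfold t1 in *; lra. }
      apply hol_continuous. apply hol_minus; [apply hol_plus; [|apply hol_plus]|].
      + apply hol_ci; auto. lra. intros; apply continuous_const. intros u Hu E.
        rewrite <- (curtain_0 al2 t1), half_curtain2 in E by (unfold t1; lra).
        rewrite <- (curtain_0 al1 u), half_curtain1 in E by lra.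
        apply (chart_inj _ _ _ _ _ _ _ _ _ J) in E; unfold t1 in *; lra.
      + apply hol_ci; auto. unfold t1; lra. intros; apply continuous_const.
        intros u Hu. apply N2; unfold t1 in *; lra.
      + apply hol_ci; auto. unfold t1; lra. intros; apply continuous_const.
        intros u Hu. apply N2; unfold t1 in *; lra.
      + apply half_chart_sides.
        * intros w _. intros P HP. unfold filtermap, within. apply filter_forall.
          intros y _. apply locally_singleton in HP. exact HP.
        * rewrite E0. apply off_sides_chart; unfold t1; lra.
    - exists e0. split; auto. intros s Ns Hs.
      destruct (Hsub s Ns Hs) as [t' [e' [A [B [C D]]]]].
      assert (Noff : forall u, 0 <= u <= delta -> al2 u <> (al2 t1 + RtoC s * (Ci * ad2 t1))%C).
      { assert (O : off_arcs (ch t' (sigma * e'))).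
        { apply off_arcs_chart. lra. intros E. rewrite E in C. lra. }
        intros u Hu. rewrite D. apply O, Hu. }
      set (zs := (al2 t1 + RtoC s * (Ci * ad2 t1))%C) in *.
      assert (Cx : forall t : R, continuous (fun _ : R => x) t) by (intros; apply continuous_const).
      rewrite (ci_translate al2 ad2 (fun _ => x) t1 (- m) m zs D2 ltac:(lra) Cx)
        by (intros u Hu; apply Noff; unfold t1 in *; lra).
      unfold winding, Rst.
      rewrite (ci_Chasles al2 ad2 (fun _ => x) 0 (t1 - m) delta zs D2 ltac:(unfold t1; lra) Cx Noff).
      rewrite (ci_Chasles al2 ad2 (fun _ => x) (t1 - m) (t1 + m) delta zs D2 ltac:(unfold t1; lra) Cx)
        by (intros u Hu; apply Noff; unfold t1 in *; lra).
      replace (t1 + - m) with (t1 - m) by ring. module X. }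
  apply nrm_minus_eq_0. intros eps Heps.
  destruct (Lim eps Heps) as [e1 [He1 L1]].
  set (s := Rmin e0 e1 / 2).
  assert (Hs0 : 0 < Rmin e0 e1) by (apply Rmin_glb_lt; auto).
  pose proof (Rmin_l e0 e1). pose proof (Rmin_r e0 e1).
  specialize (L1 s ltac:(unfold s; lra)).
  destruct (Hsub s) as [ta [ea [A1 [A2 [A3 A4]]]]]. unfold s; lra. rewrite Rabs_right; unfold s; lra.
  destruct (Hsub (- s)) as [tb [eb [B1 [B2 [B3 B4]]]]]. unfold s; lra. rewrite Rabs_left; unfold s; lra.
  replace (al2 t1 + RtoC (- s) * (Ci * ad2 t1))%C with (al2 t1 - RtoC s * (Ci * ad2 t1))%C in B4
    by (rewrite RtoC_opp; Cring).
  assert (Hs : 0 < s) by (unfold s; lra).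
  rewrite A4, B4 in L1.
  (* For sigma = 1 the normal point at s is the inner one, for sigma = -1 the one at - s. *)
  destruct Hsigma as [Es|Es].
  - assert (0 < ea) by (rewrite Es in A3; nra). assert (eb < 0) by (rewrite Es in B3; nra).
    rewrite (winding_constant x t e ta ea) in L1 by lra.
    rewrite (winding_zero x tb eb) in L1 by lra.
    replace (sigma * (2 * PI)) with (2 * PI) by (rewrite Es; ring).
    match type of L1 with norm ?u <= _ => match goal with |- norm ?v <= _ =>
      replace v with u by module X end end. exact L1.
  - assert (0 < eb) by (rewrite Es in B3; nra). assert (ea < 0) by (rewrite Es in A3; nra).
    rewrite (winding_constant x t e tb eb) in L1 by lra.
    rewrite (winding_zero x ta ea) in L1 by lra.
    rewrite <- nrm_opp.
    match type of L1 with norm ?u <= _ => match goal with |- norm ?v <= _ =>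
      replace v with u end end. exact L1.
    replace (sigma * (2 * PI)) with (- (2 * PI)) by (rewrite Es; ring).
    rewrite RtoC_opp. module X.
Qed.

(** For e < 0 the Cauchy kernel is holomorphic in the half chart, and the arc may be replaced by the
    far sides. For e > 0 this is done with the difference quotient, whose singular point lies on the
    exceptional level e, and the constant part contributes [winding_value]. *)
Lemma local_cauchy F (phi1 phi2 : R -> X) :
  continuous_on half_chart F ->
  (forall t e, - delta <= t <= delta -> 0 < e < h -> hol F (ch t (sigma * e))) ->
  (forall t, - delta <= t <= 0 -> phi1 t = F (al1 t)) ->
  (forall t, 0 <= t <= delta -> phi2 t = F (al2 t)) ->
  locally zeta (hol (sides_ci F)) /\
  forall t e, - delta < t < delta -> e < h -> e <> 0 ->
  plus (ci al1 ad1 phi1 (- delta) 0 (ch t (sigma * e)))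
       (ci al2 ad2 phi2 0 delta (ch t (sigma * e))) =
  plus (sides_ci F (ch t (sigma * e)))
       (if Rlt_dec 0 e then cs (RtoC (sigma * (2 * PI)) * Ci)%C (F (ch t (sigma * e))) else zero).
Proof.
  intros HF Hhol H1 H2. split.
  - assert (O : off_sides zeta).
    { rewrite <- (chart_zeta _ _ _ _ _ _ _ _ _ J). replace 0 with (sigma * 0) at 2 by ring.
      apply off_sides_chart; lra. }
    generalize (off_sides_open _ O). apply filter_imp. intros z. apply half_chart_sides, HF.
  - intros t e Ht He Ne. set (z := ch t (sigma * e)).
    set (KF := fun s : R * R => cs (/ (s - z))%C (F s)).
    assert (Ephi : plus (ci al1 ad1 phi1 (- delta) 0 z) (ci al2 ad2 phi2 0 delta z) =
      plus (cint al1 ad1 KF (- delta) 0) (cint al2 ad2 KF 0 delta)).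
    { f_equal; apply (RInt_ext (V := X)); rewrite Rmin_left, Rmax_right by lra; intros u Hu; unfold KF.
      rewrite H1 by lra. module X. rewrite H2 by lra. module X. }
    rewrite Ephi, <- sides_cauchy. change (sides (fun s => cs (/ (s - z))%C (F s))) with (sides KF).
    destruct (Rlt_dec 0 e) as [Pe|Pe].
    + destruct (Hhol t e) as [d Hdz]; try lra. fold z in Hdz.
      assert (L := loop_zero (dquot F z d) e).
      assert (Wv := winding_value (F z) t e Ht (conj Pe He)). fold z in Wv.
      set (KZ := fun s : R * R => cs (/ (s - z))%C (F z)).
      unfold winding in Wv. rewrite <- (sides_cauchy (fun _ => F z)) in Wv.
      change (sides (fun s => cs (/ (s - z))%C (F z))) with (sides KZ) in Wv.
      assert (Ec1 : plus (ci al1 ad1 (fun _ => F z) (- delta) 0 z) (ci al2 ad2 (fun _ => F z) 0 delta z)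
        = plus (cint al1 ad1 KZ (- delta) 0) (cint al2 ad2 KZ 0 delta)).
      { f_equal; apply (RInt_ext (V := X)); intros u Hu; unfold KZ; module X. }
      rewrite Ec1 in Wv. clear Ec1.
      assert (O : off_arcs z) by (apply off_arcs_chart; lra).
      assert (Os : off_sides z) by (apply off_sides_chart; lra).
      assert (Split : forall ga gd a b, C1 ga gd -> a <= b ->
        (forall u, a <= u <= b -> ga u <> z) -> (forall u, a <= u <= b -> half_chart (ga u)) ->
        cint ga gd (dquot F z d) a b =
        minus (cint ga gd KF a b) (cint ga gd KZ a b)).
      { intros ga gd a b Hg Hab Hoff Hin.
        assert (Cg := fun t => continuous_clamped half_chart F ga gd a b t Hab Hg HF Hin).
        rewrite <- cint_minus.
        - apply cint_ext; auto. intros u Hu. rewrite dquot_neq by auto. unfold KF, KZ. module X.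
        - apply (ex_RInt_ext (fun t => cs (gd t * / (ga t - z))%C (F (ga (clamp a b t))))).
          rewrite Rmin_left, Rmax_right by auto. intros u Hu. rewrite clamp_id by lra. unfold KF. module X.
          apply (ex_ci ga gd (fun t => F (ga (clamp a b t)))); auto.
        - apply (ex_RInt_ext (fun t => cs (gd t * / (ga t - z))%C (F z))).
          intros u Hu. unfold KZ. module X.
          apply (ex_ci ga gd (fun t => F z)); auto. intros; apply continuous_const. }
      assert (In1 : forall t e, - delta <= t <= 0 -> 0 <= e <= h -> half_chart (curtain al1 nu t e)).
      { intros t' e' Ht' He'. exists t', e'. split; [|split]; auto. lra. apply half_curtain1. lra. }
      assert (In2 : forall t e, 0 <= t <= delta -> 0 <= e <= h -> half_chart (curtain al2 nu t e)).
      { intros t' e' Ht' He'. exists t', e'. split; [|split]; auto. lra. apply half_curtain2. lra. }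
      destruct O as [O1 O2]. destruct Os as [[O3 O4] [O5 O6]].
      unfold sides in L, Wv |- *.
      rewrite (Split al1 ad1) in L; auto; try lra.
      2: { intros u Hu. rewrite <- (curtain_0 al1 u). apply In1; lra. }
      rewrite (Split al2 ad2) in L; auto; try lra.
      2: { intros u Hu. rewrite <- (curtain_0 al2 u). apply In2; lra. }
      rewrite (Split top1 ad1) in L; auto; try lra; [|apply C1_top1|intros u Hu; apply In1; lra].
      rewrite (Split top2 ad2) in L; auto; try lra; [|apply C1_top2|intros u Hu; apply In2; lra].
      rewrite (Split left_ (fun _ => nu)) in L; auto; try lra; [|apply C1_left|intros u Hu; apply In1; lra].
      rewrite (Split right_ (fun _ => nu)) in L; auto; try lra; [|apply C1_right|intros u Hu; apply In2; lra].
      rewrite <- Wv.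
      match type of L with _ -> _ -> ?u = ?v => assert (L' : u = v) end.
      { apply L. apply continuous_on_dquot; auto.
        intros t' e' Ht' He' Ne'. apply hol_dquot; auto. intros E.
        apply (chart_inj _ _ _ _ _ _ _ _ _ J) in E; try lra. destruct E as [_ E].
        apply sigma_cancel in E. lra. }
      match type of L' with ?u = ?v => match goal with |- ?p = ?q =>
        replace q with (minus p (minus u v)) by module X end end.
      rewrite L'. module X.
    + assert (Neg : e < 0) by (destruct (Rtotal_order e 0) as [N|[N|N]];
        [exact N|exfalso; exact (Ne N)|exfalso; exact (Pe N)]).
      assert (Nz : ~ half_chart z).
      { intros [t' [e' [Ht' [He' E]]]]. unfold z in E.
        apply (chart_inj _ _ _ _ _ _ _ _ _ J) in E; try lra. destruct E as [_ E].
        apply sigma_cancel in E. lra. }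
      rewrite plus_zero_r. apply loop_zero with (es := 0).
      * apply continuous_on_cauchy_kernel; auto.
      * intros t' e' Ht' He' _. apply hol_cauchy_kernel; auto. intros E. apply Nz.
        rewrite <- E. exists t', e'. split; [auto|split; [lra|reflexivity]].
Qed.

End LocalCauchy.

(** * Decomposition of contours *)

Lemma norm_RR (w : R * R) : norm w = Cmod w.
Proof.
  unfold norm; simpl. unfold prod_norm, Cmod. f_equal. unfold norm; simpl. unfold abs; simpl.
  rewrite !Rmult_1_r, <- !Rabs_mult, !Rabs_right; try ring; apply Rle_ge, Rle_0_sqr.
Qed.

Lemma C1_of_eps al ad :
  (forall t, continuous ad t) ->
  (forall t eps, 0 < eps ->
     locally t (fun s => Cmod (al s - al t - RtoC (s - t) * ad t)%C <= eps * Rabs (s - t))) ->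
  C1 al ad.
Proof.
  intros Hc H t. split; [auto|].
  assert (K : forall (f : R -> R) l, (forall eps, 0 < eps ->
    locally t (fun s => Rabs (f s - f t - (s - t) * l) <= eps * Rabs (s - t))) -> is_derive f t l).
  { intros f l Hf. split. apply (is_linear_scal_l (V := R_NormedModule)).
    intros y Hy. rewrite <- (is_filter_lim_locally_unique (V := R_NormedModule) t y Hy).
    intros eps. generalize (Hf eps (cond_pos eps)). apply filter_imp. intros s Hs.
    eapply Rle_trans; [|exact Hs]. right. reflexivity. }
  split; apply K; intros eps He; generalize (H t eps He); apply filter_imp; intros s Hs;
    (eapply Rle_trans; [|exact Hs]).
  - eapply Rle_trans; [|apply fst_le_Cmod]. right. f_equal. simpl. ring.
  - eapply Rle_trans; [|apply snd_le_Cmod]. right. f_equal. simpl. ring.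
Qed.

(* The one-sided data on a piece, continued by its tangents at the two ends. *)
Lemma piece_extension (gamma delta : R -> R * R) a b :
  a < b -> continuous_on (Icc a b) delta ->
  (forall s, Icc a b s ->
     filterdiff gamma (within (Icc a b) (locally s)) (fun h => scal h (delta s))) ->
  exists al ad, C1 al ad /\ forall t, a <= t <= b -> al t = gamma t /\ ad t = delta t.
Proof.
  intros Hab Hd Hg.
  exists (fun t => (gamma (clamp a b t) + RtoC (t - clamp a b t) * delta (clamp a b t))%C : R * R).
  exists (fun t => delta (clamp a b t)).
  assert (Cd : forall t, continuous (fun t => delta (clamp a b t)) t).
  { intros t. apply (continuous_on_comp (Icc a b) delta (clamp a b)); auto.
    apply continuous_clamp. intros; apply clamp_in; lra. }
  split.
  - apply C1_of_eps; auto. intros t eps He. assert (He2 : 0 < eps / 2) by lra.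
    assert (In : Icc a b (clamp a b t)) by (apply clamp_in; lra).
    destruct (Hg _ In) as [_ Hdom].
    assert (Lim : is_filter_lim (within (Icc a b) (locally (clamp a b t))) (clamp a b t)).
    { intros P HP. unfold within. revert HP. apply filter_imp. auto. }
    specialize (Hdom _ Lim (mkposreal _ He2)).
    apply (continuous_clamp a b t) in Hdom. unfold filtermap in Hdom.
    generalize (filter_and _ _ Hdom (proj1 (continuous_C_iff _ _) (Cd t) _ He2)).
    apply filter_imp. intros s [A B]. specialize (A (clamp_in a b s ltac:(lra))).
    set (cs := clamp a b s) in *. set (ct := clamp a b t) in *.
    replace (gamma cs + RtoC (s - cs) * delta cs - (gamma ct + RtoC (t - ct) * delta ct)
       - RtoC (s - t) * delta ct)%C
      with ((gamma cs - gamma ct - RtoC (cs - ct) * delta ct) + RtoC (s - cs) * (delta cs - delta ct))%C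
      by (rewrite !RtoC_minus; Cring).
    eapply Rle_trans. apply Cmod_triangle.
    replace (eps * Rabs (s - t)) with (eps / 2 * Rabs (s - t) + eps / 2 * Rabs (s - t)) by field.
    apply Rplus_le_compat.
    + assert (L : Rabs (cs - ct) <= Rabs (s - t)).
      { unfold cs, ct, clamp, Rmax, Rmin, Rabs. repeat (destruct Rle_dec || destruct Rcase_abs); lra. }
      apply Rle_trans with (eps / 2 * Rabs (cs - ct)).
      * eapply Rle_trans; [|exact A]. right. rewrite norm_RR. f_equal.
        unfold minus, plus, opp, scal; simpl. unfold prod_plus, prod_opp, prod_scal, plus, opp, scal; simpl.
        unfold mult; simpl.
        apply injective_projections; simpl; ring.
      * apply Rmult_le_compat_l; lra.
    + rewrite Cmod_mult, Cmod_R, Rmult_comm.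
      (* Either both parameters are clamped to the same point and the term vanishes, or s overshoots
         the interval by at most its distance to t. *)
      assert (L : cs = ct \/ Rabs (s - cs) <= Rabs (s - t)).
      { unfold cs, ct, clamp, Rmax, Rmin, Rabs. repeat (destruct Rle_dec || destruct Rcase_abs); lra. }
      destruct L as [E|L].
      * rewrite E. replace (delta ct - delta ct)%C with (RtoC 0) by Cring. rewrite Cmod_0.
        pose proof (Rabs_pos (s - t)). nra.
      * apply Rmult_le_compat; auto. apply Cmod_ge_0. apply Rabs_pos. left. exact B.
  - intros t Ht. rewrite clamp_id by auto. split; auto.
    replace (t - t) with 0 by ring. Cring.
Qed.

Record arc : Type := {
  a_al : R -> R * R; a_ad : R -> R * R; a_lo : R; a_hi : R;
  a_le : a_lo <= a_hi; a_C1 : C1 a_al a_ad }.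

Definition on_arc (A : arc) (z : R * R) : Prop := exists s, a_lo A <= s <= a_hi A /\ a_al A s = z.
Definition on_arcs (L : list arc) (z : R * R) : Prop := exists A, In A L /\ on_arc A z.

Definition velocity (gamma : R -> R * R) (t : R) : R * R :=
  (Derive (fun r => fst (gamma r)) t, Derive (fun r => snd (gamma r)) t).

Lemma velocity_C1 gamma al ad t a b :
  C1 al ad -> a < t < b -> (forall s, a <= s <= b -> al s = gamma s) -> velocity gamma t = ad t.
Proof.
  intros Ha Ht E. destruct (Ha t) as [_ [H1 H2]].
  assert (L : locally t (fun s => al s = gamma s)).
  { exists (mkposreal (Rmin (t - a) (b - t)) ltac:(apply Rmin_glb_lt; lra)). intros s Hs.
    unfold ball in Hs; simpl in Hs; unfold AbsRing_ball, abs, minus, plus, opp in Hs; simpl in Hs.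
    pose proof (Rmin_l (t - a) (b - t)). pose proof (Rmin_r (t - a) (b - t)).
    apply Rabs_def2 in Hs. apply E. lra. }
  apply injective_projections; simpl.
  - rewrite (Derive_ext_loc _ (fun s => fst (al s))).
    apply is_derive_unique, H1. revert L. apply filter_imp. intros s ->. auto.
  - rewrite (Derive_ext_loc _ (fun s => snd (al s))).
    apply is_derive_unique, H2. revert L. apply filter_imp. intros s ->. auto.
Qed.

Section Contours.
Context {X : CBanach}.

Definition arcs_int (L : list arc) (K : R * R -> X) : X :=
  fold_right plus zero (map (fun A => cint (a_al A) (a_ad A) K (a_lo A) (a_hi A)) L).

Definition contour_int (G : list (R -> R * R)) (K : R * R -> X) : X :=
  fold_right plus zero (map (fun gamma =>
    RInt (fun s => cs (velocity gamma s) (K (gamma s))) 0 1) G).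

Lemma arcs_int_app L1 L2 K : arcs_int (L1 ++ L2) K = plus (arcs_int L1 K) (arcs_int L2 K).
Proof.
  induction L1 as [|A L IH].
  - change (arcs_int L2 K = plus zero (arcs_int L2 K)). module X.
  - change (plus (cint (a_al A) (a_ad A) K (a_lo A) (a_hi A)) (arcs_int (L ++ L2) K) =
      plus (plus (cint (a_al A) (a_ad A) K (a_lo A) (a_hi A)) (arcs_int L K)) (arcs_int L2 K)).
    rewrite IH. module X.
Qed.

Lemma contour_int_app L1 L2 K :
  contour_int (L1 ++ L2) K = plus (contour_int L1 K) (contour_int L2 K).
Proof.
  induction L1 as [|A L IH].
  - change (contour_int L2 K = plus zero (contour_int L2 K)). module X.
  - set (v := RInt (fun s => cs (velocity A s) (K (A s))) 0 1).
    change (plus v (contour_int (L ++ L2) K) = plus (plus v (contour_int L K)) (contour_int L2 K)).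
    rewrite IH. module X.
Qed.

Lemma on_arcs_app L1 L2 z : on_arcs (L1 ++ L2) z <-> on_arcs L1 z \/ on_arcs L2 z.
Proof.
  unfold on_arcs. split.
  - intros [A [H1 H2]]. apply in_app_or in H1. destruct H1; [left|right]; eauto.
  - intros [[A [H1 H2]]|[A [H1 H2]]]; exists A; split; auto; apply in_or_app; auto.
Qed.

Lemma is_RInt_subarc gamma al ad (S : R * R -> Prop) (K : R * R -> X) a b :
  C1 al ad -> a <= b -> (forall s, a <= s <= b -> al s = gamma s) ->
  (forall s, a <= s <= b -> S (gamma s)) -> continuous_on S K ->
  is_RInt (fun s => cs (velocity gamma s) (K (gamma s))) a b (cint al ad K a b).
Proof.
  intros Ha Hab E HS HK.
  apply (is_RInt_ext (fun s => cs (ad s) (K (al s)))).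
  - rewrite Rmin_left, Rmax_right by auto. intros s Hs.
    rewrite (velocity_C1 gamma al ad s a b), E; auto; lra.
  - apply (RInt_correct (V := X)).
    apply (ex_RInt_ext (fun s => cs (ad s) (K (al (clamp a b s))))).
    + rewrite Rmin_left, Rmax_right by auto. intros s Hs. rewrite clamp_id; auto; lra.
    + apply ex_RInt_cont. intros t. apply continuous_cs. apply Ha.
      apply (continuous_clamped S K al ad); auto. intros u Hu. rewrite E; auto.
Qed.

(** Integral and trace are recorded for one and the same subdivision: the first computes the
    transform, the second tells where the result is holomorphic. *)
Definition arc_cover (gamma : R -> R * R) (S : R * R -> Prop) (a b : R) : Prop :=
  exists L, (forall K, continuous_on S K ->
    is_RInt (fun s => cs (velocity gamma s) (K (gamma s))) a b (arcs_int L K)) /\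
  forall z, on_arcs L z <-> exists s, a <= s <= b /\ gamma s = z.

Lemma arc_cover_single gamma al ad S a b :
  C1 al ad -> a <= b -> (forall s, a <= s <= b -> al s = gamma s) ->
  (forall s, a <= s <= b -> S (gamma s)) -> arc_cover gamma S a b.
Proof.
  intros Ha Hab E HS.
  exists (cons {| a_al := al; a_ad := ad; a_lo := a; a_hi := b; a_le := Hab; a_C1 := Ha |} nil).
  split.
  - intros K HK. unfold arcs_int. simpl.
    replace (plus (cint al ad K a b) zero) with (cint al ad K a b) by module X.
    eapply is_RInt_subarc; eauto.
  - intros z. split.
    + intros [A [[<-|[]] [s [Hs Hz]]]]. simpl in *. exists s. rewrite <- E; auto.
    + intros [s [Hs Hz]]. eexists. split. left; reflexivity. exists s. simpl. rewrite E; auto.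
Qed.

Lemma arc_cover_concat gamma S a b c :
  a <= b <= c -> arc_cover gamma S a b -> arc_cover gamma S b c -> arc_cover gamma S a c.
Proof.
  intros H [L1 [I1 Z1]] [L2 [I2 Z2]]. exists (L1 ++ L2). split.
  - intros K HK. rewrite arcs_int_app. apply (is_RInt_Chasles (V := X) _ a b c); auto.
  - intros z. rewrite on_arcs_app, Z1, Z2. split.
    + intros [[s [Hs E]]|[s [Hs E]]]; exists s; split; auto; lra.
    + intros [s [Hs E]]. destruct (Rle_dec s b); [left|right]; exists s; split; auto; lra.
Qed.

Section Pieces.
Variables (gamma : R -> R * R) (n : nat) (t : nat -> R) (delta : nat -> R -> R * R).
Hypotheses (Hn : (0 < n)%nat) (Ht0 : t 0%nat = 0) (Ht1 : t n = 1).
Hypothesis Hpiece : forall k, (k < n)%nat ->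
       t k < t (S k) /\
       continuous_on (Icc (t k) (t (S k))) (delta k) /\
       forall s, Icc (t k) (t (S k)) s ->
         delta k s <> (0, 0) /\
         filterdiff gamma (within (Icc (t k) (t (S k))) (locally s))
           (fun h => scal h (delta k s)).

Lemma piece_C1 k : (k < n)%nat -> exists al ad, C1 al ad /\
  forall s, t k <= s <= t (S k) -> al s = gamma s /\ ad s = delta k s /\ ad s <> RtoC 0.
Proof.
  intros Hk. destruct (Hpiece k Hk) as [H1 [H2 H3]].
  destruct (piece_extension gamma (delta k) (t k) (t (S k))) as [al [ad [Ha E]]]; auto.
  intros s Hs. apply H3, Hs.
  exists al, ad. split; auto. intros s Hs. destruct (E s Hs) as [E1 E2].
  split; [|split]; auto. rewrite E2. apply H3. exact Hs.
Qed.

Lemma nodes_mono j k : (j <= k <= n)%nat -> t j <= t k.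
Proof.
  intros [H1 H2]. induction H1 as [|k H1 IH]. lra.
  destruct (Hpiece k) as [L _]. lia. specialize (IH ltac:(lia)). lra.
Qed.

Lemma arc_cover_pieces Bd a b :
  (forall s, 0 <= s <= 1 -> Bd (gamma s)) -> 0 <= a <= b -> b <= 1 -> arc_cover gamma Bd a b.
Proof.
  intros HS Ha Hb.
  assert (P : forall k a b, (k < n)%nat -> t k <= a <= b -> b <= t (S k) ->
    arc_cover gamma Bd a b).
  { intros k a' b' Hk H1 H2. destruct (piece_C1 k Hk) as [al [ad [Hc E]]].
    pose proof (nodes_mono 0 k ltac:(lia)). pose proof (nodes_mono (k + 1) n ltac:(lia)).
    rewrite Nat.add_1_r in H0.
    apply (arc_cover_single gamma al ad); auto; try lra.
    intros s Hs. apply E. lra. intros s Hs. apply HS. lra. }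
  assert (Q : forall k a b, (k <= n)%nat -> 0 <= a <= b -> b <= t k -> arc_cover gamma Bd a b).
  { induction k as [|k IH]; intros a' b' Hk H1 H2.
    - apply (P 0%nat); auto. rewrite Ht0. lra. destruct (Hpiece 0%nat Hn) as [L _]. lra.
    - destruct (Rle_dec b' (t k)). apply IH; auto; lia.
      destruct (Rle_dec (t k) a'). apply (P k); auto. lra.
      apply (arc_cover_concat gamma Bd a' (t k) b'). lra.
      apply IH; try lra; lia. apply (P k); try lra; lia. }
  apply (Q n); auto. lra.
Qed.

(** The convention t k < s <= t (S k) picks the piece before s even when s is a node; [right_germ]
    has the opposite one, and at a node the two pieces differ. *)
Lemma left_germ s : 0 < s <= 1 -> exists k al ad d, (k < n)%nat /\ 0 < d /\
  t k < s <= t (S k) /\ C1 al ad /\ al 0 = gamma s /\ ad 0 = delta k s /\ ad 0 <> RtoC 0 /\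
  d <= s /\ forall u, - d <= u <= 0 -> al u = gamma (s + u).
Proof.
  intros Hs.
  assert (Q : forall k, (k <= n)%nat -> s <= t k -> exists j, (j < k)%nat /\ t j < s <= t (S j)).
  { induction k as [|k IH]; intros Hk H. rewrite Ht0 in H. lra.
    destruct (Rle_dec s (t k)) as [L|L].
    - destruct IH as [j [Hj Hj']]; auto. lia. exists j. split; auto.
    - exists k. split. lia. lra. }
  destruct (Q n) as [k [Hk Hks]]; auto. lra.
  destruct (piece_C1 k Hk) as [al [ad [Hc E]]].
  pose proof (nodes_mono 0 k ltac:(lia)).
  exists k, (fun u => al (s + u)), (fun u => ad (s + u)), (s - t k).
  rewrite Rplus_0_r. destruct (E s) as [E1 [E2 E3]]. lra.
  repeat split; auto; try lra; try apply (C1_translate al ad s Hc).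
  intros u Hu. apply E. lra.
Qed.

Lemma right_germ s : 0 <= s < 1 -> exists k al ad d, (k < n)%nat /\ 0 < d /\
  t k <= s < t (S k) /\ C1 al ad /\ al 0 = gamma s /\ ad 0 = delta k s /\ ad 0 <> RtoC 0 /\
  d <= 1 - s /\ forall u, 0 <= u <= d -> al u = gamma (s + u).
Proof.
  intros Hs.
  assert (Q : forall k, (k <= n)%nat -> s < t k -> exists j, (j < k)%nat /\ t j <= s < t (S j)).
  { induction k as [|k IH]; intros Hk H. rewrite Ht0 in H. lra.
    destruct (Rlt_dec s (t k)) as [L|L].
    - destruct IH as [j [Hj Hj']]; auto. lia. exists j. split; auto.
    - exists k. split. lia. lra. }
  destruct (Q n) as [k [Hk Hks]]; auto. lra.
  destruct (piece_C1 k Hk) as [al [ad [Hc E]]].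
  pose proof (nodes_mono (k + 1) n ltac:(lia)). rewrite Nat.add_1_r in H.
  exists k, (fun u => al (s + u)), (fun u => ad (s + u)), (t (S k) - s).
  rewrite Rplus_0_r. destruct (E s) as [E1 [E2 E3]]. lra.
  repeat split; auto; try lra; try apply (C1_translate al ad s Hc).
  intros u Hu. apply E. lra.
Qed.

End Pieces.
End Contours.

(** The bisector |d2| d1 + |d1| d2 works unless the vectors are opposite. In that case
    Cauchy-Schwarz is an equality, and the quotient is a negative real number: a cusp. *)
Lemma common_transversal (d1 d2 : R * R) :
  d1 <> RtoC 0 -> d2 <> RtoC 0 -> no_cusp d1 d2 ->
  exists tau : C, tau <> RtoC 0 /\ 0 < fst (d1 * / tau)%C /\ 0 < fst (d2 * / tau)%C.
Proof.
  intros N1 N2 Hc.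
  pose proof (Cmod_gt_0 d1) as G1. pose proof (Cmod_gt_0 d2) as G2.
  assert (P1 : 0 < Cmod d1) by (apply G1; auto). assert (P2 : 0 < Cmod d2) by (apply G2; auto).
  clear G1 G2. destruct d1 as [a b], d2 as [c d].
  set (m1 := Cmod (a, b)) in *. set (m2 := Cmod (c, d)) in *.
  assert (S1 : m1 * m1 = a * a + b * b).
  { unfold m1, Cmod. rewrite sqrt_sqrt; simpl; nra. }
  assert (S2 : m2 * m2 = c * c + d * d).
  { unfold m2, Cmod. rewrite sqrt_sqrt; simpl; nra. }
  assert (Q : 0 < m1 * m2 + (a * c + b * d)).
  { apply Rnot_le_lt. intros H. apply Hc.
    assert (Z : (m1 * m2) * (m1 * m2) = (a * c + b * d) * (a * c + b * d) + (a * d - b * c) * (a * d - b * c)).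
    { replace ((m1 * m2) * (m1 * m2)) with ((m1 * m1) * (m2 * m2)) by ring. rewrite S1, S2. ring. }
    assert (0 < m1 * m2) by (apply Rmult_lt_0_compat; auto).
    assert (X : a * d - b * c = 0) by nra.
    exists ((a * c + b * d) / (m2 * m2)). split.
    - apply Rmult_le_reg_r with (m2 * m2). nra.
      replace ((a * c + b * d) / (m2 * m2) * (m2 * m2)) with (a * c + b * d) by (field; lra). lra.
    - rewrite S2. unfold Cdiv, Cmult, Cinv, RtoC. simpl.
      apply injective_projections; simpl.
      + field. nra.
      + replace (a * (- d / (c * (c * 1) + d * (d * 1))) + b * (c / (c * (c * 1) + d * (d * 1))))
          with (- (a * d - b * c) / (c * (c * 1) + d * (d * 1))) by (field; nra).
        rewrite X. field. nra. }
  assert (K : forall x y p q, 0 < x * p + y * q -> 0 < p * p + q * q ->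
    0 < fst (((x, y) : C) * / ((p, q) : C))%C).
  { intros x y p q H1 H2. simpl.
    replace (x * (p / (p * (p * 1) + q * (q * 1))) - y * (- q / (p * (p * 1) + q * (q * 1))))
      with ((x * p + y * q) / (p * p + q * q)) by (field; lra).
    apply Rdiv_lt_0_compat; auto. }
  exists (a * m2 + c * m1, b * m2 + d * m1).
  assert (T1 : 0 < a * (a * m2 + c * m1) + b * (b * m2 + d * m1)).
  { replace (a * (a * m2 + c * m1) + b * (b * m2 + d * m1))
      with ((a * a + b * b) * m2 + m1 * (a * c + b * d)) by ring. rewrite <- S1.
    replace (m1 * m1 * m2 + m1 * (a * c + b * d)) with (m1 * (m1 * m2 + (a * c + b * d))) by ring.
    apply Rmult_lt_0_compat; auto. }
  assert (T2 : 0 < c * (a * m2 + c * m1) + d * (b * m2 + d * m1)).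
  { replace (c * (a * m2 + c * m1) + d * (b * m2 + d * m1))
      with ((c * c + d * d) * m1 + m2 * (a * c + b * d)) by ring. rewrite <- S2.
    replace (m2 * m2 * m1 + m2 * (a * c + b * d)) with (m2 * (m1 * m2 + (a * c + b * d))) by ring.
    apply Rmult_lt_0_compat; auto. }
  set (p := a * m2 + c * m1) in *. set (q := b * m2 + d * m1) in *.
  assert (T3 : 0 < p * p + q * q).
  { destruct (Req_dec p 0) as [Ep|Ep]. 2: nra. destruct (Req_dec q 0) as [Eq|Eq]. 2: nra.
    rewrite Ep, Eq in T1. lra. }
  split; [|split; apply K; auto].
  intros E. injection E as E1 E2. rewrite E1, E2 in T3. lra.
Qed.

Lemma same_transversal (d1 : R * R) : d1 <> RtoC 0 ->
  exists tau : C, tau <> RtoC 0 /\ 0 < fst (d1 * / tau)%C /\ 0 < fst (d1 * / tau)%C.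
Proof.
  intros N. exists d1. rewrite Cinv_r by auto. simpl. repeat split; auto; lra.
Qed.

Lemma C1_is_derive al ad t : C1 al ad -> is_derive al t (ad t).
Proof.
  intros Ha. split. apply is_linear_scal_l.
  intros y Hy. rewrite <- (is_filter_lim_locally_unique (V := R_NormedModule) t y Hy).
  intros eps. generalize (C1_eps al ad t Ha eps (cond_pos eps)). apply filter_imp. intros s Hs.
  eapply Rle_trans; [|exact Hs]. right. rewrite norm_RR. f_equal.
  unfold minus, plus, opp, scal; simpl. unfold prod_plus, prod_opp, prod_scal, plus, opp, scal; simpl.
  unfold mult; simpl. apply injective_projections; simpl; ring.
Qed.

Section Decomposition.
Context {X : CBanach}.
Variables (Gamma : list (R -> R * R)) (Bd : R * R -> Prop).
Hypothesis HGamma : closed_contour Gamma.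
Hypothesis HBd : forall z, Bd z <-> exists gamma, In gamma Gamma /\ on_curve gamma z.

Lemma curve_Bd gamma s : In gamma Gamma -> 0 <= s <= 1 -> Bd (gamma s).
Proof. intros H Hs. apply HBd. exists gamma. split; auto. exists s. split; auto. Qed.

Lemma curve_cover gamma a b :
  In gamma Gamma -> 0 <= a <= b -> b <= 1 -> arc_cover (X := X) gamma Bd a b.
Proof.
  intros H Ha Hb. destruct (proj1 HGamma gamma H) as [_ [n [t [delta [H1 [H2 [H3 [H4 _]]]]]]]].
  apply (arc_cover_pieces gamma n t delta); auto. intros; apply curve_Bd; auto.
Qed.

Lemma contour_cover G :
  (forall gamma, In gamma G -> In gamma Gamma) ->
  exists L, (forall K : R * R -> X, continuous_on Bd K -> contour_int G K = arcs_int L K) /\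
    forall z, on_arcs L z <-> exists gamma, In gamma G /\ on_curve gamma z.
Proof.
  induction G as [|gamma G IH]; intros HG.
  - exists nil. split; auto. intros z. split; [intros [A [[] _]]|intros [g [[] _]]].
  - destruct IH as [L [I Z]]. intros g Hg. apply HG. right; auto.
    destruct (curve_cover gamma 0 1) as [L' [I' Z']]; try lra. apply HG. left; auto.
    exists (L' ++ L). split.
    + intros K HK. rewrite arcs_int_app, <- I by auto.
      rewrite <- (is_RInt_unique _ _ _ _ (I' K HK)). reflexivity.
    + intros z. rewrite on_arcs_app, Z, Z'. split.
      * intros [H|[g [H1 H2]]]. exists gamma. split. left; auto. exact H.
        exists g. split; auto. right; auto.
      * intros [g [[<-|H1] H2]]. left; exact H2. right. eauto.
Qed.

Lemma is_RInt_shifted_arc gamma al ad (K : R * R -> X) p a b :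
  C1 al ad -> a <= b -> (forall u, a <= u <= b -> al u = gamma (p + u)) ->
  (forall u, a <= u <= b -> Bd (gamma (p + u))) -> continuous_on Bd K ->
  is_RInt (fun s => cs (velocity gamma s) (K (gamma s))) (p + a) (p + b) (cint al ad K a b).
Proof.
  intros Ha Hab E HB HK.
  assert (E' : forall s, p + a <= s <= p + b -> al (- p + s) = gamma s).
  { intros s Hs. rewrite E by lra. f_equal. ring. }
  assert (I := is_RInt_subarc gamma _ _ Bd K (p + a) (p + b) (C1_translate al ad (- p) Ha)
    ltac:(lra) E').
  replace (cint al ad K a b) with
    (cint (fun t => al (- p + t)) (fun t => ad (- p + t)) K (p + a) (p + b)).
  - apply I; auto. intros s Hs. replace s with (p + (s - p)) by ring. apply HB. lra.
  - apply is_RInt_unique.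
    apply (is_RInt_ext (fun y => scal 1 ((fun u => cs (ad u) (K (al u))) (1 * y + - p)))).
    { intros t _. replace (1 * t + - p) with (- p + t) by ring. module X. }
    apply (is_RInt_comp_lin (V := X) (fun u => cs (ad u) (K (al u))) 1 (- p) (p + a) (p + b)).
    replace (1 * (p + a) + - p) with a by ring. replace (1 * (p + b) + - p) with b by ring.
    apply (RInt_correct (V := X)).
    apply (ex_RInt_ext (fun s => cs (ad s) (K (al (clamp a b s))))).
    + rewrite Rmin_left, Rmax_right by auto. intros s Hs. rewrite clamp_id; auto; lra.
    + apply ex_RInt_cont. intros t. apply continuous_cs. apply Ha.
      apply (continuous_clamped Bd K al ad); auto. intros u Hu. rewrite E; auto.
Qed.

(* The parameters at which the two arcs meeting at a point of the curve
   end and start; they differ only at the point where the curve closes. *)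
Definition meeting (tL tR : R) : Prop := (tL = tR /\ 0 < tL < 1) \/ (tL = 1 /\ tR = 0).

(** The rest L misses the point because the curve is simple and distinct curves are disjoint, so
    near the point it contributes a holomorphic term. With d at most 1 / 2 the two short pieces do
    not overlap where the curve closes. *)
Lemma decomposition gamma tL tR al1 ad1 al2 ad2 d :
  In gamma Gamma -> meeting tL tR -> C1 al1 ad1 -> C1 al2 ad2 ->
  0 < d -> d <= tL -> d <= 1 - tR -> d <= 1 / 2 ->
  (forall u, - d <= u <= 0 -> al1 u = gamma (tL + u)) ->
  (forall u, 0 <= u <= d -> al2 u = gamma (tR + u)) ->
  exists L, (forall K : R * R -> X, continuous_on Bd K -> contour_int Gamma K =
      plus (plus (cint al1 ad1 K (- d) 0) (cint al2 ad2 K 0 d)) (arcs_int L K)) /\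
    (forall z, Bd z -> (exists u, - d <= u <= 0 /\ al1 u = z) \/
       (exists u, 0 <= u <= d /\ al2 u = z) \/ on_arcs L z) /\
    (forall z, on_arcs L z -> Bd z) /\ ~ on_arcs L (gamma tR).
Proof.
  intros Hg Hm C1' C2' Hd0 HdL HdR Hd2 E1 E2.
  assert (HtL : 0 <= tL <= 1) by (destruct Hm; lra).
  assert (HtR : 0 <= tR <= 1) by (destruct Hm; lra).
  destruct (in_split gamma Gamma Hg) as [G1 [G2 EG]].
  destruct (contour_cover (G1 ++ G2)) as [L0 [I0 Z0]].
  { intros g H. rewrite EG. apply in_or_app. apply in_app_or in H. destruct H; auto. right; right; auto. }
  destruct (proj1 HGamma gamma Hg) as [[_ [Hcl Hinj]] _].
  assert (Disj : forall g z, In g (G1 ++ G2) -> on_curve g z -> on_curve gamma z -> False).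
  { intros g z H Hgz Hz. pose proof (proj2 HGamma) as F. rewrite EG in F.
    clear - F H Hgz Hz. induction G1 as [|g1 G1 IH]; simpl in *.
    - inversion F as [|? ? F1 F2]; subst. rewrite Forall_forall in F1.
      apply (F1 g H z). auto.
    - inversion F as [|? ? F1 F2]; subst. destruct H as [->|H].
      + rewrite Forall_forall in F1. apply (F1 gamma) with z; auto.
        apply in_or_app. right; left; auto.
      + apply IH; auto. }
  assert (Int : exists L1, (forall K : R * R -> X, continuous_on Bd K ->
      RInt (fun s => cs (velocity gamma s) (K (gamma s))) 0 1 =
      plus (plus (cint al1 ad1 K (- d) 0) (cint al2 ad2 K 0 d)) (arcs_int L1 K)) /\
    (forall z, on_curve gamma z -> (exists u, - d <= u <= 0 /\ al1 u = z) \/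
       (exists u, 0 <= u <= d /\ al2 u = z) \/ on_arcs L1 z) /\
    (forall z, on_arcs L1 z -> on_curve gamma z) /\ ~ on_arcs L1 (gamma tR)).
  { assert (P1 : forall K : R * R -> X, continuous_on Bd K -> is_RInt (fun s => cs (velocity gamma s) (K (gamma s)))
        (tL + - d) (tL + 0) (cint al1 ad1 K (- d) 0)).
    { intros K HK. apply is_RInt_shifted_arc; auto. lra. intros u Hu. apply curve_Bd; auto. lra. }
    assert (P2 : forall K : R * R -> X, continuous_on Bd K -> is_RInt (fun s => cs (velocity gamma s) (K (gamma s)))
        (tR + 0) (tR + d) (cint al2 ad2 K 0 d)).
    { intros K HK. apply is_RInt_shifted_arc; auto. lra. intros u Hu. apply curve_Bd; auto. lra. }
    rewrite Rplus_0_r in P1, P2. destruct Hm as [[<- Hm]|[-> ->]].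
    - destruct (curve_cover gamma 0 (tL + - d)) as [La [Ia Za]]; auto; try lra.
      destruct (curve_cover gamma (tL + d) 1) as [Lb [Ib Zb]]; auto; try lra.
      exists (La ++ Lb). split; [|split; [|split]].
      + intros K HK. rewrite arcs_int_app. apply is_RInt_unique.
        replace (plus (plus (cint al1 ad1 K (- d) 0) (cint al2 ad2 K 0 d)) (plus (arcs_int La K) (arcs_int Lb K)))
          with (plus (plus (arcs_int La K) (cint al1 ad1 K (- d) 0)) (plus (cint al2 ad2 K 0 d) (arcs_int Lb K)))
          by module X.
        apply (is_RInt_Chasles (V := X) _ 0 tL 1); eapply (is_RInt_Chasles (V := X)); eauto.
      + intros z [s [Hs Ez]]. destruct (Rle_dec s (tL - d)); [|destruct (Rle_dec s tL); [|destruct (Rle_dec s (tL + d))]].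
        * right; right. apply on_arcs_app. left. apply Za. exists s. unfold Icc in Hs. split; auto. lra.
        * left. exists (s - tL). split. lra. rewrite E1 by lra. rewrite <- Ez. f_equal. ring.
        * right; left. exists (s - tL). split. lra. rewrite E2 by lra. rewrite <- Ez. f_equal. ring.
        * right; right. apply on_arcs_app. right. apply Zb. exists s. unfold Icc in Hs. split; auto. lra.
      + intros z. rewrite on_arcs_app, Za, Zb. intros [[s [Hs Es]]|[s [Hs Es]]]; exists s; unfold Icc; split; auto; lra.
      + rewrite on_arcs_app, Za, Zb. intros [[s [Hs Es]]|[s [Hs Es]]].
        * apply Hinj in Es; lra.
        (* Injectivity is stated on [0, 1) only, so the parameter 1 is first traded for 0. *)
        * destruct (Req_dec s 1) as [->|N]. rewrite <- Hcl in Es. apply Hinj in Es; lra.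
          apply Hinj in Es; lra.
    - destruct (curve_cover gamma d (1 + - d)) as [La [Ia Za]]; auto; try lra.
      rewrite Rplus_0_l in P2.
      exists La. split; [|split; [|split]].
      + intros K HK. apply is_RInt_unique.
        replace (plus (plus (cint al1 ad1 K (- d) 0) (cint al2 ad2 K 0 d)) (arcs_int La K))
          with (plus (plus (cint al2 ad2 K 0 d) (arcs_int La K)) (cint al1 ad1 K (- d) 0)) by module X.
        eapply (is_RInt_Chasles (V := X)); [eapply (is_RInt_Chasles (V := X))|]; eauto.
      + intros z [s [Hs Ez]]. unfold Icc in Hs. destruct (Rle_dec s d); [|destruct (Rle_dec s (1 - d))].
        * right; left. exists s. split. lra. rewrite E2 by lra. rewrite <- Ez. f_equal. ring.
        * right; right. apply Za. exists s. split; auto. lra.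
        * left. exists (s - 1). split. lra. rewrite E1 by lra. rewrite <- Ez. f_equal. ring.
      + intros z. rewrite Za. intros [s [Hs Es]]; exists s; unfold Icc; split; auto; lra.
      + rewrite Za. intros [s [Hs Es]]. apply Hinj in Es; lra. }
  destruct Int as [L1 [I1 [Z1 [Z2 Z3]]]].
  exists (L1 ++ L0). split; [|split; [|split]].
  - intros K HK. rewrite arcs_int_app, <- I0, EG by auto. rewrite !contour_int_app.
    change (contour_int (gamma :: G2) K) with
      (plus (RInt (fun s => cs (velocity gamma s) (K (gamma s))) 0 1) (contour_int G2 K)).
    rewrite I1 by auto. module X.
  - intros z Hz. apply HBd in Hz. destruct Hz as [g [Hgi Hgz]]. rewrite EG in Hgi.
    apply in_app_or in Hgi.
    assert (D : g = gamma \/ In g (G1 ++ G2)).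
    { destruct Hgi as [H|[H|H]]; [right|left|right]; auto; apply in_or_app; auto. }
    destruct D as [->|D].
    + destruct (Z1 z Hgz) as [H|[H|H]]; auto. right; right. apply on_arcs_app; auto.
    + right; right. apply on_arcs_app. right. apply Z0. eauto.
  - intros z. rewrite on_arcs_app, Z0. intros [H|[g [H1 H2]]].
    + apply HBd. exists gamma. split; auto.
    + apply HBd. exists g. split; auto. rewrite EG. apply in_or_app. apply in_app_or in H1.
      destruct H1; auto. right; right; auto.
  - rewrite on_arcs_app, Z0. intros [H|[g [H1 H2]]]; auto.
    apply (Disj g (gamma tR)); auto. exists tR. split; auto.
Qed.

(** The point lies inside a piece, at a node between consecutive pieces, or at the closing point
    between the last piece and the first. In the first case the tangent itself serves as tau; in the
    others the cusp condition supplies it. *)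
Lemma corner_germs z : Bd z -> exists gamma tL tR al1 ad1 al2 ad2 d0 tau,
  In gamma Gamma /\ meeting tL tR /\ C1 al1 ad1 /\ C1 al2 ad2 /\ al1 0 = z /\ al2 0 = z /\
  gamma tR = z /\
  0 < d0 /\ d0 <= tL /\ d0 <= 1 - tR /\ d0 <= 1 / 2 /\
  (forall u, - d0 <= u <= 0 -> al1 u = gamma (tL + u)) /\
  (forall u, 0 <= u <= d0 -> al2 u = gamma (tR + u)) /\
  tau <> RtoC 0 /\ 0 < fst (ad1 0 * / tau)%C /\ 0 < fst (ad2 0 * / tau)%C.
Proof.
  intros Hz. apply HBd in Hz. destruct Hz as [gamma [Hg [s [Hs Ez]]]].
  destruct (proj1 HGamma gamma Hg) as [[_ [Hcl Hinj]] [n [t [delta [Hn [Ht0 [Ht1 [Hp [Hcusp Hcusp1]]]]]]]]].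
  assert (HM : exists tL tR, meeting tL tR /\ gamma tL = z /\ gamma tR = z).
  { unfold Icc in Hs. destruct (Req_dec s 0) as [->|N0]; [|destruct (Req_dec s 1) as [->|N1]].
    - exists 1, 0. rewrite <- Hcl. split; auto. right; auto.
    - exists 1, 0. rewrite Hcl. split; auto. right; auto.
    - exists s, s. split; auto. left. split; auto. lra. }
  destruct HM as [tL [tR [HM [EL ER]]]].
  destruct (left_germ gamma n t delta Hn Ht0 Ht1 Hp tL) as
    [k [al1 [ad1 [d1 [Hk [Hd1 [Htk [Ca1 [A1 [A2 [A3 [A4 A5]]]]]]]]]]]].
  { destruct HM; lra. }
  destruct (right_germ gamma n t delta Hn Ht0 Ht1 Hp tR) as
    [k' [al2 [ad2 [d2 [Hk' [Hd2 [Htk' [Ca2 [B1 [B2 [B3 [B4 B5]]]]]]]]]]]].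
  { destruct HM; lra. }
  assert (Mono := nodes_mono gamma n t delta Hn Hp).
  assert (T : exists tau : C, tau <> RtoC 0 /\ 0 < fst (ad1 0%R * / tau)%C /\ 0 < fst (ad2 0%R * / tau)%C).
  { destruct HM as [[E Hm]|[E1 E2]].
    - subst tR. destruct (Rlt_dec tL (t (S k))) as [Lt|Ge].
      + assert (k' = k).
        { destruct (Nat.lt_total k' k) as [H|[H|H]]; auto.
          - pose proof (Mono (S k') k ltac:(lia)). lra.
          - pose proof (Mono (S k) k' ltac:(lia)). lra. }
        subst k'. rewrite A2, B2. rewrite A2 in A3. apply same_transversal, A3.
      + assert (k' = S k).
        { destruct (Nat.lt_total k' (S k)) as [H|[H|H]]; auto.
          - pose proof (Mono (S k') (S k) ltac:(lia)). lra.
          - destruct (Hp (S k)) as [St _]. lia. pose proof (Mono (S (S k)) k' ltac:(lia)). lra. }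
        subst k'. apply common_transversal; auto. rewrite A2, B2.
        replace tL with (t (S k)) by lra. apply Hcusp, Hk'.
    - assert (k = pred n).
      { destruct (Nat.eq_dec (S k) n) as [H|H]. lia.
        destruct (Hp (S k)) as [St _]. lia. pose proof (Mono (S (S k)) n ltac:(lia)). lra. }
      assert (k' = 0%nat).
      { destruct k' as [|k']; auto. destruct (Hp k') as [St _]. lia.
        pose proof (Mono 0%nat k' ltac:(lia)). lra. }
      apply common_transversal; auto. rewrite A2, B2, H, H0, E1, E2. exact Hcusp1. }
  destruct T as [tau [T1 [T2 T3]]].
  exists gamma, tL, tR, al1, ad1, al2, ad2, (Rmin (Rmin d1 d2) (1 / 2)), tau.
  pose proof (Rmin_l (Rmin d1 d2) (1 / 2)). pose proof (Rmin_r (Rmin d1 d2) (1 / 2)).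
  pose proof (Rmin_l d1 d2). pose proof (Rmin_r d1 d2).
  assert (0 < Rmin (Rmin d1 d2) (1 / 2)) by (repeat apply Rmin_glb_lt; lra).
  split; auto. split; auto. split; auto. split; auto.
  split. congruence. split. congruence. split; auto.
  split; auto. split. lra. split. lra. split. lra.
  split. intros u Hu. apply A5. lra. split. intros u Hu. apply B5. lra. auto.
Qed.

End Decomposition.

(** * The contour as the boundary of a plane open set *)

Lemma closure_Cmod (A : R * R -> Prop) (z : R * R) :
  closure A z <-> forall eps, 0 < eps -> exists w, Cmod (w - z)%C < eps /\ A w.
Proof.
  split.
  - intros H eps He. assert (L : locally z (fun w : R * R => Cmod (w - z)%C < eps)).
    { apply locally_Cmod. exists eps. auto. }
    destruct L as [d Hd]. destruct (H d) as [w [B Aw]]. exists w. split; auto.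
  - intros H eps. destruct (proj1 (locally_Cmod z (ball z eps)) (locally_ball z eps)) as [d [Hd B]].
    destruct (H d Hd) as [w [Hw Aw]]. exists w. split; auto.
Qed.

Lemma closure_incl {T : UniformSpace} (A : T -> Prop) z : A z -> closure A z.
Proof. intros H eps. exists z. split; auto. apply ball_center. Qed.

Lemma closure_open_complement (A : R * R -> Prop) z : ~ closure A z -> locally z (fun w => ~ closure A w).
Proof.
  intros H. rewrite closure_Cmod in H.
  assert (E : exists e, 0 < e /\ forall w, Cmod (w - z)%C < e -> ~ A w).
  { apply NNPP. intros N. apply H. intros e He. apply NNPP. intros N'. apply N.
    exists e. split; auto. intros w Hw Aw. apply N'. exists w. auto. }
  destruct E as [e [He E]]. apply locally_Cmod. exists (e / 2). split. lra.
  intros w Hw Cw. rewrite closure_Cmod in Cw. destruct (Cw (e / 2)) as [v [Hv Av]]. lra.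
  apply (E v); auto. replace (v - z)%C with ((v - w) + (w - z))%C by Cring.
  eapply Rle_lt_trans. apply Cmod_triangle. lra.
Qed.

Lemma not_boundary_cases (A : R * R -> Prop) z : ~ boundary A z -> A z \/ exterior A z.
Proof.
  intros N. destruct (classic (A z)) as [H|H]; auto. right. intros C. apply N. split; auto.
  apply closure_incl. auto.
Qed.

Lemma boundary_not_open {T : UniformSpace} (A : T -> Prop) z : open A -> A z -> ~ boundary A z.
Proof.
  intros Ho Az [_ H]. destruct (Ho z Az) as [d Hd]. destruct (H d) as [y [B N]]. auto.
Qed.

Lemma exterior_not_boundary {T : UniformSpace} (A : T -> Prop) z : exterior A z -> ~ boundary A z.
Proof. intros H [C _]. auto. Qed.

Lemma boundary_complement_open (A : R * R -> Prop) z :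
  ~ boundary A z -> locally z (fun w => ~ boundary A w).
Proof.
  intros N. apply not_and_or in N. destruct N as [N|N];
    generalize (closure_open_complement _ _ N); apply filter_imp; intros w Hw [H1 H2]; auto.
Qed.

Lemma arcs_off_open L z : ~ on_arcs L z -> locally z (fun w => ~ on_arcs L w).
Proof.
  induction L as [|A L IH]; intros N.
  - apply filter_forall. intros w [A [[] _]].
  - assert (N1 : ~ on_arcs L z).
    { intros [B [H1 H2]]. apply N. exists B. split; auto. right; auto. }
    assert (N2 : forall t, a_lo A <= t <= a_hi A -> a_al A t <> z).
    { intros t Ht E. apply N. exists A. split. left; auto. exists t. auto. }
    generalize (filter_and _ _ (IH N1) (curve_off_open _ _ _ _ _ (a_C1 A) N2)).
    apply filter_imp. intros w [H1 H2] [B [[<-|HB] HBw]].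
    + destruct HBw as [t [Ht E]]. apply (H2 t Ht E).
    + apply H1. exists B. auto.
Qed.

Section Plane.
Context {X : CBanach}.
Variables (D : R * R -> Prop) (Gamma : list (R -> R * R)).
Hypothesis HDo : open D.
Hypothesis HO : oriented_boundary D Gamma.

Lemma Bd_iff z : boundary D z <-> exists gamma, In gamma Gamma /\ on_curve gamma z.
Proof. apply HO. Qed.

(** A local substitute for the Jordan curve theorem. In a small chart the boundary is the arc alone,
    so each open half avoids it and lies entirely in D or entirely in the exterior. The orientation
    at one smooth point decides which. *)
Lemma boundary_chart zeta : boundary D zeta ->
  exists al1 ad1 al2 ad2 tau delta c M h L,
  junction al1 ad1 al2 ad2 zeta tau delta c M /\ 0 < h /\
  (forall K : R * R -> X, continuous_on (boundary D) K -> contour_int Gamma K =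
      plus (plus (cint al1 ad1 K (- delta) 0) (cint al2 ad2 K 0 delta)) (arcs_int L K)) /\
  (forall z, on_arcs L z -> boundary D z) /\ ~ on_arcs L zeta /\
  (forall u, - delta <= u <= 0 -> boundary D (al1 u)) /\
  (forall u, 0 <= u <= delta -> boundary D (al2 u)) /\
  (forall t e, - delta <= t <= delta -> 0 < e <= h -> D (chart al1 al2 tau t e)) /\
  (forall t e, - delta <= t <= delta -> - h <= e < 0 -> exterior D (chart al1 al2 tau t e)).
Proof.
  intros Hz.
  assert (HC : closed_contour Gamma) by apply HO.
  destruct (corner_germs Gamma (boundary D) HC Bd_iff zeta Hz) as
   [gamma [tL [tR [al1 [ad1 [al2 [ad2 [d0 [tau [Hg [Hm [C1' [C2' [A1 [A2 [A3 [Hd0 [HdL [HdR [Hd2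
    [E1 [E2 [Nt [P1 P2]]]]]]]]]]]]]]]]]]]]]]]].
  destruct (junction_exists al1 ad1 al2 ad2 tau C1' C2') as [d1 [c [M [Hd1 HJ]]]]; auto. congruence.
  rewrite A1 in HJ.
  set (d := Rmin d0 d1).
  assert (Hdd0 : d <= d0) by apply Rmin_l. assert (Hdd1 : d <= d1) by apply Rmin_r.
  assert (Hd : 0 < d) by (apply Rmin_glb_lt; auto).
  assert (J := HJ d (conj Hd Hdd1)).
  assert (Dec : forall d', 0 < d' <= d -> exists L, (forall K : R * R -> X,
     continuous_on (boundary D) K -> contour_int Gamma K =
      plus (plus (cint al1 ad1 K (- d') 0) (cint al2 ad2 K 0 d')) (arcs_int L K)) /\
    (forall z, boundary D z -> (exists u, - d' <= u <= 0 /\ al1 u = z) \/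
       (exists u, 0 <= u <= d' /\ al2 u = z) \/ on_arcs L z) /\
    (forall z, on_arcs L z -> boundary D z) /\ ~ on_arcs L zeta).
  { intros d' Hd'. rewrite <- A3.
    apply (decomposition Gamma (boundary D) HC Bd_iff gamma tL tR); auto; try lra.
    intros u Hu. apply E1. lra. intros u Hu. apply E2. lra. }
  (* This decomposition, at length d, serves to find a radius within which the remaining arcs are
     absent; the one in the conclusion is taken later, at the smaller length [delta]. *)
  destruct (Dec d) as [L1 [_ [Z1 [_ Z3]]]]. lra.
  assert (Loc := arcs_off_open L1 zeta Z3).
  rewrite <- (chart_zeta _ _ _ _ _ _ _ _ _ J) in Loc.
  apply (continuous_chart _ _ _ _ _ _ _ _ _ J (0, 0)) in Loc.
  destruct Loc as [r Hr]. pose proof (cond_pos r) as Hrpos.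
  set (delta := Rmin d (r / 2)). set (h := r / 2).
  assert (Hdel : 0 < delta) by (apply Rmin_glb_lt; lra).
  assert (Hdel1 : delta <= d) by apply Rmin_l. assert (Hdel2 : delta <= r / 2) by apply Rmin_r.
  assert (Hh : 0 < h) by (unfold h; lra).
  assert (NB : forall t e, - delta <= t <= delta -> - h <= e <= h -> e <> 0 ->
    ~ boundary D (chart al1 al2 tau t e)).
  { intros t e Ht He Ne HB. destruct (Z1 _ HB) as [[u [Hu Eu]]|[[u [Hu Eu]]|Hon]].
    - assert (Eu' : chart al1 al2 tau u 0 = chart al1 al2 tau t e).
      { rewrite <- Eu. unfold chart, curtain. rewrite (glue_neg al1 al2) by lra. Cring. }
      destruct (chart_inj _ _ _ _ _ _ _ _ _ J u 0 t e ltac:(lra) ltac:(lra) Eu') as [_ Z]. auto.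
    - assert (Eu' : chart al1 al2 tau u 0 = chart al1 al2 tau t e).
      { rewrite <- Eu. unfold chart, curtain. rewrite (glue_pos _ _ _ _ _ _ _ _ _ J) by lra. Cring. }
      destruct (chart_inj _ _ _ _ _ _ _ _ _ J u 0 t e ltac:(lra) ltac:(lra) Eu') as [_ Z]. auto.
    - apply (Hr (t, e)); auto. unfold h in He.
      split; unfold ball; simpl; unfold AbsRing_ball, abs, minus, plus, opp; simpl;
        rewrite Ropp_0, Rplus_0_r; apply Rabs_def1; lra. }
  assert (Jd := HJ delta (conj Hdel (Rle_trans _ _ _ Hdel1 Hdd1))).
  (* The segment between two parameter pairs whose e have equal sign does not meet e = 0; its image
     avoids the boundary, and membership in D is locally constant along it. *)
  assert (Conn : forall t e t' e', - delta <= t <= delta -> - delta <= t' <= delta ->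
     - h <= e <= h -> - h <= e' <= h -> 0 < e * e' ->
     (D (chart al1 al2 tau t e) <-> D (chart al1 al2 tau t' e'))).
  { intros t e t' e' Ht Ht' He He' Hs.
    set (z := fun l => chart al1 al2 tau ((1 - l) * t + l * t') ((1 - l) * e + l * e')).
    replace (chart al1 al2 tau t e) with (z 0) by (unfold z; f_equal; ring).
    replace (chart al1 al2 tau t' e') with (z 1) by (unfold z; f_equal; ring).
    apply (path_constant (fun l => D (z l))).
    intros l Hl.
    assert (Cv : forall a b p q, a <= p <= b -> a <= q <= b -> a <= (1 - l) * p + l * q <= b).
    { intros a b p q H1 H2. split; nra. }
    assert (Nb : ~ boundary D (z l)).
    { apply NB; try (apply Cv; auto). intros Z.
      destruct (Rlt_dec 0 e).
      - assert (0 < e') by nra.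
        assert (0 <= (1 - l) * e) by (apply Rmult_le_pos; lra).
        assert (0 <= l * e') by (apply Rmult_le_pos; lra).
        assert ((1 - l) * e = 0) by lra. assert (l * e' = 0) by lra.
        apply Rmult_integral in H2. apply Rmult_integral in H3. lra.
      - assert (e < 0) by nra. assert (e' < 0) by nra.
        assert (0 <= (1 - l) * (- e)) by (apply Rmult_le_pos; lra).
        assert (0 <= l * (- e')) by (apply Rmult_le_pos; lra).
        assert ((1 - l) * e = 0) by lra. assert (l * e' = 0) by lra.
        apply Rmult_integral in H3. apply Rmult_integral in H4. lra. }
    assert (Cz : continuous z l).
    { apply (continuous_comp_2 (fun l => (1 - l) * t + l * t') (fun l => (1 - l) * e + l * e')
        (chart al1 al2 tau)).
      - apply (ex_derive_continuous (V := R_NormedModule)). auto_derive. auto.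
      - apply (ex_derive_continuous (V := R_NormedModule)). auto_derive. auto.
      - apply (continuous_chart _ _ _ _ _ _ _ _ _ Jd). }
    destruct (not_boundary_cases D (z l) Nb) as [Dz|Ez].
    - destruct (Cz _ (HDo _ Dz)) as [e0 He0]. exists e0. split. apply cond_pos.
      intros m _ Hml. split; [intros _; exact Dz|intros _; exact (He0 m Hml)].
    - destruct (Cz _ (closure_open_complement _ _ Ez)) as [e0 He0]. exists e0. split. apply cond_pos.
      intros m _ Hml. split; intros Dm; exfalso.
      + apply (He0 m Hml). apply closure_incl, Dm.
      + apply Ez. apply closure_incl, Dm. }
  (* An interior parameter of the outgoing arc: there the curve is differentiable, as
     [positively_oriented] requires, and [chart_normal] places its two normal points in opposite
     halves. *)
  set (t1 := delta / 2).
  destruct (chart_normal _ _ _ _ _ _ _ _ _ Jd t1 h) as [e0 [He0 Hn]]; auto. unfold t1; lra.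
  assert (Hder : is_derive gamma (tR + t1) (ad2 t1)).
  { apply (is_derive_ext_loc (fun s => al2 (- tR + s))).
    - exists (mkposreal t1 ltac:(unfold t1; lra)). intros s Hs.
      unfold ball in Hs; simpl in Hs; unfold AbsRing_ball, abs, minus, plus, opp in Hs; simpl in Hs.
      apply Rabs_def2 in Hs. rewrite E2. f_equal. ring. unfold t1 in *. lra.
    - assert (Dt := C1_is_derive _ _ (tR + t1) (C1_translate _ _ (- tR) C2')).
      simpl in Dt. replace (- tR + (tR + t1)) with t1 in Dt by ring. exact Dt. }
  assert (Hpo : positively_oriented D gamma) by (apply HO; auto).
  assert (HtR : 0 <= tR) by (destruct Hm as [[H1 H2]|[H1 H2]]; lra).
  destruct (Hpo (tR + t1) (fst (ad2 t1)) (snd (ad2 t1))) as [e1 [He1 Hside]].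
  { unfold t1; lra. }
  { rewrite <- surjective_pairing. exact Hder. }
  set (s := Rmin e0 e1 / 2).
  assert (Hs0 : 0 < Rmin e0 e1) by (apply Rmin_glb_lt; auto).
  pose proof (Rmin_l e0 e1). pose proof (Rmin_r e0 e1).
  destruct (Hside s) as [Hin Hout]. unfold s; lra.
  destruct (Hn s) as [ta [ea [B1 [B2 [B3 B4]]]]]. unfold s; lra. rewrite Rabs_right; unfold s; lra.
  destruct (Hn (- s)) as [tb [eb [G1 [G2 [G3 G4]]]]]. unfold s; lra. rewrite Rabs_left; unfold s; lra.
  assert (Hs : 0 < s) by (unfold s; lra).
  assert (Hea : 0 < ea) by nra. assert (Heb : eb < 0) by nra.
  assert (Pin : D (chart al1 al2 tau ta ea)).
  { rewrite <- B4. rewrite <- E2 in Hin by (unfold t1; lra).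
    replace (al2 t1 + RtoC s * (Ci * ad2 t1))%C with
      (plus (al2 t1) (scal s (- snd (ad2 t1), fst (ad2 t1)))). exact Hin.
    unfold plus, scal; simpl; unfold prod_plus, prod_scal, plus, scal; simpl; unfold mult; simpl.
    apply injective_projections; simpl; ring. }
  assert (Pout : ~ D (chart al1 al2 tau tb eb)).
  { rewrite <- G4. rewrite <- E2 in Hout by (unfold t1; lra).
    replace (al2 t1 + RtoC (- s) * (Ci * ad2 t1))%C with
      (minus (al2 t1) (scal s (- snd (ad2 t1), fst (ad2 t1)))). exact Hout.
    unfold minus, plus, opp, scal; simpl; unfold prod_plus, prod_opp, prod_scal, plus, opp, scal; simpl;
    unfold mult; simpl.
    apply injective_projections; simpl; ring. }
  destruct (Dec delta) as [L [D1 [D2 [D3 D4]]]]. lra.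
  exists al1, ad1, al2, ad2, tau, delta, c, M, h, L.
  split; auto. split; auto. split; auto. split; auto. split; auto.
  split. { intros u Hu. rewrite E1 by lra. eapply curve_Bd; eauto. apply Bd_iff.
           destruct Hm as [[? ?]|[? ?]]; lra. }
  split. { intros u Hu. rewrite E2 by lra. eapply curve_Bd; eauto. apply Bd_iff. lra. }
  split.
  - intros t e Ht He. apply (Conn ta ea); auto; try lra. nra.
  - intros t e Ht He. destruct (not_boundary_cases D (chart al1 al2 tau t e)) as [Dz|Ez]; auto.
    + apply NB; lra.
    + exfalso. apply Pout. apply (Conn t e); auto; try lra. nra.
Qed.

End Plane.

(** * The Cauchy integral over a contour *)

Section ArcSums.
Context {X : CBanach}.
Implicit Type F : R * R -> X.

Definition arcs_ci (L : list arc) F (z : R * R) : X :=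
  fold_right plus zero (map (fun A => ci (a_al A) (a_ad A)
    (fun t => F (a_al A (clamp (a_lo A) (a_hi A) t))) (a_lo A) (a_hi A) z) L).

Definition arcs_ci_infty (L : list arc) F (z : R * R) : X :=
  fold_right plus zero (map (fun A => ci_infty (a_al A) (a_ad A)
    (fun t => F (a_al A (clamp (a_lo A) (a_hi A) t))) (a_lo A) (a_hi A) z) L).

Lemma arcs_int_ci L F z : arcs_int L (fun s => cs (/ (s - z))%C (F s)) = arcs_ci L F z.
Proof.
  unfold arcs_int, arcs_ci. induction L as [|A L IH]; simpl; auto.
  rewrite cint_ci by apply a_le. f_equal. exact IH.
Qed.

Lemma on_arcs_cons A L (z : R * R) : on_arcs (A :: L) z <-> on_arc A z \/ on_arcs L z.
Proof.
  split.
  - intros [B [[<-|H] HB]]; [left|right; exists B]; auto.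
  - intros [H|[B [H HB]]]; [exists A|exists B]; split; auto; [left|right]; auto.
Qed.

Lemma continuous_arc_density (S : R * R -> Prop) F A :
  continuous_on S F -> (forall z, on_arc A z -> S z) ->
  forall t, continuous (fun t => F (a_al A (clamp (a_lo A) (a_hi A) t))) t.
Proof.
  intros HF HS t. apply (continuous_clamped S F (a_al A) (a_ad A)); auto.
  apply a_le. apply a_C1. intros u Hu. apply HS. exists u. auto.
Qed.

Lemma hol_arcs_ci S L F z :
  continuous_on S F -> (forall w, on_arcs L w -> S w) -> ~ on_arcs L z -> hol (arcs_ci L F) z.
Proof.
  intros HF. induction L as [|A L IH]; intros HS N.
  - exact (hol_const (zero : X) z).
  - rewrite on_arcs_cons in N. apply not_or_and in N. destruct N as [N1 N2].
    apply (hol_plus (ci (a_al A) (a_ad A)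
      (fun t => F (a_al A (clamp (a_lo A) (a_hi A) t))) (a_lo A) (a_hi A)) (arcs_ci L F)).
    + apply hol_ci. apply a_C1. apply a_le.
      apply (continuous_arc_density S); auto. intros w Hw. apply HS, on_arcs_cons. auto.
      intros t Ht E. apply N1. exists t. auto.
    + apply IH; auto. intros w Hw. apply HS, on_arcs_cons. auto.
Qed.

Lemma arcs_ci_vanishes S L F :
  continuous_on S F -> (forall w, on_arcs L w -> S w) ->
  forall eps, 0 < eps -> exists M, forall w, M <= Cmod w -> norm (arcs_ci L F w) <= eps.
Proof.
  intros HF. induction L as [|A L IH]; intros HS eps He.
  - exists 0. intros w _. apply Rle_trans with 0; [|lra]. right. exact nrm_zero.
  - destruct (IH (fun w Hw => HS w (proj2 (on_arcs_cons A L w) (or_intror Hw))) (eps / 2)) as [M1 H1].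
    lra.
    destruct (ci_vanishes (a_al A) (a_ad A)
      (fun t => F (a_al A (clamp (a_lo A) (a_hi A) t))) (a_lo A) (a_hi A) (a_C1 A) (a_le A)
      (continuous_arc_density S F A HF (fun w Hw => HS w (proj2 (on_arcs_cons A L w) (or_introl Hw))))
      (eps / 2)) as [M2 H2]. lra.
    exists (Rmax M1 M2). intros w Hw.
    pose proof (Rmax_l M1 M2). pose proof (Rmax_r M1 M2).
    eapply Rle_trans. apply (nrm_plus (ci (a_al A) (a_ad A)
      (fun t => F (a_al A (clamp (a_lo A) (a_hi A) t))) (a_lo A) (a_hi A) w) (arcs_ci L F w)).
    replace eps with (eps / 2 + eps / 2) by field.
    apply Rplus_le_compat; [apply H2|apply H1]; lra.
Qed.

Lemma hol_arcs_ci_infty S L F z :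
  continuous_on S F -> (forall w, on_arcs L w -> S w) ->
  (forall w, on_arcs L w -> (z * w)%C <> RtoC 1) -> hol (arcs_ci_infty L F) z.
Proof.
  intros HF. induction L as [|A L IH]; intros HS N.
  - exact (hol_const (zero : X) z).
  - apply (hol_plus (ci_infty (a_al A) (a_ad A)
      (fun t => F (a_al A (clamp (a_lo A) (a_hi A) t))) (a_lo A) (a_hi A)) (arcs_ci_infty L F)).
    + apply hol_ci_infty. apply a_C1. apply a_le.
      apply (continuous_arc_density S); auto. intros w Hw. apply HS, on_arcs_cons. auto.
      intros t Ht. apply N. apply on_arcs_cons. left. exists t. auto.
    + apply IH; auto; intros w Hw; [apply HS|apply N]; apply on_arcs_cons; auto.
Qed.

Lemma arcs_ci_infty_inv L F w :
  w <> RtoC 0 -> ~ on_arcs L (/ w)%C -> arcs_ci_infty L F w = arcs_ci L F (/ w)%C.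
Proof.
  intros Hw. unfold arcs_ci_infty, arcs_ci. induction L as [|A L IH]; intros N; simpl; auto.
  rewrite on_arcs_cons in N. apply not_or_and in N. destruct N as [N1 N2].
  rewrite ci_infty_inv; auto. f_equal. auto. apply a_le.
  intros t Ht E. apply N1. exists t. auto.
Qed.

Lemma arcs_ci_infty_0 L F : arcs_ci_infty L F (RtoC 0) = zero.
Proof.
  induction L as [|A L IH]. reflexivity.
  change (plus (ci_infty (a_al A) (a_ad A)
      (fun t => F (a_al A (clamp (a_lo A) (a_hi A) t))) (a_lo A) (a_hi A) (RtoC 0))
      (arcs_ci_infty L F (RtoC 0)) = zero).
  rewrite IH, ci_infty_0. apply plus_zero_l.
Qed.

End ArcSums.

(** * Cauchy integrals of functions that split in the plane *)

Section PlaneTheorem.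
Context {X : CBanach}.
Variables (D : R * R -> Prop) (Gamma : list (R -> R * R)).
Hypothesis HDo : open D.
Hypothesis HO : oriented_boundary D Gamma.

Definition Phi (F : R * R -> X) (z : R * R) : X :=
  contour_int Gamma (fun s => cs (/ (s - z))%C (F s)).

Lemma Phi_arcs F : continuous_on (boundary D) F ->
  exists L, (forall w, on_arcs L w <-> boundary D w) /\
    forall z, ~ boundary D z -> Phi F z = arcs_ci L F z.
Proof.
  intros HF.
  destruct (contour_cover (X := X) Gamma (boundary D) (proj1 HO) (Bd_iff D Gamma HO) Gamma) as [L [I Z]]; auto.
  exists L. split.
  - intros w. rewrite Z. symmetry. apply (Bd_iff D Gamma HO).
  - intros z Hz. unfold Phi. rewrite I. apply arcs_int_ci.
    apply continuous_on_cauchy_kernel; auto.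
Qed.

Lemma hol_Phi F z : continuous_on (boundary D) F -> ~ boundary D z -> hol (Phi F) z.
Proof.
  intros HF Nz. destruct (Phi_arcs F HF) as [L [Z E]].
  apply (hol_ext_loc (arcs_ci L F)).
  - generalize (boundary_complement_open _ _ Nz). apply filter_imp. intros w Hw. symmetry. auto.
  - apply (hol_arcs_ci (boundary D)); auto. intros w; apply Z. rewrite Z. exact Nz.
Qed.

(** Written with [ci_infty] on each arc, the transform in the variable 1 / z stays regular at 0,
    where it vanishes. *)
Lemma hol_Phi_infty F z : continuous_on (boundary D) F ->
  (z = RtoC 0 \/ (z <> RtoC 0 /\ ~ boundary D (/ z)%C)) ->
  hol (fun w : R * R => if excluded_middle_informative (w = RtoC 0) then zero else Phi F (/ w)%C) z.
Proof.
  intros HF Hz. destruct (Phi_arcs F HF) as [L [Z E]].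
  assert (Hz' : forall w, on_arcs L w -> (z * w)%C <> RtoC 1).
  { intros w Hw E1. destruct Hz as [->|[N1 N2]].
    - replace (RtoC 0 * w)%C with (RtoC 0) in E1 by Cring. apply RtoC_inj in E1. lra.
    - apply N2. replace (/ z)%C with w. apply Z, Hw.
      replace w with (/ z * (z * w))%C. rewrite E1. Cring. Cfield. auto. }
  assert (H0 := hol_arcs_ci_infty (boundary D) L F z HF (fun w => proj1 (Z w)) Hz').
  apply (hol_ext_loc (arcs_ci_infty L F)); auto.
  (* The two expressions agree where 1 / w is off the contour; compactness of the arcs shows that
     this is so near z. *)
  assert (Loc : locally z (fun w => w <> RtoC 0 -> ~ boundary D (/ w)%C)).
  { assert (G : forall L', (forall w, on_arcs L' w -> (z * w)%C <> RtoC 1) ->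
      locally z (fun v : R * R => forall w, on_arcs L' w -> (v * w)%C <> RtoC 1)).
    { induction L' as [|A L' IH]; intros HN.
      - apply filter_forall. intros v w [B [[] _]].
      - assert (C : locally z (fun v : R * R => forall t, a_lo A <= t <= a_hi A -> (v * a_al A t)%C <> RtoC 1)).
        { destruct (continuous_bounded (fun t => Cmod (a_al A t)) (a_lo A) (a_hi A)) as [M [HM HM']].
          { intros t. apply continuous_Cmod. eapply C1_continuous, a_C1. }
          assert (exists m, 0 < m /\ forall t, a_lo A <= t <= a_hi A -> m <= Cmod (z * a_al A t - 1)%C).
          { destruct (continuity_ab_min (fun t => Cmod (z * a_al A t - 1)%C) (a_lo A) (a_hi A) (a_le A)) as [m [Hm Hm']].
            - intros t _. apply continuity_pt_filterlim.
              apply (continuous_Cmod (fun t => (z * a_al A t - 1)%C : R * R)).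
              apply (continuous_Cminus (fun t => (z * a_al A t)%C : R * R)); [|apply continuous_const].
              apply continuous_Cmult. apply continuous_const. eapply C1_continuous, a_C1.
            - exists (Cmod (z * a_al A m - 1)%C). split; auto. apply Cmod_gt_0.
              intros E1. apply (HN (a_al A m)). apply on_arcs_cons. left. exists m. auto.
              replace (z * a_al A m)%C with ((z * a_al A m - 1) + 1)%C by Cring. rewrite E1. Cring. }
          destruct H as [m [Hm Hm']]. apply locally_Cmod. exists (m / (M + 1)).
          split. apply Rdiv_lt_0_compat; lra. intros v Hv t Ht E1.
          specialize (Hm' t Ht). specialize (HM' t Ht).
          assert (Cmod (z * a_al A t - 1)%C <= m / (M + 1) * M).
          { replace (z * a_al A t - 1)%C with ((z - v) * a_al A t)%C by (rewrite <- E1; Cring).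
            rewrite Cmod_mult. apply Rmult_le_compat; try apply Cmod_ge_0; auto.
            rewrite Cmod_minus_sym. lra. }
          assert (m / (M + 1) * M < m); [|lra].
          apply Rlt_le_trans with (m / (M + 1) * (M + 1)).
          apply Rmult_lt_compat_l. apply Rdiv_lt_0_compat; lra. lra. right. field. lra. }
        generalize (filter_and _ _ C (IH (fun w Hw => HN w (proj2 (on_arcs_cons A L' w) (or_intror Hw))))).
        apply filter_imp. intros v [V1 V2] w Hw. apply on_arcs_cons in Hw.
        destruct Hw as [[t [Ht <-]]|Hw]; auto. }
    generalize (G L Hz'). apply filter_imp. intros w Hw Nw HB. apply Z in HB.
    apply (Hw _ HB). Cfield. auto. }
  revert Loc. apply filter_imp. intros w Hw.
  destruct excluded_middle_informative as [Ew|Nw].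
  - rewrite Ew. apply arcs_ci_infty_0.
  - rewrite arcs_ci_infty_inv; auto. rewrite E; auto. rewrite Z. auto.
Qed.

Definition two_pi_i : C := (RtoC (2 * PI) * Ci)%C.

Section Cauchy.
Variables (Fp Fm : R * R -> X) (cinf : X).
Hypothesis HFp : continuous_on (closure D) Fp.
Hypothesis HFpD : forall z, D z -> hol Fp z.
Hypothesis HFm : continuous_on (closure (exterior D)) Fm.
Hypothesis HFmD : forall z, exterior D z -> hol Fm z.
Hypothesis HFinf : forall eps, 0 < eps -> exists M, forall w, M <= Cmod w ->
  norm (minus (Fm w) cinf) <= eps.
Hypothesis HDb : exists M, forall z, D z -> Cmod z <= M.

Let f (z : R * R) : X := plus (Fp z) (Fm z).

Lemma boundary_closure z : boundary D z -> closure D z.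
Proof. intros H; apply H. Qed.

(** For a general open set this fails, for instance along a slit; here the lower half of a chart
    consists of exterior points. *)
Lemma boundary_closure_exterior z : boundary D z -> closure (exterior D) z.
Proof.
  intros H. destruct (boundary_chart (X := X) D Gamma HDo HO z H) as
    [al1 [ad1 [al2 [ad2 [tau [delta [c [M [h [L [J [Hh [_ [_ [_ [_ [_ [_ Hex]]]]]]]]]]]]]]]]]].
  intros eps. pose proof (continuous_chart _ _ _ _ _ _ _ _ _ J (0, 0)) as C.
  pose proof (jdelta _ _ _ _ _ _ _ _ _ J) as Hd.
  destruct (C (ball z eps)) as [d Hdd].
  { simpl. rewrite (chart_zeta _ _ _ _ _ _ _ _ _ J). apply locally_ball. }
  pose proof (cond_pos d).
  set (e := - (Rmin d h / 2)).
  assert (0 < Rmin d h) by (apply Rmin_glb_lt; lra).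
  pose proof (Rmin_l d h). pose proof (Rmin_r d h).
  exists (chart al1 al2 tau 0 e). split.
  - apply (Hdd (0, e)). split. apply ball_center.
    unfold ball; simpl; unfold AbsRing_ball, abs, minus, plus, opp; simpl.
    rewrite Ropp_0, Rplus_0_r. unfold e. apply Rabs_def1; lra.
  - apply Hex; unfold e; lra.
Qed.

Lemma continuous_on_subset {V : UniformSpace} (A B : R * R -> Prop) (F : R * R -> V) :
  (forall z, A z -> B z) -> continuous_on B F -> continuous_on A F.
Proof.
  intros S H z Hz P HP. generalize (H z (S z Hz) P HP). unfold filtermap, within.
  apply filter_imp. auto.
Qed.

Lemma continuous_on_f : continuous_on (boundary D) f.
Proof.
  intros z Hz.
  assert (H1 := continuous_on_subset _ _ _ boundary_closure HFp z Hz).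
  assert (H2 := continuous_on_subset _ _ _ boundary_closure_exterior HFm z Hz).
  unfold f. eapply (filterlim_comp_2 _ _ plus). exact H1. exact H2.
  apply (filterlim_plus (V := X)).
Qed.

Definition jump_corrected (z : R * R) : X :=
  if excluded_middle_informative (D z) then minus (Phi f z) (cs two_pi_i (Fp z))
  else plus (Phi f z) (cs two_pi_i (Fm z)).

Lemma jump_corrected_in z : D z -> jump_corrected z = minus (Phi f z) (cs two_pi_i (Fp z)).
Proof. intros H. unfold jump_corrected. destruct excluded_middle_informative; tauto. Qed.

Lemma jump_corrected_out z : exterior D z -> jump_corrected z = plus (Phi f z) (cs two_pi_i (Fm z)).
Proof.
  intros H. unfold jump_corrected. destruct excluded_middle_informative as [Dz|]; auto.
  elim H. apply closure_incl, Dz.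
Qed.

(** At a contour point [local_cauchy], for Fp on the left and Fm on the right, turns the short arcs
    into far sides. The 2 PI i terms that it produces cancel the corrections of [jump_corrected],
    and three holomorphic terms remain. *)
Lemma local_extension zeta : exists H : R * R -> X, locally zeta (fun z => hol H z /\
  (~ boundary D z -> jump_corrected z = H z)).
Proof.
  destruct (classic (boundary D zeta)) as [Hz|Nz].
  2: { exists jump_corrected.
    assert (L0 := boundary_complement_open _ _ Nz).
    destruct (not_boundary_cases D zeta Nz) as [Dz|Ez].
    - assert (LD : locally zeta (fun z => locally z D)).
      { apply locally_locally. apply HDo, Dz. }
      generalize (filter_and _ _ L0 LD). apply filter_imp. intros z [N1 N2]. split; auto.
      apply (hol_ext_loc (fun z => minus (Phi f z) (cs two_pi_i (Fp z)))).
      + revert N2. apply filter_imp. intros w Hw. symmetry. apply jump_corrected_in, Hw.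
      + apply hol_minus. apply hol_Phi; auto. apply continuous_on_f.
        apply hol_cs, HFpD, (locally_singleton _ _ N2).
    - assert (LD : locally zeta (fun z => locally z (exterior D))).
      { apply locally_locally. apply (closure_open_complement D), Ez. }
      generalize (filter_and _ _ L0 LD). apply filter_imp. intros z [N1 N2]. split; auto.
      apply (hol_ext_loc (fun z => plus (Phi f z) (cs two_pi_i (Fm z)))).
      + revert N2. apply filter_imp. intros w Hw. symmetry. apply jump_corrected_out, Hw.
      + apply hol_plus. apply hol_Phi; auto. apply continuous_on_f.
        apply hol_cs, HFmD, (locally_singleton _ _ N2). }
  destruct (boundary_chart (X := X) D Gamma HDo HO zeta Hz) as
    [al1 [ad1 [al2 [ad2 [tau [delta [c [M [h [L [J [Hh [Dec [HL1 [HL2 [B1 [B2 [Hin Hex]]]]]]]]]]]]]]]]]].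
  pose proof (jdelta _ _ _ _ _ _ _ _ _ J) as Hd.
  assert (Hc0 : forall t, chart al1 al2 tau t 0 = glue al1 al2 t).
  { intros t. unfold chart, curtain. Cring. }
  assert (Bglue : forall t, - delta <= t <= delta -> boundary D (glue al1 al2 t)).
  { intros t Ht. unfold glue. destruct Rle_dec. apply B1; lra. apply B2; lra. }
  assert (Sp : forall z, half_chart al1 al2 tau delta 1 h z -> closure D z).
  { intros z [t [e [Ht [He ->]]]]. rewrite Rmult_1_l. destruct (Req_dec e 0) as [->|Ne].
    - rewrite Hc0. apply Bglue, Ht.
    - apply closure_incl, Hin; lra. }
  assert (Sm : forall z, half_chart al1 al2 tau delta (-1) h z -> closure (exterior D) z).
  { intros z [t [e [Ht [He ->]]]]. destruct (Req_dec e 0) as [->|Ne].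
    - rewrite Rmult_0_r, Hc0. apply boundary_closure_exterior, Bglue, Ht.
    - apply closure_incl, Hex; lra. }
  assert (Cp := continuous_on_subset _ _ _ Sp HFp). assert (Cm := continuous_on_subset _ _ _ Sm HFm).
  set (p1 := fun t => Fp (al1 (clamp (- delta) 0 t))).
  set (p2 := fun t => Fp (al2 (clamp 0 delta t))).
  set (m1 := fun t => Fm (al1 (clamp (- delta) 0 t))).
  set (m2 := fun t => Fm (al2 (clamp 0 delta t))).
  destruct (local_cauchy al1 ad1 al2 ad2 zeta tau delta c M J 1 h (or_introl eq_refl) Hh Fp p1 p2 Cp)
    as [Lp Ep].
  { intros t e Ht He. apply HFpD. rewrite Rmult_1_l. apply Hin; lra. }
  { intros t Ht. unfold p1. rewrite clamp_id; auto. }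
  { intros t Ht. unfold p2. rewrite clamp_id; auto. }
  destruct (local_cauchy al1 ad1 al2 ad2 zeta tau delta c M J (-1) h (or_intror eq_refl) Hh Fm m1 m2 Cm)
    as [Lm Em].
  { intros t e Ht He. apply HFmD. apply Hex; lra. }
  { intros t Ht. unfold m1. rewrite clamp_id; auto. }
  { intros t Ht. unfold m2. rewrite clamp_id; auto. }
  set (Hp := sides_ci al1 ad1 al2 ad2 tau delta 1 h Fp) in *.
  set (Hm := sides_ci al1 ad1 al2 ad2 tau delta (-1) h Fm) in *.
  exists (fun z => plus (plus (Hp z) (Hm z)) (arcs_ci L f z)).
  assert (Loff := arcs_off_open L zeta HL2).
  destruct (chart_surj _ _ _ _ _ _ _ _ _ J delta h) as [rho [Hrho Hsurj]]; try lra.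
  assert (Lch : locally zeta (fun z : R * R => Cmod (z - zeta)%C < rho)).
  { apply locally_Cmod. exists rho. auto. }
  generalize (filter_and _ _ (filter_and _ _ Lp Lm) (filter_and _ _ Loff Lch)).
  apply filter_imp. intros z [[Z1 Z2] [Z3 Z4]]. split.
  - apply hol_plus. apply hol_plus; auto. apply (hol_arcs_ci (boundary D)); auto.
    apply continuous_on_f.
  - intros Nz. destruct (Hsurj z Z4) as [t [e [Ht [He Ez]]]].
    assert (Ne : e <> 0).
    { intros ->. apply Nz. rewrite Ez, Hc0. apply Bglue. lra. }
    assert (EPhi : Phi f z = plus (plus (plus (ci al1 ad1 p1 (- delta) 0 z) (ci al2 ad2 p2 0 delta z))
      (plus (ci al1 ad1 m1 (- delta) 0 z) (ci al2 ad2 m2 0 delta z))) (arcs_ci L f z)).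
    { unfold Phi. rewrite Dec.
      2: { apply continuous_on_cauchy_kernel; auto. apply continuous_on_f. }
      rewrite arcs_int_ci. rewrite !cint_ci by lra.
      assert (Sum : forall al ad a b, C1 al ad -> a <= b -> (forall t, a <= t <= b -> boundary D (al t)) ->
        ci al ad (fun t => f (al (clamp a b t))) a b z =
        plus (ci al ad (fun t => Fp (al (clamp a b t))) a b z)
             (ci al ad (fun t => Fm (al (clamp a b t))) a b z)).
      { intros al ad a b Ha Hab HB. unfold ci.
        assert (Off : forall t, a <= t <= b -> al t <> z).
        { intros u Hu E. apply Nz. rewrite <- E. apply HB, Hu. }
        rewrite <- RInt_add.
        - apply (RInt_ext (V := X)). intros u _. unfold f. module X.
        - apply (ex_ci al ad (fun t => Fp (al (clamp a b t)))); auto.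
          intros u. apply (continuous_clamped (closure D) Fp al ad); auto.
          intros v Hv. apply boundary_closure, HB, Hv.
        - apply (ex_ci al ad (fun t => Fm (al (clamp a b t)))); auto.
          intros u. apply (continuous_clamped (closure (exterior D)) Fm al ad); auto.
          intros v Hv. apply boundary_closure_exterior, HB, Hv. }
      rewrite (Sum al1 ad1), (Sum al2 ad2); try lra; auto.
      2: apply (jC2 _ _ _ _ _ _ _ _ _ J). 2: apply (jC1 _ _ _ _ _ _ _ _ _ J).
      unfold p1, p2, m1, m2. module X. }
    (* The same point has transversal parameter e in the left half chart and - e in the right one,
       which is built with sigma = -1. *)
    specialize (Ep t e). specialize (Em t (- e)).
    replace (1 * e) with e in Ep by ring. replace (-1 * - e) with e in Em by ring.
    rewrite <- Ez in Ep, Em. specialize (Ep Ht ltac:(lra) Ne).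
    assert (Ne' : - e <> 0) by (intros E; apply Ne; lra).
    specialize (Em Ht ltac:(lra) Ne').
    destruct (Rlt_dec 0 e) as [Pe|Pe]; destruct (Rlt_dec 0 (- e)) as [Me|Me]; try lra.
    + rewrite jump_corrected_in by (rewrite Ez; apply Hin; lra).
      rewrite EPhi, Ep, Em. unfold two_pi_i. replace (1 * (2 * PI)) with (2 * PI) by ring. module X.
    + rewrite jump_corrected_out by (rewrite Ez; apply Hex; lra).
      rewrite EPhi, Ep, Em. unfold two_pi_i. replace (-1 * (2 * PI)) with (- (2 * PI)) by ring.
      rewrite RtoC_opp. module X.
Qed.

Lemma boundary_empty_interior z : locally z (boundary D) -> False.
Proof.
  intros H. assert (Bz := locally_singleton _ _ H).
  destruct H as [d Hdd]. destruct (proj1 Bz d) as [w [Bw Dw]].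
  apply (boundary_not_open D w HDo Dw). apply Hdd, Bw.
Qed.

Lemma off_boundary_dense z eps : 0 < eps -> exists w, Cmod (w - z)%C < eps /\ ~ boundary D w.
Proof.
  intros He. apply NNPP. intros N. apply (boundary_empty_interior z).
  apply locally_Cmod. exists eps. split; auto. intros w Hw. apply NNPP. intros Nw. apply N.
  exists w. auto.
Qed.

(** The boundary of an open set has no interior, so its complement is dense. This makes local
    extensions compatible on overlaps. *)
Lemma eq_by_density (G H : R * R -> X) z :
  continuous G z -> continuous H z ->
  locally z (fun w => ~ boundary D w -> G w = H w) -> G z = H z.
Proof.
  intros CG CH HL. apply nrm_minus_eq_0. intros e He. assert (He2 : 0 < e / 2) by lra.
  generalize (filter_and _ _ HL (filter_and _ _ (proj1 (continuous_eps _ _) CG _ He2)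
    (proj1 (continuous_eps _ _) CH _ He2))). intros Hloc.
  apply locally_Cmod in Hloc. destruct Hloc as [d [Hd Hloc]].
  destruct (off_boundary_dense z d Hd) as [w [Hw Nw]].
  destruct (Hloc w Hw) as [E [A B]]. rewrite (E Nw) in A.
  replace (minus (G z) (H z)) with (minus (minus (H w) (H z)) (minus (H w) (G z))) by module X.
  eapply Rle_trans. apply nrm_minus. lra.
Qed.

Lemma jump_corrected_constant z : ~ boundary D z -> jump_corrected z = cs two_pi_i cinf.
Proof.
  set (ext := fun zeta => proj1_sig (constructive_indefinite_description _ (local_extension zeta))).
  assert (Hext : forall zeta, locally zeta (fun z => hol (ext zeta) z /\
     (~ boundary D z -> jump_corrected z = ext zeta z))).
  { intros zeta. unfold ext. destruct constructive_indefinite_description. auto. }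
  (* The diagonal of the family of local extensions; near zeta it agrees with [ext zeta] by density,
     hence is entire. *)
  set (G := fun zeta => ext zeta zeta).
  assert (Gloc : forall zeta, locally zeta (fun z => ext zeta z = G z)).
  { intros zeta. generalize (locally_locally _ _ (Hext zeta)) (Hext zeta). intros H1 H2.
    generalize (filter_and _ _ H1 H2). apply filter_imp. intros z' [A [B C]].
    unfold G. apply eq_by_density.
    - apply hol_continuous, B.
    - apply hol_continuous, (locally_singleton _ _ (Hext z')).
    - generalize (filter_and _ _ A (Hext z')). apply filter_imp.
      intros w [[W1 W2] [W3 W4]] Nw. rewrite <- W2, <- W4; auto. }
  assert (Ghol : forall zeta, hol G zeta).
  { intros zeta. apply (hol_ext_loc (ext zeta)). apply Gloc.
    apply (locally_singleton _ _ (Hext zeta)). }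
  assert (Geq : forall z', ~ boundary D z' -> jump_corrected z' = G z').
  { intros z' N. apply (locally_singleton _ _ (Hext z')), N. }
  intros Nz. rewrite Geq by auto.
  assert (Lv := liouville (fun w => minus (G w) (cs two_pi_i cinf))).
  assert (E : minus (G z) (cs two_pi_i cinf) = zero).
  { apply Lv.
    - intros w. apply hol_minus; auto. apply hol_const.
    - intros eps Heps.
      destruct (Phi_arcs f continuous_on_f) as [L [ZL EL]].
      destruct (arcs_ci_vanishes (boundary D) L f continuous_on_f (fun w => proj1 (ZL w)) (eps / 2)) as [M1 HM1].
      lra.
      assert (Hpi : 0 < Cmod two_pi_i).
      { unfold two_pi_i. rewrite Cmod_mult, Cmod_R, Cmod_Ci. pose proof PI_RGT_0.
        rewrite Rabs_right; lra. }
      destruct (HFinf (eps / 2 / Cmod two_pi_i)) as [M2 HM2].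
      { apply Rdiv_lt_0_compat; lra. }
      destruct HDb as [M3 HM3].
      (* Beyond M3 + 2 a point has distance more than 1 from D and is therefore exterior. *)
      exists (Rmax (Rmax M1 M2) (M3 + 2)). intros w Hw.
      pose proof (Rmax_l (Rmax M1 M2) (M3 + 2)). pose proof (Rmax_r (Rmax M1 M2) (M3 + 2)).
      pose proof (Rmax_l M1 M2). pose proof (Rmax_r M1 M2).
      assert (Ew : exterior D w).
      { intros Cw. rewrite closure_Cmod in Cw. destruct (Cw 1) as [v [Hv Dv]]. lra.
        specialize (HM3 v Dv).
        assert (Cmod w <= Cmod (v - w)%C + Cmod v); [|lra].
        rewrite Cmod_minus_sym. eapply Rle_trans; [|apply Cmod_triangle]. right. f_equal. Cring. }
      assert (Nw := exterior_not_boundary _ _ Ew).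
      rewrite <- Geq, jump_corrected_out, EL by auto.
      replace (minus (plus (arcs_ci L f w) (cs two_pi_i (Fm w))) (cs two_pi_i cinf))
        with (plus (arcs_ci L f w) (cs two_pi_i (minus (Fm w) cinf))) by module X.
      eapply Rle_trans. apply nrm_plus. rewrite norm_cs.
      specialize (HM1 w ltac:(lra)). specialize (HM2 w ltac:(lra)).
      assert (Cmod two_pi_i * norm (minus (Fm w) cinf) <= eps / 2); [|lra].
      replace (eps / 2) with (Cmod two_pi_i * (eps / 2 / Cmod two_pi_i)) by (field; lra).
      apply Rmult_le_compat_l; lra. }
  replace (G z) with (plus (minus (G z) (cs two_pi_i cinf)) (cs two_pi_i cinf)) by module X.
  rewrite E. module X.
Qed.

Lemma plane_cauchy z :
  (D z -> Phi f z = cs two_pi_i (plus (Fp z) cinf)) /\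
  (exterior D z -> Phi f z = cs two_pi_i (minus cinf (Fm z))).
Proof.
  split; intros Hz.
  - assert (E := jump_corrected_constant z (boundary_not_open D z HDo Hz)).
    rewrite jump_corrected_in in E by auto.
    replace (Phi f z) with (plus (minus (Phi f z) (cs two_pi_i (Fp z))) (cs two_pi_i (Fp z))) by module X.
    rewrite E. module X.
  - assert (E := jump_corrected_constant z (exterior_not_boundary D z Hz)).
    rewrite jump_corrected_out in E by auto.
    replace (Phi f z) with (minus (plus (Phi f z) (cs two_pi_i (Fm z))) (cs two_pi_i (Fm z))) by module X.
    rewrite E. module X.
Qed.
End Cauchy.
End PlaneTheorem.

(** * Recovering the density from the two boundary values *)

Section PlaneJump.
Context {X : CBanach}.

Lemma continuous_on_eps (A : R * R -> Prop) (F : R * R -> X) z eps :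
  continuous_on A F -> A z -> 0 < eps -> exists d, 0 < d /\
  forall w, A w -> Cmod (w - z)%C < d -> norm (minus (F w) (F z)) < eps.
Proof.
  intros HF Hz He.
  assert (Cc : continuous (fun x : X => minus x (F z)) (F z)).
  { apply cont_minus. apply continuous_id. apply continuous_const. }
  assert (L := proj1 (continuous_eps _ _) Cc eps He).
  apply (HF z Hz) in L. unfold filtermap, within in L. apply locally_Cmod in L.
  destruct L as [d [Hd L]]. exists d. split; auto. intros w Aw Hw. specialize (L w Hw Aw).
  replace (minus (F w) (F z)) with (minus (minus (F w) (F z)) (minus (F z) (F z))) by module X.
  exact L.
Qed.

Variables (D : R * R -> Prop) (Gamma : list (R -> R * R)).
Hypothesis HDo : open D.
Hypothesis HO : oriented_boundary D Gamma.
Variables (f gp gm : R * R -> X).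
Hypothesis Hf : continuous_on (boundary D) f.
Hypothesis Hgp : continuous_on (closure D) gp.
Hypothesis Hgm : continuous_on (closure (exterior D)) gm.
Hypothesis HgpD : forall z, D z -> Phi Gamma f z = cs two_pi_i (gp z).
Hypothesis HgmD : forall z, exterior D z -> Phi Gamma f z = cs two_pi_i (gm z).

Lemma Cmod_two_pi_i : Cmod two_pi_i = 2 * PI.
Proof.
  unfold two_pi_i. rewrite Cmod_mult, Cmod_R, Cmod_Ci. pose proof PI_RGT_0.
  rewrite Rabs_right; lra.
Qed.

(** [zeta] may be a corner; so the relation is proved at the points [al2 t1] with small t1 > 0,
    where the contour is C1 on both sides, and then t1 tends to 0. *)
Lemma plane_jump zeta : boundary D zeta -> f zeta = minus (gp zeta) (gm zeta).
Proof.
  intros Hz.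
  destruct (boundary_chart (X := X) D Gamma HDo HO zeta Hz) as
    [al1 [ad1 [al2 [ad2 [tau [delta [c [M [h [L [J [Hh [Dec [HL1 [HL2 [B1 [B2 [Hin Hex]]]]]]]]]]]]]]]]]].
  pose proof (jdelta _ _ _ _ _ _ _ _ _ J) as Hd.
  pose proof (jc _ _ _ _ _ _ _ _ _ J) as Hc.
  assert (C1' := jC1 _ _ _ _ _ _ _ _ _ J). assert (C2' := jC2 _ _ _ _ _ _ _ _ _ J).
  assert (Z2 := jz2 _ _ _ _ _ _ _ _ _ J).
  assert (Ch1 : forall t, t <= 0 -> al1 t = chart al1 al2 tau t 0).
  { intros t Ht. unfold chart, curtain. rewrite (glue_neg al1 al2) by auto. Cring. }
  assert (Ch2 : forall t, 0 <= t -> al2 t = chart al1 al2 tau t 0).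
  { intros t Ht. unfold chart, curtain. rewrite (glue_pos _ _ _ _ _ _ _ _ _ J) by auto. Cring. }
  set (F1 := fun t => f (al1 (clamp (- delta) 0 t))). set (F2 := fun t => f (al2 (clamp 0 delta t))).
  assert (CF1 : forall t, continuous F1 t).
  { intros t. apply (continuous_clamped (boundary D) f al1 ad1); auto. lra. }
  assert (CF2 : forall t, continuous F2 t).
  { intros t. apply (continuous_clamped (boundary D) f al2 ad2); auto. lra. }
  assert (EPhi : forall z, ~ boundary D z -> Phi Gamma f z =
     plus (plus (ci al1 ad1 F1 (- delta) 0 z) (ci al2 ad2 F2 0 delta z)) (arcs_ci L f z)).
  { intros z Nz. unfold Phi. rewrite Dec by (apply continuous_on_cauchy_kernel; auto).
    rewrite arcs_int_ci, !cint_ci by lra. reflexivity. }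
  assert (Loff := arcs_off_open L zeta HL2). rewrite <- Z2 in Loff.
  apply (C1_continuous al2 ad2 0 C2') in Loff. destruct Loff as [r Hr].
  pose proof (cond_pos r) as Hrpos.
  (* t1 < r keeps the point off the remaining arcs and 0 < t1 < delta off the ends; all but a short
     piece of the integral is then continuous there. *)
  assert (Near : forall t1, 0 < t1 < delta -> t1 < r ->
    f (al2 t1) = minus (gp (al2 t1)) (gm (al2 t1))).
  { intros t1 Ht1 Ht1r.
    assert (HB : boundary D (al2 t1)) by (apply B2; lra).
    assert (HL : ~ on_arcs L (al2 t1)).
    { apply (Hr t1). unfold ball; simpl; unfold AbsRing_ball, abs, minus, plus, opp; simpl.
      rewrite Ropp_0, Rplus_0_r, Rabs_right; lra. }
    assert (Nd2 : ad2 t1 <> RtoC 0).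
    { intros E. destruct (jslope2 _ _ _ _ _ _ _ _ _ J t1) as [B _]. lra. rewrite E in B.
      replace (RtoC 0 * / tau)%C with (RtoC 0) in B by Cring. simpl in B. lra. }
    destruct (chart_normal _ _ _ _ _ _ _ _ _ J t1 h) as [e0 [He0 Hn]]; auto.
    assert (Side : forall s, s <> 0 -> Rabs s < e0 ->
      (0 < s -> D (al2 t1 + RtoC s * (Ci * ad2 t1))%C) /\
      (s < 0 -> exterior D (al2 t1 + RtoC s * (Ci * ad2 t1))%C)).
    { intros s Ns Hs. destruct (Hn s Ns Hs) as [t [e [A1 [A2 [A3 A4]]]]]. rewrite A4.
      split; intros H. apply Hin; try lra. nra. apply Hex; try lra. nra. }
    assert (SideB : forall s, s <> 0 -> Rabs s < e0 ->
      ~ boundary D (al2 t1 + RtoC s * (Ci * ad2 t1))%C).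
    { intros s Ns Hs. destruct (Side s Ns Hs) as [S1 S2]. destruct (Rlt_dec 0 s).
      apply boundary_not_open; auto. apply exterior_not_boundary, S2. lra. }
    assert (Jl := jump_limit (fun u => al2 (t1 + u)) (fun u => ad2 (t1 + u)) (fun u => F2 (t1 + u))
      (Phi Gamma f) (C1_translate _ _ t1 C2')).
    simpl in Jl. rewrite Rplus_0_r in Jl.
    assert (Lim : forall eps, 0 < eps -> exists e1, 0 < e1 /\ forall s, 0 < s < e1 ->
      norm (minus (minus (Phi Gamma f (al2 t1 + RtoC s * (Ci * ad2 t1))%C)
         (Phi Gamma f (al2 t1 - RtoC s * (Ci * ad2 t1))%C)) (cs (RtoC (2 * PI) * Ci)%C (F2 t1))) <= eps).
    { apply Jl; auto; clear Jl.
      - intros t. apply (continuous_comp (fun u => t1 + u) F2); auto.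
        apply (ex_derive_continuous (V := R_NormedModule)). auto_derive. auto.
      - intros eta Heta. set (m := Rmin eta (Rmin t1 (delta - t1) / 2)).
        assert (Hmm : 0 < Rmin t1 (delta - t1)) by (apply Rmin_glb_lt; lra).
        assert (Hm : 0 < m) by (apply Rmin_glb_lt; lra).
        assert (m <= eta) by apply Rmin_l.
        assert (m <= Rmin t1 (delta - t1) / 2) by apply Rmin_r.
        pose proof (Rmin_l t1 (delta - t1)). pose proof (Rmin_r t1 (delta - t1)).
        set (Rst := fun z => plus (plus (ci al1 ad1 F1 (- delta) 0 z)
          (plus (ci al2 ad2 F2 0 (t1 - m) z) (ci al2 ad2 F2 (t1 + m) delta z))) (arcs_ci L f z)).
        assert (Inj2 : forall u, 0 <= u <= delta -> u <> t1 -> al2 u <> al2 t1).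
        { intros u Hu Nu E. apply Nu. rewrite !Ch2 in E by lra.
          apply (chart_inj _ _ _ _ _ _ _ _ _ J) in E; lra. }
        exists (- m), m, Rst. split. lra. split. lra. split.
        + apply hol_continuous. unfold Rst.
          apply hol_plus; [apply hol_plus; [|apply hol_plus]|].
          * apply hol_ci; auto. lra. intros u Hu E. rewrite Ch1, Ch2 in E by lra.
            apply (chart_inj _ _ _ _ _ _ _ _ _ J) in E; lra.
          * apply hol_ci; auto. lra. intros u Hu. apply Inj2; lra.
          * apply hol_ci; auto. lra. intros u Hu. apply Inj2; lra.
          * apply (hol_arcs_ci (boundary D)); auto.
        + exists e0. split; auto. intros s Ns Hs.
          assert (NB := SideB s Ns Hs).
          set (zs := (al2 t1 + RtoC s * (Ci * ad2 t1))%C) in *.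
          assert (Noff : forall u, 0 <= u <= delta -> al2 u <> zs).
          { intros u Hu E. apply NB. rewrite <- E. auto. }
          rewrite EPhi by auto. unfold Rst.
          rewrite (ci_translate al2 ad2 F2 t1 (- m) m zs C2' ltac:(lra) CF2)
            by (intros u Hu; apply Noff; lra).
          rewrite (ci_Chasles al2 ad2 F2 0 (t1 - m) delta zs C2' ltac:(lra) CF2 Noff).
          rewrite (ci_Chasles al2 ad2 F2 (t1 - m) (t1 + m) delta zs C2' ltac:(lra) CF2)
            by (intros u Hu; apply Noff; lra).
          replace (t1 + - m) with (t1 - m) by ring. module X. }
    assert (EF : F2 t1 = f (al2 t1)) by (unfold F2; rewrite clamp_id; auto; lra).
    rewrite EF in Lim.
    symmetry. apply nrm_minus_eq_0. intros eps Heps.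
    assert (He3 : 0 < eps / 3) by lra.
    destruct (Lim (eps / 3) He3) as [e1 [He1 L1]].
    destruct (continuous_on_eps _ _ (al2 t1) _ Hgp (boundary_closure D _ HB) He3) as [dp [Hdp Lp]].
    destruct (continuous_on_eps _ _ (al2 t1) _ Hgm
      (boundary_closure_exterior (X := X) D Gamma HDo HO _ HB) He3) as [dm [Hdm Lm]].
    set (k := Cmod (ad2 t1) + 1).
    assert (Hk : 0 < k) by (unfold k; pose proof (Cmod_ge_0 (ad2 t1)); lra).
    (* A third of eps each goes to the jump, to gp and to gm; k converts a bound on s into one on
       the normal displacement. *)
    set (s := Rmin (Rmin e0 e1) (Rmin (dp / k) (dm / k)) / 2).
    pose proof (Rmin_l (Rmin e0 e1) (Rmin (dp / k) (dm / k))).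
    pose proof (Rmin_r (Rmin e0 e1) (Rmin (dp / k) (dm / k))).
    pose proof (Rmin_l e0 e1). pose proof (Rmin_r e0 e1).
    pose proof (Rmin_l (dp / k) (dm / k)). pose proof (Rmin_r (dp / k) (dm / k)).
    assert (Hs0 : 0 < Rmin (Rmin e0 e1) (Rmin (dp / k) (dm / k))).
    { repeat apply Rmin_glb_lt; auto; apply Rdiv_lt_0_compat; auto. }
    assert (Hs : 0 < s) by (unfold s; lra).
    specialize (L1 s ltac:(unfold s; lra)).
    destruct (Side s) as [S1 _]; try lra. rewrite Rabs_right; unfold s; lra.
    destruct (Side (- s)) as [_ S2]; try lra. rewrite Rabs_left; unfold s; lra.
    specialize (S1 Hs). specialize (S2 ltac:(lra)).
    replace (al2 t1 + RtoC (- s) * (Ci * ad2 t1))%C with (al2 t1 - RtoC s * (Ci * ad2 t1))%C in S2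
      by (rewrite RtoC_opp; Cring).
    assert (Bs : forall d, s < d / k -> Cmod (RtoC s * (Ci * ad2 t1))%C < d).
    { intros d H5. rewrite !Cmod_mult, Cmod_R, Cmod_Ci, Rabs_right, Rmult_1_l by lra.
      apply Rlt_le_trans with (d / k * k). apply Rle_lt_trans with (s * k).
      apply Rmult_le_compat_l; unfold k; lra. apply Rmult_lt_compat_r; lra. right. field. lra. }
    set (zp := (al2 t1 + RtoC s * (Ci * ad2 t1))%C) in *.
    set (zm := (al2 t1 - RtoC s * (Ci * ad2 t1))%C) in *.
    assert (Vp : norm (minus (gp zp) (gp (al2 t1))) < eps / 3).
    { apply Lp. apply closure_incl, S1. unfold zp.
      replace (al2 t1 + RtoC s * (Ci * ad2 t1) - al2 t1)%C with (RtoC s * (Ci * ad2 t1))%C by Cring.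
      apply Bs. unfold s. lra. }
    assert (Vm : norm (minus (gm zm) (gm (al2 t1))) < eps / 3).
    { apply Lm. apply closure_incl, S2. unfold zm.
      replace (al2 t1 - RtoC s * (Ci * ad2 t1) - al2 t1)%C with (- (RtoC s * (Ci * ad2 t1)))%C by Cring.
      rewrite Cmod_opp. apply Bs. unfold s. lra. }
    rewrite HgpD, HgmD in L1 by auto.
    replace (minus (minus (cs two_pi_i (gp zp)) (cs two_pi_i (gm zm)))
       (cs (RtoC (2 * PI) * Ci)%C (f (al2 t1)))) with
      (cs two_pi_i (minus (minus (gp zp) (gm zm)) (f (al2 t1)))) in L1
      by (unfold two_pi_i; module X).
    rewrite norm_cs, Cmod_two_pi_i in L1.
    assert (V : norm (minus (minus (gp zp) (gm zm)) (f (al2 t1))) <= eps / 3).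
    { pose proof PI2_3_2. unfold PI2 in *. pose proof (nrm_ge_0 (minus (minus (gp zp) (gm zm)) (f (al2 t1)))).
      nra. }
    replace (minus (minus (gp (al2 t1)) (gm (al2 t1))) (f (al2 t1))) with
      (minus (minus (minus (gp zp) (gm zm)) (f (al2 t1)))
         (minus (minus (gp zp) (gp (al2 t1))) (minus (gm zm) (gm (al2 t1))))) by module X.
    replace eps with (eps / 3 + (eps / 3 + eps / 3)) by field.
    eapply Rle_trans. apply nrm_minus. apply Rplus_le_compat; auto.
    eapply Rle_trans. apply nrm_minus. lra. }
  set (P2 := fun t => gp (al2 (clamp 0 delta t))). set (M2 := fun t => gm (al2 (clamp 0 delta t))).
  assert (CE : forall t, continuous (fun t => minus (F2 t) (minus (P2 t) (M2 t))) t).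
  { intros t. apply cont_minus; auto. apply cont_minus.
    - apply (continuous_clamped (closure D) gp al2 ad2); auto. lra.
      intros u Hu. apply boundary_closure; auto.
    - apply (continuous_clamped (closure (exterior D)) gm al2 ad2); auto. lra.
      intros u Hu. apply (boundary_closure_exterior (X := X) D Gamma HDo HO); auto. }
  set (q := Rmin delta r / 2).
  assert (Hq0 : 0 < Rmin delta r) by (apply Rmin_glb_lt; lra).
  pose proof (Rmin_l delta r). pose proof (Rmin_r delta r).
  assert (Val : forall t, 0 < t <= q -> minus (F2 t) (minus (P2 t) (M2 t)) = zero).
  { intros t Ht. unfold F2, P2, M2. rewrite clamp_id by (unfold q in Ht; lra).
    rewrite Near by (unfold q in Ht; lra). module X. }
  assert (Hq : 0 < q) by (unfold q; lra).
  assert (E0 := eq_of_constant_inside _ 0 q Hq (CE 0) (CE q)).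
  cbv beta in E0. rewrite (Val q) in E0 by lra.
  assert (E1 : minus (F2 0) (minus (P2 0) (M2 0)) = zero).
  { apply E0. intros x y Hx Hxy Hy. rewrite !Val by lra. auto. }
  unfold F2, P2, M2 in E1. rewrite clamp_id in E1 by lra. rewrite Z2 in E1.
  replace (f zeta) with (plus (minus (f zeta) (minus (gp zeta) (gm zeta))) (minus (gp zeta) (gm zeta)))
    by module X.
  rewrite E1. module X.
Qed.
End PlaneJump.

(** * Quaternions and axially symmetric sets *)

Lemma quat_eq (a b c d a' b' c' d' : R) :
  a = a' -> b = b' -> c = c' -> d = d' -> (a, b, c, d) = (a', b', c', d').
Proof. congruence. Qed.

Ltac quat_ring :=
  repeat match goal with q : quat |- _ => destruct q as [[[? ?] ?] ?] end;
  unfold slice, Hminus, Hconj, Hopp, Hmult, Hplus, RtoH, Cplus; cbn [fst snd];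
  apply quat_eq; try ring.

Lemma Hmult_assoc p q r : Hmult p (Hmult q r) = Hmult (Hmult p q) r.
Proof. quat_ring. Qed.
Lemma Hmult_plus_r p q r : Hmult p (Hplus q r) = Hplus (Hmult p q) (Hmult p r).
Proof. quat_ring. Qed.
Lemma Hmult_plus_l p q r : Hmult (Hplus p q) r = Hplus (Hmult p r) (Hmult q r).
Proof. quat_ring. Qed.

Lemma imag_unit_square (j : quat) : imag_unit j -> Hmult j j = RtoH (-1).
Proof.
  destruct j as [[[a b] c] d]. intros [H1 H2]. simpl in H1. subst a. unfold Hnorm in H2.
  assert (E : b * b + c * c + d * d = 1).
  { replace (b * b + c * c + d * d) with (0 ^ 2 + b ^ 2 + c ^ 2 + d ^ 2) by ring.
    rewrite <- (sqrt_sqrt (0 ^ 2 + b ^ 2 + c ^ 2 + d ^ 2)), H2 by nra. ring. }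
  unfold Hmult, RtoH. apply quat_eq; try ring. lra.
Qed.

Lemma Hmult_real (a : R) q : Hmult q (RtoH a) = Hmult (RtoH a) q.
Proof. quat_ring. Qed.

Lemma slice_plus j z w : slice j (z + w)%C = Hplus (slice j z) (slice j w).
Proof. destruct z, w. quat_ring. Qed.

Lemma slice_mult j z w : imag_unit j -> slice j (z * w)%C = Hmult (slice j z) (slice j w).
Proof.
  intros Hj. assert (E := imag_unit_square j Hj).
  destruct z as [x y], w as [u v], j as [[[a b] c] d]. destruct Hj as [Ha _]. simpl in Ha. subst a.
  unfold Hmult, RtoH in E. injection E as E1 _ _ _.
  unfold slice, Hmult, Hplus, RtoH, Cmult. cbn [fst snd].
  apply quat_eq; try ring.
  replace (x * u - y * v) with (x * u + y * v * -1) by ring. rewrite <- E1. ring.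
Qed.

Lemma slice_real j a : slice j (RtoC a) = RtoH a.
Proof. unfold RtoC. quat_ring. Qed.

Lemma slice_Ci j : slice j Ci = j.
Proof. unfold Ci. quat_ring. Qed.

Lemma imag_unit_components (j : quat) : imag_unit j ->
  exists b c d, j = (0, b, c, d) /\ b * b + c * c + d * d = 1.
Proof.
  destruct j as [[[a b] c] d]. intros [H1 H2]. simpl in H1. subst a. exists b, c, d. split; auto.
  unfold Hnorm in H2.
  replace (b * b + c * c + d * d) with (0 ^ 2 + b ^ 2 + c ^ 2 + d ^ 2) by ring.
  rewrite <- (sqrt_sqrt (0 ^ 2 + b ^ 2 + c ^ 2 + d ^ 2)), H2 by nra. ring.
Qed.

Lemma Hnorm_slice j z : imag_unit j -> Hnorm (slice j z) = Cmod z.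
Proof.
  intros Hj. destruct (imag_unit_components j Hj) as [b [c [d [-> E]]]]. destruct z as [x y].
  unfold slice, Hmult, Hplus, RtoH, Hnorm, Cmod. cbn [fst snd]. f_equal.
  replace (y ^ 2) with (y * y * (b * b + c * c + d * d)) by (rewrite E; ring). ring.
Qed.

Lemma Hinv_slice j w : imag_unit j -> Hinv (slice j w) = slice j (/ w)%C.
Proof.
  intros Hj. unfold Hinv. rewrite Hnorm_slice by auto.
  assert (E : Cmod w ^ 2 = fst w ^ 2 + snd w ^ 2).
  { unfold Cmod. apply pow2_sqrt. nra. }
  rewrite E. destruct (imag_unit_components j Hj) as [b [c [d [-> _]]]]. destruct w as [x y].
  unfold slice, Hconj, Hmult, Hplus, RtoH, Cinv. cbn [fst snd]. unfold Rdiv.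
  apply quat_eq; ring.
Qed.

(** Kept transparent, so that [cs z] and [lmul (slice j z)] are convertible; later proofs pass
    between them by [change]. *)
Definition slice_space (X : QBanach) (j : quat) (Hj : imag_unit j) : CBanach.
Proof.
  refine (Build_CBanach (qb_space X) (fun z x => lmul (slice j z) x) _ _ _ _ _).
  - intros. apply lmul_plus_r.
  - intros. rewrite slice_plus. apply lmul_plus_l.
  - intros. rewrite slice_mult by exact Hj. symmetry. apply lmul_assoc.
  - intros. rewrite slice_real. apply lmul_real.
  - intros. rewrite norm_lmul, Hnorm_slice by exact Hj. reflexivity.
Defined.

(** The representative of [q] in the closed upper half plane. Its continuity is what transports
    closures and limits from H to a single plane. *)
Definition rho (q : quat) : R * R := (Hre q, Hnorm (Him q)).

Lemma e1_unit : imag_unit (0, 1, 0, 0).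
Proof.
  split. reflexivity. unfold Hnorm. replace (0 ^ 2 + 1 ^ 2 + 0 ^ 2 + 0 ^ 2) with 1 by ring. apply sqrt_1.
Qed.

Lemma rho_slice i z : imag_unit i -> rho (slice i z) = (fst z, Rabs (snd z)).
Proof.
  intros Hi. destruct (imag_unit_components i Hi) as [b [c [d [-> E]]]]. destruct z as [x y].
  unfold rho, slice, Hmult, Hplus, RtoH, Hre, Him, Hnorm. cbn [fst snd]. f_equal. ring.
  rewrite <- sqrt_Rsqr_abs. f_equal. unfold Rsqr.
  replace (y * y) with (y * y * (b * b + c * c + d * d)) by (rewrite E; ring). ring.
Qed.

Lemma slice_of_rho q : exists i, imag_unit i /\ q = slice i (rho q).
Proof.
  destruct q as [[[a b] c] d].
  (* For real q every unit works, and e1 is an arbitrary choice. *)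
  destruct (Req_dec (b * b + c * c + d * d) 0) as [E|N].
  - exists (0, 1, 0, 0). split. apply e1_unit.
    assert (b = 0) by nra. assert (c = 0) by nra. assert (d = 0) by nra. subst.
    unfold rho, slice, Hmult, Hplus, RtoH, Hre, Him, Hnorm. cbn [fst snd].
    replace (0 ^ 2 + 0 ^ 2 + 0 ^ 2 + 0 ^ 2) with 0 by ring. rewrite sqrt_0.
    apply quat_eq; ring.
  - assert (P : 0 < b * b + c * c + d * d) by nra.
    set (n := sqrt (b * b + c * c + d * d)).
    assert (Hn : 0 < n) by (apply sqrt_lt_R0; auto).
    assert (Hnn : n * n = b * b + c * c + d * d) by (apply sqrt_sqrt; lra).
    exists (0, b / n, c / n, d / n). split.
    + split. reflexivity. unfold Hnorm. rewrite <- sqrt_1. f_equal.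
      replace (0 ^ 2 + (b / n) ^ 2 + (c / n) ^ 2 + (d / n) ^ 2) with ((b * b + c * c + d * d) / (n * n))
        by (field; lra). rewrite Hnn. field. lra.
    + unfold rho, slice, Hmult, Hplus, RtoH, Hre, Him, Hnorm. cbn [fst snd].
      replace (0 ^ 2 + b ^ 2 + c ^ 2 + d ^ 2) with (b * b + c * c + d * d) by ring. fold n.
      apply quat_eq; field; lra.
Qed.

Lemma rho_nonneg q : 0 <= snd (rho q).
Proof. destruct q as [[[a b] c] d]. apply sqrt_pos. Qed.

(* Membership depends on the class [q] only, read off in the plane C_j. *)
Definition Sym (j : quat) (A : quat -> Prop) : Prop := forall q, A q <-> A (slice j (rho q)).

Lemma Sym_slice j A i z : imag_unit j -> imag_unit i -> Sym j A -> (A (slice i z) <-> A (slice j z)).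
Proof. intros Hj Hi S. rewrite (S (slice i z)), (S (slice j z)), !rho_slice; tauto. Qed.

Lemma Sym_conj j A z : imag_unit j -> Sym j A -> (A (slice j (fst z, - snd z)) <-> A (slice j z)).
Proof.
  intros Hj S. rewrite (S (slice j z)), (S (slice j (fst z, - snd z))), !rho_slice by auto.
  cbn [fst snd]. rewrite Rabs_Ropp. tauto.
Qed.

Lemma axially_symmetric_Sym j A : imag_unit j -> axially_symmetric A -> Sym j A.
Proof.
  intros Hj HA q. split; intros H.
  - apply (HA q); auto. exists j. split; auto.
  - apply (HA (slice j (rho q))); auto. destruct (slice_of_rho q) as [i [Hi E]].
    exists i. split; auto. change (Hre (slice j (rho q)), Hnorm (Him (slice j (rho q)))) with (rho (slice j (rho q))).
    rewrite rho_slice by auto. rewrite Rabs_right by (apply Rle_ge, rho_nonneg).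
    rewrite <- surjective_pairing. exact E.
Qed.

Lemma Sym_not j A : Sym j A -> Sym j (fun q => ~ A q).
Proof. intros S q. specialize (S q). tauto. Qed.

Lemma continuous_pair {T U V : UniformSpace} (f : T -> U) (g : T -> V) x :
  continuous f x -> continuous g x -> continuous (fun t => (f t, g t)) x.
Proof.
  intros Hf Hg P [e He]. unfold filtermap.
  assert (L1 : locally x (fun t => ball (f x) e (f t))) by exact (Hf _ (locally_ball (f x) e)).
  assert (L2 : locally x (fun t => ball (g x) e (g t))) by exact (Hg _ (locally_ball (g x) e)).
  generalize (filter_and _ _ L1 L2).
  apply filter_imp. intros t [A B]. apply He. split; assumption.
Qed.

Lemma continuous_slice i z : continuous (slice i) z.
Proof.
  destruct i as [[[a b] c] d].
  apply (continuous_ext (fun z : R * R => (fst z + a * snd z, b * snd z, c * snd z, d * snd z))).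
  { intros [x y]. unfold slice, Hmult, Hplus, RtoH. cbn [fst snd]. apply quat_eq; ring. }
  assert (M : forall k : R, continuous (fun z : R * R => k * snd z) z).
  { intros k. apply (continuous_scal_r (V := R_NormedModule) k (fun z : R * R => snd z)).
    apply continuous_snd. }
  repeat apply continuous_pair; auto.
  apply (continuous_plus (V := R_NormedModule) (fun z : R * R => fst z) (fun z => a * snd z)); auto.
  apply continuous_fst.
Qed.

Lemma continuous_quat_components q :
  continuous (fun p : quat => fst (fst (fst p))) q /\ continuous (fun p : quat => snd (fst (fst p))) q /\
  continuous (fun p : quat => snd (fst p)) q /\ continuous (fun p : quat => snd p) q.
Proof.
  assert (A1 : continuous (fun p : quat => fst p) q) by apply continuous_fst.
  assert (A2 : continuous (fun p : quat => fst (fst p)) q).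
  { apply (continuous_comp (fun p : quat => fst p) fst); auto. apply continuous_fst. }
  repeat split.
  - apply (continuous_comp (fun p : quat => fst (fst p)) fst); auto. apply continuous_fst.
  - apply (continuous_comp (fun p : quat => fst (fst p)) snd); auto. apply continuous_snd.
  - apply (continuous_comp (fun p : quat => fst p) snd); auto. apply continuous_snd.
  - apply continuous_snd.
Qed.

Lemma continuous_Hnorm_Him q : continuous (fun p => Hnorm (Him p)) q.
Proof.
  destruct (continuous_quat_components q) as [_ [B [C D]]].
  apply (continuous_ext (fun p : quat => sqrt (snd (fst (fst p)) * snd (fst (fst p)) +
    snd (fst p) * snd (fst p) + snd p * snd p))).
  { intros [[[a b] c] d]. unfold Him, Hnorm. cbn [fst snd]. f_equal. ring. }
  apply (continuous_comp (fun p : quat => snd (fst (fst p)) * snd (fst (fst p)) +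
    snd (fst p) * snd (fst p) + snd p * snd p) sqrt); [|apply continuous_sqrt].
  assert (M : forall f : quat -> R, continuous f q -> continuous (fun p => f p * f p) q).
  { intros f Hf. apply (continuous_mult (K := R_AbsRing) f f); auto. }
  apply (continuous_plus (V := R_NormedModule) (fun p : quat => snd (fst (fst p)) * snd (fst (fst p)) +
    snd (fst p) * snd (fst p)) (fun p => snd p * snd p)).
  apply (continuous_plus (V := R_NormedModule) (fun p : quat => snd (fst (fst p)) * snd (fst (fst p)))
     (fun p => snd (fst p) * snd (fst p))).
  apply (M (fun p : quat => snd (fst (fst p)))); auto.
  apply (M (fun p : quat => snd (fst p))); auto.
  apply (M (fun p : quat => snd p)); auto.
Qed.

Lemma continuous_rho q : continuous rho q.
Proof.
  apply (continuous_pair (fun p => Hre p) (fun p => Hnorm (Him p))).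
  - apply (continuous_ext (fun p : quat => fst (fst (fst p)))).
    intros [[[a b] c] d]; reflexivity.
    exact (proj1 (continuous_quat_components q)).
  - apply continuous_Hnorm_Him.
Qed.

Lemma continuous_conj (z : R * R) : continuous (fun z : R * R => (fst z, - snd z)) z.
Proof.
  apply (continuous_pair (fun z : R * R => fst z) (fun z => - snd z)). apply continuous_fst.
  apply (continuous_opp (V := R_NormedModule) (fun z : R * R => snd z)). apply continuous_snd.
Qed.

Lemma closure_map {T U : UniformSpace} (A : T -> Prop) (B : U -> Prop) (phi : T -> U) x :
  continuous phi x -> (forall y, A y -> B (phi y)) -> closure A x -> closure B (phi x).
Proof.
  intros Hphi HAB HA eps. destruct (Hphi _ (locally_ball (phi x) eps)) as [d Hd].
  destruct (HA d) as [y [By Ay]]. exists (phi y). split; [exact (Hd y By)|auto].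
Qed.

Section SymmetricSets.
Variables (j : quat) (A : quat -> Prop).
Hypotheses (Hj : imag_unit j) (HA : Sym j A).

(** One inclusion is continuity of [slice j]. For the other, [rho] moves nearby points of A into the
    upper half of C_j without leaving A, and conjugation reaches the lower half. *)
Lemma closure_slice_j z : closure A (slice j z) <-> closure (fun z => A (slice j z)) z.
Proof.
  split; intros H.
  - assert (C : closure (fun z => A (slice j z)) (rho (slice j z))).
    { apply (closure_map A _ rho); auto. apply continuous_rho. intros q Hq. exact (proj1 (HA q) Hq). }
    rewrite rho_slice in C by auto. destruct z as [x y]. cbn [fst snd] in C.
    destruct (Rle_dec 0 y).
    + rewrite Rabs_right in C by lra. exact C.
    + rewrite Rabs_left in C by lra.
      apply (closure_map _ (fun z => A (slice j z)) (fun z : R * R => (fst z, - snd z))) in C.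
      * cbn [fst snd] in C. rewrite Ropp_involutive in C. exact C.
      * apply continuous_conj.
      * intros w Hw. apply Sym_conj; auto.
  - apply (closure_map (fun z => A (slice j z)) A (slice j)); auto. apply continuous_slice.
Qed.

Lemma Sym_closure : Sym j (closure A).
Proof.
  intros q. rewrite closure_slice_j. split; intros H.
  - apply (closure_map A _ rho); auto. apply continuous_rho. intros p Hp. exact (proj1 (HA p) Hp).
  - destruct (slice_of_rho q) as [i [Hi E]]. rewrite E.
    apply (closure_map (fun z => A (slice j z)) A (slice i)); auto. apply continuous_slice.
    intros w Hw. apply (Sym_slice j); auto.
Qed.

Lemma slice_base_iff z : slice_base A z <-> A (slice j z).
Proof.
  split.
  - intros [i [Hi H]]. apply (Sym_slice j A i) in H; auto.
  - intros H. exists j. auto.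
Qed.
End SymmetricSets.

Lemma boundary_slice_j j A z : imag_unit j -> Sym j A ->
  (boundary A (slice j z) <-> boundary (fun z => A (slice j z)) z).
Proof.
  intros Hj HA. unfold boundary. rewrite (closure_slice_j j A), (closure_slice_j j (fun q => ~ A q)); auto.
  tauto. apply Sym_not, HA.
Qed.

Lemma exterior_slice_j j A z : imag_unit j -> Sym j A ->
  (exterior A (slice j z) <-> exterior (fun z => A (slice j z)) z).
Proof. intros Hj HA. unfold exterior. rewrite closure_slice_j by auto. tauto. Qed.

Lemma Sym_boundary j A : imag_unit j -> Sym j A -> Sym j (boundary A).
Proof.
  intros Hj HA q. unfold boundary.
  rewrite (Sym_closure j A Hj HA q), (Sym_closure j _ Hj (Sym_not j A HA) q). tauto.
Qed.

Lemma Sym_exterior j A : imag_unit j -> Sym j A -> Sym j (exterior A).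
Proof. intros Hj HA. apply Sym_not, Sym_closure; auto. Qed.

Lemma eq_on_closure {T : UniformSpace} {V : NormedModule R_AbsRing} (A : T -> Prop) (G H : T -> V) x :
  continuous_on (closure A) G -> continuous_on (closure A) H ->
  (forall y, A y -> G y = H y) -> closure A x -> G x = H x.
Proof.
  intros HG HH E Hx. apply (eq_close (G x) (H x)). intros eps.
  assert (He2 : 0 < eps / 2) by (pose proof (cond_pos eps); lra).
  assert (L1 := HG x Hx _ (locally_ball (G x) (mkposreal _ He2))).
  assert (L2 := HH x Hx _ (locally_ball (H x) (mkposreal _ He2))).
  unfold filtermap, within in L1, L2. destruct (filter_and _ _ L1 L2) as [d Hd].
  destruct (Hx d) as [y [By Ay]]. destruct (Hd y By) as [B1 B2].
  specialize (B1 (closure_incl _ _ Ay)). specialize (B2 (closure_incl _ _ Ay)).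
  rewrite (E y Ay) in B1.
  replace (pos eps) with (eps / 2 + eps / 2) by field.
  apply (ball_triangle (G x) (H y) (H x) (eps / 2) (eps / 2)). exact B1. apply ball_sym. exact B2.
Qed.

(** * The representation formula *)

Section Representation.
Context {X : QBanach}.

Lemma continuous_lmul {T : UniformSpace} (q : quat) (g : T -> X) x :
  continuous g x -> continuous (fun t => lmul q (g t)) x.
Proof.
  intros Hg. destruct (slice_of_rho q) as [i [Hi E]]. rewrite E.
  apply (continuous_cs (X := slice_space X i Hi) (fun _ => rho q) g); auto. apply continuous_const.
Qed.

Lemma is_RInt_lmul (q : quat) (g : R -> X) a b l :
  is_RInt g a b l -> is_RInt (fun t => lmul q (g t)) a b (lmul q l).
Proof.
  intros Hg. destruct (slice_of_rho q) as [i [Hi E]]. rewrite E.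
  apply (is_RInt_cs (X := slice_space X i Hi) (rho q) g); auto.
Qed.

(* The coefficients of the representation formula
   g(u + i v) = (1 - i j)/2 g(u + j v) + (1 + i j)/2 g(u - j v). *)
Definition repr1 (i j : quat) : quat := Hmult (RtoH (1 / 2)) (Hminus (RtoH 1) (Hmult i j)).
Definition repr2 (i j : quat) : quat := Hmult (RtoH (1 / 2)) (Hplus (RtoH 1) (Hmult i j)).

(** Equivalent to being a slice function on a symmetric set, but free of components: a linear
    identity between values of g, hence stable under sums, integration and limits. *)
Definition has_repr (j : quat) (A : quat -> Prop) (g : quat -> X) : Prop :=
  forall i z, imag_unit i -> A (slice j z) ->
  g (slice i z) = plus (lmul (repr1 i j) (g (slice j z)))
                       (lmul (repr2 i j) (g (slice j (fst z, - snd z)))).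

Lemma repr_sum i j (x : X) : plus (lmul (repr1 i j) x) (lmul (repr2 i j) x) = x.
Proof.
  rewrite <- lmul_plus_l. replace (Hplus (repr1 i j) (repr2 i j)) with (RtoH 1).
  apply lmul_one. unfold repr1, repr2. destruct i as [[[a b] c] d], j as [[[a' b'] c'] d'].
  unfold Hminus, Hopp, Hmult, Hplus, RtoH. apply quat_eq; field.
Qed.

Lemma lmul_opp_l q (x : X) : lmul (Hopp q) x = opp (lmul q x).
Proof.
  replace (Hopp q) with (Hmult (RtoH (-1)) q) by quat_ring.
  rewrite <- lmul_assoc, lmul_real. exact (scal_opp_one (K := R_Ring) _).
Qed.

Lemma lmul_opp_r q (x : X) : lmul q (opp x) = opp (lmul q x).
Proof.
  rewrite <- lmul_opp_l. replace (opp x) with (lmul (RtoH (-1)) x).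
  rewrite lmul_assoc. f_equal. quat_ring.
  rewrite lmul_real. exact (scal_opp_one (K := R_Ring) _).
Qed.

(** With r1 and r2 for the two coefficients, r1 + r2 = 1 and r1 j - r2 j = - i j j = i. *)
Lemma repr_components i j (x y : X) : imag_unit j ->
  plus (lmul (repr1 i j) (plus x (lmul j y))) (lmul (repr2 i j) (plus x (lmul j (opp y))))
  = plus x (lmul i y).
Proof.
  intros Hj. assert (E := imag_unit_square j Hj).
  rewrite !lmul_plus_r, !lmul_opp_r, !lmul_assoc.
  transitivity (plus (plus (lmul (repr1 i j) x) (lmul (repr2 i j) x))
    (plus (lmul (Hmult (repr1 i j) j) y) (opp (lmul (Hmult (repr2 i j) j) y)))).
  { rewrite !plus_assoc. f_equal. rewrite <- !plus_assoc. f_equal. apply plus_comm. }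
  rewrite repr_sum. f_equal. rewrite <- lmul_opp_l, <- lmul_plus_l. f_equal.
  replace (Hplus (Hmult (repr1 i j) j) (Hopp (Hmult (repr2 i j) j)))
    with (Hmult (RtoH (-1)) (Hmult i (Hmult j j))).
  - rewrite E. destruct i as [[[a b] c] d]. unfold Hmult, RtoH. apply quat_eq; ring.
  - clear E Hj. unfold repr1, repr2. destruct i as [[[a b] c] d], j as [[[a' b'] c'] d'].
    unfold Hminus, Hopp, Hmult, Hplus, RtoH. apply quat_eq; field.
Qed.

Lemma slice_components_repr j A (g : quat -> X) g0 g1 :
  imag_unit j -> Sym j A -> slice_components A g g0 g1 -> has_repr j A g.
Proof.
  intros Hj HA [H1 H2] i z Hi Hz.
  rewrite (H1 i z), (H1 j z), (H1 j (fst z, - snd z)); auto.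
  - destruct z as [x y]. destruct (H2 x y) as [E1 E2]. exists j. auto.
    cbn [fst snd]. rewrite E1, E2. symmetry. apply repr_components, Hj.
  - apply Sym_conj; auto.
  - apply (Sym_slice j); auto.
Qed.

(** Even part in v of g on C_j; [comp1] is the odd part freed from its factor j by multiplication
    with - j = 1 / j. *)
Definition comp0 (j : quat) (g : quat -> X) (z : R * R) : X :=
  scal (1 / 2) (plus (g (slice j z)) (g (slice j (fst z, - snd z)))).
Definition comp1 (j : quat) (g : quat -> X) (z : R * R) : X :=
  scal (1 / 2) (lmul (Hopp j) (minus (g (slice j z)) (g (slice j (fst z, - snd z))))).

Lemma repr_slice_components j A (g : quat -> X) :
  imag_unit j -> Sym j A -> has_repr j A g -> slice_components A g (comp0 j g) (comp1 j g).
Proof.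
  intros Hj HA Hg. split.
  - intros i z Hi Hz. rewrite Hg; auto. 2: apply (Sym_slice j A i); auto.
    unfold comp0, comp1. set (x := g (slice j z)). set (y := g (slice j (fst z, - snd z))).
    rewrite <- !lmul_real, !lmul_assoc. unfold minus.
    rewrite !lmul_plus_r, !lmul_opp_r.
    transitivity (plus (plus (lmul (RtoH (1 / 2)) x) (lmul (Hmult (Hmult i (RtoH (1 / 2))) (Hopp j)) x))
      (plus (lmul (RtoH (1 / 2)) y) (opp (lmul (Hmult (Hmult i (RtoH (1 / 2))) (Hopp j)) y)))).
    + rewrite <- lmul_opp_l, <- !lmul_plus_l. f_equal; f_equal; unfold repr1, repr2.
      * destruct i as [[[a b] c] d], j as [[[a' b'] c'] d'].
        unfold Hminus, Hopp, Hmult, Hplus, RtoH. apply quat_eq; field.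
      * destruct i as [[[a b] c] d], j as [[[a' b'] c'] d'].
        unfold Hminus, Hopp, Hmult, Hplus, RtoH. apply quat_eq; field.
    + rewrite !plus_assoc. f_equal. rewrite <- !plus_assoc. f_equal. apply plus_comm.
  - intros u v _. unfold comp0, comp1. cbn [fst snd]. rewrite Ropp_involutive. split.
    + f_equal. apply plus_comm.
    + set (x := g (slice j (u, v))). set (y := g (slice j (u, - v))).
      transitivity (scal (1 / 2) (opp (lmul (Hopp j) (minus x y)))).
      * f_equal. rewrite <- lmul_opp_r. f_equal. symmetry. apply opp_minus.
      * exact (scal_opp_r (K := R_Ring) (1 / 2) (lmul (Hopp j) (minus x y))).
Qed.

End Representation.

(** * The slice Cauchy transform *)

Lemma slice_opp j z : slice j (- z)%C = Hopp (slice j z).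
Proof. destruct z. unfold Copp. quat_ring. Qed.

Lemma Hconj_slice (j : quat) z : imag_unit j -> Hconj (slice j z) = slice j (Cconj z).
Proof.
  intros Hj. destruct (imag_unit_components j Hj) as [b [c [d [-> _]]]]. destruct z.
  unfold Cconj. quat_ring.
Qed.

Lemma Hre_slice (j : quat) z : imag_unit j -> Hre (slice j z) = fst z.
Proof.
  intros Hj. destruct (imag_unit_components j Hj) as [b [c [d [-> _]]]]. destruct z.
  unfold slice, Hmult, Hplus, RtoH, Hre. cbn [fst snd]. ring.
Qed.

(* p^2 - 2 p Re(s) + |s|^2 is the value in C_i of [kernel_den s z], for p = slice i z
   and for the point with coordinates s in any C_j. *)
Definition kernel_den (s z : C) : C :=
  (z * z - z * RtoC (2 * fst s) + RtoC (Cmod s ^ 2))%C.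

Lemma SLinv_slices i j s z : imag_unit i -> imag_unit j ->
  SLinv (slice j s) (slice i z) =
  Hmult (Hopp (slice i (/ kernel_den s z)%C)) (Hminus (slice i z) (slice j (Cconj s))).
Proof.
  intros Hi Hj. unfold SLinv. rewrite Hnorm_slice, Hre_slice, Hconj_slice by auto.
  f_equal. f_equal. rewrite <- Hinv_slice by auto. f_equal.
  unfold kernel_den, Cminus, Hminus. rewrite !slice_plus, slice_opp, !slice_mult, !slice_real by auto.
  reflexivity.
Qed.

Lemma kernel_den_factor s z : kernel_den s z = ((z - s) * (z - Cconj s))%C.
Proof.
  unfold kernel_den. replace (Cmod s ^ 2) with (fst s ^ 2 + snd s ^ 2).
  - destruct s as [a b], z as [x y]. unfold Cminus, Cplus, Cmult, Copp, Cconj, RtoC. cbn [fst snd].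
    f_equal; ring.
  - unfold Cmod. symmetry. apply pow2_sqrt. nra.
Qed.

(** Within one plane everything commutes, and one factor of (z - s) (z - conj s) cancels against the
    numerator. *)
Lemma SLinv_slice j s z : imag_unit j -> z <> s -> z <> Cconj s ->
  SLinv (slice j s) (slice j z) = slice j (/ (s - z))%C.
Proof.
  intros Hj N1 N2. rewrite SLinv_slices, kernel_den_factor by auto.
  unfold Hminus. rewrite <- !slice_opp, <- slice_plus, <- slice_mult by auto. f_equal.
  assert (M1 := Cminus_neq_0 z s N1). assert (M2 := Cminus_neq_0 z _ N2).
  assert (M3 := Cminus_neq_0 s z (not_eq_sym N1)).
  Cfield. split; auto.
Qed.

(** As a function of p = x + i y the kernel has the form al + i be with al and be independent of i:
    the denominator is a polynomial in p with real coefficients, and the conjugate of s stands to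
    the right of every i. *)
Lemma SLinv_repr i j s z : imag_unit i -> imag_unit j ->
  SLinv (slice j s) (slice i z) =
  Hplus (Hmult (repr1 i j) (SLinv (slice j s) (slice j z)))
        (Hmult (repr2 i j) (SLinv (slice j s) (slice j (fst z, - snd z)))).
Proof.
  intros Hi Hj. rewrite !SLinv_slices by auto.
  assert (E : (/ kernel_den s (fst z, - snd z)%R)%C =
    (fst (/ kernel_den s z)%C, - snd (/ kernel_den s z)%C)).
  { destruct s as [a b], z as [x y]. unfold kernel_den, Cinv, Cminus, Cplus, Cmult, Copp, RtoC.
    cbn [fst snd]. apply injective_projections; cbn [fst snd].
    all: unfold Rdiv; rewrite ?Ropp_mult_distr_l; f_equal; [ring|f_equal; ring]. }
  rewrite E. destruct (/ kernel_den s z)%C as [a b]. destruct z as [x y]. cbn [fst snd].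
  generalize (slice j (Cconj s)). intros w.
  set (al := Hopp (Hminus (RtoH (a * x - b * y)) (Hmult (RtoH a) w))).
  set (be := Hopp (Hminus (RtoH (a * y + b * x)) (Hmult (RtoH b) w))).
  (* Used with (v, b') = (y, b) and (- y, - b); the condition v b' = y b says that conjugation
     leaves [al] unchanged. *)
  assert (K : forall i v b', imag_unit i -> v * b' = y * b ->
    Hmult (Hopp (slice i (a, b'))) (Hminus (slice i (x, v)) w) =
    Hplus al (Hmult i (Hopp (Hminus (RtoH (a * v + b' * x)) (Hmult (RtoH b') w))))).
  { intros k v b' Hk Ev. unfold Hminus at 1. rewrite Hmult_plus_r, <- slice_opp, <- slice_mult by auto.
    clear E. destruct k as [[[k0 k1] k2] k3], w as [[[w0 w1] w2] w3].
    unfold al, slice, Cmult, Copp, Hminus, Hopp, Hmult, Hplus, RtoH. cbn [fst snd].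
    replace (b * y) with (b' * v) by lra. apply quat_eq; ring. }
  rewrite (K i y b), (K j y b), (K j (- y) (- b)) by (auto; ring).
  fold be. replace (Hopp (Hminus (RtoH (a * - y + - b * x)) (Hmult (RtoH (- b)) w))) with (Hopp be)
    by (unfold be; quat_ring).
  assert (S := imag_unit_square j Hj). generalize dependent al. generalize dependent be. intros be al _.
  transitivity (Hplus al (Hmult (Hmult (RtoH (-1)) (Hmult i (Hmult j j))) be)).
  - rewrite S. quat_ring.
  - unfold repr1, repr2. clear. destruct i as [[[i0 i1] i2] i3], j as [[[j0 j1] j2] j3],
      al as [[[a0 a1] a2] a3], be as [[[b0 b1] b2] b3].
    unfold Hminus, Hopp, Hmult, Hplus, RtoH. apply quat_eq; field.
Qed.

Section CauchyTransform.
Context {X : QBanach}.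
Variables (U : quat -> Prop) (j : quat) (Gamma : list (R -> R * R)) (f : quat -> X).
Hypotheses (Hj : imag_unit j) (HU : Sym j U).
Hypothesis HO : oriented_boundary (fun z => U (slice j z)) Gamma.
Hypothesis Hf : continuous_on (boundary U) f.

Notation XC := (slice_space X j Hj).
Notation D := (fun z => U (slice j z)).

Lemma continuous_on_slice {V : UniformSpace} (A : quat -> Prop) (g : quat -> V) :
  continuous_on A g -> continuous_on (fun z => A (slice j z)) (fun z => g (slice j z)).
Proof.
  intros Hg z Hz P HP. specialize (Hg _ Hz P HP).
  exact (continuous_slice j z _ Hg).
Qed.

Lemma continuous_on_boundary_slice : continuous_on (boundary D) (fun z => f (slice j z)).
Proof.
  apply (continuous_on_subset _ (fun z => boundary U (slice j z))).
  - intros z. apply (boundary_slice_j j U); auto.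
  - apply continuous_on_slice, Hf.
Qed.

Lemma is_RInt_slice_kernel gamma z : In gamma Gamma -> ~ boundary U (slice j z) ->
  is_RInt (fun t => lmul (Hmult (SLinv (slice j (gamma t)) (slice j z)) (dsj j gamma t))
                         (f (slice j (gamma t)))) 0 1
    (cs (c := XC) (- Ci)%C
       (RInt (V := XC) (fun t => cs (c := XC) (velocity gamma t)
          (cs (c := XC) (/ (gamma t - z))%C (f (slice j (gamma t))))) 0 1)).
Proof.
  intros Hg Nz. assert (Nz' : ~ boundary D z).
  { intros H. apply Nz. apply (boundary_slice_j j U); auto. }
  destruct (curve_cover (X := XC) Gamma (boundary D) (proj1 HO) (Bd_iff D Gamma HO) gamma 0 1) as [L [I _]]; auto; try lra.
  specialize (I _ (continuous_on_cauchy_kernel (X := XC) (boundary D) _ z continuous_on_boundary_slice Nz')).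
  cbv beta in I. rewrite (is_RInt_unique _ _ _ _ I).
  apply (is_RInt_ext (V := XC) (fun t => cs (c := XC) (- Ci)%C (cs (c := XC) (velocity gamma t)
     (cs (c := XC) (/ (gamma t - z))%C (f (slice j (gamma t))))))).
  - intros t Ht. rewrite Rmin_left, Rmax_right in Ht by lra.
    assert (HB : boundary D (gamma t)).
    { apply (curve_Bd Gamma (boundary D) (Bd_iff D Gamma HO)); auto. lra. }
    (* [SLinv_slice] asks that z differ from the conjugate of the contour point as well; the
       boundary is symmetric. *)
    assert (HB' : boundary D (Cconj (gamma t))).
    { apply (boundary_slice_j j U); auto.
      change (Cconj (gamma t)) with (fst (gamma t), - snd (gamma t)).
      apply (Sym_conj j); auto. apply Sym_boundary; auto. apply (boundary_slice_j j U); auto. }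
    rewrite SLinv_slice; auto; [|intros ->; auto..].
    unfold dsj. change (lmul (slice j (- Ci)%C) (lmul (slice j (velocity gamma t))
      (lmul (slice j (/ (gamma t - z))%C) (f (slice j (gamma t))))) =
      lmul (Hmult (slice j (/ (gamma t - z))%C) (Hmult (Hopp j) (slice j (velocity gamma t)))) (f (slice j (gamma t)))).
    rewrite !lmul_assoc. f_equal.
    replace (Hopp j) with (slice j (- Ci)%C) by (rewrite slice_opp, slice_Ci; reflexivity).
    rewrite <- !slice_mult by auto. f_equal. ring.
  - apply (is_RInt_cs (X := XC)), I.
Qed.

(** The constants combine to (2 PI i) (1 / (2 PI)) (- i) = 1, the last factor coming from ds_j = - j
    ds. *)
Lemma cauchy_integral_slice z : ~ boundary U (slice j z) ->
  cs (c := XC) two_pi_i (cauchy_integral j Gamma f (slice j z)) = Phi (X := XC) Gamma (fun z => f (slice j z)) z.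
Proof.
  intros Nz. unfold cauchy_integral, Phi, contour_int.
  assert (E : forall G, (forall gamma, In gamma G -> In gamma Gamma) ->
    fold_right plus zero (map (fun gamma => RInt (fun t => lmul (Hmult (SLinv (slice j (gamma t)) (slice j z)) (dsj j gamma t))
                         (f (slice j (gamma t)))) 0 1) G) =
    cs (c := XC) (- Ci)%C (fold_right plus zero (map (fun gamma =>
      RInt (V := XC) (fun t => cs (c := XC) (velocity gamma t)
          (cs (c := XC) (/ (gamma t - z))%C (f (slice j (gamma t))))) 0 1) G))).
  { induction G as [|gamma G IH]; intros HG.
    - symmetry. apply (cs_zero_r (X := XC)).
    - simpl map. simpl fold_right. rewrite (cs_plus_r XC). f_equal.
      + apply is_RInt_unique. apply is_RInt_slice_kernel; auto. apply HG. left. reflexivity.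
      + apply IH. intros g Hg. apply HG. right. exact Hg. }
  rewrite E by auto. set (y := fold_right _ _ _).
  transitivity (cs (c := XC) two_pi_i (scal (/ (2 * PI)) (cs (c := XC) (- Ci)%C y))). reflexivity.
  pose proof PI_RGT_0.
  let S := constr:(XC) in module_coefs S. unfold two_pi_i. rewrite RtoC_inv by lra.
  assert (RtoC (2 * PI) <> RtoC 0). { intros E1. apply RtoC_inj in E1. lra. }
  replace (RtoC (2 * PI) * Ci * (/ RtoC (2 * PI) * (- Ci * 1)))%C with (- (Ci * Ci))%C by (Cfield; auto).
  unfold Ci, Cmult, Copp. simpl. unfold RtoC. f_equal; ring.
Qed.

(** The coefficients in [SLinv_repr] do not depend on s and come out of the integral; integrability
    is inherited from C_j, at z and at its conjugate. *)
Lemma cauchy_integral_repr : has_repr j (fun q => ~ boundary U q) (cauchy_integral j Gamma f).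
Proof.
  intros i z Hi Nz.
  assert (Nz' : ~ boundary U (slice j (fst z, - snd z))).
  { rewrite (Sym_conj j); auto. apply Sym_boundary; auto. }
  set (T := fun G q => fold_right plus zero (map (fun gamma => RInt (fun t =>
     lmul (Hmult (SLinv (slice j (gamma t)) q) (dsj j gamma t)) (f (slice j (gamma t)))) 0 1) G)).
  assert (E : forall G, (forall gamma, In gamma G -> In gamma Gamma) ->
    T G (slice i z) = plus (lmul (repr1 i j) (T G (slice j z))) (lmul (repr2 i j) (T G (slice j (fst z, - snd z))))).
  { induction G as [|gamma G IH]; intros HG.
    - unfold T. simpl.
      assert (Z : forall q, lmul q (zero : X) = zero).
      { intros q. destruct (slice_of_rho q) as [k [Hk ->]]. apply (cs_zero_r (X := slice_space X k Hk)). }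
      rewrite !Z. symmetry. apply plus_zero_l.
    - assert (S : forall q, T (gamma :: G) q = plus (RInt (fun t =>
        lmul (Hmult (SLinv (slice j (gamma t)) q) (dsj j gamma t)) (f (slice j (gamma t)))) 0 1) (T G q)) by reflexivity.
      rewrite !S, IH, !lmul_plus_r by (intros; apply HG; right; auto).
      assert (I1 := is_RInt_slice_kernel gamma z (HG _ (or_introl eq_refl)) Nz).
      assert (I2 := is_RInt_slice_kernel gamma _ (HG _ (or_introl eq_refl)) Nz').
      assert (I3 := is_RInt_plus _ _ _ _ _ _ (is_RInt_lmul (repr1 i j) _ _ _ _ I1) (is_RInt_lmul (repr2 i j) _ _ _ _ I2)).
      rewrite (is_RInt_unique _ _ _ _ I1), (is_RInt_unique _ _ _ _ I2).
      match type of I3 with is_RInt _ _ _ ?l => assert (I : RInt (fun t =>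
        lmul (Hmult (SLinv (slice j (gamma t)) (slice i z)) (dsj j gamma t)) (f (slice j (gamma t)))) 0 1 = l) end.
      { apply is_RInt_unique. revert I3. apply is_RInt_ext. intros t _.
        rewrite (SLinv_repr i j) by auto. rewrite Hmult_plus_l, lmul_plus_l, <- !Hmult_assoc, <- !lmul_assoc.
        reflexivity. }
      rewrite I. rewrite <- !plus_assoc. f_equal. rewrite !plus_assoc. f_equal. apply plus_comm. }
  change (scal (/ (2 * PI)) (T Gamma (slice i z)) =
    plus (lmul (repr1 i j) (scal (/ (2 * PI)) (T Gamma (slice j z))))
         (lmul (repr2 i j) (scal (/ (2 * PI)) (T Gamma (slice j (fst z, - snd z)))))).
  rewrite E by auto. rewrite <- !lmul_real, lmul_plus_r, !lmul_assoc, <- !Hmult_real. reflexivity.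
Qed.

End CauchyTransform.

(** * Slice hyperholomorphic and slice continuous functions *)

Section RealDifferentiability.
Context {X : CBanach}.
Implicit Types F g h : R * R -> X.

(** Frechet differentiability with the linear map given by its two partial derivatives; complex
    differentiability then reads dy = i dx. *)
Definition real_diff g (z : R * R) (dx dy : X) : Prop :=
  forall eps, 0 < eps -> locally z (fun w : R * R =>
    norm (minus (minus (g w) (g z)) (plus (scal (fst w - fst z) dx) (scal (snd w - snd z) dy)))
    <= eps * Cmod (w - z)%C).

Lemma norm_minus_RR (w z : R * R) : norm (minus w z) = Cmod (w - z)%C.
Proof. rewrite norm_RR. reflexivity. Qed.

Lemma filterdiff_real_diff g z : ex_filterdiff g (locally z) -> exists dx dy, real_diff g z dx dy.
Proof.
  intros [l [Hl H]]. exists (l (1, 0)), (l (0, 1)). intros eps He.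
  generalize (H z (fun P HP => HP) (mkposreal eps He)). apply filter_imp. intros w Hw.
  rewrite norm_minus_RR in Hw. eapply Rle_trans; [|exact Hw]. right. f_equal. f_equal.
  rewrite <- !(linear_scal l Hl), <- (linear_plus l Hl). f_equal.
  destruct w as [a b], z as [x y]. unfold minus, plus, opp, scal; simpl.
  unfold prod_plus, prod_opp, prod_scal, plus, opp, scal; simpl. unfold mult; simpl.
  apply injective_projections; simpl; ring.
Qed.

Lemma real_diff_filterdiff g z dx dy : real_diff g z dx dy -> ex_filterdiff g (locally z).
Proof.
  intros H. exists (fun w : R * R => plus (scal (fst w) dx) (scal (snd w) dy)). split.
  - split.
    + intros [x1 x2] [y1 y2]. revert x1 x2 y1 y2.
      change (forall x1 x2 y1 y2 : R, plus (scal (x1 + y1) dx) (scal (x2 + y2) dy) =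
        plus (plus (scal x1 dx) (scal x2 dy)) (plus (scal y1 dx) (scal y2 dy))).
      intros. module X.
    + intros k [x1 x2]. revert k x1 x2.
      change (forall k x1 x2 : R, plus (scal (k * x1) dx) (scal (k * x2) dy) =
        scal k (plus (scal x1 dx) (scal x2 dy))).
      intros. module X.
    + exists (norm dx + norm dy + 1). pose proof (nrm_ge_0 dx). pose proof (nrm_ge_0 dy).
      split. lra. intros w. rewrite norm_RR. eapply Rle_trans. apply nrm_plus.
      rewrite <- !cs_real, !norm_cs, !Cmod_R.
      pose proof (fst_le_Cmod w). pose proof (snd_le_Cmod w). pose proof (Cmod_ge_0 w). nra.
  - intros y Hy. rewrite <- (is_filter_lim_locally_unique (V := prod_NormedModule R_AbsRing R_NormedModule R_NormedModule) z y Hy).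
    intros eps. generalize (H eps (cond_pos eps)). apply filter_imp. intros w Hw.
    rewrite norm_minus_RR. exact Hw.
Qed.

Lemma real_diff_dx g z dx dy : real_diff g z dx dy -> is_derive (fun u => g (u, snd z)) (fst z) dx.
Proof.
  intros H. apply is_derive_eps. intros eps He.
  assert (C : continuous (fun u : R => (u, snd z)) (fst z)).
  { apply continuous_pair_iff. split; simpl. apply continuous_id. apply continuous_const. }
  rewrite <- surjective_pairing.
  assert (L : locally (fst z, snd z) (fun w : R * R =>
    norm (minus (minus (g w) (g z)) (plus (scal (fst w - fst z) dx) (scal (snd w - snd z) dy)))
    <= eps * Cmod (w - z)%C)) by (rewrite <- surjective_pairing; apply H, He).
  assert (L' := C _ L). unfold filtermap in L'. revert L'. apply filter_imp. intros u Hu. cbn [fst snd] in Hu.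
  assert (E : Cmod ((u, snd z) - z)%C = Rabs (u - fst z)).
  { rewrite <- Cmod_R. f_equal. destruct z. unfold RtoC, Cminus, Cplus, Copp; simpl. f_equal; ring. }
  rewrite <- E. eapply Rle_trans; [|exact Hu]. right. f_equal.
  set (a := g (u, snd z)). set (b := g z). generalize (u - fst z). intros r. cbn [snd].
  rewrite Rminus_diag.
  change (minus (minus a b) (scal r dx) = minus (minus a b) (plus (scal r dx) (scal 0 dy))). module X.
Qed.

Lemma real_diff_dy g z dx dy : real_diff g z dx dy -> is_derive (fun v => g (fst z, v)) (snd z) dy.
Proof.
  intros H. apply is_derive_eps. intros eps He.
  assert (C : continuous (fun v : R => (fst z, v)) (snd z)).
  { apply continuous_pair_iff. split; simpl. apply continuous_const. apply continuous_id. }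
  rewrite <- surjective_pairing.
  assert (L : locally (fst z, snd z) (fun w : R * R =>
    norm (minus (minus (g w) (g z)) (plus (scal (fst w - fst z) dx) (scal (snd w - snd z) dy)))
    <= eps * Cmod (w - z)%C)) by (rewrite <- surjective_pairing; apply H, He).
  assert (L' := C _ L). unfold filtermap in L'. revert L'. apply filter_imp. intros u Hu. cbn [fst snd] in Hu.
  assert (E : Cmod ((fst z, u) - z)%C = Rabs (u - snd z)).
  { rewrite <- Cmod_R. transitivity (Cmod (RtoC (u - snd z) * Ci)%C).
    - f_equal. destruct z. unfold RtoC, Cminus, Cplus, Cmult, Copp, Ci; simpl. f_equal; ring.
    - rewrite Cmod_mult, Cmod_Ci. ring. }
  rewrite <- E. eapply Rle_trans; [|exact Hu]. right. f_equal.
  set (a := g (fst z, u)). set (b := g z). generalize (u - snd z). intros r. cbn [fst].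
  rewrite Rminus_diag.
  change (minus (minus a b) (scal r dy) = minus (minus a b) (plus (scal 0 dx) (scal r dy))). module X.
Qed.

Lemma is_derive_eps_inv (f : R -> X) t l : is_derive f t l ->
  forall eps, 0 < eps ->
    locally t (fun s => norm (minus (minus (f s) (f t)) (scal (s - t) l)) <= eps * Rabs (s - t)).
Proof. intros [_ H] eps He. exact (H t (fun P HP => HP) (mkposreal eps He)). Qed.

Lemma is_derive_unique_X (f : R -> X) t l l' : is_derive f t l -> is_derive f t l' -> l = l'.
Proof.
  intros H H'. apply nrm_minus_eq_0. intros eps He.
  assert (He2 : 0 < eps / 2) by lra.
  destruct (filter_and _ _ (is_derive_eps_inv f t l H _ He2) (is_derive_eps_inv f t l' H' _ He2)) as [d Hd].
  pose proof (cond_pos d) as Hd0.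
  destruct (Hd (t + d / 2)) as [A B].
  { unfold ball; simpl. unfold AbsRing_ball, abs, minus, plus, opp; simpl. apply Rabs_def1; lra. }
  replace (t + d / 2 - t) with (d / 2) in A, B by ring. rewrite Rabs_right in A, B by lra.
  set (k := minus (f (t + d / 2)) (f t)) in A, B.
  assert (N : norm (cs (RtoC (d / 2)) (minus l l')) <= eps * (d / 2)).
  { replace (cs (RtoC (d / 2)) (minus l l')) with (minus (minus k (scal (d / 2) l')) (minus k (scal (d / 2) l))) by module X.
    eapply Rle_trans. apply nrm_minus.
    apply Rle_trans with (eps / 2 * (d / 2) + eps / 2 * (d / 2)). apply Rplus_le_compat; assumption. lra. }
  rewrite norm_cs, Cmod_R, Rabs_right in N by lra. rewrite Rmult_comm in N.
  apply (Rmult_le_reg_r (d / 2)); [lra|exact N].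
Qed.

Lemma real_diff_of_partials g z dx dy : ex_filterdiff g (locally z) ->
  is_derive (fun u => g (u, snd z)) (fst z) dx -> is_derive (fun v => g (fst z, v)) (snd z) dy ->
  real_diff g z dx dy.
Proof.
  intros H Hx Hy. destruct (filterdiff_real_diff g z H) as [dx' [dy' H']].
  rewrite (is_derive_unique_X _ _ _ _ Hx (real_diff_dx _ _ _ _ H')).
  rewrite (is_derive_unique_X _ _ _ _ Hy (real_diff_dy _ _ _ _ H')). exact H'.
Qed.

Lemma real_diff_lin (a b : C) g h z dx dy dx' dy' : real_diff g z dx dy -> real_diff h z dx' dy' ->
  real_diff (fun w => plus (cs a (g w)) (cs b (h w))) z
    (plus (cs a dx) (cs b dx')) (plus (cs a dy) (cs b dy')).
Proof.
  intros Hg Hh eps He. set (M := Cmod a + Cmod b + 1).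
  pose proof (Cmod_ge_0 a). pose proof (Cmod_ge_0 b).
  assert (HM : 0 < M) by (unfold M; lra).
  assert (He1 : 0 < eps / M) by (apply Rdiv_lt_0_compat; lra).
  generalize (filter_and _ _ (Hg _ He1) (Hh _ He1)). apply filter_imp. intros w [A B].
  set (u := minus (minus (g w) (g z)) _) in A. set (v := minus (minus (h w) (h z)) _) in B.
  match goal with |- norm ?e <= _ => replace e with (plus (cs a u) (cs b v)) end.
  - eapply Rle_trans. apply nrm_plus. rewrite !norm_cs.
    apply Rle_trans with (Cmod a * (eps / M * Cmod (w - z)%C) + Cmod b * (eps / M * Cmod (w - z)%C)).
    + apply Rplus_le_compat; apply Rmult_le_compat_l; auto.
    + replace eps with (eps / M * M) at 3 by (field; lra).
      pose proof (Cmod_ge_0 (w - z)%C).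
      assert (0 <= eps / M * Cmod (w - z)%C) by (apply Rmult_le_pos; lra). unfold M in *. nra.
  - unfold u, v. set (g1 := g w). set (g2 := g z). set (h1 := h w). set (h2 := h z). module X.
Qed.

Lemma real_diff_ext g h z dx dy : (forall w, g w = h w) -> real_diff g z dx dy -> real_diff h z dx dy.
Proof.
  intros E H eps He. generalize (H eps He). apply filter_imp. intros w. rewrite !E. auto.
Qed.

Lemma real_diff_conj g z dx dy : real_diff g (fst z, - snd z) dx dy ->
  real_diff (fun w : R * R => g (fst w, - snd w)) z dx (opp dy).
Proof.
  intros H eps He. assert (L := continuous_conj z _ (H eps He)). unfold filtermap in L. revert L. apply filter_imp. intros w Hw.
  cbn [fst snd] in Hw.
  replace (Cmod (w - z)%C) with (Cmod ((fst w, (- snd w)%R) - (fst z, (- snd z)%R))%C).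
  - eapply Rle_trans; [|exact Hw]. right. f_equal.
    set (a := g (fst w, - snd w)). set (b := g (fst z, - snd z)).
    assert (E : forall p q : R, - p - - q = - (p - q)) by (intros; ring).
    rewrite E. generalize (fst w - fst z) (snd w - snd z).
    intros p q. module X.
  - unfold Cmod. f_equal. destruct w, z. unfold Cminus, Cplus, Copp. cbn [fst snd]. ring.
Qed.

Lemma cs_components (w z : R * R) (d : X) :
  plus (scal (fst w - fst z) d) (scal (snd w - snd z) (cs Ci d)) = cs (w - z)%C d.
Proof.
  module_coefs X. destruct w, z.
  unfold RtoC, Cminus, Cplus, Cmult, Copp, Ci; cbn [fst snd]. f_equal; ring.
Qed.

Lemma hasderiv_real_diff F z d : hasderiv F z d -> real_diff F z d (cs Ci d).
Proof.
  intros [Q [HQ [E L]]] eps He.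
  generalize (filter_and _ _ L (proj1 (continuous_eps _ _) HQ eps He)).
  apply filter_imp. intros w [A B]. rewrite A.
  apply Rle_trans with (norm (cs (w - z)%C (minus (Q w) (Q z)))).
  - right. f_equal. rewrite E. set (q := Q w).
    transitivity (minus (cs (w - z)%C q) (cs (w - z)%C d)). 2: module X.
    rewrite <- (cs_components w z d). reflexivity.
  - rewrite norm_cs, Rmult_comm. apply Rmult_le_compat_r. apply Cmod_ge_0. left. exact B.
Qed.

(** By [cs_components] the linear part is multiplication by w - z; dividing the remainder by w - z
    shows that [dquot] is continuous at z. *)
Lemma real_diff_hasderiv F z d : real_diff F z d (cs Ci d) -> hasderiv F z d.
Proof.
  intros H. assert (E0 : dquot F z d z = d).
  { unfold dquot. destruct Req_EM_T as [|N]; auto. elim N.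
    replace (z - z)%C with (RtoC 0) by Cring. apply Cmod_0. }
  exists (dquot F z d). split; [|split].
  - apply continuous_eps. intros eps He.
    assert (He2 : 0 < eps / 2) by lra.
    generalize (H _ He2). apply filter_imp. intros w Hw. rewrite E0.
    unfold dquot. destruct Req_EM_T as [E|N].
    + replace (minus d d) with (zero : X) by module X. rewrite nrm_zero. exact He.
    + assert (Nz : (w - z)%C <> RtoC 0) by (intros E; apply N; rewrite E; apply Cmod_0).
      pose proof (Cmod_ge_0 (w - z)%C).
      replace (minus (cs (/ (w - z))%C (minus (F w) (F z))) d) with
        (cs (/ (w - z))%C (minus (minus (F w) (F z)) (plus (scal (fst w - fst z) d) (scal (snd w - snd z) (cs Ci d))))).
      * rewrite norm_cs, Cmod_inv by exact Nz. rewrite Rmult_comm.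
        apply Rle_lt_trans with (eps / 2 * Cmod (w - z)%C * / Cmod (w - z)%C).
        apply Rmult_le_compat_r; auto. left. apply Rinv_0_lt_compat. lra.
        rewrite Rmult_assoc, Rinv_r by auto. lra.
      * set (a := F w). set (b := F z).
        transitivity (cs (/ (w - z))%C (minus (minus a b) (cs (w - z)%C d))).
        { f_equal. f_equal. exact (cs_components w z d). }
        module_coefs X; Cfield; exact Nz.
  - exact E0.
  - apply filter_forall. intros w. unfold dquot. destruct Req_EM_T as [E|N].
    + apply Cmod_eq_0 in E. rewrite E, cs_zero_l.
      replace w with z. module X. replace w with ((w - z) + z)%C by Cring. rewrite E. Cring.
    + set (a := F w). set (b := F z). module_coefs X; Cfield; intros E; apply N; rewrite E; apply Cmod_0.
Qed.

Lemma cr_first (d d' : X) :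
  minus (plus (cs (RtoC (1 / 2)) d) (cs (RtoC (1 / 2)) d'))
    (plus (cs (RtoC (1 / 2) * - Ci)%C (cs Ci d)) (cs (RtoC (1 / 2) * Ci)%C (opp (cs Ci d')))) = zero.
Proof.
  module_coefs X; unfold Cminus, RtoC, Cplus, Cmult, Copp, Ci; cbn [fst snd]; f_equal; field.
Qed.

Lemma cr_second (d d' : X) :
  plus (plus (cs (RtoC (1 / 2)) (cs Ci d)) (cs (RtoC (1 / 2)) (opp (cs Ci d'))))
    (plus (cs (RtoC (1 / 2) * - Ci)%C d) (cs (RtoC (1 / 2) * Ci)%C d')) = zero.
Proof.
  module_coefs X; unfold Cminus, RtoC, Cplus, Cmult, Copp, Ci; cbn [fst snd]; f_equal; field.
Qed.
End RealDifferentiability.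

Section SliceHolomorphy.
Context {X : QBanach}.
Variables (j : quat) (Hj : imag_unit j).
Notation XC := (slice_space X j Hj).

(** The equations make the v-derivative - du1 + j du0 of g0 + j g1 equal to j times its u-derivative
    du0 + j du1. *)
Lemma cauchy_riemann_hol (g0 g1 : R * R -> X) z : cauchy_riemann g0 g1 z ->
  hol (X := XC) (fun w => plus (g0 w) (lmul j (g1 w))) z.
Proof.
  intros [D0 [D1 [du0 [dv0 [du1 [dv1 [H1 [H2 [H3 [H4 [E1 E2]]]]]]]]]]].
  assert (R0 := real_diff_of_partials (X := XC) g0 z du0 dv0 D0 H1 H2).
  assert (R1 := real_diff_of_partials (X := XC) g1 z du1 dv1 D1 H3 H4).
  assert (R2 := real_diff_lin (X := XC) 1 Ci g0 g1 z _ _ _ _ R0 R1).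
  assert (F1 : dv1 = du0).
  { symmetry. change (minus (G := XC) du0 dv1 = zero) in E1. change (@eq XC du0 dv1).
    transitivity (plus (minus (G := XC) du0 dv1) dv1). let S := constr:(XC) in module S.
    rewrite E1. let S := constr:(XC) in module S. }
  assert (F2 : dv0 = opp du1).
  { change (plus (G := XC) dv0 du1 = zero) in E2. change (@eq XC dv0 (opp (G := XC) du1)).
    transitivity (minus (plus (G := XC) dv0 du1) du1). let S := constr:(XC) in module S.
    rewrite E2. let S := constr:(XC) in module S. }
  exists (plus (cs (c := XC) 1 du0) (cs (c := XC) Ci du1)). apply real_diff_hasderiv.
  assert (F3 : plus (cs (c := XC) 1 dv0) (cs (c := XC) Ci dv1) =
    cs (c := XC) Ci (plus (cs (c := XC) 1 du0) (cs (c := XC) Ci du1))).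
  { rewrite F1, F2. change (plus (cs (c := XC) 1 (opp (G := XC) du1)) (cs (c := XC) Ci du0) =
      cs (c := XC) Ci (plus (cs (c := XC) 1 du0) (cs (c := XC) Ci du1))).
    (let S := constr:(XC) in module_coefs S). all: unfold RtoC, Cplus, Cmult, Copp, Ci; cbn [fst snd]; f_equal; ring. }
  rewrite <- F3. revert R2. apply real_diff_ext. intros w.
  change (plus (cs (c := XC) 1 (g0 w)) (lmul (slice j Ci) (g1 w)) = plus (g0 w) (lmul j (g1 w))).
  rewrite cs_one, slice_Ci. reflexivity.
Qed.

(** The components are combinations of g on C_j and of its reflection in the real axis; hence
    holomorphy is required at z and at the conjugate point. *)
Lemma hol_cauchy_riemann (g : quat -> X) z :
  hol (X := XC) (fun w => g (slice j w)) z -> hol (X := XC) (fun w => g (slice j w)) (fst z, - snd z) ->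
  cauchy_riemann (comp0 j g) (comp1 j g) z.
Proof.
  intros [d Hd] [d' Hd']. set (G := fun w : R * R => g (slice j w) : XC).
  assert (R1 := hasderiv_real_diff (X := XC) G z d Hd).
  assert (R2 := real_diff_conj (X := XC) G z _ _ (hasderiv_real_diff (X := XC) G _ d' Hd')).
  assert (C0 := real_diff_lin (X := XC) (RtoC (1 / 2)) (RtoC (1 / 2)) _ _ _ _ _ _ _ R1 R2).
  assert (C1 := real_diff_lin (X := XC) (RtoC (1 / 2) * - Ci)%C (RtoC (1 / 2) * Ci)%C _ _ _ _ _ _ _ R1 R2).
  apply (real_diff_ext (X := XC) _ (comp0 j g)) in C0.
  2: { intros w. unfold comp0, G. set (x := g (slice j w)). set (y := g (slice j (fst w, _))).
    change (plus (cs (c := XC) (RtoC (1 / 2)) x) (cs (c := XC) (RtoC (1 / 2)) y) = scal (1 / 2) (plus (G := XC) x y)).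
    let S := constr:(XC) in module S. }
  apply (real_diff_ext (X := XC) _ (comp1 j g)) in C1.
  2: { intros w. unfold comp1, G. set (x := g (slice j w)). set (y := g (slice j (fst w, _))).
    replace (Hopp j) with (slice j (- Ci)%C) by (rewrite slice_opp, slice_Ci; reflexivity).
    change (plus (cs (c := XC) (RtoC (1 / 2) * - Ci)%C x) (cs (c := XC) (RtoC (1 / 2) * Ci)%C y) =
      scal (1 / 2) (cs (c := XC) (- Ci)%C (minus (G := XC) x y))).
    let S := constr:(XC) in module S. }
  split; [|split]. exact (real_diff_filterdiff _ _ _ _ C0). exact (real_diff_filterdiff _ _ _ _ C1).
  eexists. eexists. eexists. eexists.
  split; [|split; [|split; [|split; [|split]]]].
  - exact (real_diff_dx _ _ _ _ C0).
  - exact (real_diff_dy _ _ _ _ C0).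
  - exact (real_diff_dx _ _ _ _ C1).
  - exact (real_diff_dy _ _ _ _ C1).
  - exact (cr_first (X := XC) d d').
  - exact (cr_second (X := XC) d d').
Qed.

End SliceHolomorphy.

(** * Slice continuity and continuity on subsets of H *)

Section ContinuousOn.
Context {T : UniformSpace}.

Lemma continuous_on_norm {V : NormedModule R_AbsRing} (A : T -> Prop) (g : T -> V) :
  continuous_on A g <-> forall x, A x -> forall eps, 0 < eps ->
    locally x (fun y => A y -> norm (minus (g y) (g x)) < eps).
Proof.
  split; intros H x Hx.
  - intros eps He. exact (proj1 (filterlim_locally_ball_norm g (g x)) (H x Hx) (mkposreal eps He)).
  - apply (proj2 (filterlim_locally_ball_norm g (g x))). intros eps. exact (H x Hx eps (cond_pos eps)).
Qed.

Lemma continuous_on_post {U V : UniformSpace} (A : T -> Prop) (phi : U -> V) (g : T -> U) :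
  (forall y, continuous phi y) -> continuous_on A g -> continuous_on A (fun x => phi (g x)).
Proof. intros Hp Hg x Hx. eapply filterlim_comp. apply Hg, Hx. apply Hp. Qed.

Lemma continuous_on_pre {U V : UniformSpace} (A : T -> Prop) (B : U -> Prop) (phi : U -> T) (g : T -> V) :
  (forall y, continuous phi y) -> (forall y, B y -> A (phi y)) ->
  continuous_on A g -> continuous_on B (fun y => g (phi y)).
Proof.
  intros Hp HB Hg y Hy P HP. assert (L := Hp y _ (Hg _ (HB y Hy) P HP)).
  unfold filtermap, within in *. revert L. apply filter_imp. auto.
Qed.

Lemma continuous_on_plus {V : NormedModule R_AbsRing} (A : T -> Prop) (g h : T -> V) :
  continuous_on A g -> continuous_on A h -> continuous_on A (fun x => plus (g x) (h x)).
Proof.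
  intros Hg Hh x Hx. eapply (filterlim_comp_2 _ _ plus). apply Hg, Hx. apply Hh, Hx.
  apply (filterlim_plus (V := V)).
Qed.

Lemma continuous_on_const {V : UniformSpace} (A : T -> Prop) (y : V) : continuous_on A (fun _ => y).
Proof. intros x Hx. apply filterlim_const. Qed.

Lemma continuous_on_opp {V : NormedModule R_AbsRing} (A : T -> Prop) (g : T -> V) :
  continuous_on A g -> continuous_on A (fun x => opp (g x)).
Proof.
  apply (continuous_on_post A (fun y : V => opp y)). intros y.
  apply (continuous_opp (fun y : V => y)), continuous_id.
Qed.
End ContinuousOn.

Lemma eq_opp_zero {X : CBanach} (x : X) : x = opp x -> x = zero.
Proof.
  intros H. transitivity (scal (1 / 2) (minus x (opp x))).
  - module_coefs X. unfold Cminus, RtoC, Cplus, Cmult, Copp. cbn [fst snd]. f_equal; field.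
  - rewrite <- H. module X.
Qed.

Section SliceContinuity.
Context {X : QBanach}.
Variables (j : quat) (Hj : imag_unit j).
Notation XC := (slice_space X j Hj).

(** Expanding p in the real basis of H makes p x a combination of four fixed vectors with continuous
    real coefficients. *)
Lemma continuous_lmul_l (x : X) (q : quat) : continuous (fun p => lmul p x) q.
Proof.
  destruct (continuous_quat_components q) as [C0 [C1 [C2 C3]]].
  apply (continuous_ext (fun p : quat =>
    plus (plus (scal (fst (fst (fst p))) x) (scal (snd (fst (fst p))) (lmul (0, 1, 0, 0) x)))
         (plus (scal (snd (fst p)) (lmul (0, 0, 1, 0) x)) (scal (snd p) (lmul (0, 0, 0, 1) x))))).
  - intros [[[a b] c] d]. cbn [fst snd].
    transitivity (lmul (Hplus (Hplus (RtoH a) (Hmult (RtoH b) (0, 1, 0, 0)))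
      (Hplus (Hmult (RtoH c) (0, 0, 1, 0)) (Hmult (RtoH d) (0, 0, 0, 1)))) x).
    + rewrite !lmul_plus_l, <- !lmul_assoc, !lmul_real. reflexivity.
    + f_equal. unfold Hmult, Hplus, RtoH. apply quat_eq; ring.
  - assert (S : forall (h : quat -> R) (y : X), continuous h q -> continuous (fun p => scal (h p) y) q).
    { intros h y Hh. apply (continuous_scal_l h y). exact Hh. }
    apply (continuous_plus (fun p : quat => plus (scal (fst (fst (fst p))) x) (scal (snd (fst (fst p))) (lmul (0, 1, 0, 0) x)))
       (fun p => plus (scal (snd (fst p)) (lmul (0, 0, 1, 0) x)) (scal (snd p) (lmul (0, 0, 0, 1) x)))).
    + apply (continuous_plus (fun p : quat => scal (fst (fst (fst p))) x) (fun p => scal (snd (fst (fst p))) (lmul (0, 1, 0, 0) x))).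
      apply (S (fun p : quat => fst (fst (fst p)))); auto. apply (S (fun p : quat => snd (fst (fst p)))); auto.
    + apply (continuous_plus (fun p : quat => scal (snd (fst p)) (lmul (0, 0, 1, 0) x)) (fun p => scal (snd p) (lmul (0, 0, 0, 1) x))).
      apply (S (fun p : quat => snd (fst p))); auto. apply (S (fun p : quat => snd p)); auto.
Qed.

Lemma imag_unit_norm_lmul i (x : X) : imag_unit i -> norm (lmul i x) = norm x.
Proof. intros [_ E]. rewrite norm_lmul, E. apply Rmult_1_l. Qed.

(* The unit i of q = u + i v varies continuously with q off the real axis only. *)
Lemma imag_part_continuous (x : X) (q : quat) (i : quat) : imag_unit i -> q = slice i (rho q) ->
  snd (rho q) <> 0 -> forall eps, 0 < eps ->
  locally q (fun p => forall k, imag_unit k -> p = slice k (rho p) -> norm (minus (lmul k x) (lmul i x)) < eps).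
Proof.
  intros Hi Eq N eps He. set (v := snd (rho q)) in *.
  assert (Cr := continuous_rho q). rewrite continuous_pair_iff in Cr. destruct Cr as [Cu Cv].
  (* For p = u + k |Im p| this is (|Im p| / v) k x: continuous in p, and close to k x because |Im p|
     is close to v. *)
  set (h := fun p => scal (/ v) (minus (lmul p x) (scal (fst (rho p)) x))).
  assert (Ch : continuous h q).
  { apply (continuous_scal_r (/ v) (fun p => minus (lmul p x) (scal (fst (rho p)) x))).
    apply (continuous_minus (fun p => lmul p x) (fun p => scal (fst (rho p)) x)).
    apply continuous_lmul_l. apply (continuous_scal_l (fun p => fst (rho p)) x), Cu. }
  assert (Eh : forall p k, imag_unit k -> p = slice k (rho p) -> h p = scal (/ v * snd (rho p)) (lmul k x)).
  { intros p k Hk Ep. unfold h. replace (lmul p x) with (lmul (slice k (rho p)) x) by (rewrite <- Ep; reflexivity).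
    destruct (rho p) as [a b]. cbn [fst snd].
    replace (lmul (slice k (a, b)) x) with (plus (scal a x) (scal b (lmul k x))).
    - set (y := lmul k x). let S := constr:(XC) in module S.
    - transitivity (plus (lmul (RtoH a) x) (lmul (RtoH b) (lmul k x))). rewrite !lmul_real. reflexivity.
      rewrite lmul_assoc, <- lmul_plus_l. f_equal. unfold slice. cbn [fst snd].
      f_equal. symmetry. apply Hmult_real. }
  assert (He2 : 0 < eps / 2) by lra.
  assert (L1 := proj1 (continuous_eps (X := XC) h q) Ch _ He2).
  assert (Cw : continuous (fun p => (1 - / v * snd (rho p)) * norm x) q).
  { apply (continuous_mult (K := R_AbsRing) (fun p => 1 - / v * snd (rho p)) (fun _ => norm x)); [|apply continuous_const].
    apply (continuous_minus (V := R_NormedModule) (fun _ => 1) (fun p => / v * snd (rho p))). apply continuous_const.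
    apply (continuous_mult (K := R_AbsRing) (fun _ => / v) (fun p => snd (rho p))). apply continuous_const. exact Cv. }
  assert (L2 : locally q (fun p => ball ((1 - / v * snd (rho q)) * norm x) (mkposreal _ He2) ((1 - / v * snd (rho p)) * norm x)))
    by exact (Cw _ (locally_ball _ _)).
  generalize (filter_and _ _ L1 L2). apply filter_imp. intros p [A B] k Hk Ep.
  rewrite (Eh p k Hk Ep), (Eh q i Hi Eq) in A. fold v in A, B.
  assert (B' : Rabs ((1 - / v * snd (rho p)) * norm x - (1 - / v * v) * norm x) < eps / 2) by exact B.
  replace (/ v * v) with 1 in A, B' by (field; auto). clear B. revert B' A.
  generalize (/ v * snd (rho p)). intros t B A.
  replace ((1 - t) * norm x - (1 - 1) * norm x) with ((1 - t) * norm x) in B by ring.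
  set (y := lmul k x) in *. set (w := lmul i x) in *.
  assert (Ny : norm y = norm x) by (apply imag_unit_norm_lmul; auto).
  assert (S : norm (minus y w) <= norm (cs (c := XC) (RtoC (1 - t)) y) + norm (minus (G := XC) (scal t y) (scal 1 w))).
  { eapply Rle_trans; [|apply (nrm_plus (X := XC))]. right. f_equal.
    change (minus (G := XC) y w = plus (cs (c := XC) (RtoC (1 - t)) y) (minus (G := XC) (scal t y) (scal 1 w))).
    let S := constr:(XC) in module S. }
  eapply Rle_lt_trans. exact S.
  rewrite (norm_cs XC), Cmod_R. change (norm (y : XC)) with (norm y).
  assert (Q : Rabs (1 - t) * norm (V := XC) y < eps / 2).
  { change (Rabs (1 - t) * norm y < eps / 2). rewrite Ny. rewrite Rabs_mult in B.
    rewrite (Rabs_right (norm x)) in B by (apply Rle_ge, norm_ge_0). exact B. }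
  replace eps with (eps / 2 + eps / 2) by field. apply Rplus_lt_compat. exact Q. exact A.
Qed.

(** At real points the unit has no limit, but there the odd component g1 is zero; elsewhere
    [imag_part_continuous] applies. *)
Lemma slice_continuous_continuous_on A (g : quat -> X) : Sym j A -> slice_continuous A g -> continuous_on A g.
Proof.
  intros HA [g0 [g1 [[H1 H2] [C0 C1]]]].
  assert (D0 : continuous_on A (fun q => g0 (rho q))).
  { apply (continuous_on_pre (slice_base A)); auto. apply continuous_rho.
    intros q Hq. exists j. split; auto. exact (proj1 (HA q) Hq). }
  assert (D1 : continuous_on A (fun q => g1 (rho q))).
  { apply (continuous_on_pre (slice_base A)); auto. apply continuous_rho.
    intros q Hq. exists j. split; auto. exact (proj1 (HA q) Hq). }
  assert (Eg : forall p k, A p -> imag_unit k -> p = slice k (rho p) -> g p = plus (g0 (rho p)) (lmul k (g1 (rho p)))).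
  { intros p k Hp Hk Ep. rewrite <- H1; auto. f_equal. exact Ep. rewrite <- Ep. exact Hp. }
  apply (proj2 (continuous_on_norm A g)). intros q Hq eps He.
  destruct (slice_of_rho q) as [i [Hi Eq]].
  assert (He4 : 0 < eps / 4) by lra.
  assert (L0 := proj1 (continuous_on_norm A _) D0 q Hq _ He4).
  assert (L1 := proj1 (continuous_on_norm A _) D1 q Hq _ He4).
  set (x := g1 (rho q)) in *.
  assert (L2 : locally q (fun p => forall k, imag_unit k -> p = slice k (rho p) -> norm (minus (lmul k x) (lmul i x)) < eps / 4)).
  { destruct (Req_dec (snd (rho q)) 0) as [Z|N]; [|apply imag_part_continuous; auto].
    assert (Ex : x = zero).
    { destruct (H2 (fst (rho q)) (snd (rho q))) as [_ O].
      - exists j. split; auto. rewrite <- surjective_pairing. exact (proj1 (HA q) Hq).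
      - rewrite Z, Ropp_0, <- Z, <- surjective_pairing in O. fold x in O.
        apply (eq_opp_zero (X := XC)). exact O. }
    apply filter_forall. intros p k _ _. rewrite Ex.
    assert (Zk : forall q, lmul q (zero : X) = zero).
    { intros q'. destruct (slice_of_rho q') as [k' [Hk ->]]. apply (cs_zero_r (X := slice_space X k' Hk)). }
    rewrite !Zk. replace (norm _) with 0; auto. symmetry.
    transitivity (norm (zero : X)). f_equal. apply (minus_eq_zero (G := X)). apply (norm_zero (V := X)). }
  generalize (filter_and _ _ L0 (filter_and _ _ L1 L2)). apply filter_imp.
  intros p [B0 [B1 B2]] Hp. specialize (B0 Hp). specialize (B1 Hp).
  destruct (slice_of_rho p) as [k [Hk Ep]]. specialize (B2 k Hk Ep).
  rewrite (Eg p k Hp Hk Ep), (Eg q i Hq Hi Eq). fold x.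
  set (a := g0 (rho p)) in *. set (b := g0 (rho q)) in *. set (y := g1 (rho p)) in *.
  (* The second terms differ by k y - i x = k (y - x) + (k x - i x): a change of component and a
     change of unit. *)
  assert (B3 : norm (lmul k (minus y x)) < eps / 4) by (rewrite imag_unit_norm_lmul; auto).
  apply Rle_lt_trans with (norm (minus a b) + (norm (lmul k (minus y x)) + norm (minus (lmul k x) (lmul i x)))).
  2: { apply Rlt_trans with (eps / 4 + (eps / 4 + eps / 4)); [|lra].
    apply Rplus_lt_compat; [exact B0|]. apply Rplus_lt_compat; [exact B3|exact B2]. }
  eapply Rle_trans; [|apply Rplus_le_compat_l, (nrm_plus (X := XC))].
  eapply Rle_trans; [|apply (nrm_plus (X := XC))]. right. f_equal.
  assert (E : lmul k (minus y x) = minus (lmul k y) (lmul k x)).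
  { unfold minus. rewrite lmul_plus_r, lmul_opp_r. reflexivity. }
  rewrite E.
  set (ky := lmul k y). set (kx := lmul k x). set (ix := lmul i x).
  change (minus (G := XC) (plus a ky) (plus b ix) = plus (minus (G := XC) a b) (plus (minus (G := XC) ky kx) (minus (G := XC) kx ix))).
  let S := constr:(XC) in module S.
Qed.

Lemma continuous_on_comp01 A (g : quat -> X) : Sym j A -> continuous_on A g ->
  continuous_on (slice_base A) (comp0 j g) /\ continuous_on (slice_base A) (comp1 j g).
Proof.
  intros HA Hg.
  assert (G1 : continuous_on (slice_base A) (fun z => g (slice j z))).
  { apply (continuous_on_pre A); auto. apply continuous_slice.
    intros z. apply slice_base_iff; auto. }
  assert (G2 : continuous_on (slice_base A) (fun z : R * R => g (slice j (fst z, - snd z)))).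
  { apply (continuous_on_pre (slice_base A) (slice_base A) (fun z : R * R => (fst z, - snd z)) (fun z => g (slice j z))); auto.
    apply continuous_conj. intros z. rewrite !(slice_base_iff j) by auto. apply Sym_conj; auto. }
  split.
  - apply (continuous_on_post (slice_base A) (fun x : X => scal (1 / 2) x)).
    intros y. apply (continuous_scal_r (1 / 2) (fun x : X => x)), continuous_id.
    apply (continuous_on_plus (slice_base A) (fun z => g (slice j z))); auto.
  - apply (continuous_on_post (slice_base A) (fun x : X => scal (1 / 2) (lmul (Hopp j) x))).
    intros y. apply (continuous_scal_r (1 / 2) (fun x : X => lmul (Hopp j) x)), continuous_lmul, continuous_id.
    apply (continuous_on_plus (slice_base A) (fun z => g (slice j z))); auto.
    apply (continuous_on_opp (V := X) (slice_base A) (fun z : R * R => g (slice j (fst z, - snd z)))), G2.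
Qed.

Lemma repr_slice_continuous A (g : quat -> X) : Sym j A -> has_repr j A g -> continuous_on A g -> slice_continuous A g.
Proof.
  intros HA Hr Hg. exists (comp0 j g), (comp1 j g). split.
  apply repr_slice_components; auto. apply continuous_on_comp01; auto.
Qed.
End SliceContinuity.

(** * Splittings *)

Lemma closure_mono {T : UniformSpace} (A B : T -> Prop) x :
  (forall y, A y -> B y) -> closure A x -> closure B x.
Proof. intros S H eps. destruct (H eps) as [y [H1 H2]]. exists y. auto. Qed.

Lemma two_pi_i_neq_0 : two_pi_i <> RtoC 0.
Proof. intros E. pose proof Cmod_two_pi_i as M. rewrite E, Cmod_0 in M. pose proof PI_RGT_0. lra. Qed.

Lemma cs_two_pi_i_cancel {X : CBanach} (x y : X) : cs two_pi_i x = cs two_pi_i y -> x = y.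
Proof.
  intros E. pose proof two_pi_i_neq_0.
  transitivity (cs (/ two_pi_i)%C (cs two_pi_i x)). module_coefs X. Cfield. auto.
  rewrite E. module_coefs X. Cfield. auto.
Qed.

Lemma contour_int_ext {X : CBanach} (G : list (R -> R * R)) (K K' : R * R -> X) :
  (forall gamma z, In gamma G -> on_curve gamma z -> K z = K' z) -> contour_int G K = contour_int G K'.
Proof.
  induction G as [|gamma G IH]; intros H. reflexivity.
  unfold contour_int in *. simpl. f_equal.
  - apply RInt_ext. intros t Ht. rewrite Rmin_left, Rmax_right in Ht by lra. f_equal.
    apply (H gamma). left; reflexivity. exists t. split; auto. unfold Icc. lra.
  - apply IH. intros g z Hg. apply H. right. exact Hg.
Qed.

Lemma exterior_of_bounded (D : R * R -> Prop) M : (forall z, D z -> Cmod z <= M) ->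
  forall z, M < Cmod z -> exterior D z.
Proof.
  intros HD z Hz Cz. rewrite closure_Cmod in Cz.
  destruct (Cz (Cmod z - M)) as [w [H1 H2]]. lra.
  specialize (HD w H2). assert (Cmod z <= Cmod w + Cmod (w - z)%C); [|lra].
  replace z with (w + - (w - z))%C at 1 by Cring. eapply Rle_trans. apply Cmod_triangle.
  rewrite Cmod_opp. lra.
Qed.

Section AxiallySymmetricSet.
Variables (U : quat -> Prop) (j : quat).
Hypotheses (Hj : imag_unit j) (HU : Sym j U) (HUo : open U) (HUb : Hbounded U).
Notation D := (fun z => U (slice j z)).

Lemma open_slice : open D.
Proof. intros z Hz. exact (continuous_slice j z _ (HUo _ Hz)). Qed.

Lemma bounded_slice : exists M, forall z, D z -> Cmod z <= M.
Proof.
  destruct HUb as [M HM]. exists M. intros z Hz. rewrite <- (Hnorm_slice j) by auto. apply HM, Hz.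
Qed.

Lemma exterior_D z : exterior D z <-> exterior U (slice j z).
Proof. symmetry. apply exterior_slice_j; auto. Qed.

Lemma closure_D z : closure D z <-> closure U (slice j z).
Proof. symmetry. apply closure_slice_j; auto. Qed.

Lemma closure_exterior_D z : closure (exterior D) z <-> closure (exterior U) (slice j z).
Proof.
  rewrite (closure_slice_j j (exterior U)) by (auto; apply Sym_exterior; auto).
  split; apply closure_mono; intros w; apply exterior_D.
Qed.

Lemma boundary_D z : boundary D z <-> boundary U (slice j z).
Proof. symmetry. apply boundary_slice_j; auto. Qed.

Definition inverted (p : quat) : Prop := p = RtoH 0 \/ (p <> RtoH 0 /\ exterior U (Hinv p)).

Lemma slice_eq_0 i z : imag_unit i -> (slice i z = RtoH 0 <-> z = RtoC 0).
Proof.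
  intros Hi. split; intros E.
  - apply Cmod_eq_0. rewrite <- (Hnorm_slice i) by auto. rewrite E. rewrite <- (slice_real i), Hnorm_slice by auto.
    apply Cmod_0.
  - rewrite E. apply slice_real.
Qed.

Lemma inverted_slice i z : imag_unit i ->
  (inverted (slice i z) <-> z = RtoC 0 \/ (z <> RtoC 0 /\ exterior D (/ z)%C)).
Proof.
  intros Hi. unfold inverted. rewrite slice_eq_0, Hinv_slice by auto. rewrite exterior_D.
  rewrite (Sym_slice j (exterior U) i) by (auto; apply Sym_exterior; auto). tauto.
Qed.

Lemma Cinv_conj (z : C) : (/ (fst z, (- snd z)%R))%C = (fst (/ z)%C, (- snd (/ z)%C)%R).
Proof.
  destruct z as [x y]. unfold Cinv; cbn [fst snd]. apply injective_projections; cbn [fst snd].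
  all: unfold Rdiv; rewrite ?Ropp_mult_distr_l; f_equal; f_equal; ring.
Qed.

Lemma Sym_inverted : Sym j inverted.
Proof.
  intros q. destruct (slice_of_rho q) as [i [Hi E]]. rewrite E at 1.
  rewrite !inverted_slice by auto. tauto.
Qed.

(** Near 0 this is boundedness of U; elsewhere the exterior is open and inversion continuous. *)
Lemma inverted_open z : inverted (slice j z) -> locally z (fun w => inverted (slice j w)).
Proof.
  intros Hz. apply inverted_slice in Hz; auto.
  destruct Hz as [->|[N E]].
  - destruct bounded_slice as [M HM]. apply locally_Cmod.
    exists (/ (Rabs M + 1)). pose proof (Rabs_pos M). split. apply Rinv_0_lt_compat; lra.
    intros w Hw. apply inverted_slice; auto.
    replace (w - 0)%C with w in Hw by Cring.
    destruct (Ceq_dec w (RtoC 0)) as [|Nw]; auto. right. split; auto.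
    apply (exterior_of_bounded D M HM). rewrite Cmod_inv by auto.
    apply Rle_lt_trans with (Rabs M). apply Rle_abs.
    apply Rlt_trans with (Rabs M + 1). lra.
    rewrite <- (Rinv_inv (Rabs M + 1)). apply Rinv_lt_contravar; auto.
    apply Rmult_lt_0_compat. apply Cmod_gt_0; auto. apply Rinv_0_lt_compat; lra.
  - assert (C := continuous_Cinv (fun w : R * R => w) z (continuous_id z) N).
    assert (L := C _ (closure_open_complement D _ E)). unfold filtermap in L.
    generalize (filter_and _ _ L (locally_neq z (RtoC 0) N)). apply filter_imp.
    intros w [L1 L2]. apply inverted_slice; auto.
Qed.
End AxiallySymmetricSet.

Section Repr.
Context {X : QBanach}.
Variables (j : quat) (A : quat -> Prop).
Hypotheses (Hj : imag_unit j) (HA : Sym j A).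

Lemma has_repr_mono (B : quat -> Prop) (g : quat -> X) :
  (forall q, B q -> A q) -> has_repr j A g -> has_repr j B g.
Proof. intros S H i z Hi Hz. auto. Qed.

Lemma has_repr_ext (g h : quat -> X) : (forall q, A q -> g q = h q) -> has_repr j A g -> has_repr j A h.
Proof.
  intros E H i z Hi Hz. rewrite <- !E; auto. apply Sym_conj; auto. apply (Sym_slice j); auto.
Qed.

Lemma has_repr_eq (g h : quat -> X) : has_repr j A g -> has_repr j A h ->
  (forall z, A (slice j z) -> g (slice j z) = h (slice j z)) -> forall q, A q -> g q = h q.
Proof.
  intros Hg Hh E q Hq. destruct (slice_of_rho q) as [i [Hi Eq]].
  assert (Hz : A (slice j (rho q))) by exact (proj1 (HA q) Hq).
  rewrite Eq, (Hg i _ Hi Hz), (Hh i _ Hi Hz), !E; auto. apply Sym_conj; auto.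
Qed.

Lemma has_repr_const (x : X) : has_repr j A (fun _ => x).
Proof. intros i z _ _. symmetry. apply repr_sum. Qed.

Lemma has_repr_opp (g : quat -> X) : has_repr j A g -> has_repr j A (fun q => opp (g q)).
Proof.
  intros H i z Hi Hz. rewrite (H i z Hi Hz), !lmul_opp_r.
  apply (opp_plus (G := X)).
Qed.

Lemma has_repr_plus (g h : quat -> X) : has_repr j A g -> has_repr j A h ->
  has_repr j A (fun q => plus (g q) (h q)).
Proof.
  intros Hg Hh i z Hi Hz. rewrite (Hg i z Hi Hz), (Hh i z Hi Hz), !lmul_plus_r.
  rewrite <- !plus_assoc. f_equal. rewrite !plus_assoc. f_equal. apply plus_comm.
Qed.

(** For fixed i both sides of the identity are continuous in z on the closure of the plane section
    of A. *)
Lemma has_repr_closure (g : quat -> X) : has_repr j A g -> continuous_on (closure A) g ->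
  has_repr j (closure A) g.
Proof.
  intros H C i z Hi Hz.
  assert (Ck : forall k, imag_unit k -> continuous_on (closure (fun z => A (slice j z))) (fun z => g (slice k z))).
  { intros k Hk. apply (continuous_on_pre (closure A)); auto. apply continuous_slice.
    intros w Hw. apply (Sym_slice j); auto. apply Sym_closure; auto. apply closure_slice_j; auto. }
  apply (eq_on_closure (V := X) (fun z => A (slice j z)) (fun z => g (slice i z))
    (fun z : R * R => plus (lmul (repr1 i j) (g (slice j z))) (lmul (repr2 i j) (g (slice j (fst z, - snd z)))))).
  - apply Ck, Hi.
  - apply (continuous_on_plus (V := X) (closure (fun z => A (slice j z)))
      (fun z : R * R => lmul (repr1 i j) (g (slice j z)))
      (fun z : R * R => lmul (repr2 i j) (g (slice j (fst z, - snd z))))).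
    + apply (continuous_on_post (closure (fun z => A (slice j z))) (fun x : X => lmul (repr1 i j) x)).
      intros y. apply continuous_lmul, continuous_id. apply Ck, Hj.
    + apply (continuous_on_post (closure (fun z => A (slice j z))) (fun x : X => lmul (repr2 i j) x)).
      intros y. apply continuous_lmul, continuous_id.
      apply (continuous_on_pre (closure (fun z => A (slice j z))) (closure (fun z => A (slice j z)))
        (fun z : R * R => (fst z, - snd z)) (fun z => g (slice j z))); auto.
      apply continuous_conj. intros w. rewrite <- !(closure_slice_j j A) by auto.
      apply Sym_conj; auto. apply Sym_closure; auto.
  - intros w Hw. apply H; auto.
  - apply closure_slice_j; auto.
Qed.

Lemma slice_hyperholomorphic_repr (g : quat -> X) : slice_hyperholomorphic A g -> has_repr j A g.
Proof. intros [g0 [g1 [H _]]]. exact (slice_components_repr j A g g0 g1 Hj HA H). Qed.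

Lemma slice_continuous_repr (g : quat -> X) : slice_continuous A g -> has_repr j A g.
Proof. intros [g0 [g1 [H _]]]. exact (slice_components_repr j A g g0 g1 Hj HA H). Qed.

Notation XC := (slice_space X j Hj).

Lemma slice_hyperholomorphic_hol (g : quat -> X) z : slice_hyperholomorphic A g ->
  locally z (fun w => A (slice j w)) -> hol (X := XC) (fun w => g (slice j w)) z.
Proof.
  intros [g0 [g1 [[H _] C]]] L.
  apply (hol_ext_loc (X := XC) (fun w => plus (g0 w) (lmul j (g1 w)))).
  - revert L. apply filter_imp. intros w Hw. symmetry. apply H; auto.
  - apply cauchy_riemann_hol, C. exists j. split; auto. exact (locally_singleton _ _ L).
Qed.

(** Holomorphy has to be checked in one plane only; the representation formula gives components that
    serve for all units. *)
Lemma hol_slice_hyperholomorphic (g : quat -> X) : has_repr j A g ->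
  (forall z, A (slice j z) -> hol (X := XC) (fun w => g (slice j w)) z) -> slice_hyperholomorphic A g.
Proof.
  intros Hr Hg. exists (comp0 j g), (comp1 j g). split. apply repr_slice_components; auto.
  intros z Hz. apply slice_base_iff with (j := j) in Hz; auto.
  apply (hol_cauchy_riemann j Hj). auto. apply Hg, Sym_conj; auto.
Qed.
End Repr.

(** * The transform of a function that splits *)

Section Transform.
Context {X : QBanach}.
Variables (U : quat -> Prop) (j : quat) (Gamma : list (R -> R * R)) (f : quat -> X).
Hypotheses (Hj : imag_unit j) (HU : Sym j U) (HUo : open U) (HUb : Hbounded U).
Hypothesis HO : oriented_boundary (fun z => U (slice j z)) Gamma.
Hypothesis Hfs : slice_continuous (boundary U) f.

Notation XC := (slice_space X j Hj).
Notation D := (fun z => U (slice j z)).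
Notation fint := (cauchy_integral j Gamma f).
Notation F := (fun z => f (slice j z)).

Lemma f_continuous : continuous_on (boundary U) f.
Proof. apply (slice_continuous_continuous_on j Hj); auto. apply Sym_boundary; auto. Qed.

Lemma fint_slice z : ~ boundary U (slice j z) ->
  cs (c := XC) two_pi_i (fint (slice j z)) = Phi (X := XC) Gamma F z.
Proof. apply (cauchy_integral_slice U j Gamma f Hj HU HO f_continuous). Qed.

Lemma fint_repr : has_repr j (fun q => ~ boundary U q) fint.
Proof. apply (cauchy_integral_repr U j Gamma f Hj HU HO f_continuous). Qed.

Lemma inside_not_boundary q : U q -> ~ boundary U q.
Proof. apply boundary_not_open, HUo. Qed.

Lemma continuous_on_closure_D (g : quat -> X) : continuous_on (closure U) g ->
  continuous_on (closure D) (fun z => g (slice j z)).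
Proof.
  intros Hg. apply (continuous_on_pre (closure U)); auto. apply continuous_slice.
  intros z. apply closure_D; auto.
Qed.

Lemma continuous_on_closure_exterior_D (g : quat -> X) : continuous_on (closure (exterior U)) g ->
  continuous_on (closure (exterior D)) (fun z => g (slice j z)).
Proof.
  intros Hg. apply (continuous_on_pre (closure (exterior U))); auto. apply continuous_slice.
  intros z. apply closure_exterior_D; auto.
Qed.

Lemma exterior_D_open z : exterior U (slice j z) -> locally z (fun w => exterior U (slice j w)).
Proof.
  intros Hz. apply exterior_D in Hz; auto. generalize (closure_open_complement D z Hz).
  apply filter_imp. intros w. apply (exterior_D U j Hj HU).
Qed.

Section Splitting.
Variables (fp : quat -> X) (fm : quat_ext -> X).
Hypothesis HS : is_splitting U f fp fm.

(** Slice hyperholomorphy at infinity gives continuity of p -> fm (1 / p) at 0, which is a limit of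
    fm along C_j. *)
Lemma splitting_at_infinity eps : 0 < eps ->
  exists M, forall w, M <= Cmod w -> norm (V := XC) (minus (fm (Some (slice j w))) (fm None)) <= eps.
Proof.
  intros He. destruct HS as [_ [_ [_ [[_ Hinf] _]]]].
  assert (H0 : inverted U (slice j (RtoC 0))) by (left; apply slice_real).
  assert (HH := slice_hyperholomorphic_hol j (inverted U) Hj (at_inverse fm) (RtoC 0) Hinf
    (inverted_open U j Hj HU HUb _ H0)).
  apply hol_continuous in HH.
  assert (L := proj1 (continuous_eps (X := XC) _ _) HH eps He). cbv beta in L.
  rewrite locally_Cmod in L. destruct L as [d [Hd L]].
  exists (/ d + 1). intros w Hw. assert (0 < / d) by (apply Rinv_0_lt_compat; auto).
  assert (Nw : w <> RtoC 0). { intros E. rewrite E, Cmod_0 in Hw. lra. }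
  assert (Ni : (/ w)%C <> RtoC 0).
  { intros E. apply (C1_nz). replace (RtoC 1) with (w * / w)%C by (Cfield; auto). rewrite E. Cring. }
  specialize (L (/ w)%C). left. revert L.
  replace (at_inverse fm (slice j (/ w)%C)) with (fm (Some (slice j w))).
  replace (at_inverse fm (slice j (RtoC 0))) with (fm None).
  - intros L. apply L. replace (/ w - 0)%C with (/ w)%C by Cring. rewrite Cmod_inv by auto.
    rewrite <- (Rinv_inv d). apply Rinv_lt_contravar; [|lra]. apply Rmult_lt_0_compat; lra.
  - unfold at_inverse. destruct Req_EM_T as [|N]; auto. elim N.
    rewrite Hnorm_slice by auto. apply Cmod_0.
  - unfold at_inverse. destruct Req_EM_T as [E|N].
    + rewrite Hnorm_slice in E by auto. apply Cmod_eq_0 in E. contradiction.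
    + rewrite Hinv_slice by auto. do 3 f_equal. Cfield. auto.
Qed.

Lemma splitting_formula_slice z :
  (U (slice j z) -> fint (slice j z) = plus (fp (slice j z)) (fm None)) /\
  (exterior U (slice j z) -> fint (slice j z) = minus (fm None) (fm (Some (slice j z)))).
Proof.
  destruct HS as [Cp [Hp [Cm [[Hm _] Ef]]]].
  apply (slice_continuous_continuous_on j Hj) in Cp; [|apply Sym_closure; auto].
  apply (slice_continuous_continuous_on j Hj) in Cm; [|apply Sym_closure; auto; apply Sym_exterior; auto].
  assert (P := plane_cauchy (X := XC) D Gamma (open_slice U j HUo) HO
    (fun z => fp (slice j z)) (fun z => fm (Some (slice j z))) (fm None)
    (continuous_on_closure_D _ Cp)
    (fun z Hz => slice_hyperholomorphic_hol j U Hj fp z Hp (open_slice U j HUo z Hz))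
    (continuous_on_closure_exterior_D _ Cm)
    (fun z Hz => slice_hyperholomorphic_hol j (exterior U) Hj (fun q => fm (Some q)) z Hm
       (exterior_D_open z (proj1 (exterior_D U j Hj HU z) Hz)))
    splitting_at_infinity (bounded_slice U j Hj HUb) z).
  assert (E : Phi (X := XC) Gamma F z = Phi (X := XC) Gamma (fun z => plus (fp (slice j z)) (fm (Some (slice j z)))) z).
  { apply (contour_int_ext (X := XC)). intros gamma w Hg Hw. f_equal. apply Ef.
    apply boundary_D; auto. apply (Bd_iff D Gamma HO). exists gamma. auto. }
  destruct P as [P1 P2]. split; intros Hz.
  - apply (cs_two_pi_i_cancel (X := XC)). rewrite fint_slice by (apply inside_not_boundary, Hz).
    rewrite E. apply P1, Hz.
  - apply (cs_two_pi_i_cancel (X := XC)). rewrite fint_slice by (apply exterior_not_boundary, Hz).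
    rewrite E. apply P2. apply exterior_D; auto.
Qed.

(** Both sides satisfy the representation formula, so the equality in C_j is enough. *)
Lemma splitting_formula :
  (forall q, U q -> fint q = plus (fp q) (fm None)) /\
  (forall q, exterior U q -> fint q = plus (fm None) (opp (fm (Some q)))).
Proof.
  destruct HS as [_ [Hp [_ [[Hm _] _]]]]. split.
  - apply (has_repr_eq j U Hj HU).
    + apply (has_repr_mono j _ U fint inside_not_boundary fint_repr).
    + apply has_repr_plus. apply slice_hyperholomorphic_repr; auto. apply has_repr_const.
    + intros z. apply splitting_formula_slice.
  - apply (has_repr_eq j (exterior U) Hj (Sym_exterior j U Hj HU)).
    + apply (has_repr_mono j _ (exterior U) fint (exterior_not_boundary U) fint_repr).
    + apply has_repr_plus. apply has_repr_const. apply has_repr_opp.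
      apply slice_hyperholomorphic_repr; auto. apply Sym_exterior; auto.
    + intros z. apply splitting_formula_slice.
Qed.
End Splitting.
End Transform.

(** * From continuous extensions of the transform to a splitting *)

Section Extensions.
Context {X : QBanach}.
Variables (U : quat -> Prop) (j : quat) (Gamma : list (R -> R * R)) (f : quat -> X).
Hypotheses (Hj : imag_unit j) (HU : Sym j U) (HUo : open U) (HUb : Hbounded U).
Hypothesis HO : oriented_boundary (fun z => U (slice j z)) Gamma.
Hypothesis Hfs : slice_continuous (boundary U) f.

Notation XC := (slice_space X j Hj).
Notation D := (fun z => U (slice j z)).
Notation fint := (cauchy_integral j Gamma f).
Notation F := (fun z => f (slice j z)).

Lemma F_continuous : continuous_on (boundary D) F.
Proof. apply (continuous_on_boundary_slice U j f Hj HU (f_continuous U j f Hj HU Hfs)). Qed.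

Lemma fint_Phi z : ~ boundary U (slice j z) ->
  fint (slice j z) = cs (c := XC) (/ two_pi_i)%C (Phi (X := XC) Gamma F z).
Proof.
  intros N. rewrite <- (fint_slice U j Gamma f Hj HU HO Hfs z N).
  pose proof two_pi_i_neq_0.
  set (y := fint (slice j z)). change (@eq XC y (cs (c := XC) (/ two_pi_i)%C (cs (c := XC) two_pi_i y))).
  (let S := constr:(XC) in module_coefs S). Cfield. auto.
Qed.

Lemma hol_fint z : ~ boundary U (slice j z) -> hol (X := XC) (fun w => fint (slice j w)) z.
Proof.
  intros N. assert (N' : ~ boundary D z) by (intros B; apply N, boundary_D; auto).
  apply (hol_ext_loc (X := XC) (fun w => cs (c := XC) (/ two_pi_i)%C (Phi (X := XC) Gamma F w))).
  - generalize (boundary_complement_open D z N'). apply filter_imp. intros w Hw. symmetry.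
    apply fint_Phi. intros B. apply Hw, boundary_D; auto.
  - apply (hol_cs (X := XC)), (hol_Phi (X := XC) D Gamma HO). apply F_continuous. exact N'.
Qed.

Section Data.
Variables (gp : quat -> X) (gm : quat_ext -> X).
Hypothesis HgpE : forall q, U q -> gp q = fint q.
Hypothesis HgpC : continuous_on (closure U) gp.
Hypothesis HgmE : forall q, exterior U q -> gm (Some q) = fint q.
Hypothesis HgmC : continuous_on (closure (exterior U)) (fun q => gm (Some q)).
Hypothesis Hgm0 : gm None = zero.

Lemma gp_repr : has_repr j (closure U) gp.
Proof.
  apply has_repr_closure; auto. apply (has_repr_ext j U Hj HU fint).
  intros q Hq. symmetry. auto.
  apply (has_repr_mono j _ U fint (inside_not_boundary U HUo) (fint_repr U j Gamma f Hj HU HO Hfs)).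
Qed.

Lemma gm_repr_exterior : has_repr j (exterior U) (fun q => gm (Some q)).
Proof.
  apply (has_repr_ext j _ Hj (Sym_exterior j U Hj HU) fint).
  intros q Hq. symmetry. auto.
  apply (has_repr_mono j _ (exterior U) fint (exterior_not_boundary U) (fint_repr U j Gamma f Hj HU HO Hfs)).
Qed.

Lemma gm_repr : has_repr j (closure (exterior U)) (fun q => gm (Some q)).
Proof. apply has_repr_closure; auto. apply Sym_exterior; auto. apply gm_repr_exterior. Qed.

Lemma boundary_closure_exterior_U q : boundary U q -> closure (exterior U) q.
Proof.
  intros Hq. apply (Sym_closure j); auto. apply Sym_exterior; auto.
  apply closure_exterior_D; auto.
  apply (boundary_closure_exterior (X := XC) D Gamma (open_slice U j HUo) HO).
  apply boundary_D; auto. exact (proj1 (Sym_boundary j U Hj HU q) Hq).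
Qed.

(** [plane_jump] gives the relation in C_j. It spreads to H because f, gp and gm satisfy the
    representation formula on the boundary, gp and gm by passage to closures. *)
Lemma extensions_jump q : boundary U q -> f q = plus (gp q) (opp (gm (Some q))).
Proof.
  revert q. apply (has_repr_eq j (boundary U) Hj (Sym_boundary j U Hj HU) f (fun q => plus (gp q) (opp (gm (Some q))))).
  - apply slice_continuous_repr; auto. apply Sym_boundary; auto.
  - apply has_repr_plus.
    + apply (has_repr_mono j (closure U)); [intros p Hp; apply Hp|apply gp_repr].
    + apply (has_repr_opp j _ (fun q => gm (Some q))), (has_repr_mono j (closure (exterior U))); [|apply gm_repr].
      apply boundary_closure_exterior_U.
  - intros z Hz. apply (plane_jump (X := XC) D Gamma (open_slice U j HUo) HO F
      (fun z => gp (slice j z)) (fun z => gm (Some (slice j z)))).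
    + apply F_continuous.
    + apply continuous_on_closure_D; auto.
    + apply (continuous_on_closure_exterior_D U j Hj HU (fun q => gm (Some q))); auto.
    + intros w Hw. rewrite HgpE by auto. symmetry. apply (fint_slice U j Gamma f Hj HU HO Hfs).
      apply inside_not_boundary; auto.
    + intros w Hw. apply exterior_D in Hw; auto. rewrite HgmE by auto. symmetry.
      apply (fint_slice U j Gamma f Hj HU HO Hfs). apply exterior_not_boundary; auto.
    + apply boundary_D; auto.
Qed.

Lemma extensions_plus_hyperholomorphic : slice_hyperholomorphic U gp.
Proof.
  apply (hol_slice_hyperholomorphic j U Hj HU).
  - apply (has_repr_mono j (closure U)); [|apply gp_repr]. intros q. apply closure_incl.
  - intros z Hz. apply (hol_ext_loc (X := XC) (fun w => fint (slice j w))).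
    + generalize (open_slice U j HUo z Hz). apply filter_imp. intros w Hw. symmetry. auto.
    + apply hol_fint, inside_not_boundary; auto.
Qed.

Lemma extensions_minus_hyperholomorphic : slice_hyperholomorphic (exterior U) (fun q => opp (gm (Some q))).
Proof.
  apply (hol_slice_hyperholomorphic j (exterior U) Hj (Sym_exterior j U Hj HU)).
  - apply (has_repr_opp j _ (fun q => gm (Some q))), gm_repr_exterior.
  - intros z Hz. apply (hol_opp (X := XC)).
    apply (hol_ext_loc (X := XC) (fun w => fint (slice j w))).
    + generalize (exterior_D_open U j Hj HU z Hz). apply filter_imp. intros w Hw. symmetry. auto.
    + apply hol_fint, exterior_not_boundary; auto.
Qed.

Lemma at_inverse_slice (g : quat_ext -> X) i z : imag_unit i ->
  at_inverse g (slice i z) = if excluded_middle_informative (z = RtoC 0) then g None else g (Some (slice i (/ z)%C)).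
Proof.
  intros Hi. unfold at_inverse. rewrite Hnorm_slice, Hinv_slice by auto.
  destruct Req_EM_T as [E|N]; destruct excluded_middle_informative as [E'|N']; auto.
  - elim N'. apply Cmod_eq_0, E.
  - elim N. rewrite E'. apply Cmod_0.
Qed.

(** In the variable 1 / p the transform is the function of [hol_Phi_infty], holomorphic at 0 with
    value 0; [Hgm0] says that gm takes this value. *)
Lemma extensions_at_infinity : slice_hyperholomorphic (inverted U) (at_inverse (fun p => opp (gm p))).
Proof.
  apply (hol_slice_hyperholomorphic j (inverted U) Hj (Sym_inverted U j Hj HU)).
  - intros i z Hi Hz. apply inverted_slice with (j := j) in Hz; auto.
    assert (Hc : (fst z, (- snd z)%R) = RtoC 0 <-> z = RtoC 0).
    { destruct z as [x y]. unfold RtoC. cbn [fst snd]. split; intros E; injection E; intros; f_equal; lra. }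
    rewrite !at_inverse_slice by auto.
    destruct excluded_middle_informative as [E|N]; destruct excluded_middle_informative as [E'|N']; try tauto.
    (* z = 0 is its own conjugate, and the two coefficients add up to 1. *)
    + symmetry. apply repr_sum.
    + rewrite Cinv_conj. destruct Hz as [|[_ Hz]]; [tauto|].
      apply (has_repr_opp j (exterior U) _ gm_repr_exterior i (/ z)%C Hi).
      apply exterior_D; auto.
  - intros z Hz.
    apply (hol_ext_loc (X := XC) (fun w => opp (cs (c := XC) (/ two_pi_i)%C
      (if excluded_middle_informative (w = RtoC 0) then zero else Phi (X := XC) Gamma F (/ w)%C)))).
    + generalize (inverted_open U j Hj HU HUb z Hz). apply filter_imp. intros w Hw.
      apply inverted_slice with (j := j) in Hw; auto.
      rewrite at_inverse_slice by auto. destruct excluded_middle_informative as [E|N].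
      * rewrite Hgm0. f_equal. apply (cs_zero_r (X := XC)).
      * destruct Hw as [|[_ Hw]]; [tauto|]. apply exterior_D in Hw; auto.
        rewrite HgmE by auto. rewrite fint_Phi; auto. apply exterior_not_boundary, Hw.
    + apply (hol_opp (X := XC)), (hol_cs (X := XC)).
      apply (hol_Phi_infty (X := XC) D Gamma HO). apply F_continuous.
      apply inverted_slice with (j := j) in Hz; auto.
      destruct Hz as [|[N Hz]]; auto. right. split; auto. apply exterior_not_boundary, Hz.
Qed.

Lemma extensions_splitting : is_splitting U f gp (fun p => opp (gm p)).
Proof.
  split; [|split; [|split; [|split; [split|]]]].
  - apply (repr_slice_continuous j Hj); auto. apply Sym_closure; auto. apply gp_repr.
  - apply extensions_plus_hyperholomorphic.
  - apply (repr_slice_continuous j Hj). apply Sym_closure; auto. apply Sym_exterior; auto.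
    apply (has_repr_opp j _ (fun q => gm (Some q))), gm_repr.
    apply (continuous_on_opp (V := X) (closure (exterior U)) (fun q => gm (Some q))), HgmC.
  - apply extensions_minus_hyperholomorphic.
  - apply extensions_at_infinity.
  - apply extensions_jump.
Qed.

(** With hm zero at infinity, [splitting_formula] determines hp and hm on the two open sets, and
    continuity determines them on the closures. *)
Lemma extensions_unique (hp : quat -> X) (hm : quat_ext -> X) :
  is_splitting U f hp hm -> hm None = zero ->
  (forall q, closure U q -> hp q = gp q) /\
  (forall q, closure (exterior U) q -> hm (Some q) = opp (gm (Some q))).
Proof.
  intros HS H0. destruct (splitting_formula U j Gamma f Hj HU HUo HUb HO Hfs hp hm HS) as [P1 P2].
  destruct HS as [Cp [_ [Cm _]]].
  apply (slice_continuous_continuous_on j Hj) in Cp; [|apply Sym_closure; auto].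
  apply (slice_continuous_continuous_on j Hj) in Cm; [|apply Sym_closure; auto; apply Sym_exterior; auto].
  split.
  - intros q. apply (eq_on_closure (V := X) U hp gp q Cp HgpC).
    intros p Hp. rewrite HgpE, P1, H0 by auto. symmetry. apply (plus_zero_r (G := X)).
  - intros q. apply (eq_on_closure (V := X) (exterior U) (fun q => hm (Some q)) (fun q => opp (gm (Some q))) q Cm).
    apply (continuous_on_opp (V := X) (closure (exterior U)) (fun q => gm (Some q))), HgmC.
    intros p Hp. rewrite HgmE, P2, H0 by auto. symmetry.
    transitivity (opp (G := X) (opp (hm (Some p)))). f_equal. apply (plus_zero_l (G := X)). apply (opp_opp (G := X)).
Qed.
End Data.
End Extensions.

Theorem theorem3p11 :
  forall (X : QBanach) (U : quat -> Prop),
    open U -> Hbounded U -> axially_symmetric U ->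
    (forall i, imag_unit i ->
       exists Gamma, oriented_boundary (fun z => U (slice i z)) Gamma) ->
  forall f : quat -> X, slice_continuous (boundary U) f ->
  forall (j : quat) (Gamma : list (R -> R * R)),
    imag_unit j -> oriented_boundary (fun z => U (slice j z)) Gamma ->
  let fhat : quat_ext -> X := cauchy_transform j Gamma f in
  (splits_additively U f <->
     (exists gp, extends_plus U fhat gp) /\
     (exists gm, extends_minus U fhat gm)) /\
  (forall (gp : quat -> X) (gm : quat_ext -> X),
     extends_plus U fhat gp -> extends_minus U fhat gm ->
     (forall q, boundary U q -> f q = plus (gp q) (opp (gm (Some q)))) /\
     is_splitting U f gp (fun p => opp (gm p)) /\
     opp (gm None) = zero /\
     (forall (hp : quat -> X) (hm : quat_ext -> X),
        is_splitting U f hp hm -> hm None = zero ->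
        (forall q, closure U q -> hp q = gp q) /\
        (forall q, closure (exterior U) q -> hm (Some q) = opp (gm (Some q))))).
Proof.
  intros X U HUo HUb HUs _ f Hf j Gamma Hj HO fhat.
  assert (HU := axially_symmetric_Sym j U Hj HUs).
  split; [split|].
  - intros [fp [fm HS]].
    destruct (splitting_formula U j Gamma f Hj HU HUo HUb HO Hf fp fm HS) as [P1 P2].
    destruct HS as [Cp [_ [Cm _]]].
    apply (slice_continuous_continuous_on j Hj) in Cp; [|apply Sym_closure; auto].
    apply (slice_continuous_continuous_on j Hj) in Cm; [|apply Sym_closure; auto; apply Sym_exterior; auto].
    split.
    + exists (fun q => plus (fp q) (fm None)). split.
      * intros q Hq. symmetry. apply P1, Hq.
      * apply (continuous_on_plus (V := X) (closure U) fp (fun _ => fm None)); auto. apply continuous_on_const.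
    (* Zero is the prescribed value of the transform at infinity, and also what the formula gives
       there, fm(oo) - fm(oo). *)
    + exists (fun p => match p with Some q => plus (fm None) (opp (fm (Some q))) | None => zero end).
      split; [split|reflexivity].
      * intros q Hq. symmetry. apply P2, Hq.
      * apply (continuous_on_plus (V := X) (closure (exterior U)) (fun _ => fm None) (fun q => opp (fm (Some q)))).
        apply continuous_on_const.
        apply (continuous_on_opp (V := X) (closure (exterior U)) (fun q => fm (Some q))), Cm.
  - intros [[gp [E1 C1]] [gm [[E2 C2] E3]]]. exists gp, (fun p => opp (gm p)).
    apply (extensions_splitting U j Gamma f Hj HU HUo HUb HO Hf); auto.
  - intros gp gm [E1 C1] [[E2 C2] E3]. split; [|split; [|split]].
    + apply (extensions_jump U j Gamma f Hj HU HUo HO Hf); auto.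
    + apply (extensions_splitting U j Gamma f Hj HU HUo HUb HO Hf); auto.
    + rewrite E3. apply (opp_zero (G := X)).
    + intros hp hm. apply (extensions_unique U j Gamma f Hj HU HUo HUb HO Hf); auto.
Qed.
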